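(* Let $\mathscr{O}$ be an integral domain containing $\mathbb{Z}_p$ as a subalgebra, with fraction field $\mathscr{L}$. Let $F$ be a number field, $w\nmid p$ a finite place of $F$, and $T:G_F\to\mathscr{O}$ a pseudorepresentation with $T=T_1+\cdots+T_n$, where $T_1,\dots,T_n:G_F\to\mathscr{O}$ are traces of irreducible representations $\sigma_1,\dots,\sigma_n$ of $G_F$ over $\overline{\mathscr{L}}$ whose restrictions to $W_w$ are monodromic. Suppose that the irreducibility and purity locus of $T_1,\dots,T_n$ (at $w$) is nonempty. Then there exist positive integers $m$, $t_1\le t_2\le\cdots\le t_m$ and irreducible Frobenius-semisimple representations $r_1,\dots,r_m$ of $W_w$ with coefficients in $\mathscr{O}^{\mathrm{intal}}[1/p]$ such that the following hold. (1) $T|_{W_w}=\sum_{i=1}^m\sum_{j=1}^{t_i}\mathrm{tr}\,\big(r_i|\mathrm{Art}_K^{-1}|_K^{j-1}\big)$, where $K=F_w$. (2) If $(\mathcal{O},\mathfrak{p},\kappa,\mathrm{res},\rho_1,\dots,\rho_n)$ is an element of the irreducibility and purity locus of $T_1,\dots,T_n$, with associated choices $\widetilde\rho_i$, $\varrho_i$, $\mathfrak{a}$, then for any lifts $\mathrm{res}^\dagger$, $\pi_{\mathfrak{p}}^\dagger$, $(\pi_{\mathfrak{a}}\circ h_{\mathfrak{p}})^\dagger$ of $\mathrm{res}$, $\pi_{\mathfrak{p}}$, $\pi_{\mathfrak{a}}\circ h_{\mathfrak{p}}$ respectively, there are isomorphisms $$\mathrm{WD}\Big(\bigoplus_{i=1}^n\rho_i|_{W_w}\Big)^{\mathrm{Fr\text{-}ss}}\simeq\bigoplus_{i=1}^m\mathrm{Sp}_{t_i}(\pi_{\mathfrak{p}}^\dagger\circ\mathrm{res}^\dagger\circ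 r_i),$$ $$\mathrm{WD}\Big(\bigoplus_{i=1}^n(\pi_{\mathfrak{a}}\circ\varrho_i)\otimes\overline{Q}(\mathcal{O}_{\mathfrak{p}}^h/\mathfrak{a})|_{W_w}\Big)^{\mathrm{Fr\text{-}ss}}\simeq\bigoplus_{i=1}^m\mathrm{Sp}_{t_i}((\pi_{\mathfrak{a}}\circ h_{\mathfrak{p}})^\dagger\circ\mathrm{res}^\dagger\circ r_i),$$ $$\mathrm{WD}\Big(\bigoplus_{i=1}^n\widetilde\rho_i|_{W_w}\Big)^{\mathrm{Fr\text{-}ss}}\simeq\bigoplus_{i=1}^m\mathrm{Sp}_{t_i}(\mathrm{res}^\dagger\circ r_i),$$ $$\mathrm{WD}\Big(\bigoplus_{i=1}^n\sigma_i|_{W_w}\Big)^{\mathrm{Fr\text{-}ss}}\simeq\bigoplus_{i=1}^m\mathrm{Sp}_{t_i}(r_i).$$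
   Context: Irreducibility and purity locus. For a local ring $A$, $A^h$ denotes its Henselization, with the same residue field; a local ring is Hausdorff if the intersection of all powers of its maximal ideal is $0$. For a prime ideal $\mathfrak{p}$ of a ring, $\pi_{\mathfrak{p}}$ is reduction mod $\mathfrak{p}$. The irreducibility and ($w$-)purity locus of $T_1,\dots,T_n$ is the collection of all tuples $(\mathcal{O},\mathfrak{p},\kappa,\mathrm{res},\rho_1,\dots,\rho_n)$ where: $\mathcal{O}$ is a domain over $\mathbb{Z}_p$; $\mathfrak{p}$ is a prime ideal of $\mathcal{O}$ such that $\mathcal{O}_{\mathfrak{p}}^h$ is Hausdorff; $\kappa=\mathcal{O}_{\mathfrak{p}}/\mathfrak{p}\mathcal{O}_{\mathfrak{p}}$ is an algebraic extension of $\mathbb{Q}_p$; $\mathrm{res}:\mathscr{O}\hookrightarrow\mathcal{O}$ is an injective $\mathbb{Z}_p$-algebra homomorphism; and for each $1\le i\le n$, $\rho_i$ is an irreducible $G_F$-representation over $\overline{\kappa}$ (identified with $\overline{\mathbb{Q}}_p$) with $\pi_{\mathfrak{p}}\circ\mathrm{res}\circ T_i=\mathrm{tr}\,\rho_i$ and $\rho_i|_{G_w}$ pure (of some weight depending on $i$). Choices. For each element of this locus one chooses semisimple $G_F$-representations $\widetilde\rho_1,\dots,\widetilde\rho_n$ over $\overline{Q}(\mathcal{O})$ with $\mathrm{tr}\,\widetilde\rho_i=\mathrm{res}\circ T_i$ (they exist by Taylor), $G_F$-representations $\varrho_1,\dots,\varrho_n$ over $\mathcal{O}_{\mathfrak{p}}^h$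 with $\mathrm{tr}\,\varrho_i=\mathrm{res}\circ T_i$ (they exist by Nyssen), and a minimal prime $\mathfrak{a}$ of $\mathcal{O}_{\mathfrak{p}}^h$. The composite maps $\mathcal{O}\to\mathcal{O}/\mathfrak{p}\to\kappa$, $\mathcal{O}\to\mathcal{O}_{\mathfrak{p}}\to\mathcal{O}_{\mathfrak{p}}^h$ and $\mathcal{O}\to\mathcal{O}_{\mathfrak{p}}\to\mathcal{O}_{\mathfrak{p}}^h\to\mathcal{O}_{\mathfrak{p}}^h/\mathfrak{a}$ are denoted $\pi_{\mathfrak{p}}$, $h_{\mathfrak{p}}$, $\pi_{\mathfrak{a}}\circ h_{\mathfrak{p}}$ (the last is injective). Rings. For a domain $A$: $Q(A)$ is its fraction field, $\overline{Q}(A)$ an algebraic closure of it and $A^{\mathrm{intal}}$ the integral closure of $A$ in $\overline{Q}(A)$. A lift $f^\dagger$ of a homomorphism $f:A\to B$ of domains is any homomorphism $A^{\mathrm{intal}}\to B^{\mathrm{intal}}$ extending $f$, also denoting its extension to $A^{\mathrm{intal}}[1/p]\to B^{\mathrm{intal}}[1/p]$ when $p\ne0$ in $B$. Local notation. $G_F$ is the absolute Galois group of $F$; $K=F_w$, $G_w\supset W_w\supset I_w$ are the absolute Galois group, Weil group and inertia group of $K$, $q$ is the cardinality of its residue field, $\phi\in W_w$ a fixed lift of the geometric Frobenius, $v_K:W_w\to\mathbb{Z}$ the homomorphism trivial on $I_w$ with $v_K(\phi)=1$, $|\mathrm{Art}_K^{-1}|_K$ the character $\sigma\mapsto q^{-v_K(\sigma)}$,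 $t_{\zeta,p}:I_w\to\mathbb{Z}_p$ a fixed tame surjection. ''Representation'' means group homomorphism (no continuity). A pseudorepresentation is a pseudocharacter in the usual sense. Weil-Deligne representations. A Weil-Deligne representation on a free module $M$ of finite rank over a characteristic zero domain $A$ is $(r,M,N)$ with $r:W_w\to\mathrm{Aut}_A(M)$, $r(I_w)$ finite, $N\in\mathrm{End}_A(M)$ nilpotent, $r(\sigma)Nr(\sigma)^{-1}=q^{-v_K(\sigma)}N$. A representation of $W_w$ on a free $A$-module $M$ of finite rank is irreducible Frobenius-semisimple if $M\otimes\overline{Q}(A)$ is irreducible, $\phi$ acts semisimply on it and $I_w$ acts through a finite quotient. Writing $r(\phi)=r(\phi)^{ss}u$ (commuting semisimple and unipotent parts, over a large enough field), $(r,N)^{\mathrm{Fr\text{-}ss}}$ is $(\sigma\mapsto r(\sigma)u^{-v_K(\sigma)},N)$. $\mathrm{Sp}_t(r)$ is the Weil-Deligne representation on $M^t$ with action $r|\mathrm{Art}_K^{-1}|_K^{t-1}\oplus\cdots\oplus r$, $N$ mapping $r|\mathrm{Art}_K^{-1}|_K^{i}$ isomorphically to $r|\mathrm{Art}_K^{-1}|_K^{i+1}$ for $0\le i\le t-2$ and zero on $r|\mathrm{Art}_K^{-1}|_K^{t-1}$ (here taken over the relevant algebraically closed field). A representation $\rho$ of $W_w$ on a module $M$ over a characteristic zero $\mathbb{Z}_p$-algebra $A$ is monodromic if there are a finite extension $K'/K$ and a nilpotent $N\in\mathrm{End}(M\otimes_A A[1/p])$ with $\rho(\tau)=\exp(t_{\zeta,p}(\tau)N)$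 for $\tau\in I_{K'}$; then $\mathrm{WD}(\rho)=(\sigma\mapsto\rho(\sigma)\exp(-t_{\zeta,p}(\phi^{-v_K(\sigma)}\sigma)N),N)$. Purity. A $q$-Weil number of weight $a$ is an algebraic number all of whose complex absolute values are $q^{a/2}$ and which becomes an algebraic integer after multiplication by a power of $q$. A Frobenius-semisimple Weil-Deligne representation over $\overline{\mathbb{Q}}_p$ is pure of weight $a$ if the $\phi$-eigenvalues on the $i$-th graded piece of its monodromy filtration are $q$-Weil numbers of weight $a+i$ for all $i$. A representation of $G_w$ or $W_w$ is pure if its restriction to $W_w$ is monodromic and the Frobenius-semisimplification of the associated Weil-Deligne representation is pure. *)

(* Defs.v *)
(* MathComp, with the classical axioms of mathcomp.classical.boolp. *)
From HB Require Import structures.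
From mathcomp Require Import all_boot all_order all_fingroup all_algebra.
From mathcomp Require Import all_field ring_quotient fraction boolp.

Set Implicit Arguments.
Unset Strict Implicit.
Unset Printing Implicit Defensive.

Import Order.TTheory GRing.Theory Num.Theory.
Local Open Scope ring_scope.

(* A model of Z_p: an inverse limit of the rings Z/p^(n+1)Z along the
   reduction maps. *)
Record padicInt (p : nat) := PadicInt {
  zp_ring :> idomainType;
  zp_proj : forall n : nat, {rmorphism zp_ring -> 'Z_(p ^ n.+1)};
  zp_proj_coh : forall n x,
    (zp_proj n x : nat) = ((zp_proj n.+1 x : nat) %% p ^ n.+1)%N;
  zp_lim : forall a : (forall n : nat, 'Z_(p ^ n.+1)),
    (forall n, (a n : nat) = ((a n.+1 : nat) %% p ^ n.+1)%N) ->
    exists! x : zp_ring, forall n, zp_proj n x = a n }.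

Record algClosure (K : fieldType) := AlgClosure {
  ac_sort :> closedFieldType;
  ac_emb : {rmorphism K -> ac_sort};
  ac_alg : forall x : ac_sort, algebraicOver ac_emb x }.

Definition Qbar (A : idomainType) := algClosure {fraction A}.

Definition qemb (A : idomainType) (C : Qbar A) : {rmorphism A -> C} :=
  (ac_emb C \o @tofrac A : {rmorphism A -> C}).

Section IntegralClosure.
Context (A : idomainType) (C : Qbar A) (p : nat).

Definition intal_pred : {pred C} := fun x => `[< integralOver (qemb C) x >].

Definition intalp_pred : {pred C} :=
  fun x => `[< exists k : nat, integralOver (qemb C) (p%:R ^+ k * x) >].

Lemma intal_subring : subring_closed intal_pred.
Proof.
split=> [|x y /asboolP hx /asboolP hy|x y /asboolP hx /asboolP hy].
- by apply/asboolP/integral1.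
- by apply/asboolP/integral_sub.
- by apply/asboolP/integral_mul.
Qed.

Lemma intalp_subring : subring_closed intalp_pred.
Proof.
have pE k : integralOver (qemb C) (p%:R ^+ k).
  by rewrite -natrX; apply: integral_nat.
split=> [|x y /asboolP[k hx] /asboolP[l hy]|x y /asboolP[k hx] /asboolP[l hy]].
- by apply/asboolP; exists 0%N; rewrite mulr1; apply: integral1.
- apply/asboolP; exists (k + l)%N; rewrite mulrBr {1}addnC !exprD -!mulrA.
  by apply: integral_sub; apply: integral_mul.
- apply/asboolP; exists (k + l)%N; rewrite exprD mulrACA.
  exact: integral_mul.
Qed.

HB.instance Definition _ :=
  GRing.isSubringClosed.Build C intal_pred intal_subring.
HB.instance Definition _ :=
  GRing.isSubringClosed.Build C intalp_pred intalp_subring.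

Record intal := Intal { intal_val :> C; _ : intal_val \in intal_pred }.
HB.instance Definition _ := [isSub for intal_val].
HB.instance Definition _ := [Choice of intal by <:].
HB.instance Definition _ := [SubChoice_isSubComNzRing of intal by <:].

Record intalp := Intalp { intalp_val :> C; _ : intalp_val \in intalp_pred }.
HB.instance Definition _ := [isSub for intalp_val].
HB.instance Definition _ := [Choice of intalp by <:].
HB.instance Definition _ := [SubChoice_isSubComNzRing of intalp by <:].

End IntegralClosure.

(* A lift of f : A -> B to the integral closures, together with its (unique)
   extension to A^intal[1/p] -> B^intal[1/p]. *)
Record ilift (p : nat) (A B : idomainType) (f : {rmorphism A -> B})
    (CA : Qbar A) (CB : Qbar B) := ILift {
  ilift_intal : {rmorphism intal CA -> intal CB};
  ilift_ext : forall (a : A) (x : intal CA),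
    (x : CA) = qemb CA a -> (ilift_intal x : CB) = qemb CB (f a);
  ilift_intalp :> {rmorphism intalp CA p -> intalp CB p};
  ilift_intalp_ext : forall (x : intal CA) (y : intalp CA p),
    (x : CA) = (y : CA) -> (ilift_intalp y : CB) = (ilift_intal x : CB) }.

(* The maximal ideal of a local ring is its set of non-units. *)
Definition is_local (A : comUnitRingType) : Prop :=
  forall x y : A, x \isn't a GRing.unit -> y \isn't a GRing.unit ->
    x + y \isn't a GRing.unit.

Definition local_hom (A B : comUnitRingType) (f : A -> B) : Prop :=
  forall x, f x \is a GRing.unit -> x \is a GRing.unit.

Definition henselian (A : comUnitRingType) : Prop :=
  is_local A /\
  forall (f : {poly A}) (a : A), f \is monic ->
    f.[a] \isn't a GRing.unit -> f^`().[a] \is a GRing.unit ->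
    exists2 b : A, root f b & b - a \isn't a GRing.unit.

Definition is_henselization (A H : comUnitRingType) (h : {rmorphism A -> H})
    : Prop :=
  [/\ henselian H, local_hom h &
      forall (B : comUnitRingType) (g : {rmorphism A -> B}),
        henselian B -> local_hom g ->
        exists u : {rmorphism H -> B},
          (local_hom u /\ u \o h =1 g) /\
          forall u' : {rmorphism H -> B},
            local_hom u' -> u' \o h =1 g -> u' =1 u].

Definition is_localization_at (A : comNzRingType) (P : prime_idealr A)
    (B : comUnitRingType) (f : {rmorphism A -> B}) : Prop :=
  [/\ forall s, s \notin P -> f s \is a GRing.unit,
      forall b, exists a s, s \notin P /\ b = f a / f s &
      forall a, f a = 0 -> exists2 s, s \notin P & s * a = 0].

Fixpoint ideal_pow (A : comNzRingType) (I : A -> Prop) (k : nat) : A -> Prop :=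
  if k is k'.+1 then
    fun x => exists s : seq (A * A),
      {in s, forall y, I y.1 /\ ideal_pow I k' y.2} /\
      x = \sum_(y <- s) y.1 * y.2
  else fun=> True.

Definition hausdorff_local (A : comUnitRingType) : Prop :=
  forall x : A,
    (forall k, ideal_pow (fun y => y \isn't a GRing.unit) k x) -> x = 0.

Definition minimal_prime (A : comNzRingType) (P : prime_idealr A) : Prop :=
  forall Q : prime_idealr A, {subset Q <= P} -> {subset P <= Q}.

Definition is_aut (K L : fieldType) (i : K -> L) (s : L -> L) : Prop :=
  [/\ GRing.zmod_morphism s, GRing.monoid_morphism s, bijective s &
      forall x, s (i x) = i x].

(* Aut(Kbar/K) for an algebraic closure Kbar of K; since K has characteristic
   zero wherever this is used, this is the absolute Galois group of K. The
   product is composition, (s * t) x = s (t x). *)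
Record AbsGal (K : fieldType) (L : algClosure K) := GalAut {
  gal_fun :> L -> L;
  galP : is_aut (ac_emb L) gal_fun }.

Section GaloisGroup.
Context (K : fieldType) (L : algClosure K).
Implicit Types s t : AbsGal L.

Lemma gal_ext s t : s =1 t :> (L -> L) -> s = t.
Proof.
case: s t => [s sP] [t tP] /= /funext e; case: _ / e in tP *.
by rewrite (Prop_irrelevance sP tP).
Qed.

HB.instance Definition _ := gen_eqMixin (AbsGal L).
HB.instance Definition _ := gen_choiceMixin (AbsGal L).

Lemma gal_zmod_morphism s : GRing.zmod_morphism s.
Proof. by case: (galP s). Qed.
Lemma gal_monoid_morphism s : GRing.monoid_morphism s.
Proof. by case: (galP s). Qed.

HB.instance Definition _ s :=
  GRing.isZmodMorphism.Build L L (gal_fun s) (gal_zmod_morphism s).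
HB.instance Definition _ s :=
  GRing.isMonoidMorphism.Build L L (gal_fun s) (gal_monoid_morphism s).

Lemma gal_id_aut : is_aut (ac_emb L) (@id L).
Proof. by split=> //; exists id. Qed.

Lemma gal_comp_aut s t : is_aut (ac_emb L) (s \o t).
Proof.
case: (galP s) (galP t) => [sB sM sb sK] [tB tM tb tK]; split.
- by move=> x y /=; rewrite tB sB.
- by split=> [|x y] /=; rewrite ?tM ?sM.
- exact: bij_comp.
- by move=> x /=; rewrite tK sK.
Qed.

Lemma gal_inv_ex s : exists t : AbsGal L, cancel s t /\ cancel t s.
Proof.
case: (galP s) => sB sM [t st ts] sK.
have tP : is_aut (ac_emb L) t.
  split.
  - by move=> x y; apply: (can_inj st); rewrite sB !ts.
  - split=> [|x y]; apply: (can_inj st); first by rewrite ts sM.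
    by rewrite sM !ts.
  - by exists s.
  - by move=> x; rewrite -{1}[ac_emb L x]sK st.
by exists (GalAut tP).
Qed.

Definition gal_one : AbsGal L := GalAut gal_id_aut.
Definition gal_mul s t : AbsGal L := GalAut (gal_comp_aut s t).
Definition gal_inv s : AbsGal L := sval (cid (gal_inv_ex s)).

Lemma gal_mulA : associative gal_mul.
Proof. by move=> s t u; apply: gal_ext. Qed.
Lemma gal_mul1 : left_id gal_one gal_mul.
Proof. by move=> s; apply: gal_ext. Qed.
Lemma gal_1mul : right_id gal_one gal_mul.
Proof. by move=> s; apply: gal_ext. Qed.
Lemma gal_mulV : left_inverse gal_one gal_inv gal_mul.
Proof.
move=> s; apply: gal_ext => x /=; rewrite /gal_inv.
by case: cid => t [/= st _]; apply: st.
Qed.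
Lemma gal_Vmul : right_inverse gal_one gal_inv gal_mul.
Proof.
move=> s; apply: gal_ext => x /=; rewrite /gal_inv.
by case: cid => t [/= _ ts]; apply: ts.
Qed.

HB.instance Definition _ := isGroup.Build (AbsGal L)
  gal_mulA gal_mul1 gal_1mul gal_mulV gal_Vmul.

End GaloisGroup.

Definition gexpz (G : groupType) (g : G) (n : int) : G :=
  match n with Posz k => (g ^+ k)%g | Negz k => (g ^- k.+1)%g end.

(* Matrices act on column vectors. A representation of a subgroup H of G is a
   function on G whose values outside H are irrelevant; [whole] is G itself. *)
Definition whole (G : Type) : G -> Prop := fun=> True.

Section Representations.
Context (G : groupType) (H : G -> Prop).

Definition is_rep (A : comNzRingType) (d : nat) (r : G -> 'M[A]_d) : Prop :=
  r 1%g = 1%:M /\ forall g h, H g -> H h -> r (g * h)%g = r g *m r h.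

Definition stable_sub (E : fieldType) (d : nat) (r : G -> 'M[E]_d)
    (U : {vspace 'cV[E]_d}) : Prop :=
  forall g, H g -> forall x, x \in U -> r g *m x \in U.

Definition irreducible_rep (E : fieldType) (d : nat) (r : G -> 'M[E]_d)
    : Prop :=
  [/\ is_rep r, (0 < d)%N &
      forall U, stable_sub r U -> U = 0%VS \/ U = fullv].

Definition semisimple_rep (E : fieldType) (d : nat) (r : G -> 'M[E]_d)
    : Prop :=
  is_rep r /\
  forall U, stable_sub r U ->
    exists V, [/\ stable_sub r V, (U + V)%VS = fullv & (U :&: V)%VS = 0%VS].

End Representations.

Definition rep_dsum (G : Type) (A : comNzRingType) (n : nat) (d : 'I_n -> nat)
    (r : forall i, G -> 'M[A]_(d i)) : G -> 'M[A]_(\sum_i d i) :=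
  fun g => \mxdiag_i r i g.

(* For s with cycles (j_1 ... j_k), the product over the cycles of
   T (g_(j_1) ... g_(j_k)). *)
Definition cycle_prod (G : groupType) (A : comNzRingType) (T : G -> A)
    (n : nat) (g : 'I_n -> G) (s : 'S_n) : A :=
  \prod_(c in porbits s)
    if [pick j in c] is Some j then
      T (\prod_(i <- traject s j #|c|) g i)%g
    else 1.

Definition pseudocharacter (G : groupType) (A : comNzRingType) (T : G -> A)
    : Prop :=
  exists d : nat,
    [/\ T 1%g = d%:R,
        forall g h, T (g * h)%g = T (h * g)%g &
        forall g : 'I_d.+1 -> G,
          \sum_(s : 'S_d.+1) (-1) ^+ s * cycle_prod T g s = 0].

(* A normalized discrete valuation; its value at 0 is irrelevant. On a number
   field these are exactly the finite places. *)
Record dval (K : fieldType) := DVal {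
  dv_fun :> K -> int;
  dvM : forall x y, x != 0 -> y != 0 -> dv_fun (x * y) = dv_fun x + dv_fun y;
  dvD : forall x y, x != 0 -> y != 0 -> x + y != 0 ->
    Num.min (dv_fun x) (dv_fun y) <= dv_fun (x + y);
  dv_surj : exists2 x, x != 0 & dv_fun x = 1 }.

Definition dv_ge (K : fieldType) (v : dval K) (n : int) (x : K) : bool :=
  (x == 0) || (n <= v x).

Record completion (K : fieldType) (v : dval K) := Completion {
  cp_field :> fieldType;
  cp_val : dval cp_field;
  cp_emb : {rmorphism K -> cp_field};
  cp_valE : forall x, x != 0 -> cp_val (cp_emb x) = v x;
  cp_dense : forall (y : cp_field) (n : int),
    exists x, dv_ge cp_val n (y - cp_emb x);
  cp_complete : forall u : nat -> cp_field,
    (forall n : int, exists k : nat, forall a b,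
        (k <= a)%N -> (k <= b)%N -> dv_ge cp_val n (u a - u b)) ->
    exists l, forall n : int, exists k : nat, forall a,
        (k <= a)%N -> dv_ge cp_val n (u a - l) }.

(* q is the cardinality of the residue field: some list of q integral elements
   meets every residue class exactly once. *)
Definition residue_card (K : fieldType) (v : dval K) (q : nat) : Prop :=
  exists s : seq K,
    [/\ size s = q, all (dv_ge v 0) s &
        forall x, dv_ge v 0 x -> count (fun y => dv_ge v 1 (x - y)) s = 1%N].

Section WeilGroup.
Context (K : fieldType) (v : dval K) (L : algClosure K) (q : nat).

(* The integral closure of the valuation ring of K in L. *)
Definition bar_integer (x : L) : Prop :=
  exists P : {poly K},
    [/\ P \is monic, forall i, dv_ge v 0 P`_i & root (map_poly (ac_emb L) P) x].

(* The maximal ideal of that ring, as the radical of the ideal generated by a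
   uniformizer u of K. *)
Definition bar_maximal (x : L) : Prop :=
  bar_integer x /\
  exists (u : K) (k : nat),
    [/\ u != 0, v u = 1 & bar_integer (x ^+ k / ac_emb L u)].

(* s induces on the residue field of L the n-th power of the geometric
   Frobenius, i.e. of the inverse of y |-> y ^ q. *)
Definition frob_power (n : int) (s : AbsGal L) : Prop :=
  forall x, bar_integer x ->
    match n with
    | Posz k => bar_maximal (s x ^+ (q ^ k) - x)
    | Negz k => bar_maximal (s x - x ^+ (q ^ k.+1))
    end.

Definition weil (s : AbsGal L) : Prop := exists n, frob_power n s.

Definition inertia (s : AbsGal L) : Prop :=
  forall x, bar_integer x -> bar_maximal (s x - x).

End WeilGroup.

(* The local notation at a place of residue characteristic different from p:
   q, phi, v_K, and t_{zeta,p}. The map t is given by Kummer theory,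
   s (u^(1/p^k)) = zeta_k ^ (t s) * u^(1/p^k) for every uniformizer u. The
   values of lw_v and lw_t outside W_w and I_w respectively are irrelevant. *)
Record localWeil (p : nat) (Zp : padicInt p) (K : fieldType) (v : dval K)
    (L : algClosure K) := LocalWeil {
  lw_q : nat;
  lw_qP : residue_card v lw_q;
  lw_phi : AbsGal L;
  lw_phiP : frob_power v lw_q 1 lw_phi;
  lw_v : AbsGal L -> int;
  lw_vM : forall s t, weil v lw_q s -> weil v lw_q t ->
    lw_v (s * t)%g = lw_v s + lw_v t;
  lw_vI : forall s, inertia v s -> lw_v s = 0;
  lw_vphi : lw_v lw_phi = 1;
  lw_zeta : nat -> L;
  lw_zeta_prim : forall k, (p ^ k)%N.-primitive_root (lw_zeta k);
  lw_zeta_coh : forall k, lw_zeta k.+1 ^+ p = lw_zeta k;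
  lw_t : AbsGal L -> Zp;
  lw_tM : forall s t, inertia v s -> inertia v t ->
    lw_t (s * t)%g = lw_t s + lw_t t;
  lw_t_surj : forall z, exists2 s, inertia v s & lw_t s = z;
  lw_t_kummer : forall (s : AbsGal L) (u : K) (k : nat) (x : L),
    inertia v s -> u != 0 -> v u = 1 -> x ^+ (p ^ k.+1) = ac_emb L u ->
    s x = lw_zeta k.+1 ^+ (zp_proj Zp k (lw_t s)) * x }.

(* The map G_w -> G_F induced by an embedding Fbar -> Kbar over F -> F_w. *)
Record decomposition (F : fieldType) (w : dval F) (Fbar : algClosure F)
    (K : completion w) (L : algClosure K) := Decomposition {
  dc_emb : {rmorphism Fbar -> L};
  dc_embE : forall x, dc_emb (ac_emb Fbar x) = ac_emb L (cp_emb K x);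
  dc_res :> AbsGal L -> AbsGal Fbar;
  dc_resE : forall s x, dc_emb (dc_res s x) = s (dc_emb x) }.

Definition mxpowz (E : fieldType) (d : nat) (A : 'M[E]_d) (n : int) : 'M[E]_d :=
  match n with Posz k => A ^+ k | Negz k => invmx A ^+ k.+1 end.

Definition nilpotent_mx (E : fieldType) (d : nat) (N : 'M[E]_d) : Prop :=
  exists k : nat, N ^+ k = 0.

(* Used for nilpotent N only, where N ^+ d = 0. *)
Definition mxexp (E : fieldType) (d : nat) (N : 'M[E]_d) : 'M[E]_d :=
  \sum_(k < d) (k`!%:R)^-1 *: N ^+ k.

Section MonodromyFiltration.
Context (E : fieldType) (d : nat) (N : 'M[E]_d).

Definition monodromy_filtration (M : int -> {vspace 'cV[E]_d}) : Prop :=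
  [/\ forall i, (M (i - 1) <= M i)%VS,
      exists b : nat, M b%:Z = fullv /\ M (- b%:Z) = 0%VS,
      forall i x, x \in M i -> N *m x \in M (i - 2),
      forall (k : nat) x, x \in M k%:Z ->
        N ^+ k *m x \in M (- k%:Z - 1) -> x \in M (k%:Z - 1) &
      forall (k : nat) y, y \in M (- k%:Z) ->
        exists2 x, x \in M k%:Z & y - N ^+ k *m x \in M (- k%:Z - 1)].

End MonodromyFiltration.

(* l is an algebraic number all of whose complex conjugates have absolute value
   q^(a/2), and q^k l is an algebraic integer for some k. *)
Definition weil_number (E : fieldType) (q : nat) (a : int) (l : E) : Prop :=
  (exists P : {poly rat},
     [/\ irreducible_poly P, root (map_poly ratr P) l &
         forall z : algC, root (map_poly ratr P) z ->
           `|z| = sqrtC (q%:R) ^ a]) /\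
  (exists k : nat, integralOver (intr : int -> E) (q%:R ^+ k * l)).

Record wdrep (G : Type) (E : fieldType) := WDRep {
  wd_dim : nat;
  wd_rep : G -> 'M[E]_wd_dim;
  wd_N : 'M[E]_wd_dim }.

Definition wd_dsum (G : Type) (E : fieldType) (n : nat)
    (D : 'I_n -> wdrep G E) : wdrep G E :=
  WDRep (fun g => \mxdiag_i wd_rep (D i) g) (\mxdiag_i wd_N (D i)).

Section WeilDeligne.
Context (p : nat) (Zp : padicInt p) (K : fieldType) (v : dval K)
  (L : algClosure K) (W : localWeil Zp v L).
Context (E : closedFieldType).

Let q := lw_q W.
Let phi := lw_phi W.
Let vK := lw_v W.
Let inW : AbsGal L -> Prop := weil v q.

Definition art_inv (s : AbsGal L) : E := (q%:R : E) ^ (- vK s).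

Definition wd_iso (D D' : wdrep (AbsGal L) E) : Prop :=
  exists (P : 'M[E]_(wd_dim D', wd_dim D)) (Q : 'M[E]_(wd_dim D, wd_dim D')),
    [/\ P *m Q = 1%:M, Q *m P = 1%:M,
        forall s, inW s -> P *m wd_rep D s = wd_rep D' s *m P &
        P *m wd_N D = wd_N D' *m P].

Definition is_frss (D D' : wdrep (AbsGal L) E) : Prop :=
  exists S U : 'M[E]_(wd_dim D),
    [/\ wd_rep D phi = S *m U, S *m U = U *m S, diagonalizable S,
        nilpotent_mx (U - 1%:M) &
        D' = WDRep (fun s => wd_rep D s *m mxpowz U (- vK s)) (wd_N D)].

(* Sp_t(r) on M^t; block k carries r |Art^-1|^(t-1-k). *)
Definition Sp (t d : nat) (r : AbsGal L -> 'M[E]_d) : wdrep (AbsGal L) E :=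
  WDRep
    (fun s => \mxdiag_(k < t) (art_inv s ^+ (t - k.+1) *: r s))
    (\mxblock_(k < t, l < t)
       (if l == k.+1 :> nat then 1%:M else 0 : 'M[E]_d)).

Definition eigenvalue_gr (D : wdrep (AbsGal L) E)
    (M : int -> {vspace 'cV[E]_(wd_dim D)}) (i : int) (l : E) : Prop :=
  exists x, [/\ x \in M i, x \notin M (i - 1) &
                wd_rep D phi *m x - l *: x \in M (i - 1)].

Definition wd_pure (a : int) (D : wdrep (AbsGal L) E) : Prop :=
  exists2 M, monodromy_filtration (wd_N D) M &
    forall i l, eigenvalue_gr M i l -> weil_number q (a + i) l.

Context (c : {rmorphism Zp -> E}).

(* N is the monodromy of r; every finite extension K' of K in L is K(s) for a
   finite list s, and I_K' is the subgroup of I_K that fixes s. *)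
Definition is_monodromy (d : nat) (r : AbsGal L -> 'M[E]_d) (N : 'M[E]_d) : Prop :=
  nilpotent_mx N /\
  exists s : seq L, forall g : AbsGal L, inertia v g ->
    {in s, forall x, g x = x} -> r g = mxexp (c (lw_t W g) *: N).

Definition monodromic (d : nat) (r : AbsGal L -> 'M[E]_d) : Prop :=
  exists N, is_monodromy r N.

Definition WD (d : nat) (r : AbsGal L -> 'M[E]_d) (N : 'M[E]_d)
    : wdrep (AbsGal L) E :=
  WDRep
    (fun s => r s *m
       mxexp (- c (lw_t W (gexpz phi (- vK s) * s)%g) *: N)) N.

(* D is the Frobenius-semisimplification of WD(r), up to isomorphism. *)
Definition wd_frss_iso (d : nat) (r : AbsGal L -> 'M[E]_d) (D : wdrep (AbsGal L) E)
    : Prop :=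
  exists N D', [/\ is_monodromy r N, is_frss (WD r N) D' & wd_iso D' D].

Definition pure_rep (d : nat) (r : AbsGal L -> 'M[E]_d) : Prop :=
  exists N D' a, [/\ is_monodromy r N, is_frss (WD r N) D' & wd_pure a D'].

End WeilDeligne.

Section Locus.
Context (p : nat) (Zp : padicInt p).
Context (F : fieldType) (w : dval F) (Fbar : algClosure F).
Context (K : completion w) (L : algClosure K).
Context (W : localWeil Zp (cp_val K) L) (dec : decomposition Fbar L).
Context (O : idomainType) (iota : {rmorphism Zp -> O}).

Definition irr_fss_rep (C : Qbar O) (d : nat) (r : AbsGal L -> 'M[intalp C p]_d)
    : Prop :=
  let rC := fun s => map_mx (@intalp_val O C p) (r s) in
  [/\ is_rep (weil (cp_val K) (lw_q W)) r,
      irreducible_rep (weil (cp_val K) (lw_q W)) rC,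
      diagonalizable (rC (lw_phi W)) &
      exists l : seq 'M[C]_d, forall s, inertia (cp_val K) s -> rC s \in l].

Context (n : nat) (T : 'I_n -> AbsGal Fbar -> O).

(* The ring A of le_A is the ring \mathcal{O} of the tuple; le_loc and le_hens
   are its localization at le_P and the Henselization of the latter. *)
Record locus_elt := LocusElt {
  le_A : idomainType;
  le_alg : {rmorphism Zp -> le_A};
  le_P : prime_idealr le_A;
  le_AP : comUnitRingType;
  le_loc : {rmorphism le_A -> le_AP};
  le_locP : is_localization_at le_P le_loc;
  le_Ah : comUnitRingType;
  le_hens : {rmorphism le_AP -> le_Ah};
  le_hensP : is_henselization le_hens;
  le_hausdorff : hausdorff_local le_Ah;
  (* A surjection from a local ring onto a field is its residue map. *)
  le_kappa : fieldType;
  le_red : {rmorphism le_AP -> le_kappa};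
  le_red_surj : forall y, exists x, le_red x = y;
  le_Qp : {rmorphism {fraction Zp} -> le_kappa};
  le_QpE : forall z : Zp, le_Qp (tofrac z) = le_red (le_loc (le_alg z));
  le_Qp_alg : forall y, algebraicOver le_Qp y;
  le_kbar : Qbar le_kappa;
  le_res : {rmorphism O -> le_A};
  le_res_inj : injective le_res;
  le_resE : forall z, le_res (iota z) = le_alg z;
  le_pi : {rmorphism le_A -> le_kappa} :=
    (le_red \o le_loc : {rmorphism le_A -> le_kappa});
  le_Zp_kbar : {rmorphism Zp -> le_kbar} :=
    (qemb le_kbar \o le_pi \o le_alg : {rmorphism Zp -> le_kbar});
  le_dim : 'I_n -> nat;
  le_rho : forall i, AbsGal Fbar -> 'M[le_kbar]_(le_dim i);
  le_rho_irr : forall i, irreducible_rep (@whole _) (le_rho i);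
  le_rho_tr : forall i g,
    qemb le_kbar (le_pi (le_res (T i g))) = \tr (le_rho i g);
  le_rho_pure : forall i,
    pure_rep W le_Zp_kbar (fun s : AbsGal L => le_rho i (dec s)) }.

Definition le_hp (x : locus_elt) : {rmorphism le_A x -> le_Ah x} :=
  (le_hens x \o le_loc x : {rmorphism le_A x -> le_Ah x}).

(* The choices attached to an element of the locus: an algebraic closure of
   Q(A), the rho_i^~, the varrho_i, the minimal prime a, the quotient
   B = A_P^h / a and an algebraic closure of Q(B). *)
Record locus_choice (x : locus_elt) := LocusChoice {
  lc_Abar : Qbar (le_A x);
  lc_dim : 'I_n -> nat;
  lc_rho : forall i, AbsGal Fbar -> 'M[lc_Abar]_(lc_dim i);
  lc_rho_ss : forall i, semisimple_rep (@whole _) (lc_rho i);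
  lc_rho_tr : forall i g,
    qemb lc_Abar (le_res x (T i g)) = \tr (lc_rho i g);
  lc_dimh : 'I_n -> nat;
  lc_rhoh : forall i, AbsGal Fbar -> 'M[le_Ah x]_(lc_dimh i);
  lc_rhoh_rep : forall i, is_rep (@whole _) (lc_rhoh i);
  lc_rhoh_tr : forall i g,
    le_hp x (le_res x (T i g)) = \tr (lc_rhoh i g);
  lc_a : prime_idealr (le_Ah x);
  lc_a_min : minimal_prime lc_a;
  lc_B : idomainType;
  lc_pia : {rmorphism le_Ah x -> lc_B};
  lc_pia_surj : forall y, exists z, lc_pia z = y;
  lc_pia_ker : forall z, (lc_pia z == 0) = (z \in lc_a);
  lc_Bbar : Qbar lc_B }.

Definition lc_piahp (x : locus_elt) (c : locus_choice x)
    : {rmorphism le_A x -> lc_B c} :=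
  (lc_pia c \o le_hp x : {rmorphism le_A x -> lc_B c}).

Definition lc_Zp_Abar (x : locus_elt) (c : locus_choice x)
    : {rmorphism Zp -> lc_Abar c} :=
  (qemb (lc_Abar c) \o le_alg x : {rmorphism Zp -> lc_Abar c}).

Definition lc_Zp_Bbar (x : locus_elt) (c : locus_choice x)
    : {rmorphism Zp -> lc_Bbar c} :=
  (qemb (lc_Bbar c) \o lc_piahp c \o le_alg x
     : {rmorphism Zp -> lc_Bbar c}).

End Locus.

(* Main.v *)
Require Import Defs.
From HB Require Import structures.
From mathcomp Require Import all_boot all_order all_fingroup all_algebra.
From mathcomp Require Import all_field ring_quotient fraction boolp.

From mathcomp Require Import ring zify.

Set Implicit Arguments.
Unset Strict Implicit.
Unset Printing Implicit Defensive.

Import Order.TTheory GRing.Theory Num.Theory.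
Local Open Scope ring_scope.


(** Write S for the integral closure of O with p inverted. A point of the locus
    gives a map psi from O to an algebraically closed field k over which the
    representations are irreducible and pure. Each coefficient field E of the
    theorem receives O by a map whose kernel lies in ker psi; for the quotient
    of the Henselization this is because an element of the local ring that does
    not vanish in the residue field is a unit ([pi_unit]). So whatever is
    expressed by traces and is nonzero over k is nonzero over E, and irreducibility
    over k lets matrices over E be tested by traces ([basis_transfer]). In
    particular the monodromy exists over E: it is an integral polynomial in the
    image of one tame element ([mono_transfer]).

    Weights. Over k, purity attaches a weight to each eigenvalue of Frobenius.
    The eigenvalues of sigma_i(phi) lie in S by Newton's identities, and they
    can be adjoined to O so that the larger ring C still maps to S and to k
    compatibly ([extension_exists]). Eigenvalues of different weights are
    different over k, hence a Bezout identity over C separates them, and at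
    rho(phi) it gives, over every E, idempotents e_m for the weights m
    ([lab_bezout], [wt_graded]): these commute with the Weil group since powers of
    eigenvalues of different weights differ too, and N lowers the weight by 2,
    since q times an eigenvalue has its weight raised by 2. Up to a nonzero
    scalar N^m e_m is the value of an element of the group algebra C[G], built
    from (rho(tau) - 1)^m for a tame element tau ([wt_tame]). The rank of such
    a value is read off a Gram matrix of traces, so it can only drop from E to k
    ([linked_rank]). Over k, purity makes N^m an isomorphism from weight m to
    weight -m; over E the weight spaces have the same dimensions, as these count
    eigenvalues, so N^m is an isomorphism over E as well ([weight_transfer]).

    Reconstruction. A graded Weil-Deligne representation with this hard
    Lefschetz property is the sum of the Sp_(k+1) of its primitive parts of
    weight k ([sp_iso]), and Frobenius-semisimple representations are determined
    by their characters ([good_equiv]). The character of a primitive part is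
    a difference of characters of weight spaces ([prim_tr]), and those are given
    over all E by the same fractions of elements of S ([compat]). Over the
    closure of Frac O the primitive parts do not depend on the chosen point
    ([prim_unique]). Their irreducible constituents have finite image up to an
    unramified twist, and are therefore realised over S, which contains the
    algebraic numbers and the eigenvalues of Frobenius ([good_realize],
    [constituents]). These are the r_i. Their images under S -> E have the
    characters of the primitive parts over E, which gives the isomorphisms
    ([case_iso]); taking traces over the closure of Frac O gives the formula for
    T. *)

(** * Polynomials in a matrix, Jordan decomposition, spectra *)

Section PolyMx.
Context (R : comNzRingType).

(** Evaluation of a polynomial at a square matrix of any size, including 0,
    where matrices do not form a nontrivial ring. *)
Definition pmx n : 'M[R]_n -> {poly R} -> 'M[R]_n :=
  match n with 0 => fun _ _ => 0 | n'.+1 => fun A p => horner_mx A p end.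

Lemma expmxS n (A : 'M[R]_n) k : A ^+ k.+1 = A *m A ^+ k.
Proof. exact: exprS. Qed.
Lemma expmxSr n (A : 'M[R]_n) k : A ^+ k.+1 = A ^+ k *m A.
Proof. exact: exprSr. Qed.

Lemma mx0_eq n (A B : 'M[R]_(0, n)) : A = B.
Proof. by apply/matrixP=> - []. Qed.

Lemma pmxD n (A : 'M_n) p q : pmx A (p + q) = pmx A p + pmx A q.
Proof. by case: n A => [|n] A; [exact: mx0_eq | exact: rmorphD]. Qed.
Lemma pmxB n (A : 'M_n) p q : pmx A (p - q) = pmx A p - pmx A q.
Proof. by case: n A => [|n] A; [exact: mx0_eq | exact: rmorphB]. Qed.
Lemma pmxM n (A : 'M_n) p q : pmx A (p * q) = pmx A p *m pmx A q.
Proof. by case: n A => [|n] A; [exact: mx0_eq | exact: rmorphM]. Qed.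
Lemma pmxC n (A : 'M_n) c : pmx A c%:P = c%:M.
Proof. by case: n A => [|n] A; [exact: mx0_eq | exact: horner_mx_C]. Qed.
Lemma pmxX n (A : 'M_n) : pmx A 'X = A.
Proof. by case: n A => [|n] A; [exact: mx0_eq | exact: horner_mx_X]. Qed.
Lemma pmx0 n (A : 'M_n) : pmx A 0 = 0.
Proof. by rewrite -polyC0 pmxC; apply/matrixP=> i j; rewrite !mxE mul0rn. Qed.
Lemma pmx1 n (A : 'M_n) : pmx A 1 = 1%:M.
Proof. by rewrite -polyC1 pmxC. Qed.
Lemma pmxXsubC n (A : 'M_n) a : pmx A ('X - a%:P) = A - a%:M.
Proof. by rewrite pmxB pmxX pmxC. Qed.
Lemma pmx_exp n (A : 'M_n) p k : pmx A (p ^+ k) = pmx A p ^+ k.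
Proof. by elim: k => [|k IH]; rewrite ?pmx1 // !exprS pmxM IH. Qed.
Lemma pmxXn n (A : 'M_n) k : pmx A 'X^k = A ^+ k.
Proof. by rewrite pmx_exp pmxX. Qed.
Lemma pmx_sum n (A : 'M_n) I (r : seq I) P (F : I -> {poly R}) :
  pmx A (\sum_(i <- r | P i) F i) = \sum_(i <- r | P i) pmx A (F i).
Proof.
exact: (big_morph (pmx A) (pmxD A) (pmx0 A)).
Qed.
Lemma pmxZ n (A : 'M_n) c p : pmx A (c *: p) = c *: pmx A p.
Proof. by rewrite -mul_polyC pmxM pmxC mul_scalar_mx. Qed.

Lemma pmxE n (A : 'M_n) p : pmx A p = \sum_(i < size p) p`_i *: A ^+ i.
Proof.
rewrite -{1}[p]coefK poly_def pmx_sum; apply: eq_bigr => i _.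
by rewrite pmxZ pmxXn.
Qed.

Lemma pmx_char n (A : 'M_n) : pmx A (char_poly A) = 0.
Proof. by case: n A => [|n] A; [exact: mx0_eq | exact: Cayley_Hamilton]. Qed.

Lemma pmx_twine m n (A : 'M_m) (B : 'M_n) (X : 'M_(m, n)) p :
  A *m X = X *m B -> pmx A p *m X = X *m pmx B p.
Proof.
move=> AX; elim/poly_ind: p => [|p c IH]; first by rewrite !pmx0 mul0mx mulmx0.
rewrite !pmxD !pmxM !pmxX !pmxC mulmxDl mulmxDr -mulmxA AX mulmxA IH mulmxA.
by rewrite scalar_mxC.
Qed.

Lemma expmx_twine m n (A : 'M[R]_m) (B : 'M[R]_n) (X : 'M[R]_(m, n)) k :
  A *m X = X *m B -> A ^+ k *m X = X *m B ^+ k.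
Proof. by move=> h; rewrite -!pmxXn; apply: pmx_twine. Qed.

Lemma pmxMC n (A : 'M_n) p q : pmx A p *m pmx A q = pmx A q *m pmx A p.
Proof. by rewrite -!pmxM mulrC. Qed.

End PolyMx.

Lemma map_pmx (R R' : comNzRingType) (f : {rmorphism R -> R'}) n
  (A : 'M[R]_n) p : map_mx f (pmx A p) = pmx (map_mx f A) (map_poly f p).
Proof.
case: n A => [|n] A; [exact: mx0_eq | exact: map_horner_mx].
Qed.

Lemma dvdp_pmx0 (F : fieldType) n (A : 'M[F]_n) p q :
  p %| q -> pmx A p = 0 -> pmx A q = 0.
Proof. by case/dvdpP=> r -> pA; rewrite pmxM pA mulmx0. Qed.

Lemma dvdp_prod_seq (F : fieldType) (r : seq F) (q : {poly F}) :
  (forall z, z \in r -> 'X - z%:P %| q) ->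
  \prod_(z <- r) ('X - z%:P) %| q ^+ size r.
Proof.
elim: r => [|z r IH] h; first by rewrite big_nil dvd1p.
rewrite big_cons exprS dvdp_mul ?h ?mem_head // IH // => y yr.
by rewrite h // inE yr orbT.
Qed.

Lemma coprimep_XsubC_exp (F : fieldType) (a : F) k q :
  ~~ root q a -> coprimep (('X - a%:P) ^+ k) q.
Proof. by move=> h; rewrite coprimep_expl // coprimep_sym coprimep_XsubC. Qed.

Lemma crt_poly (F : fieldType) (rs : seq F) k : uniq rs ->
  exists L : {poly F}, forall a, a \in rs -> ('X - a%:P) ^+ k %| L - a%:P.
Proof.
elim: rs => [|b rs IH] /=; first by exists 0.
case/andP=> nb /IH[L' hL'].
pose M := \prod_(a <- rs) ('X - a%:P) ^+ k.
have : coprimep M (('X - b%:P) ^+ k).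
  rewrite coprimep_sym coprimep_XsubC_exp // /M; apply/negP.
  rewrite /root horner_prod prodf_seq_eq0 => /hasP[a ar].
  rewrite /= horner_exp hornerXsubC expf_eq0 subr_eq0 => /andP[_ /eqP e].
  by rewrite e ar in nb.
case/Bezout_eq1_coprimepP=> -[u v] /= uv.
exists (L' + u * M * (b%:P - L')) => a; rewrite inE => /orP[/eqP->|ar].
  have -> : L' + u * M * (b%:P - L') - b%:P
     = (L' - b%:P) * v * ('X - b%:P) ^+ k.
    have e : v * ('X - b%:P) ^+ k = 1 - u * M by rewrite -uv addrAC subrr add0r.
    by rewrite -[RHS]mulrA e; ring.
  exact: dvdp_mull.
have -> : L' + u * M * (b%:P - L') - a%:P
   = (L' - a%:P) + (u * (b%:P - L')) * M by ring.
rewrite dvdp_add ?hL' //; apply: dvdp_mull.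
by rewrite /M (big_rem a ar) /= dvdp_mulr.
Qed.

Lemma lagrange_poly (F : fieldType) (b : F) (rs : seq F) : uniq (b :: rs) ->
  exists l : F -> {poly F}, \sum_(a <- b :: rs) l a = 1 /\
   forall a, a \in b :: rs ->
     \prod_(z <- b :: rs) ('X - z%:P) %| ('X - a%:P) * l a.
Proof.
elim: rs b => [|c rs IH] b.
  move=> _; exists (fun=> 1); split=> [|a]; first by rewrite big_seq1.
  by rewrite inE => /eqP->; rewrite big_seq1 mulr1.
rewrite cons_uniq => /andP[nb /[dup] U /IH[l [l1 l2]]].
set rs' := c :: rs in nb U l1 l2 *.
pose Q := \prod_(z <- rs') ('X - z%:P).
have : coprimep Q (('X - b%:P) ^+ 1).
  rewrite coprimep_sym coprimep_XsubC_exp // /Q; apply/negP.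
  by rewrite root_prod_XsubC; apply/negP.
rewrite expr1 => /Bezout_eq1_coprimepP[-[u v] /= uv].
exists (fun a => if a == b then u * Q else v * ('X - b%:P) * l a); split.
  rewrite big_cons eqxx big_seq (eq_bigr (fun a => v * ('X - b%:P) * l a)).
    by rewrite -big_seq -mulr_sumr l1 mulr1.
  by move=> a ar; case: eqP => // e; rewrite -e ar in nb.
move=> a; rewrite big_cons -/Q; case: eqP => [->|/eqP ab].
  by move=> _; rewrite mulrCA dvdp_mull.
rewrite inE (negPf ab) /= => /l2 h.
rewrite -mulrA mulrCA dvdp_mull // mulrCA.
by rewrite dvdp_mul2l // -size_poly_eq0 size_XsubC.
Qed.

(** Diagonalizability as a polynomial condition, valid in every size. *)
Definition ssmx (F : fieldType) n (A : 'M[F]_n) :=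
  exists rs : seq F, uniq rs /\ pmx A (\prod_(z <- rs) ('X - z%:P)) = 0.

Lemma ssmxP (F : fieldType) n (A : 'M[F]_n) : diagonalizable A <-> ssmx A.
Proof.
case: n A => [|n] A.
  split=> _; first by exists [::]; split=> //; exact: mx0_eq.
  exists 1%:M; first exact: unitmx1.
  by apply/is_diag_mxP=> - [].
split=> [/diagonalizableP[rs u h]|[rs [u h]]].
  by exists rs; split=> //; apply/mxminpoly_minP.
by apply/diagonalizableP; exists rs => //; apply/mxminpoly_minP.
Qed.

(** Spectral idempotents of a semisimple matrix, as polynomials in it. *)
Lemma ssmx_idem (F : fieldType) n (A : 'M[F]_n) : ssmx A ->
  exists (rs : seq F) (l : F -> {poly F}), [/\ uniq rs,
    \sum_(a <- rs) pmx A (l a) = 1%:M &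
    forall a, a \in rs -> A *m pmx A (l a) = a *: pmx A (l a)].
Proof.
case=> [[|b rs] [u h]].
  exists [::], (fun=> 0); split=> //; rewrite big_nil.
  by move: h; rewrite big_nil pmx1.
have [l [l1 l2]] := lagrange_poly u.
exists (b :: rs), l; split=> //; first by rewrite -pmx_sum l1 pmx1.
move=> a /l2 /dvdp_pmx0 /(_ h) /eqP.
by rewrite pmxM pmxXsubC mulmxBl mul_scalar_mx subr_eq0 => /eqP.
Qed.

Section Nilpotent.
Context (F : closedFieldType).

Lemma char_poly_split n (A : 'M[F]_n) :
  exists r : seq F, char_poly A = \prod_(z <- r) ('X - z%:P) /\ size r = n.
Proof.
have [r e] := closed_field_poly_normal (char_poly A).
have mon := char_poly_monic A.
rewrite (monicP mon) scale1r in e.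
exists r; split=> //; apply/succn_inj.
by rewrite -(size_char_poly A) {1}e size_prod_XsubC.
Qed.

Lemma char_poly_tr n (A : 'M[F]_n) : char_poly A^T = char_poly A.
Proof.
rewrite /char_poly -[RHS]det_tr; congr (\det _).
by apply/matrixP=> i j; rewrite !mxE eq_sym.
Qed.

Lemma eigen_col n (A : 'M[F]_n) a : root (char_poly A) a ->
  exists2 v : 'cV_n, v != 0 & A *m v = a *: v.
Proof.
rewrite -char_poly_tr -eigenvalue_root_char => /eigenvalueP[v e v0].
exists v^T; first by rewrite trmx_eq0.
by apply: trmx_inj; rewrite trmx_mul trmxK e linearZ /= trmxK.
Qed.

Lemma root_eigen n (A : 'M[F]_n) (v : 'cV_n) a : v != 0 -> A *m v = a *: v ->
  root (char_poly A) a.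
Proof.
move=> v0 e; rewrite -char_poly_tr -eigenvalue_root_char; apply/eigenvalueP.
exists v^T; last by rewrite trmx_eq0.
by rewrite -trmx_mul e linearZ.
Qed.

Lemma exp_eigen n (A : 'M[F]_n) (v : 'cV_n) a k :
  A *m v = a *: v -> A ^+ k *m v = a ^+ k *: v.
Proof.
move=> e; elim: k => [|k IH]; first by rewrite scale1r mul1mx.
by rewrite exprS -mulmxA IH -scalemxAr e scalerA -exprSr.
Qed.

Lemma pmx_eigen n (A : 'M[F]_n) (v : 'cV_n) a p :
  A *m v = a *: v -> pmx A p *m v = p.[a] *: v.
Proof.
move=> e; elim/poly_ind: p => [|p c IH]; first by rewrite pmx0 mul0mx horner0 scale0r.
rewrite pmxD pmxM pmxX pmxC mulmxDl -mulmxA e -scalemxAr IH mul_scalar_mx.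
by rewrite scalerA -scalerDl !hornerE mulrC.
Qed.

Lemma nilp_char n (N : 'M[F]_n) : nilpotent_mx N -> char_poly N = 'X^n.
Proof.
case=> k Nk; have [r [e sr]] := char_poly_split N; rewrite e -[in RHS]sr.
suff h : forall z, z \in r -> 'X - z%:P = 'X :> {poly F}.
  by rewrite (eq_big_seq _ h) big_const_seq count_predT iter_mulr_1.
move=> z zr; have : root (char_poly N) z by rewrite e root_prod_XsubC.
case/eigen_col=> v v0 /exp_eigen -/(_ k); rewrite Nk mul0mx => /esym/eqP.
rewrite scaler_eq0 (negPf v0) orbF expf_eq0 => /andP[_ /eqP->].
by rewrite subr0.
Qed.

Lemma nilp_exp n (N : 'M[F]_n) k : nilpotent_mx N -> (n <= k)%N -> N ^+ k = 0.
Proof.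
move=> /nilp_char h /subnK <-; rewrite exprD.
by have := pmx_char N; rewrite h pmxXn => ->; rewrite mulr0.
Qed.

Lemma nilp_tr n (N : 'M[F]_n) : nilpotent_mx N -> \tr N = 0.
Proof.
case: n N => [|n] N h; first by rewrite /mxtrace big_ord0.
have := char_poly_trace N isT; rewrite nilp_char // coefXn /=.
by rewrite eqn_leq ltnn andbF => /eqP; rewrite eq_sym oppr_eq0 => /eqP.
Qed.

Lemma nilp_mul n (A B : 'M[F]_n) : nilpotent_mx A -> A *m B = B *m A ->
  nilpotent_mx (A *m B).
Proof. by case=> k h c; exists k; rewrite -[A *m B]/(A * B) exprMn_comm // h mul0r. Qed.

Lemma unip_unit n (A : 'M[F]_n) : nilpotent_mx (A - 1%:M) -> A \in unitmx.
Proof.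
case=> k h; pose X : 'M_n := 1%:M - A.
have hX : X ^+ k = 0 by rewrite /X -opprB exprNn h mulr0.
have := subrX1 X k; have -> : X - 1 = - A by rewrite /X addrAC subrr add0r.
rewrite hX sub0r mulNr => /oppr_inj e.
by case/mulmx1_unit: (esym e).
Qed.

End Nilpotent.

Lemma invmx_twine (F : fieldType) m n (A : 'M[F]_m) (B : 'M[F]_n) X :
  A \in unitmx -> B \in unitmx -> A *m X = X *m B ->
  invmx A *m X = X *m invmx B.
Proof.
move=> uA uB e; apply: (canRL (mulmxK uB)).
by rewrite -mulmxA -e mulKmx.
Qed.

Section Jordan.
Context (F : closedFieldType).

(** The semisimple part is a polynomial in A, found by the Chinese remainder
    theorem. *)
Lemma jordan_exists n (A : 'M[F]_n) : A \in unitmx ->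
  exists S U : 'M[F]_n, [/\ A = S *m U, S *m U = U *m S, ssmx S,
    nilpotent_mx (U - 1%:M) & S \in unitmx].
Proof.
move=> uA; have [r [er sr]] := char_poly_split A.
have [L hL] := crt_poly n.+1 (undup_uniq r).
have hr z : z \in r -> ('X - z%:P) ^+ n.+1 %| L - z%:P.
  by rewrite -mem_undup; apply: hL.
pose S := pmx A L.
have SA : A *m S = S *m A by rewrite /S -{1 4}[A]pmxX pmxMC.
have nSA : nilpotent_mx (A - S).
  exists n; rewrite -{1}[A]pmxX -pmxB -pmx_exp.
  apply: (dvdp_pmx0 _ (pmx_char A)); rewrite er -sr.
  apply: dvdp_prod_seq => z /hr h.
  have -> : 'X - L = ('X - z%:P) - (L - z%:P) by ring.
  rewrite dvdp_sub //; apply: dvdp_trans h.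
  by rewrite exprS dvdp_mulr.
have nAS : nilpotent_mx (invmx A *m S - 1%:M).
  have -> : invmx A *m S - 1%:M = (A - S) *m (- invmx A).
    rewrite mulmxN mulmxBl mulmxV //.
    rewrite opprB; congr (_ - _).
    by rewrite -{2}[S](mulKmx uA) SA mulmxA mulmxK.
  apply: nilp_mul => //; rewrite mulmxN mulNmx; congr (- _).
  rewrite mulmxBl mulmxBr mulmxV // mulVmx //; congr (_ - _).
  by rewrite -{1}[S](mulKmx uA) SA mulmxA mulmxK.
have uS : S \in unitmx.
  by rewrite -(mulKVmx uA S) unitmx_mul uA (unip_unit nAS).
exists S, (invmx S *m A); split=> //.
- by rewrite mulKVmx.
- by rewrite mulKVmx // -mulmxA SA mulKmx.
- exists (undup r); split; first exact: undup_uniq.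
  have -> : pmx S (\prod_(z <- undup r) ('X - z%:P))
     = pmx A (\prod_(z <- undup r) (L - z%:P)).
    elim: (undup r) => [|z s IH]; first by rewrite !big_nil !pmx1.
    by rewrite !big_cons !pmxM IH pmxXsubC pmxB pmxC.
  apply: (dvdp_pmx0 _ (pmx_char A)); rewrite er.
  apply: (@dvdp_trans _ (\prod_(z <- undup r) ('X - z%:P) ^+ n)).
    rewrite -sr prodrXl; apply: dvdp_prod_seq => z; rewrite -mem_undup => zr.
    by rewrite (big_rem z zr) dvdp_mulr.
  rewrite !big_seq; apply: (big_ind2 (fun p q : {poly F} => p %| q)) => //.
    by move=> p q p' q' h h'; rewrite dvdp_mul.
  move=> z zr; apply: dvdp_trans (hL z zr).
  by rewrite exprSr dvdp_mulr.
have -> : invmx S *m A - 1%:M = (A - S) *m invmx S.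
  by rewrite mulmxBl mulmxV // (invmx_twine uS uS (esym SA)).
apply: nilp_mul => //; rewrite mulmxBl mulmxBr mulmxV // mulVmx //.
by rewrite (invmx_twine uS uS (esym SA)).
Qed.

(** On each eigenspace of S, with eigenvalue a, the matrix A - a is nilpotent, so the
    congruence on L gives L(A) = a there. *)
Lemma jordan_key n (A S U : 'M[F]_n) :
  A = S *m U -> S *m U = U *m S -> ssmx S -> nilpotent_mx (U - 1%:M) ->
  exists rs : seq F, forall k L, (n < k)%N ->
    (forall a, a \in rs -> ('X - a%:P) ^+ k %| L - a%:P) -> pmx A L = S.
Proof.
move=> AE SU sS nU.
have [rs [l [urs l1 lE]]] := ssmx_idem sS.
exists rs => k0 L nk hL.
have {k0 nk}hL a : a \in rs -> ('X - a%:P) ^+ n.+1 %| L - a%:P.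
  by move/hL; apply: dvdp_trans; apply: dvdp_exp2l.
have SU1 : S *m (U - 1%:M) = (U - 1%:M) *m S.
  by rewrite mulmxBl mulmxBr SU mulmx1 mul1mx.
have nSU : nilpotent_mx (S *m (U - 1%:M)).
  by rewrite SU1; apply: nilp_mul.
rewrite -[LHS]mulmx1 -[RHS]mulmx1 -l1 !mulmx_sumr big_seq [RHS]big_seq.
apply: eq_bigr => a ar; rewrite lE //; set e := pmx S (l a).
have Ue : (U - 1%:M) *m e = e *m (U - 1%:M).
  by rewrite /e (pmx_twine (B := S) (X := U - 1%:M)).
have Se : S *m e = e *m S by rewrite /e (pmx_twine (B := S) (X := S)).
have We : (A - a%:M) *m e = e *m (S *m (U - 1%:M)).
  rewrite mulmxBl AE SU -mulmxA lE // mul_scalar_mx -scalemxAr -scalerBr.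
  rewrite -/e -[X in _ - X]mul1mx -mulmxBl Ue scalemxAl -lE // -/e Se.
  by rewrite mulmxA.
move: (S *m (U - 1%:M)) nSU We => T nT We.
have h k : (A - a%:M) ^+ k *m e = e *m T ^+ k.
  exact: expmx_twine.
have : pmx A (('X - a%:P) ^+ n.+1) *m e = 0.
  by rewrite pmx_exp pmxXsubC h (nilp_exp nT) // mulmx0.
have /dvdpP[q Eq] := hL a ar.
move=> h0; apply/eqP; rewrite -subr_eq0 -mul_scalar_mx -mulmxBl -(pmxC A).
by rewrite -pmxB Eq pmxM -mulmxA h0 mulmx0.
Qed.

Lemma jordan_poly n (A S U : 'M[F]_n) (cs : seq F) :
  A = S *m U -> S *m U = U *m S -> ssmx S -> nilpotent_mx (U - 1%:M) ->
  exists L, pmx A L = S /\ forall a, a \in cs -> 'X - a%:P %| L - a%:P.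
Proof.
move=> AE SU sS nU; have [rs h] := jordan_key AE SU sS nU.
have [L hL] := crt_poly n.+1 (undup_uniq (rs ++ cs)).
exists L; split.
  by apply: (h n.+1) => // a ar; apply: hL; rewrite mem_undup mem_cat ar.
move=> a ac; have := hL a; rewrite mem_undup mem_cat ac orbT => /(_ isT).
by apply: dvdp_trans; rewrite exprS dvdp_mulr.
Qed.

(** One polynomial gives the semisimple parts of both matrices, so these inherit
    the relation. *)
Lemma jordan_twine m n (A S U : 'M[F]_m) (B S' U' : 'M[F]_n) c
  (X : 'M_(m, n)) :
  A = S *m U -> S *m U = U *m S -> ssmx S -> nilpotent_mx (U - 1%:M) ->
  B = S' *m U' -> S' *m U' = U' *m S' -> ssmx S' -> nilpotent_mx (U' - 1%:M) ->
  c != 0 -> A *m X = c *: X *m B -> S *m X = c *: X *m S'.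
Proof.
move=> AE AC sS nU BE BC sS' nU' c0 AX.
have sS2 : ssmx (c *: S').
  case: sS' => rs [u h]; exists [seq c * a | a <- rs].
  split; first by rewrite map_inj_uniq //; apply: mulfI.
  have -> : pmx (c *: S') (\prod_(z <- [seq c * a | a <- rs]) ('X - z%:P))
    = c ^+ size rs *: pmx S' (\prod_(z <- rs) ('X - z%:P)).
    rewrite big_map; elim: rs {u h} => [|z s IH].
      by rewrite !big_nil !pmx1 scale1r.
    rewrite !big_cons !pmxM IH !pmxXsubC -scale_scalar_mx -scalerBr.
    by rewrite -scalemxAl -scalemxAr scalerA -exprS.
  by rewrite h scaler0.
have BE2 : c *: B = (c *: S') *m U' by rewrite BE scalemxAl.
have BC2 : (c *: S') *m U' = U' *m (c *: S') by rewrite -scalemxAl BC scalemxAr.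
have [rs h] := jordan_key AE AC sS nU.
have [rs' h'] := jordan_key BE2 BC2 sS2 nU'.
have [L hL] := crt_poly (m + n).+1 (undup_uniq (rs ++ rs')).
have eS : pmx A L = S.
  apply: (h (m + n).+1) => [|a ar]; first by rewrite ltnS leq_addr.
  by apply: hL; rewrite mem_undup mem_cat ar.
have eS' : pmx (c *: B) L = c *: S'.
  apply: (h' (m + n).+1) => [|a ar]; first by rewrite ltnS leq_addl.
  by apply: hL; rewrite mem_undup mem_cat ar orbT.
rewrite -eS (pmx_twine (B := c *: B)) ?eS' -?scalemxAr ?scalemxAl //.
Qed.

End Jordan.

Section Spectrum.
Context (F : closedFieldType).
Context (char0 : forall n, n.+1%:R != 0 :> F).

Lemma natc_neq0 n : (0 < n)%N -> n%:R != 0 :> F.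
Proof. by case: n. Qed.

Lemma natc_inj m n : m%:R = n%:R :> F -> m = n.
Proof.
wlog le_mn : m n / (m <= n)%N => [h e|].
  by case/orP: (leq_total m n) => le; [exact: h | exact/esym/h].
move=> /eqP; rewrite eq_sym -subr_eq0 -natrB //.
by case: (n - m)%N (subnK le_mn) => [|k] // _; rewrite (negPf (char0 k)).
Qed.

(** The multiset of eigenvalues, with multiplicities, seen through traces. *)
Definition spec n (A : 'M[F]_n) (s : seq F) :=
  size s = n /\ forall k, \tr (A ^+ k) = \sum_(a <- s) a ^+ k.

(** If the multisets differ, a polynomial that vanishes at all entries but one
    contradicts the equality of power sums, in characteristic 0. *)
Lemma power_sums_perm (s t : seq F) :
  (forall k, \sum_(a <- s) a ^+ k = \sum_(a <- t) a ^+ k) -> perm_eq s t.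
Proof.
move=> h.
have hp (p : {poly F}) : \sum_(a <- s) p.[a] = \sum_(a <- t) p.[a].
  under eq_bigr do rewrite horner_coef; under [RHS]eq_bigr do rewrite horner_coef.
  rewrite exchange_big [RHS]exchange_big /=; apply: eq_bigr => i _.
  by rewrite -!mulr_sumr h.
apply/allP=> b _ /=; apply/eqP/natc_inj.
pose rs := rem b (undup (b :: s ++ t)).
pose p := \prod_(z <- rs) ('X - z%:P).
have U : uniq (b :: rs).
  rewrite -(perm_uniq (perm_to_rem _)) ?undup_uniq //.
  by rewrite mem_undup mem_head.
have pb : p.[b] != 0.
  by move: U => /= /andP[h' _]; rewrite -[_ == 0]/(root p b) root_prod_XsubC.
have key (u : seq F) : {subset u <= s ++ t} ->
    \sum_(a <- u) p.[a] = (count_mem b u)%:R * p.[b].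
  move=> sub; rewrite (bigID (pred1 b)) /= [X in _ + X]big1_seq ?addr0.
    rewrite (eq_bigr (fun=> p.[b])) => [|i /eqP-> //].
    by rewrite big_const_seq iter_addr_0 mulr_natl.
  move=> i /andP[ib /sub iu]; apply/eqP; rewrite -[_ == 0]/(root p i).
  rewrite root_prod_XsubC mem_rem_uniq ?undup_uniq // inE ib mem_undup inE iu.
  by rewrite orbT.
apply: (mulIf pb); rewrite -!key ?hp // => x; rewrite mem_cat => ->//.
by rewrite orbT.
Qed.

(** A U - A = A (U - 1) is nilpotent when A and U commute. *)
Lemma unip_comm_tr n (A U : 'M[F]_n) : nilpotent_mx (U - 1%:M) ->
  A *m U = U *m A -> \tr (A *m U) = \tr A.
Proof.
move=> nU AU; rewrite -[U](subrK 1%:M) mulmxDr mulmx1 linearD /=.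
have h : A *m (U - 1%:M) = (U - 1%:M) *m A.
  by rewrite mulmxBr mulmxBl AU mulmx1 mul1mx.
by rewrite h (nilp_tr (nilp_mul nU (esym h))) add0r.
Qed.

Lemma unip_exp n (U : 'M[F]_n) k : nilpotent_mx (U - 1%:M) ->
  nilpotent_mx (U ^+ k - 1%:M).
Proof.
move=> nU; have -> : U ^+ k - 1%:M = U ^+ k - 1 by [].
rewrite subrX1; apply: nilp_mul => //.
rewrite -[_ *m _]/((U - 1) * _) -[_ *m _]/(_ * (U - 1)).
apply: commr_sum => i _; apply: commrX.
by apply: commr_sym; apply: commrB => //; apply: commr1.
Qed.

Lemma nilp_last n p (N : 'M[F]_n) (v : 'M_(n, p)) : nilpotent_mx N -> v != 0 ->
  exists j, N ^+ j *m v != 0 /\ N *m (N ^+ j *m v) = 0.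
Proof.
case=> k Nk v0.
have ex : exists i, N ^+ i *m v == 0 by exists k; rewrite Nk mul0mx.
case: (ex_minnP ex) => [[|i]] /eqP h hm.
  by move: h; rewrite mul1mx => e; rewrite e eqxx in v0.
exists i; split; last by rewrite mulmxA -expmxS.
by apply/negP=> /hm; rewrite ltnn.
Qed.

Lemma spec_exists n (A : 'M[F]_n) : A \in unitmx ->
  exists2 s, spec A s & s =i root (char_poly A).
Proof.
move=> uA; have [S [U [AE AC sS nU uS]]] := jordan_exists uA.
have /ssmxP[P uP /(diagonalizable_forLR uP)[d]] := sS.
rewrite mxpoly.conjVmx // => SE.
have PS : P *m S = diag_mx d *m P by rewrite SE !mulmxA mulmxV // mul1mx.
pose s := [seq d 0 i | i <- enum 'I_n].
have ssP a (v : 'cV_n) : v != 0 -> S *m v = a *: v -> a \in s.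
  move=> v0 Sv; have : P *m v != 0 :> 'cV_n.
    by apply: contraNneq v0 => e; rewrite -[v](mulKmx uP) e mulmx0.
  case/cV0Pn=> i wi; apply/mapP; exists i; first by rewrite mem_enum.
  have : (P *m (S *m v)) i 0 = (P *m (a *: v)) i 0 by rewrite Sv.
  rewrite mulmxA PS -mulmxA mul_diag_mx -scalemxAr.
  by move: wi; rewrite !mxE => wi /(mulIf wi).
exists s.
  split=> [|k]; first by rewrite size_map size_enum_ord.
  have -> : A ^+ k = S ^+ k *m U ^+ k by rewrite AE; apply: exprMn_comm.
  rewrite unip_comm_tr; first last.
  - apply: expmx_twine; symmetry; apply: expmx_twine; exact: esym.
  - exact: unip_exp.
  rewrite -[S ^+ k](mulKmx uP) mxtrace_mulC.
  have -> : P *m S ^+ k = diag_mx d ^+ k *m P by rewrite (expmx_twine k (esym PS)).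
  rewrite mulmxK // big_map big_enum /=; apply: eq_bigr => i _.
  have -> : diag_mx d ^+ k = diag_mx (\row_j d 0 j ^+ k).
    elim: k => [|k IH].
      by apply/matrixP=> x y; rewrite expr0 !mxE expr0.
    rewrite expmxS IH mulmx_diag; congr diag_mx.
    by apply/rowP=> x; rewrite !mxE exprS.
  by rewrite !mxE eqxx mulr1n.
move=> a; apply/idP/idP => [/mapP[i _ ->]|].
  pose v : 'cV_n := invmx P *m delta_mx i 0.
  have v0 : v != 0.
    apply/negP=> /eqP/(congr1 (mulmx P)); rewrite mulKVmx // mulmx0.
    by move/matrixP/(_ i 0)/eqP; rewrite !mxE !eqxx oner_eq0.
  have Sv : S *m v = d 0 i *: v.
    rewrite SE -!mulmxA mulKVmx // scalemxAr; congr (_ *m _).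
    apply/colP=> j; rewrite mul_diag_mx !mxE eqxx andbT.
    by case: eqP => [->|]; rewrite ?mulr0.
  have [j [w0 Uw]] := nilp_last nU v0.
  apply: (root_eigen w0); rewrite AE -mulmxA.
  have SU1 : S *m (U - 1%:M) = (U - 1%:M) *m S.
    by rewrite mulmxBl mulmxBr AC mulmx1 mul1mx.
  move/eqP: Uw; rewrite mulmxBl mul1mx subr_eq0 => /eqP->.
  by rewrite mulmxA -(expmx_twine j (esym SU1)) -mulmxA Sv -scalemxAr.
move=> /eigen_col[v v0 Av]; apply: (ssP a v) => //.
have [L [LS /(_ a (mem_head _ _))/dvdpP[q]]] := jordan_poly [:: a] AE AC sS nU.
move=> Lq; rewrite -LS (pmx_eigen _ Av); congr (_ *: _).
move/(congr1 (horner^~ a)): Lq.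
by rewrite hornerM hornerXsubC subrr mulr0 hornerD hornerN hornerC => /eqP; rewrite subr_eq0 => /eqP.
Qed.

Lemma spec_uniq n (A : 'M[F]_n) s t : spec A s -> spec A t -> perm_eq s t.
Proof. by move=> [_ h] [_ h']; apply: power_sums_perm => k; rewrite -h. Qed.

End Spectrum.

(** * Ranks and irreducible sets of matrices *)

Section LinAlg.
Context (F : fieldType).

Lemma idem_factor n (e : 'M[F]_n) : e *m e = e ->
  exists r (X : 'M_(n, r)) (Y : 'M_(r, n)),
    [/\ X *m Y = e, Y *m X = 1%:M & r = \rank e].
Proof.
move=> ee; exists (\rank e), (col_base e), (row_base e); split=> //.
  exact: mulmx_base.
apply: (row_full_inj (col_base_full e)); apply: (row_free_inj (row_base_free e)).
by rewrite /= mulmx1 mulmxA -mulmxA !mulmx_base ee.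
Qed.

Lemma idem_tr n (e : 'M[F]_n) : e *m e = e -> \tr e = (\rank e)%:R.
Proof.
case/idem_factor=> r [X [Y [XY YX re]]].
by rewrite -XY mxtrace_mulC YX mxtrace1 XY re.
Qed.

(** A Bezout identity u p + v q = 1 evaluated at A and B splits X into two terms
    that vanish. *)
Lemma sylvester0 m n (A : 'M[F]_m) (B : 'M[F]_n) (X : 'M_(m, n)) p q :
  A *m X = X *m B -> X *m pmx B p = 0 -> pmx A q *m X = 0 ->
  coprimep p q -> X = 0.
Proof.
move=> AX Xp qX /Bezout_eq1_coprimepP[[u v] /= uv].
rewrite -[X]mul1mx -(pmx1 A) -uv pmxD !pmxM mulmxDl -!mulmxA qX mulmx0 addr0.
by rewrite (pmx_twine _ AX) Xp mulmx0.
Qed.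

(** Equality of ranks makes the row spaces of Z and e, and the column spaces of Z
    and f, coincide. *)
Lemma iso_of_rank m n (Z : 'M[F]_(m, n)) (e : 'M_n) (f : 'M_m) :
  Z = Z *m e -> Z = f *m Z -> \rank Z = \rank e -> \rank Z = \rank f ->
  e *m e = e -> f *m f = f ->
  exists J, [/\ J *m Z = e, Z *m J = f & J = e *m J *m f].
Proof.
move=> Ze fZ re rf ee ff.
have sZe : (Z <= e)%MS by rewrite Ze submxMl.
have/submxP[J1 eJ] : (e <= Z)%MS.
  by rewrite -(geq_leqif (mxrank_leqif_sup sZe)) re.
have sfZ : (Z^T <= f^T)%MS by rewrite fZ trmx_mul submxMl.
have/submxP[J2 fJ] : (f^T <= Z^T)%MS.
  by rewrite -(geq_leqif (mxrank_leqif_sup sfZ)) !mxrank_tr rf.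
have {}fJ : f = Z *m J2^T by rewrite -[f]trmxK fJ trmx_mul trmxK.
exists (e *m J1 *m f); split.
- by rewrite -mulmxA -fZ -mulmxA -eJ ee.
- by rewrite !mulmxA -Ze {1}fJ !mulmxA -[Z *m J1 *m Z]mulmxA -eJ -Ze -fJ.
by rewrite !mulmxA ee -[RHS]mulmxA ff.
Qed.

Lemma rank_ker_le m p n (Z : 'M[F]_(m, n)) (e : 'M_(p, n)) :
  (forall x : 'cV_n, Z *m x = 0 -> e *m x = 0) -> (\rank e <= \rank Z)%N.
Proof.
move=> h; apply: mxrankS; rewrite submxE; apply/eqP/matrixP=> i j.
have /h : Z *m col j (cokermx Z) = 0.
  by rewrite colE mulmxA mulmx_coker mul0mx.
by rewrite colE mulmxA -colE => /colP/(_ i); rewrite !mxE.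
Qed.

Lemma rank_im_le m p n (Z : 'M[F]_(m, n)) (e : 'M_(m, p)) :
  (forall y : 'cV_p, exists x : 'cV_n, e *m y = Z *m x) ->
  (\rank e <= \rank Z)%N.
Proof.
move=> h; rewrite -[leqLHS]mxrank_tr -[leqRHS]mxrank_tr; apply: mxrankS.
apply/row_subP=> i; rewrite -tr_col.
have [x ex] := h (delta_mx i 0).
by rewrite colE ex trmx_mul submxMl.
Qed.

(** Nonvanishing of minors passes up along a map of kernels. *)
Lemma rank_map_le (C : comNzRingType) (F1 F2 : fieldType)
  (c1 : {rmorphism C -> F1}) (c2 : {rmorphism C -> F2}) m n (A : 'M[C]_(m, n)) :
  (forall z, c1 z = 0 -> c2 z = 0) ->
  (\rank (map_mx c2 A) <= \rank (map_mx c1 A))%N.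
Proof.
move=> h; set A2 := map_mx c2 A; set A1 := map_mx c1 A.
pose f := maxrankfun A2; pose B := rowsub f A2.
have fB : row_full B^T.
  by rewrite /row_full mxrank_tr; apply: (maxrowsub_free A2).
pose g := fullrankfun fB; pose M := mxsub f g A.
have : \det (map_mx c2 M) != 0.
  have -> : map_mx c2 M = (rowsub g B^T)^T by apply/matrixP=> i j; rewrite !mxE.
  by rewrite det_tr -unitfE -unitmxE fullrowsub_unit.
rewrite det_map_mx => nz2.
have : \det (map_mx c1 M) != 0.
  by rewrite det_map_mx; apply: contra_neq nz2 => /h.
rewrite -unitfE -unitmxE -row_full_unit => /eqP <-.
have -> : map_mx c1 M = rowsub f 1%:M *m A1 *m (rowsub g 1%:M)^T.
  have -> : (rowsub g 1%:M)^T = colsub g 1%:M :> 'M[F1]_(_, _).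
    by apply/matrixP=> i j; rewrite !mxE eq_sym.
  rewrite mul_rowsub_mx mul1mx mulmx_colsub mulmx1.
  by apply/matrixP=> i j; rewrite !mxE.
by apply: leq_trans (mxrankM_maxl _ _) (mxrankM_maxr _ _).
Qed.

(** Take a subspace contained in P of largest dimension. *)
Lemma vspace_pred n (P : 'cV[F]_n -> Prop) :
  P 0 -> (forall a x y, P x -> P y -> P (a *: x + y)) ->
  exists U : {vspace 'cV[F]_n}, forall x, x \in U <-> P x.
Proof.
move=> P0 Pl.
pose good k := `[< exists2 U : {vspace 'cV[F]_n},
   \dim U = k & forall x, x \in U -> P x >].
have ex0 : exists k, good k.
  exists 0%N; apply/asboolP; exists 0%VS; first exact: dimv0.
  by move=> x; rewrite memv0 => /eqP->.
have bnd k : good k -> (k <= \dim (fullv : {vspace 'cV[F]_n}))%N.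
  by case/asboolP=> U <- _; apply: dimvS; apply: subvf.
case: (ex_maxnP ex0 bnd) => k /asboolP[U dU UP] kmax.
exists U => x; split=> [/UP //|Px].
have : good (\dim (U + <[x]>)%VS).
  apply/asboolP; exists (U + <[x]>)%VS => // y /memv_addP[u uU [v /vlineP[a ->] ->]].
  by rewrite addrC; apply: Pl => //; apply: UP.
move/kmax; rewrite -dU => le.
have /eqP-> : U == (U + <[x]>)%VS by rewrite eqEdim addvSl.
by rewrite memvE addvSr.
Qed.

(** While a free family is not a basis, some nonzero z kills it, but z does not kill
    all of P. *)
Lemma free_rows n (P : 'rV[F]_n -> Prop) :
  (forall z : 'cV_n, (forall v, P v -> v *m z = 0) -> z = 0) ->
  exists2 M : 'M_n, M \in unitmx & forall i, P (row i M).
Proof.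
move=> h.
suff /(_ n (leqnn n))[M fM PM] : forall r, (r <= n)%N ->
    exists2 M : 'M_(r, n), row_free M & forall i, P (row i M).
  by exists M; rewrite -?row_free_unit.
elim=> [|r IH] lern.
  by exists 0; [rewrite /row_free mxrank0 | case].
have [M fM PM] := IH (ltnW lern).
have [v Pv vM] : exists2 v, P v & ~~ (v <= M)%MS.
  apply: contrapT => hn.
  have : cokermx M = 0.
    apply/matrixP=> i j.
    suff /colP/(_ i) : col j (cokermx M) = 0 by rewrite !mxE.
    apply: h => v Pv; rewrite colE mulmxA.
    have /submxP[D ->] : (v <= M)%MS.
      by apply: contrapT => /negP nv; apply: hn; exists v.
    by rewrite -[D *m M *m _]mulmxA mulmx_coker mulmx0 mul0mx.
  move/eqP; rewrite -mxrank_eq0 mxrank_coker subn_eq0 (eqP fM).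
  by rewrite leqNgt lern.
exists (col_mx v M : 'M_(1 + r, n)).
  have e : \rank (v + M)%MS = \rank (col_mx v M) by rewrite addsmxE.
  rewrite -row_leq_rank -e.
  have := ltn_leqif (mxrank_leqif_sup (addsmxSr v M)).
  by rewrite addsmx_sub (negPf vM) (eqP fM) => ->.
change (forall i : 'I_(1 + r), P (row i (col_mx v M))) => i.
case: (split_ordP i) => j ->; last by rewrite rowKd.
by rewrite rowKu (_ : row j v = v) //; apply/rowP=> k; rewrite !mxE (ord1 j).
Qed.

End LinAlg.

Section Irreducible.
Context (F : closedFieldType) (n : nat) (P : 'M[F]_n -> Prop).
Context (P1 : P 1%:M) (PM : forall x y, P x -> P y -> P (x *m y)).
Context (n_gt0 : (0 < n)%N).
Context (irr : forall U : {vspace 'cV[F]_n},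
  (forall g, P g -> forall x, x \in U -> g *m x \in U) -> U = 0%VS \/ U = fullv).

Lemma irr_pred (Q : 'cV[F]_n -> Prop) : Q 0 ->
  (forall a x y, Q x -> Q y -> Q (a *: x + y)) ->
  (forall g x, P g -> Q x -> Q (g *m x)) ->
  (forall x, Q x -> x = 0) \/ (forall x, Q x).
Proof.
move=> Q0 Ql Qg; have [U UQ] := vspace_pred Q0 Ql.
case: (@irr U) => [g Pg x /UQ Qx|U0|U1]; first by apply/UQ/Qg.
  by left=> x /UQ; rewrite U0 memv0 => /eqP.
by right=> x; apply/UQ; rewrite U1 memvf.
Qed.

Lemma irr_col (u : 'cV_n) (f : 'rV_n) : u != 0 ->
  (forall g, P g -> f *m g *m u = 0) -> f = 0.
Proof.
move=> u0 h; case: (@irr_pred (fun z => forall g, P g -> f *m g *m z = 0)).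
- by move=> g _; rewrite mulmx0.
- by move=> a x y hx hy g Pg; rewrite mulmxDr -scalemxAr hx ?hy // scaler0 addr0.
- by move=> g x Pg hx k Pk; rewrite mulmxA -[f *m k *m g]mulmxA; apply/hx/PM.
- by move/(_ u h) => e; rewrite e eqxx in u0.
move=> hz; apply/rowP=> i; have := hz (delta_mx i 0) _ P1.
by rewrite mulmx1 -colE => /colP/(_ 0); rewrite !mxE.
Qed.

Lemma irr_row (v : 'rV_n) (z : 'cV_n) : v != 0 ->
  (forall g, P g -> v *m g *m z = 0) -> z = 0.
Proof.
move=> v0 h; case: (@irr_pred (fun z => forall g, P g -> v *m g *m z = 0)).
- by move=> g _; rewrite mulmx0.
- by move=> a x y hx hy g Pg; rewrite mulmxDr -scalemxAr hx ?hy // scaler0 addr0.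
- by move=> g x Pg hx k Pk; rewrite mulmxA -[v *m k *m g]mulmxA; apply/hx/PM.
- by move/(_ z h).
move=> hz; have v00 : v = 0.
  apply/rowP=> i; have := hz (delta_mx i 0) _ P1.
  by rewrite mulmx1 -colE => /colP/(_ 0); rewrite !mxE.
by rewrite v00 eqxx in v0.
Qed.

(** A nonzero element x of least rank in the algebra A has rank one: for y in A,
    x y has an eigenvalue a on the image of x, and x y x - a x has smaller rank,
    so that x y x = a x. The predicate R0 records where the eigenvalues lie. *)
Lemma irr_rank_one (A : 'M[F]_n -> Prop) (R0 : F -> Prop) :
  (forall x, P x -> A x) ->
  (forall x y, A x -> A y -> A (x *m y)) ->
  (forall x y, A x -> A y -> A (x - y)) ->
  (forall a x, R0 a -> A x -> A (a *: x)) ->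
  (forall b a (v : 'cV_n), A b -> v != 0 -> b *m v = a *: v -> R0 a) ->
  exists (u : 'cV_n) (v : 'rV_n), [/\ A (u *m v), u != 0, v != 0 &
    forall y, A y -> R0 ((v *m y *m u) 0 0)].
Proof.
move=> PA AM AB AZ Aeig.
pose good k := `[< exists x, [/\ A x, x != 0 & \rank x = k] >].
have ex : exists k, good k.
  exists (\rank (1%:M : 'M[F]_n)); apply/asboolP; exists 1%:M; split=> //.
    exact: PA.
  by rewrite -mxrank_eq0 mxrank1 -lt0n.
case: (ex_minnP ex) => r /asboolP[x [Ax x0 rx]] xmin.
have key y : A y -> exists2 a, R0 a & x *m y *m x = a *: x.
  move=> Ay.
  have [s [C [B [xE fC rs]]]] : exists s (C : 'M_(n, s)) (B : 'M_(s, n)),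
      [/\ x = C *m B, row_full C & s = \rank x].
    by exists (\rank x), (col_base x), (row_base x); rewrite mulmx_base col_base_full.
  pose M0 := B *m y *m C.
  have r0 : (0 < s)%N by rewrite rs lt0n mxrank_eq0.
  have [a ra] : exists a, root (char_poly M0) a.
    apply/closed_rootP; rewrite size_char_poly; apply/eqP=> - [e].
    by rewrite e in r0.
  have [w w0 Mw] := eigen_col ra.
  have xyC : x *m y *m C = C *m M0 by rewrite {1}xE /M0 !mulmxA.
  have Cw0 : C *m w != 0.
    apply: contraNneq w0 => e.
    by apply/eqP/(row_full_inj fC); rewrite e mulmx0.
  have Ra : R0 a.
    apply: (Aeig (x *m y) a (C *m w)) => //; first exact: AM.
    by rewrite mulmxA xyC -mulmxA Mw scalemxAr.
  exists a => //; apply/eqP; rewrite -subr_eq0; apply/negPn/negP=> z0.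
  have zE : x *m y *m x - a *: x = C *m ((M0 - a%:M) *m B).
    rewrite {2 3}xE mulmxA xyC mulmxBl mulmxBr -mulmxA mul_scalar_mx.
    by rewrite -scalemxAr.
  have : good (\rank (x *m y *m x - a *: x)).
    apply/asboolP; exists (x *m y *m x - a *: x); split=> //.
    by apply: AB; [apply: (AM) => //; apply: AM | apply: AZ].
  move/xmin; rewrite -rx -rs leqNgt => /negP; apply.
  rewrite zE mulmxA; apply: leq_ltn_trans (mxrankM_maxl _ _) _.
  apply: leq_ltn_trans (mxrankM_maxr _ _) _.
  rewrite ltn_neqAle rank_leq_row andbT.
  apply/negP=> /eqP e.
  have : (M0 - a%:M) \in unitmx by rewrite -row_full_unit /row_full e.
  move=> uM; case/negP: w0; rewrite -[w](mulKmx uM) mulmxBl Mw mul_scalar_mx.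
  by rewrite subrr mulmx0.
have [i [j xij]] : exists i j, x i j != 0.
  apply: contrapT => hn; case/negP: x0; apply/eqP/matrixP=> i j; rewrite mxE.
  by apply/eqP/negPn/negP=> h; apply: hn; exists i, j.
pose u : 'cV_n := x *m delta_mx j 0.
have u0 : u != 0.
  apply: contraNneq xij => /colP/(_ i).
  by rewrite /u -colE !mxE => ->.
pose f0 : 'rV_n := (x i j)^-1 *: delta_mx 0 i.
have f0u : f0 *m u = 1%:M.
  rewrite /f0 -scalemxAl -rowE /u -colE; apply/matrixP=> k l.
  by rewrite !mxE !ord1 eqxx mulVf.
have ann (f : 'rV_n) : f *m u = 0 -> f *m x = 0.
  move=> fu; apply: (irr_col u0) => g /PA/key[a _ e].
  by rewrite /u !mulmxA -[f *m x *m g]mulmxA -[f *m _ *m x]mulmxA e -scalemxAr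
    -scalemxAl -mulmxA -/u fu scaler0.
have xE : x = u *m (f0 *m x).
  apply/eqP; rewrite -subr_eq0; apply/eqP/row_matrixP=> k; rewrite row0.
  rewrite -{1}[x]mul1mx mulmxA -mulmxBl row_mul; apply: ann.
  by rewrite -row_mul mulmxBl mul1mx -mulmxA f0u mulmx1 subrr row0.
exists u, (f0 *m x); rewrite -xE; split=> //.
  by apply: contraNneq x0 => e; rewrite xE e mulmx0.
move=> y /key[a Ra]; rewrite {1 2}xE.
set v := f0 *m x; have -> : u *m v *m y *m (u *m v) = (v *m y *m u) 0 0 *: x.
  rewrite [in RHS]xE -/v scalemxAr -mul_scalar_mx.
  by rewrite -[((v *m y *m u) 0 0)%:M]mx11_scalar !mulmxA.
move/eqP; rewrite -subr_eq0 -scalerBl scaler_eq0 (negPf x0) orbF subr_eq0.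
by move/eqP->.
Qed.

(** Burnside: the algebra contains a rank one matrix, whose translates on both
    sides read off all entries of Z. *)
Lemma irr_trace_nondeg (Z : 'M[F]_n) :
  (forall g, P g -> \tr (Z *m g) = 0) -> Z = 0.
Proof.
move=> hZ; pose A y := forall Z : 'M[F]_n,
  (forall g, P g -> \tr (Z *m g) = 0) -> \tr (Z *m y) = 0.
have [|||||u [v [Auv u0 v0 _]]] := @irr_rank_one A (fun=> True).
- by move=> x Px Y; apply.
- move=> x y Ax Ay Y hY; rewrite mulmxA mxtrace_mulC mulmxA; apply: Ax => g Pg.
  rewrite -mulmxA mxtrace_mulC; apply: Ay => k Pk.
  by rewrite -mulmxA; apply/hY/PM.
- by move=> x y Ax Ay Y hY; rewrite mulmxBr linearB /= Ax ?Ay // subrr.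
- by move=> a x _ Ax Y hY; rewrite -scalemxAr linearZ /= Ax // mulr0.
- by [].
apply/matrixP=> i j.
have h k l : P k -> P l -> v *m k *m (Z *m l *m u) = 0.
  move=> Pk Pl.
  have : \tr (k *m Z *m l *m (u *m v)) = 0.
    apply: Auv => g Pg; rewrite -!mulmxA mxtrace_mulC -!mulmxA.
    by apply/hZ/PM; [| apply: PM].
  rewrite mulmxA mxtrace_mulC !mulmxA => e.
  by rewrite [LHS]mx11_scalar -trace_mx11 e; apply/matrixP=> a b; rewrite !mxE mul0rn.
have h2 l : P l -> Z *m l *m u = 0.
  by move=> Pl; apply: (irr_row v0) => k Pk; apply: h.
have : row i Z = 0.
  apply: (irr_col u0) => g Pg.
  by rewrite -!row_mul h2 // row0.
by move/rowP/(_ j); rewrite !mxE.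
Qed.

End Irreducible.

(** * Exponentials and Gram matrices of traces *)

Section Exponential.
Context (F : closedFieldType) (char0 : forall n, n.+1%:R != 0 :> F).

Lemma scale_expmx n a (N : 'M[F]_n) k : (a *: N) ^+ k = a ^+ k *: N ^+ k.
Proof.
elim: k => [|k IH]; first by rewrite !expr0 scale1r.
by rewrite !expmxS IH -scalemxAl -scalemxAr scalerA exprS.
Qed.

Definition exp_poly d (a : F) : {poly F} := \poly_(k < d) (a ^+ k / k`!%:R).

Lemma mxexpE n a (N : 'M[F]_n) : mxexp (a *: N) = pmx N (exp_poly n a).
Proof.
rewrite /exp_poly poly_def pmx_sum; apply: eq_bigr => k _.
by rewrite pmxZ pmxXn scale_expmx scalerA mulrC.
Qed.

Lemma fact_neq0 k : k`!%:R != 0 :> F.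
Proof. by have := fact_gt0 k; case: (k`!). Qed.

Lemma pmx_low0 n (N : 'M[F]_n) (p : {poly F}) : nilpotent_mx N ->
  (forall k, (k < n)%N -> p`_k = 0) -> pmx N p = 0.
Proof.
move=> nN h; rewrite pmxE big1 // => k _; case: (ltnP k n) => kn.
  by rewrite h // scale0r.
by rewrite (nilp_exp nN kn) scaler0.
Qed.

Lemma mxexpD n a b (N : 'M[F]_n) : nilpotent_mx N ->
  mxexp (a *: N) *m mxexp (b *: N) = mxexp ((a + b) *: N).
Proof.
move=> nN; rewrite !mxexpE -pmxM; apply/eqP; rewrite -subr_eq0 -pmxB.
apply/eqP/pmx_low0 => // k kn; rewrite coefB coefM coef_poly kn.
apply/eqP; rewrite subr_eq0; apply/eqP.
rewrite addrC exprDn mulr_suml; apply: eq_bigr => i _.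
have ik : (i <= k)%N by rewrite -ltnS.
rewrite !coef_poly (leq_ltn_trans ik kn) (leq_ltn_trans (leq_subr i k) kn).
have e : k`!%:R = 'C(k, i)%:R * (i`!%:R * (k - i)`!%:R) :> F.
  by rewrite -!natrM bin_fact.
rewrite e -[_ *+ 'C(k, i)]mulr_natl !invfM.
have hC : 'C(k, i)%:R != 0 :> F by apply: contraTneq (fact_neq0 k); rewrite e => ->; rewrite mul0r eqxx.
rewrite [RHS](_ : _ = ('C(k, i)%:R * 'C(k, i)%:R^-1) *
  (a ^+ i / i`!%:R * (b ^+ (k - i) / (k - i)`!%:R))); last by ring.
by rewrite mulfV // mul1r.
Qed.

Lemma mxexp0 n : mxexp (0 : 'M[F]_n) = 1%:M.
Proof.
case: n => [|n]; first exact: mx0_eq.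
rewrite /mxexp big_ord_recl big1 ?addr0 => [|i _].
  by rewrite fact0 invr1 scale1r.
by rewrite expmxS mul0mx scaler0.
Qed.

Lemma mxexpK n a (N : 'M[F]_n) : nilpotent_mx N ->
  mxexp (a *: N) *m mxexp (- a *: N) = 1%:M.
Proof. by move=> nN; rewrite mxexpD // subrr scale0r mxexp0. Qed.

Lemma mxexp_twine n (A M N : 'M[F]_n) : A *m N = M *m A ->
  A *m mxexp N = mxexp M *m A.
Proof.
move=> h; rewrite mulmx_suml mulmx_sumr; apply: eq_bigr => k _.
by rewrite -scalemxAl -scalemxAr (expmx_twine k (esym h)).
Qed.

(** Each entry is a polynomial with infinitely many roots. *)
Lemma mxpoly_nat0 m n d (A : nat -> 'M[F]_(m, n)) :
  (forall t : nat, \sum_(k < d) t%:R ^+ k *: A k = 0) ->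
  forall k, (k < d)%N -> A k = 0.
Proof.
move=> h k kd; apply/matrixP=> i j; rewrite mxE.
pose p := \poly_(k < d) A k i j.
have p0 : p = 0.
  apply: (@roots_geq_poly_eq0 _ p [seq t%:R | t <- iota 0 d]); last first.
  - by rewrite size_map size_iota size_poly.
  - rewrite map_inj_uniq ?iota_uniq //; exact: natc_inj.
  apply/allP=> _ /mapP[t _ ->]; rewrite /root horner_poly.
  have /matrixP/(_ i j) := h t; rewrite summxE mxE => e; rewrite -[X in _ == X]e.
  by apply/eqP/eq_bigr=> a _; rewrite mxE mulrC.
by have := coef_poly d (fun k => A k i j) k; rewrite -/p p0 coef0 kd.
Qed.

Lemma mxexp_inj n (X Y : 'M[F]_n) : nilpotent_mx X -> nilpotent_mx Y ->
  (forall t : nat, mxexp (t%:R *: X) = mxexp (t%:R *: Y)) -> X = Y.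
Proof.
move=> nX nY h.
have [n1|n1] := leqP n 1.
  have := nilp_exp nX n1; have := nilp_exp nY n1; rewrite !expr1 => -> ->.
  by [].
have := @mxpoly_nat0 _ _ n (fun k => (k`!%:R)^-1 *: (X ^+ k - Y ^+ k)) _ 1 n1.
rewrite !expr1 invr1 scale1r => /(_ _)/eqP; rewrite subr_eq0 => e; apply/eqP/e.
move=> t; apply/eqP.
rewrite (eq_bigr (fun k : 'I_n => (k`!%:R)^-1 *: (t%:R *: X) ^+ k
   - (k`!%:R)^-1 *: (t%:R *: Y) ^+ k)); last first.
  move=> k _; rewrite !scale_expmx -scalerBr -scalerBr !scalerA.
  by rewrite mulrC.
by rewrite sumrB subr_eq0; apply/eqP/h.
Qed.

End Exponential.

Section Gram.
Context (F : fieldType).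

Lemma lin_mulmxM m n p q (A : 'M[F]_(m, n)) (B : 'M_(n, p)) :
  lin_mulmx (A *m B) = lin_mulmx B *m lin_mulmx A :> 'M_(p * q, m * q).
Proof.
apply/row_matrixP=> i; rewrite !rowE mulmxA -[delta_mx 0 i]vec_mxK.
by rewrite !mul_vec_lin /= mulmxA.
Qed.

Lemma lin_mulmx1 n q : lin_mulmx (1%:M : 'M[F]_n) = 1%:M :> 'M_(n * q).
Proof.
apply/row_matrixP=> i; rewrite !rowE mulmx1 -[delta_mx 0 i]vec_mxK.
by rewrite mul_vec_lin /= mul1mx.
Qed.

Lemma rank_lin_mulmx m n q (A : 'M[F]_(m, n)) :
  \rank (lin_mulmx A : 'M_(n * q, m * q)) = (\rank A * q)%N.
Proof.
apply/eqP; rewrite eqn_leq; apply/andP; split.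
  rewrite -{1}(mulmx_base A) lin_mulmxM.
  by apply: leq_trans (mxrankM_maxl _ _) _; apply: rank_leq_col.
have [C hC] : exists C, C *m col_base A = 1%:M.
  by apply/row_fullP/col_base_full.
have [R hR] : exists R, row_base A *m R = 1%:M.
  by apply/row_freeP/row_base_free.
have e : C *m A *m R = 1%:M.
  by rewrite -hR -[X in C *m X]mulmx_base mulmxA hC mul1mx.
have := congr1 (fun B => \rank (lin_mulmx B : 'M_(_ * q, _ * q))) e.
rewrite lin_mulmx1 mxrank1 => <-; rewrite !lin_mulmxM.
by apply: leq_trans (mxrankM_maxr _ _) (mxrankM_maxl _ _).
Qed.

Lemma mxvec_dot m n (A B : 'M[F]_(m, n)) :
  (mxvec A *m (mxvec B)^T) 0 0 = \tr (A^T *m B).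
Proof.
rewrite mxE /mxtrace (reindex _ (curry_mxvec_bij _ _)) /=.
rewrite (eq_bigr (fun k : 'I_m * 'I_n => A k.1 k.2 * B k.1 k.2)); last first.
  by case=> i j _; rewrite mxE !mxvecE.
rewrite -(pair_bigA _ (fun i j => A i j * B i j)) exchange_big.
by apply: eq_bigr => j _; rewrite mxE; apply: eq_bigr => i _; rewrite mxE.
Qed.

Definition vecs N d (g : 'I_N -> 'M[F]_d) : 'M_(N, d * d) :=
  \matrix_i mxvec (g i).

Definition gram N d (g : 'I_N -> 'M[F]_d) (X : 'M_d) : 'M_N :=
  \matrix_(i, j) \tr (g i *m X *m g j).

Lemma gramE N d (g : 'I_N -> 'M[F]_d) X :
  gram g X = vecs (fun i => (g i)^T) *m (vecs g *m lin_mulmx X)^T.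
Proof.
apply/matrixP=> i j; rewrite mxE -mulmxA -[g i]trmxK -mxvec_dot.
rewrite -[mxvec (X *m g j)]mul_vec_lin !mxE; apply: eq_bigr => k _.
rewrite !mxE; congr (_ * _); apply: eq_bigr => l _.
by rewrite !mxE.
Qed.

Lemma gram_rank_le N d (g : 'I_N -> 'M[F]_d) X :
  (\rank (gram g X) <= \rank X * d)%N.
Proof.
rewrite gramE; apply: leq_trans (mxrankM_maxr _ _) _.
by rewrite mxrank_tr -rank_lin_mulmx mxrankM_maxr.
Qed.

Lemma gram_rank_vecs N d (g : 'I_N -> 'M[F]_d) X :
  (\rank (gram g X) <= \rank (vecs g))%N.
Proof.
rewrite gramE; apply: leq_trans (mxrankM_maxr _ _) _.
by rewrite mxrank_tr mxrankM_maxl.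
Qed.

(** When the g_i span all matrices, the Gram matrix is equivalent to left
    multiplication by X on d x d matrices. *)
Lemma gram_rank_eq d (g : 'I_(d * d) -> 'M[F]_d) X :
  vecs g \in unitmx -> \rank (gram g X) = (\rank X * d)%N.
Proof.
move=> ug; rewrite gramE -rank_lin_mulmx.
pose T : 'M[F]_(d * d) := lin_mx trmx.
have TT : T *m T = 1%:M.
  apply/row_matrixP=> i; rewrite !rowE mulmxA mulmx1 -[delta_mx 0 i]vec_mxK.
  by rewrite !mul_vec_lin /= trmxK.
have uT : T \in unitmx by case/mulmx1_unit: TT.
have -> : vecs (fun i => (g i)^T) = vecs g *m T.
  by apply/row_matrixP=> i; rewrite row_mul !rowK mul_vec_lin.
rewrite eqmxMfull ?row_full_unit ?unitmx_mul ?ug //.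
by rewrite mxrank_tr eqmxMfull ?row_full_unit.
Qed.

End Gram.

(** * Characters of a finite group extended by a semisimple operator *)

Section TraceOps.
Context (F : fieldType).

Lemma tr_lin_mul n (B C : 'M[F]_n) :
  \tr (lin_mulmx B *m lin_mulmxr C : 'M_(n * n)) = \tr B * \tr C.
Proof.
rewrite {1}/mxtrace (reindex _ (curry_mxvec_bij _ _)) /=.
rewrite (eq_bigr (fun k : 'I_n * 'I_n => B k.1 k.1 * C k.2 k.2)); last first.
  case=> i j _ /=; set k := mxvec_index i j; set M := _ *m _.
  have -> : M k k = ((delta_mx 0 k : 'rV_(n * n)) *m M) 0 k by rewrite -rowE [RHS]mxE.
  rewrite /k -mxvec_delta mulmxA !mul_vec_lin /= mxvecE mxE (bigD1 j) //=.
  rewrite big1 ?addr0 => [|l lj]; last first.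
    rewrite mxE big1 ?mul0r // => a _.
    by rewrite mxE (negPf lj) andbF mulr0.
  congr (_ * _); rewrite mxE (bigD1 i) //= big1 ?addr0 => [|a ai].
    by rewrite mxE !eqxx mulr1.
  by rewrite mxE (negPf ai) mulr0.
rewrite -(pair_bigA _ (fun i j => B i i * C j j)) /= /mxtrace mulr_suml.
by apply: eq_bigr => i _; rewrite mulr_sumr.
Qed.

End TraceOps.

(** The representation theory of a finite group extended by a semisimple
    operator that normalises it: A acts semisimply, l is the finite group. *)
Section Frame.
Context (F : closedFieldType) (char0 : forall n, n.+1%:R != 0 :> F).
Context (n : nat) (A : 'M[F]_n) (l : seq 'M[F]_n).
Context (uA : A \in unitmx) (sA : ssmx A) (ul : uniq l) (l1 : 1%:M \in l).
Context (lM : forall y z, y \in l -> z \in l -> y *m z \in l).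
Context (lU : forall y, y \in l -> y \in unitmx).
Context (lA : forall y, y \in l -> A *m y *m invmx A \in l).

Definition cent X := A *m X = X *m A /\ forall y, y \in l -> y *m X = X *m y.

Lemma centM X Y : cent X -> cent Y -> cent (X *m Y).
Proof.
case=> hX kX [hY kY]; split=> [|y yl]; first by rewrite mulmxA hX -mulmxA hY mulmxA.
by rewrite mulmxA kX // -mulmxA kY // mulmxA.
Qed.
Lemma centD X Y : cent X -> cent Y -> cent (X + Y).
Proof.
by case=> hX kX [hY kY]; split=> [|y yl]; rewrite mulmxDr mulmxDl ?hX ?hY ?kX ?kY.
Qed.
Lemma centB X Y : cent X -> cent Y -> cent (X - Y).
Proof.
by case=> hX kX [hY kY]; split=> [|y yl]; rewrite mulmxBr mulmxBl ?hX ?hY ?kX ?kY.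
Qed.
Lemma cent0 : cent 0.
Proof. by split=> [|y _]; rewrite mulmx0 mul0mx. Qed.

Lemma sum_stable (f g : 'M[F]_n -> 'M[F]_n) (V : zmodType) (h : 'M[F]_n -> V) :
  cancel f g -> (forall y, y \in l -> f y \in l) ->
  \sum_(y <- l) h (f y) = \sum_(y <- l) h y.
Proof.
move=> fg fl; rewrite -(big_map f xpredT h); apply: perm_big.
have U : uniq (map f l) by rewrite map_inj_uniq //; apply: can_inj fg.
have sub : {subset map f l <= l} by move=> _ /mapP[y yl ->]; apply: fl.
apply: uniq_perm => //.
by have [] := uniq_min_size U sub; rewrite ?size_map.
Qed.

Context (rs : seq F) (L : F -> {poly F}) (urs : uniq rs).
Context (e1 : \sum_(a <- rs) pmx A (L a) = 1%:M).
Context (eA : forall a, a \in rs -> A *m pmx A (L a) = a *: pmx A (L a)).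
Let e a := pmx A (L a).

Let Ae a : A *m e a = e a *m A.
Proof. exact/esym/(pmx_twine (B := A)). Qed.

Let ee a : a \in rs -> e a *m e a = e a.
Proof.
move=> ars; have z b : b \in rs -> b != a -> e a *m e b = 0.
  move=> brs ba; apply/eqP; have : (b - a) *: (e a *m e b) == 0.
    rewrite scalerBl subr_eq0 scalemxAr -(eA brs) scalemxAl -(eA ars).
    by rewrite -/(e a) -/(e b) mulmxA -Ae.
  by rewrite scaler_eq0 subr_eq0 (negPf ba).
have : e a *m 1%:M = \sum_(b <- rs) e a *m e b by rewrite -e1 mulmx_sumr.
rewrite mulmx1 (bigD1_seq a) //= big1_seq ?addr0 // => b /andP[ba brs].
exact: z.
Qed.

Definition aver X : 'M[F]_n := (size l)%:R^-1 *:
  \sum_(y <- l) y *m (\sum_(a <- rs) e a *m X *m e a) *m invmx y.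

Let sz : (size l)%:R != 0 :> F.
Proof. by apply: natc_neq0 => //; case: l l1. Qed.

Lemma aver1 : aver 1%:M = 1%:M.
Proof.
rewrite /aver.
have -> : \sum_(a <- rs) e a *m 1%:M *m e a = 1%:M.
  by rewrite -[RHS]e1 !big_seq; apply: eq_bigr => a ars; rewrite mulmx1 ee.
rewrite big_seq (eq_bigr (fun=> 1%:M)) => [|y yl]; last first.
  by rewrite mulmx1 mulmxV // lU.
rewrite -big_seq big_const_seq count_predT iter_addr_0 -scaler_nat scalerA.
by rewrite mulVf // scale1r.
Qed.

Lemma averMl X Y : cent X -> aver (X *m Y) = X *m aver Y.
Proof.
case=> XA Xl; rewrite /aver -scalemxAr mulmx_sumr; congr (_ *: _).
rewrite big_seq [RHS]big_seq; have -> : \sum_(a <- rs) e a *m (X *m Y) *m e a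
  = X *m \sum_(a <- rs) e a *m Y *m e a.
  rewrite mulmx_sumr; apply: eq_bigr => a _.
  by rewrite !mulmxA /e (pmx_twine (B := A)).
by apply: eq_bigr => y yl; rewrite mulmxA Xl // -!mulmxA.
Qed.

Lemma averMr X Y : cent Y -> aver (X *m Y) = aver X *m Y.
Proof.
case=> YA Yl; rewrite /aver -scalemxAl mulmx_suml; congr (_ *: _).
rewrite big_seq [RHS]big_seq; have -> : \sum_(a <- rs) e a *m (X *m Y) *m e a
  = (\sum_(a <- rs) e a *m X *m e a) *m Y.
  rewrite mulmx_suml; apply: eq_bigr => a _.
  by rewrite -!mulmxA /e (pmx_twine (B := A) (X := Y)).
apply: eq_bigr => y yl; rewrite -[RHS]mulmxA.
by rewrite (invmx_twine (lU yl) (lU yl) (Yl y yl)) !mulmxA.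
Qed.

Lemma aver_cent X : cent (aver X).
Proof.
pose S := \sum_(a <- rs) e a *m X *m e a.
have AS : A *m S = S *m A.
  rewrite mulmx_sumr mulmx_suml !big_seq; apply: eq_bigr => a ars.
  by rewrite !mulmxA eA // -[RHS]mulmxA -Ae eA // -scalemxAr -!scalemxAl.
split.
  rewrite /aver -scalemxAr -scalemxAl mulmx_sumr mulmx_suml -/S; congr (_ *: _).
  rewrite -[RHS](sum_stable (f := fun y => A *m y *m invmx A)
     (g := fun y => invmx A *m y *m A) (fun y => y *m S *m invmx y *m A)) //.
  rewrite !big_seq; apply: eq_bigr => y yl.
    have uy := lU yl.
    have -> : invmx (A *m y *m invmx A) = A *m invmx y *m invmx A.
      apply: (can_inj (mulKmx (lU (lA yl)))); rewrite mulmxV ?lU ?lA //.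
      by rewrite !mulmxA mulmxKV // mulmxK // mulmxV.
    rewrite -[RHS]mulmxA mulmxKV //.
    rewrite -[A *m y *m invmx A *m S]mulmxA (invmx_twine uA uA AS).
    by rewrite !mulmxA mulmxKV.
  by move=> y /=; rewrite !mulmxA mulVmx // mul1mx mulmxKV.
move=> z zl; have uz := lU zl.
rewrite /aver -scalemxAr -scalemxAl mulmx_sumr mulmx_suml -/S; congr (_ *: _).
rewrite -[RHS](sum_stable (f := mulmx z) (g := mulmx (invmx z))
   (fun y => y *m S *m invmx y *m z)) //.
- rewrite !big_seq; apply: eq_bigr => y yl; have uy := lU yl.
  have -> : invmx (z *m y) = invmx y *m invmx z.
    apply: (can_inj (mulKmx (lU (lM zl yl)))); rewrite mulmxV ?lU ?lM //.
    by rewrite !mulmxA mulmxK // mulmxV.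
  by rewrite !mulmxA mulmxKV.
- exact: mulKmx.
by move=> y yl; apply: lM.
Qed.

(** Averaging over A and l is linear over the centraliser, so it preserves the
    relation X Y X = X. *)
Lemma cent_reg X : cent X -> exists2 Y, cent Y & X *m Y *m X = X.
Proof.
move=> cX; exists (aver (pinvmx X)); first exact: aver_cent.
rewrite -averMl // -averMr //.
by rewrite mulmxKpV // -[X in aver X]mulmx1 averMl // aver1 mulmx1.
Qed.

Lemma aver_id X : cent X -> aver X = X.
Proof. by move=> cX; rewrite -[X in aver X]mulmx1 averMl // aver1 mulmx1. Qed.

Let opmx P Q : 'M[F]_(n * n) := \sum_(y <- l) \sum_(a <- rs)
  (size l)%:R^-1 *: (lin_mulmx (y *m e a *m P) *m lin_mulmxr (Q *m e a *m invmx y)).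

Let opmxE P Q X : mxvec X *m opmx P Q = mxvec (aver (P *m X *m Q)).
Proof.
rewrite /opmx mulmx_sumr /aver linearZ linear_sum /= scaler_sumr.
apply: eq_bigr => y _; rewrite mulmx_sumr mulmx_sumr mulmx_suml linear_sum.
rewrite scaler_sumr; apply: eq_bigr => a _.
rewrite -scalemxAr mulmxA !mul_vec_lin /=; congr (_ *: mxvec _).
by rewrite !mulmxA.
Qed.

(** The operator X -> aver (p X p) is a nonzero idempotent, so its trace is not
    zero; only traces of the form tr (A^m y p) enter that trace. *)
Lemma cent_hom_neq0 p1 p2 : cent p1 -> cent p2 ->
  p1 *m p1 = p1 -> p2 *m p2 = p2 -> p1 != 0 ->
  (forall y p, y \in l -> \tr (y *m pmx A p *m p1) = \tr (y *m pmx A p *m p2)) ->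
  exists X, [/\ cent X, X != 0 & X = p2 *m X *m p1].
Proof.
move=> c1 c2 i1 i2 p0 ht.
apply: contrapT => hn.
have z X : aver (p2 *m X *m p1) = 0.
  apply: contrapT => /eqP h; apply: hn; exists (aver (p2 *m X *m p1)).
  split=> //; first exact: aver_cent.
  by rewrite -averMl // -averMr // -!mulmxA i1 !mulmxA i2.
have E2 : opmx p2 p1 = 0.
  apply/row_matrixP=> i; rewrite rowE -[delta_mx 0 i]vec_mxK opmxE z row0.
  by rewrite linear0.
have t1 : \tr (opmx p1 p1) = \tr (opmx p2 p1).
  rewrite !raddf_sum !big_seq /=; apply: eq_bigr => y yl.
  rewrite !raddf_sum; apply: eq_bigr => a _ /=.
  by rewrite !linearZ /= !tr_lin_mul ht.
have E1 : opmx p1 p1 *m opmx p1 p1 = opmx p1 p1.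
  apply/row_matrixP=> i; rewrite !rowE mulmxA -[delta_mx 0 i]vec_mxK !opmxE.
  set X := vec_mx _; congr mxvec.
  have -> : aver (p1 *m X *m p1) = p1 *m aver X *m p1.
    by rewrite averMr // averMl.
  rewrite !mulmxA i1 -!mulmxA i1 !mulmxA; rewrite averMr // averMl //.
  by rewrite aver_id //; apply: aver_cent.
have : opmx p1 p1 != 0.
  apply: contraNneq p0 => h0; apply/eqP/(can_inj mxvecK).
  have := opmxE p1 p1 p1; rewrite h0 mulmx0 i1 i1 aver_id // => <-.
  by rewrite linear0.
rewrite -mxrank_eq0 => /negP; apply.
have := idem_tr E1; rewrite t1 E2 raddf0 => /eqP; rewrite eq_sym.
by rewrite -[0]/(0%:R) => /eqP/natc_inj-> //.
Qed.

(** Equivalence of idempotents of equal character (Brauer-Nesbitt). *)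
Lemma cent_equiv p1 p2 : cent p1 -> cent p2 ->
  p1 *m p1 = p1 -> p2 *m p2 = p2 ->
  (forall y p, y \in l -> \tr (y *m pmx A p *m p1) = \tr (y *m pmx A p *m p2)) ->
  exists X Y, [/\ cent X, cent Y, Y *m X = p1 & X *m Y = p2] /\
    [/\ X = p2 *m X & Y = p1 *m Y] /\ [/\ X = X *m p1 & Y = Y *m p2].
Proof.
have [k] := ubnP (\rank p1); elim: k => // k IH in p1 p2 *; rewrite ltnS => rk.
move=> c1 c2 i1 i2 ht.
have [p0|p0] := eqVneq p1 0.
  have tr0 : \tr p2 = 0.
    by have := ht 1%:M 1 l1; rewrite pmx1 !mul1mx p0 raddf0 => <-.
  have p20 : p2 = 0.
    apply/eqP; rewrite -mxrank_eq0; apply/eqP/(natc_inj char0).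
    by rewrite -idem_tr // tr0.
  exists 0, 0; rewrite p0 p20 !mulmx0.
  by split; [split=> //; exact: cent0 | split].
have [X0 [cX X00 XE]] := cent_hom_neq0 c1 c2 i1 i2 p0 ht.
have [Y0 cY XYX] := cent_reg cX.
have Xl : p2 *m X0 = X0 by rewrite XE -mulmxA mulmxA !mulmxA i2.
have Xr : X0 *m p1 = X0 by rewrite XE -mulmxA i1.
pose Z := p1 *m Y0 *m p2; have cZ : cent Z by apply: centM => //; apply: centM.
have XZX : X0 *m Z *m X0 = X0 by rewrite /Z !mulmxA Xr -!mulmxA Xl mulmxA.
have Zl : p1 *m Z = Z by rewrite /Z !mulmxA i1.
have Zr : Z *m p2 = Z by rewrite /Z -!mulmxA i2.
pose q1 := Z *m X0; pose q2 := X0 *m Z.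
have j1 : q1 *m q1 = q1 by rewrite /q1 -mulmxA [X0 *m _]mulmxA XZX.
have j2 : q2 *m q2 = q2 by rewrite /q2 mulmxA XZX.
have p1q : p1 *m q1 = q1 by rewrite /q1 mulmxA Zl.
have qp1 : q1 *m p1 = q1 by rewrite /q1 -mulmxA Xr.
have p2q : p2 *m q2 = q2 by rewrite /q2 mulmxA Xl.
have qp2 : q2 *m p2 = q2 by rewrite /q2 -mulmxA Zr.
have cq1 : cent q1 by apply: centM.
have cq2 : cent q2 by apply: centM.
have k1 : (p1 - q1) *m (p1 - q1) = p1 - q1.
  by rewrite mulmxBr !mulmxBl i1 j1 p1q qp1 subrr subr0.
have k2 : (p2 - q2) *m (p2 - q2) = p2 - q2.
  by rewrite mulmxBr !mulmxBl i2 j2 p2q qp2 subrr subr0.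
have q10 : q1 != 0.
  by apply: contraNneq X00 => q0; rewrite -XZX -mulmxA -/q1 q0 mulmx0.
have [||||||X' [Y' [[cX' cY' YX XY] [[Xl' Yl'] [Xr' Yr']]]]] :=
    IH (p1 - q1) (p2 - q2).
- apply: leq_trans rk; have : \rank p1 = (\rank (p1 - q1)%R + \rank q1)%N.
    apply: (natc_inj char0); rewrite natrD -!idem_tr // -raddfD /=.
    by rewrite subrK.
  by move=> ->; rewrite -[ltnLHS]addn0 ltn_add2l lt0n mxrank_eq0.
- exact: centB.
- exact: centB.
- by [].
- by [].
- move=> y p yl; rewrite !mulmxBr !raddfB /= ht //; congr (_ - _).
  rewrite /q1 /q2 mulmxA mxtrace_mulC mulmxA.
  case: cX => hX kX; rewrite !mulmxA -(kX _ yl) -[y *m X0 *m _]mulmxA.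
  by rewrite -(pmx_twine p hX) !mulmxA.
have Xq1 : X0 *m q1 = X0 by rewrite /q1 mulmxA.
have Xq2 : q2 *m X0 = X0 by [].
have Zq : Z *m X0 *m Z = q1 *m Z by [].
pose Z2 := q1 *m Z.
have Z2X : Z2 *m X0 = q1 by rewrite /Z2 -mulmxA -/q1 j1.
have XZ2 : X0 *m Z2 = q2 by rewrite /Z2 mulmxA Xq1.
have Z2q : Z2 = Z2 *m q2 by rewrite /Z2 /q2 mulmxA -[q1 *m Z *m X0]mulmxA -/q1 j1.
exists (X' + X0), (Y' + Z2).
have cZ2 : cent Z2 by apply: centM.
have Y'X0 : Y' *m X0 = 0.
  by rewrite Yr' -Xq2 mulmxA -[Y' *m _ *m q2]mulmxA mulmxBl p2q j2 subrr mulmx0 mul0mx.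
have Z2X' : Z2 *m X' = 0.
  by rewrite Xl' Z2q mulmxA -[Z2 *m q2 *m _]mulmxA mulmxBr qp2 j2 subrr mulmx0 mul0mx.
have X'Z2 : X' *m Z2 = 0.
  by rewrite Xr' /Z2 mulmxA -[X' *m _ *m q1]mulmxA mulmxBl p1q j1 subrr mulmx0 mul0mx.
have X0Y' : X0 *m Y' = 0.
  by rewrite Yl' -Xq1 mulmxA -[X0 *m q1 *m _]mulmxA mulmxBr qp1 j1 subrr mulmx0 mul0mx.
have Xl2 : X' = p2 *m X' by rewrite {2}Xl' mulmxA mulmxBr i2 p2q -Xl'.
have Yl2 : Y' = p1 *m Y' by rewrite {2}Yl' mulmxA mulmxBr i1 p1q -Yl'.
have Xr2 : X' = X' *m p1 by rewrite {2}Xr' -mulmxA mulmxBl i1 qp1 -Xr'.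
have Yr2 : Y' = Y' *m p2 by rewrite {2}Yr' -mulmxA mulmxBl i2 qp2 -Yr'.
split; first split.
- exact: centD.
- exact: centD.
- by rewrite mulmxDl !mulmxDr YX Y'X0 Z2X' Z2X addr0 add0r subrK.
- by rewrite mulmxDl !mulmxDr XY X'Z2 X0Y' XZ2 addr0 add0r subrK.
split; split.
- by rewrite mulmxDr -Xl2 Xl.
- by rewrite mulmxDr -Yl2 /Z2 mulmxA p1q.
- by rewrite mulmxDl -Xr2 Xr.
by rewrite mulmxDl -Yr2 /Z2 -mulmxA Zr.
Qed.

End Frame.

(** * Frobenius-semisimple representations of an abstract Weil group *)

(** An abstract Weil group H with its inertia subgroup I and a Frobenius
    element: H is generated by I, which Frobenius normalises, and Frobenius. *)
Record wgroup (G : groupType) := WGroup {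
  wH : G -> Prop;
  wI : G -> Prop;
  wphi : G;
  wH1 : wH 1%g;
  wHM : forall g h, wH g -> wH h -> wH (g * h)%g;
  wHV : forall g, wH g -> wH g^-1%g;
  wHphi : wH wphi;
  wIH : forall i, wI i -> wH i;
  wI1 : wI 1%g;
  wIM : forall i j, wI i -> wI j -> wI (i * j)%g;
  wIV : forall i, wI i -> wI i^-1%g;
  wIphi : forall i, wI i -> wI (wphi * i * wphi^-1)%g;
  wHgen : forall g, wH g -> exists (k : nat) i, wI i /\
    (g = wphi ^+ k * i \/ wphi ^+ k * g = i)%g }.

Section GoodRep.
Context (F : closedFieldType) (char0 : forall n, n.+1%:R != 0 :> F).
Context (G : groupType) (w : wgroup G).
Implicit Types (n m : nat).

(** Frobenius-semisimple representations with finite inertial image. *)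
Definition good n (r : G -> 'M[F]_n) := [/\ is_rep (wH w) r, ssmx (r (wphi w)) &
  exists l : seq 'M[F]_n, forall i, wI w i -> r i \in l].

Definition twine n m (r : G -> 'M[F]_n) (s : G -> 'M[F]_m) (X : 'M_(n, m)) :=
  forall g, wH w g -> r g *m X = X *m s g.

Lemma twineM n m p (r : G -> 'M[F]_n) (s : G -> 'M[F]_m) (t : G -> 'M[F]_p) X Y :
  twine r s X -> twine s t Y -> twine r t (X *m Y).
Proof. by move=> h k g Hg; rewrite mulmxA h // -mulmxA k // mulmxA. Qed.

Lemma rep_unit n (r : G -> 'M[F]_n) g : is_rep (wH w) r -> wH w g ->
  r g \in unitmx /\ invmx (r g) = r g^-1%g.
Proof.
move=> [r1 rM] Hg; have e : r g *m r g^-1%g = 1%:M.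
  by rewrite -rM ?mulgV //; apply: wHV.
have [u _] := mulmx1_unit e; split=> //.
by apply: (can_inj (mulKmx u)); rewrite mulmxV.
Qed.

Lemma wHX k : wH w (wphi w ^+ k)%g.
Proof.
elim: k => [|k IH]; first by rewrite expg0; apply: wH1.
by rewrite expgS; apply: wHM => //; apply: wHphi.
Qed.

Lemma rep_exp n (r : G -> 'M[F]_n) k : is_rep (wH w) r ->
  r (wphi w ^+ k)%g = r (wphi w) ^+ k.
Proof.
move=> [r1 rM]; elim: k => [|k IH]; first by rewrite expg0 r1.
by rewrite expgS rM ?IH ?expmxS //; [apply: wHphi | apply: wHX].
Qed.

Lemma twine_gen n m (r : G -> 'M[F]_n) (s : G -> 'M[F]_m) (X : 'M_(n, m)) :
  is_rep (wH w) r -> is_rep (wH w) s ->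
  r (wphi w) *m X = X *m s (wphi w) ->
  (forall i, wI w i -> r i *m X = X *m s i) -> twine r s X.
Proof.
move=> hr hs hp hi g Hg; have [k [i [Ii]]] := wHgen Hg.
have hk := expmx_twine k hp; have [_ rM] := hr; have [_ sM] := hs.
case=> [->|gi].
  rewrite rM ?sM ?rep_exp //; try exact: wHX; try exact: wIH.
  by rewrite -mulmxA hi // mulmxA hk -mulmxA.
have [u _] := rep_unit hr (wHX k); rewrite rep_exp // in u.
apply: (can_inj (mulKmx u)); rewrite mulmxA.
rewrite -{1}rep_exp // -rM // ?gi ?hi //; last exact: wHX.
by rewrite mulmxA hk -rep_exp // -mulmxA -sM ?gi //; apply: wHX.
Qed.

Lemma good_frame n (r : G -> 'M[F]_n) : good r ->
  exists l : seq 'M[F]_n, [/\ uniq l, 1%:M \in l,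
   forall y z, y \in l -> z \in l -> y *m z \in l,
   forall y, y \in l -> y \in unitmx &
   forall y, y \in l -> r (wphi w) *m y *m invmx (r (wphi w)) \in l] /\
   forall y, y \in l <-> exists2 i, wI w i & y = r i.
Proof.
move=> [hr _ [l0 hl0]]; have [r1 rM] := hr.
pose l := undup [seq y <- l0 | `[< exists2 i, wI w i & y = r i >]].
have lE y : y \in l <-> exists2 i, wI w i & y = r i.
  rewrite mem_undup mem_filter; split=> [/andP[/asboolP]|] // [i Ii ->].
  by rewrite hl0 // andbT; apply/asboolP; exists i.
exists l; split=> //; split.
- exact: undup_uniq.
- by apply/lE; exists 1%g => //; apply: wI1.
- move=> y z /lE[i Ii ->] /lE[j Ij ->]; apply/lE; exists (i * j)%g.
    exact: wIM.
  by rewrite rM //; apply: wIH.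
- by move=> y /lE[i Ii ->]; case: (rep_unit hr (wIH Ii)).
move=> y /lE[i Ii ->]; apply/lE; exists (wphi w * i * (wphi w)^-1)%g.
  exact: wIphi.
have Hp := wHphi w; have Hi := wIH Ii.
by rewrite !rM ?(rep_unit hr Hp).2 //; [apply: wHM | apply: wHV].
Qed.

Lemma good_reg1 n (r : G -> 'M[F]_n) X : good r -> twine r r X ->
  exists2 Y, twine r r Y & X *m Y *m X = X.
Proof.
move=> gr tX; have [hr sr _] := gr.
have [l [[ul l1 lM lU lA] lE]] := good_frame gr.
have [rs [L [urs e1 eA]]] := ssmx_idem sr.
have uA := (rep_unit hr (wHphi w)).1.
have [|Y [YA Yl] XYX] :=
  cent_reg char0 uA ul l1 lM lU lA urs e1 eA (X := X).
  split; first exact/tX/wHphi.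
  by move=> y /lE[i Ii ->]; apply/tX/wIH.
exists Y => //; apply: twine_gen => // i Ii.
by apply: Yl; apply/lE; exists i.
Qed.

Lemma good_equiv1 n (r : G -> 'M[F]_n) p1 p2 : good r ->
  twine r r p1 -> twine r r p2 -> p1 *m p1 = p1 -> p2 *m p2 = p2 ->
  (forall g, wH w g -> \tr (r g *m p1) = \tr (r g *m p2)) ->
  exists X Y, [/\ twine r r X, twine r r Y, Y *m X = p1 & X *m Y = p2] /\
    [/\ X = p2 *m X & Y = p1 *m Y] /\ [/\ X = X *m p1 & Y = Y *m p2].
Proof.
move=> gr t1 t2 i1 i2 ht; have [hr sr _] := gr.
have [l [[ul l1 lM lU lA] lE]] := good_frame gr.
have [rs [L [urs e1 eA]]] := ssmx_idem sr.
have uA := (rep_unit hr (wHphi w)).1.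
have c p : twine r r p -> cent (r (wphi w)) l p.
  move=> tp; split; first exact/tp/wHphi.
  by move=> y /lE[i Ii ->]; apply/tp/wIH.
have c' p : cent (r (wphi w)) l p -> twine r r p.
  move=> [hp hl]; apply: twine_gen => // i Ii.
  by apply: hl; apply/lE; exists i.
have [|X [Y [[cX cY YX XY] h]]] :=
  cent_equiv char0 uA ul l1 lM lU lA urs e1 eA (c _ t1) (c _ t2) i1 i2.
  move=> y p /lE[i Ii ->]; rewrite pmxE !mulmx_sumr !mulmx_suml !raddf_sum /=.
  apply: eq_bigr => k _; rewrite -!scalemxAr -!scalemxAl !linearZ /=.
  have [_ rM] := hr; rewrite -rep_exp // -rM ?ht //.
  + by apply: wHM; [apply: wIH | apply: wHX].
  + exact: wIH.
  exact: wHX.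
by exists X, Y; split=> //; split=> //; apply: c'.
Qed.

Definition dsum2 n m (r : G -> 'M[F]_n) (s : G -> 'M[F]_m) : G -> 'M[F]_(n + m) :=
  fun g => block_mx (r g) 0 0 (s g).

Lemma pmx_block n m (A : 'M[F]_n) (B : 'M[F]_m) p :
  pmx (block_mx A 0 0 B) p = block_mx (pmx A p) 0 0 (pmx B p).
Proof.
elim/poly_ind: p => [|p c IH]; first by rewrite !pmx0 block_mx0.
rewrite !pmxD !pmxM !pmxX !pmxC IH mulmx_block !mulmx0 !mul0mx !addr0 add0r.
by rewrite scalar_mx_block add_block_mx !addr0.
Qed.

Lemma ssmx_common n m (A : 'M[F]_n) (B : 'M[F]_m) : ssmx A -> ssmx B ->
  exists rs, [/\ uniq rs, pmx A (\prod_(z <- rs) ('X - z%:P)) = 0 &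
    pmx B (\prod_(z <- rs) ('X - z%:P)) = 0].
Proof.
move=> [ra [ua ha]] [rb [ub hb]]; exists (undup (ra ++ rb)).
have d (s t : seq F) : uniq s -> {subset s <= t} ->
    \prod_(z <- s) ('X - z%:P) %| \prod_(z <- t) ('X - z%:P).
  move=> us st; apply: uniq_roots_dvdp; last by rewrite uniq_rootsE.
  by apply/allP=> x /st xt; rewrite root_prod_XsubC.
split; first exact: undup_uniq.
- by apply: dvdp_pmx0 ha; apply: d => // x; rewrite mem_undup mem_cat => ->.
by apply: dvdp_pmx0 hb; apply: d => // x; rewrite mem_undup mem_cat orbC => ->.
Qed.

Lemma good_dsum2 n m (r : G -> 'M[F]_n) (s : G -> 'M[F]_m) :
  good r -> good s -> good (dsum2 r s).
Proof.
move=> [[r1 rM] sr [l hl]] [[s1 sM] ss [k hk]]; split.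
- split; first by rewrite /dsum2 r1 s1 -scalar_mx_block.
  move=> g h Hg Hh; rewrite /dsum2 rM // sM // mulmx_block.
  by rewrite !mulmx0 !mul0mx !addr0 add0r.
- have [rs [u h1 h2]] := ssmx_common sr ss; exists rs; split=> //.
  by rewrite /dsum2 pmx_block h1 h2 block_mx0.
exists [seq block_mx a 0 0 b | a <- l, b <- k] => i Ii.
by apply/allpairsP; exists (r i, s i); split; [apply: hl | apply: hk |].
Qed.

Lemma twine_block n m (r : G -> 'M[F]_n) (s : G -> 'M[F]_m) A B C D :
  twine (dsum2 r s) (dsum2 r s) (block_mx A B C D) <->
  [/\ twine r r A, twine r s B, twine s r C & twine s s D].
Proof.
split=> [h|[hA hB hC hD] g Hg].
  split=> g /h; rewrite /dsum2 !mulmx_block !mulmx0 !mul0mx !addr0 !add0r;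
    by case/eq_block_mx.
rewrite /dsum2 !mulmx_block !mulmx0 !mul0mx !addr0 !add0r.
by rewrite hA // hB // hC // hD.
Qed.

(** The case of endomorphisms, applied to X as an off-diagonal block on the direct
    sum of r and s. *)
Lemma good_reg n m (r : G -> 'M[F]_n) (s : G -> 'M[F]_m) X :
  good r -> good s -> twine r s X ->
  exists2 Y, twine s r Y & X *m Y *m X = X.
Proof.
move=> gr gs tX.
have [|Y tY e] := good_reg1 (X := block_mx 0 X 0 0) (good_dsum2 gr gs).
  by apply/twine_block; split=> // g _; rewrite mulmx0 mul0mx.
exists (dlsubmx Y).
  by move: tY; rewrite -{1}[Y]submxK => /twine_block[].
move: e; rewrite -{1}[Y]submxK !mulmx_block !mulmx0 !mul0mx !addr0 !add0r.
by case/eq_block_mx.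
Qed.

(** Inside the direct sum of r and s this is the case of two idempotents of one
    representation. *)
Lemma good_equiv n m (r : G -> 'M[F]_n) (s : G -> 'M[F]_m) p q :
  good r -> good s ->
  twine r r p -> twine s s q -> p *m p = p -> q *m q = q ->
  (forall g, wH w g -> \tr (r g *m p) = \tr (s g *m q)) ->
  exists X Y, [/\ twine r s X, twine s r Y, X *m Y = p & Y *m X = q] /\
    [/\ X = p *m X & X = X *m q].
Proof.
move=> gr gs tp tq pp qq ht.
have z a b (u : G -> 'M[F]_a) (v : G -> 'M[F]_b) : twine u v 0.
  by move=> g _; rewrite mulmx0 mul0mx.
have [||||g Hg|X [Y [[tX tY YX XY] [[Xl Yl] [Xr Yr]]]]] :=
  good_equiv1 (p1 := block_mx p 0 0 0) (p2 := block_mx 0 0 0 q)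
    (good_dsum2 gr gs).
- by apply/twine_block; split.
- by apply/twine_block; split.
- by rewrite mulmx_block !mulmx0 !mul0mx !addr0 pp.
- by rewrite mulmx_block !mulmx0 !mul0mx !add0r qq.
- rewrite /dsum2 !mulmx_block !mulmx0 !mul0mx !addr0 !add0r !mxtrace_block.
  by rewrite !raddf0 addr0 add0r ht.
move: tX tY YX XY Xl Yl Xr Yr; rewrite -[X]submxK -[Y]submxK.
move/twine_block=> [_ _ tX _] /twine_block[_ tY _ _].
rewrite !mulmx_block !mulmx0 !mul0mx !addr0 !add0r.
move=> /eq_block_mx[YX _ _ _] /eq_block_mx[_ _ _ XY].
move=> /eq_block_mx[X1 X2 X3 X4] /eq_block_mx[Y1 Y2 Y3 Y4].
move=> /eq_block_mx[X5 X6 X7 X8] /eq_block_mx[Y5 Y6 Y7 Y8].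
exists (ursubmx Y), (dlsubmx X); split; split=> //.
- by rewrite -YX X1 mulmx0 add0r.
- by rewrite -XY X8 mul0mx addr0.
Qed.

End GoodRep.

(** * Decomposition into irreducibles *)

Lemma vspace_mx (F : fieldType) e (U : {vspace 'cV[F]_e}) :
  exists s (B : 'M_(e, s)) (B' : 'M_(s, e)), [/\ B' *m B = 1%:M, s = \dim U,
   forall c, B *m c \in U & forall x, x \in U -> x = B *m (B' *m x)].
Proof.
pose b := vbasis U; have bU := vbasisP U.
pose B : 'M_(e, \dim U) := \matrix_(i, j) b`_j i 0.
pose B' : 'M_(\dim U, e) := \matrix_(i, j) coord b i (delta_mx j 0).
have BE c : B *m c = \sum_j c j 0 *: b`_j.
  apply/colP=> i; rewrite summxE !mxE; apply: eq_bigr => j _.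
  by rewrite !mxE mulrC.
have B'E x : B' *m x = \col_i coord b i x.
  apply/colP=> i; rewrite !mxE [in RHS](matrix_sum_delta x) linear_sum /=.
  apply: eq_bigr => j _; rewrite big_ord1 linearZ /= mxE mulrC.
  by congr (_ * _); rewrite ord1.
exists (\dim U), B, B'; split=> // [||x xU].
- apply/matrixP=> i j.
  have -> : (B' *m B) i j = (B' *m col j B) i 0.
    by rewrite !mxE; apply: eq_bigr => k _; rewrite !mxE.
  have -> : col j B = b`_j by apply/colP=> k; rewrite !mxE.
  by rewrite B'E !mxE coord_free ?(basis_free bU) // eq_sym.
- move=> c; rewrite BE; apply: memv_suml => j _; apply: memvZ.
  by apply: vbasis_mem; rewrite mem_nth ?size_tuple.
rewrite BE B'E {1}(coord_vbasis xU); apply: eq_bigr => i _.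
by rewrite mxE.
Qed.

Record piece (F : fieldType) n := Piece {
  pc_e : nat; pc_X : 'M[F]_(n, pc_e); pc_Y : 'M[F]_(pc_e, n) }.
HB.instance Definition _ (F : fieldType) n := gen_eqMixin (piece F n).

Section Decomp.
Context (F : closedFieldType) (char0 : forall n, n.+1%:R != 0 :> F).
Context (G : groupType) (w : wgroup G).

Lemma good_sub n m (r : G -> 'M[F]_n) (R : G -> 'M[F]_m) X Y :
  good w r -> Y *m X = 1%:M -> twine w r R X -> good w R.
Proof.
move=> [[r1 rM] [rs [u h]] [l hl]] YX tX.
have XI : injective (mulmx X : 'M_m -> _).
  by move=> a b /(congr1 (mulmx Y)); rewrite !mulmxA YX !mul1mx.
split.
- split=> [|g k Hg Hk].
    by apply: XI; rewrite -tX ?r1 ?mul1mx ?mulmx1 //; apply: wH1.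
  apply: XI; rewrite -tX ?rM //; last exact: wHM.
  by rewrite -mulmxA (tX k) // !mulmxA (tX g).
- exists rs; split=> //; apply: XI.
  by rewrite -(pmx_twine _ (tX _ (wHphi w))) h mul0mx mulmx0.
exists [seq Y *m y *m X | y <- l] => i Ii; apply/mapP; exists (r i).
  exact: hl.
by rewrite -mulmxA tX ?mulmxA ?YX ?mul1mx //; apply: wIH.
Qed.

Definition piece_rep n (r : G -> 'M[F]_n) (c : piece F n) : G -> 'M[F]_(pc_e c) :=
  fun g => pc_Y c *m r g *m pc_X c.

Definition piece_ok n (r : G -> 'M[F]_n) p (c : piece F n) :=
  [/\ pc_Y c *m pc_X c = 1%:M, irreducible_rep (wH w) (piece_rep r c),
    twine w r (piece_rep r c) (pc_X c), twine w (piece_rep r c) r (pc_Y c) &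
    p *m pc_X c = pc_X c].

Lemma good_piece n (r : G -> 'M[F]_n) p c :
  good w r -> piece_ok r p c -> good w (piece_rep r c).
Proof. by move=> gr [YX _ tX _ _]; apply: good_sub gr YX tX. Qed.

(** Split off a nonzero sub-idempotent of least rank: by semisimplicity it is
    irreducible. *)
Lemma good_decomp n (r : G -> 'M[F]_n) p : good w r -> twine w r r p ->
  p *m p = p -> exists ps : seq (piece F n),
    p = \sum_(c <- ps) pc_X c *m pc_Y c /\ forall c, c \in ps -> piece_ok r p c.
Proof.
move=> gr; have [k] := ubnP (\rank p); elim: k => // k IH in p *.
rewrite ltnS => rk tp pp.
have [p0|p0] := eqVneq p 0; first by exists [::]; rewrite big_nil.
pose ok e := [/\ twine w r r e, e *m e = e, p *m e = e, e *m p = e & e != 0].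
pose P j := `[< exists2 e, ok e & \rank e = j >].
have ex : exists j, P j by exists (\rank p); apply/asboolP; exists p.
case: (ex_minnP ex) => d /asboolP[e [te ee pe ep e0] re] dmin.
have [s [X [Y [XY YX se]]]] := idem_factor ee.
pose c := Piece X Y.
have tX : twine w r (piece_rep r c) X.
  move=> g Hg; rewrite /piece_rep /= !mulmxA XY -te //.
  by rewrite -XY -!mulmxA YX mulmx1.
have tY : twine w (piece_rep r c) r Y.
  move=> g Hg; have -> : piece_rep r c g = Y *m r g *m X by [].
  by rewrite -!mulmxA XY te // -XY !mulmxA YX mul1mx.
have eX : e *m X = X by rewrite -XY -mulmxA YX mulmx1.
have pX : p *m X = X by rewrite -{1}eX mulmxA pe.
have s0 : (0 < s)%N by rewrite se lt0n mxrank_eq0.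
have gR : good w (piece_rep r c) by apply: good_sub gr YX tX.
have irr : irreducible_rep (wH w) (piece_rep r c).
  have [hR _ _] := gR; split=> // U stU.
  have [u [B [B' [BB uU BU UB]]]] := vspace_mx U.
  pose S g := B' *m piece_rep r c g *m B.
  have tB : twine w (piece_rep r c) S B.
    move=> g Hg; apply/row_matrixP=> i; apply/rowP=> j.
    have := UB (piece_rep r c g *m col j B).
    rewrite stU // ?colE ?BU // => /(_ isT).
    rewrite !mulmxA -!colE => /colP/(_ i).
    by rewrite ![col j _ i 0]mxE ![row i _ 0 j]mxE.
  have gS : good w S by apply: good_sub gR BB tB.
  have tXB : twine w r S (X *m B) by apply: twineM tX tB.
  have [Z tZ XZX] := good_reg char0 gr gS tXB.
  have [u0|u0] := posnP u.
    left; apply/eqP; rewrite -dimv_eq0 -uU u0 //.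
  right; pose q := X *m B *m Z *m e.
  have eq : e *m (X *m B *m Z) = X *m B *m Z by rewrite !mulmxA eX.
  have qX : q *m (X *m B) = X *m B by rewrite /q -!mulmxA [e *m _]mulmxA eX -[RHS]XZX !mulmxA.
  have q0 : q != 0.
    apply: contraTneq u0 => q0; rewrite q0 mul0mx in qX.
    have : B' *m (Y *m (X *m B)) = 1%:M by rewrite [Y *m _]mulmxA YX mul1mx BB.
    rewrite -qX !mulmx0 => /(congr1 (mxrank)); rewrite mxrank0 mxrank1 => <-.
    by [].
  have : P (\rank q).
    apply/asboolP; exists q => //; split=> //.
    - by apply: twineM te; apply: twineM tXB tZ.
    - rewrite {2}/q !mulmxA -[q *m X *m B]mulmxA qX -/q.
      by rewrite /q.
    - by rewrite /q !mulmxA pX.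
    by rewrite /q -[LHS]mulmxA ep.
  move/dmin; rewrite -re -se => le.
  apply/eqP; rewrite eqEdim subvf dimvf /dim /= muln1 -uU.
  apply: leq_trans le _; rewrite /q -!mulmxA mulmxA.
  apply: leq_trans (mxrankM_maxl _ _) _; apply: rank_leq_col.
have okc : piece_ok r p c by split.
have [|||ps [hp hps]] := IH (p - e).
- apply: leq_trans rk; have : \rank p = (\rank (p - e)%R + \rank e)%N.
    apply: (natc_inj char0); rewrite natrD -!idem_tr //.
      by rewrite -raddfD /= subrK.
    by rewrite mulmxBr !mulmxBl pp ee pe ep subrr subr0.
  by move=> ->; rewrite -[ltnLHS]addn0 ltn_add2l lt0n mxrank_eq0.
- by move=> g Hg; rewrite mulmxBr mulmxBl tp // te.
- by rewrite mulmxBr !mulmxBl pp ee pe ep subrr subr0.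
exists (c :: ps); split; first by rewrite big_cons /= -hp XY addrC subrK.
move=> x; rewrite inE => /orP[/eqP->|/hps[h1 h2 h3 h4 h5]] //.
split=> //; have := congr1 (mulmx p) h5.
by rewrite mulmxA mulmxBr pp pe h5.
Qed.

End Decomp.

(** * Descent of finite irreducible groups *)

Section RatMorph.
Context (F : fieldType) (char0 : forall n, n.+1%:R != 0 :> F).

Lemma intr_char0 (z : int) : z != 0 -> z%:~R != 0 :> F.
Proof.
case: z => [[|n]|n] // _; first exact: char0.
by rewrite NegzE mulrNz oppr_eq0; apply: char0.
Qed.

Lemma rat_morph : exists f : {rmorphism rat -> F}, True.
Proof.
have nz (x : rat) : (denq x)%:~R != 0 :> F by rewrite intr_char0 ?denq_neq0.
have key (a b c d : int) : b != 0 -> d != 0 -> (a%:Q / b%:Q = c%:Q / d%:Q) ->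
    a%:~R / b%:~R = c%:~R / d%:~R :> F.
  move=> b0 d0 /eqP; rewrite eqr_div ?intr_eq0 // -!rmorphM /= eqr_int => /eqP e.
  by apply/eqP; rewrite eqr_div ?intr_char0 // -!rmorphM /= e.
have rE (a b : int) : b != 0 -> @ratr F (a%:Q / b%:Q) = a%:~R / b%:~R.
  by move=> b0; apply: key; rewrite ?denq_neq0 // divq_num_den.
have fB : GRing.zmod_morphism (@ratr F).
  move=> x y; rewrite -{1}[x]divq_num_den -{1}[y]divq_num_den.
  have dx := denq_neq0 x; have dy := denq_neq0 y.
  have -> : (numq x)%:Q / (denq x)%:Q - (numq y)%:Q / (denq y)%:Q =
    (numq x * denq y - numq y * denq x)%:Q / (denq x * denq y)%:Q.
    rewrite rmorphB !rmorphM /=; field.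
    by rewrite !intr_eq0 dx dy.
  rewrite rE ?mulf_neq0 // rmorphB !rmorphM /= /ratr; field.
  by rewrite !nz.
have fM : GRing.monoid_morphism (@ratr F).
  split=> [|x y]; first by rewrite /ratr divr1.
  have dx := denq_neq0 x; have dy := denq_neq0 y.
  rewrite -{1}[x]divq_num_den -{1}[y]divq_num_den.
  have -> : (numq x)%:Q / (denq x)%:Q * ((numq y)%:Q / (denq y)%:Q) =
    (numq x * numq y)%:Q / (denq x * denq y)%:Q.
    by rewrite !rmorphM /= mulf_div.
  by rewrite rE ?mulf_neq0 // !rmorphM /= /ratr mulf_div.
pose pA := GRing.isZmodMorphism.Build _ _ _ fB.
pose pM := GRing.isMonoidMorphism.Build _ _ _ fM.
pose f : {rmorphism rat -> F} := HB.pack (@ratr F) pA pM.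
by exists f.
Qed.

End RatMorph.

Section Realize.
Context (F : closedFieldType) (char0 : forall n, n.+1%:R != 0 :> F).
Context (K0 : subringClosed F).
Context (K0V : forall x, x \in K0 -> x^-1 \in K0).
Context (K0root : forall (p : {poly F}) a, p \is monic -> p \is a polyOver K0 ->
  root p a -> a \in K0).

Lemma char_poly_over n (A : 'M[F]_n) : (forall i j, A i j \in K0) ->
  char_poly A \is a polyOver K0.
Proof.
move=> h; apply: rpred_sum => s _; apply: rpredM.
  by apply: rpredX; rewrite rpredN; apply: rpred1.
apply: rpred_prod => i _; rewrite !mxE; apply: rpredB.
  by apply: rpredMn; apply: polyOverX.
by rewrite polyOverC.
Qed.

Lemma det_over n (A : 'M[F]_n) : (forall i j, A i j \in K0) -> \det A \in K0.
Proof.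
move=> h; apply: rpred_sum => s _; apply: rpredM.
  by apply: rpredX; rewrite rpredN; apply: rpred1.
by apply: rpred_prod => i _.
Qed.

Lemma mulmx_over m n p (A : 'M[F]_(m, n)) (B : 'M_(n, p)) :
  (forall i j, A i j \in K0) -> (forall i j, B i j \in K0) ->
  forall i j, (A *m B) i j \in K0.
Proof.
by move=> hA hB i j; rewrite mxE; apply: rpred_sum => k _; apply: rpredM.
Qed.

Lemma invmx_over n (A : 'M[F]_n) : (forall i j, A i j \in K0) ->
  forall i j, invmx A i j \in K0.
Proof.
move=> h i j; rewrite /invmx; case: ifP => // _.
rewrite !mxE; apply: rpredM; first by apply/K0V/det_over.
rewrite /cofactor; apply: rpredM.
  by apply: rpredX; rewrite rpredN; apply: rpred1.
by apply: det_over => a b; rewrite !mxE.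
Qed.

(** The group algebra over the subfield K0 contains a rank one element, as the
    eigenvalues of its elements are in K0; its orbit spans a K0-form. *)
Lemma finite_realize n (l : seq 'M[F]_n) : (0 < n)%N -> 1%:M \in l ->
  (forall y z, y \in l -> z \in l -> y *m z \in l) ->
  (forall U : {vspace 'cV[F]_n}, (forall g, g \in l -> forall x, x \in U ->
     g *m x \in U) -> U = 0%VS \/ U = fullv) ->
  exists2 H : 'M_n, H \in unitmx &
    forall y, y \in l -> forall i j, (invmx H *m y *m H) i j \in K0.
Proof.
move=> n0 l1 lM irr.
pose A y := forall Q : 'M[F]_n -> Prop, (forall z, z \in l -> Q z) ->
  (forall x z, Q x -> Q z -> Q (x - z)) ->
  (forall a x, a \in K0 -> Q x -> Q (a *: x)) -> Q y.
have Al y : y \in l -> A y by move=> yl Q h _ _; apply: h.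
pose N := size l; pose t (i : 'I_N) := nth 0 l i.
have tl i : t i \in l by apply: mem_nth.
have tP y : y \in l -> exists i, y = t i.
  move=> yl; have il : (index y l < N)%N by rewrite index_mem.
  by exists (Ordinal il); rewrite /t nth_index.
have AC b : A b -> exists C : 'M[F]_N, (forall i j, C i j \in K0) /\
    forall i, b *m t i = \sum_j C i j *: t j.
  move/(_ (fun b => exists C : 'M[F]_N, (forall i j, C i j \in K0) /\
    forall i, b *m t i = \sum_j C i j *: t j)); apply=> [z zl|x z [C [hC eC]] [D [hD eD]]|a x aK [C [hC eC]]].
  - have ex i : exists j, z *m t i = t j by apply/tP/lM.
    pose f i := sval (cid (ex i)).
    exists (\matrix_(i, j) (j == f i)%:R); split=> [i j|i].
      by rewrite mxE; apply: rpred_nat.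
    rewrite (bigD1 (f i)) //= mxE eqxx scale1r big1 ?addr0.
      by rewrite /f; case: cid.
    by move=> j /negPf jf; rewrite mxE jf scale0r.
  - exists (C - D); split=> [i j|i]; first by rewrite !mxE rpredB.
    rewrite mulmxBl eC eD -sumrB; apply: eq_bigr => j _.
    by rewrite !mxE scalerBl.
  exists (a *: C); split=> [i j|i]; first by rewrite mxE rpredM.
  rewrite -scalemxAl eC scaler_sumr; apply: eq_bigr => j _.
  by rewrite mxE scalerA.
pose P y := is_true (y \in l).
have [|||||u [v [Auv u0 v0 huv]]] :=
  irr_rank_one l1 lM n0 irr (A := A) (R0 := fun a => a \in K0).
- by move=> x; apply: Al.
- move=> x z Ax Az Q Ql QB QZ.
  apply: (Ax (fun x => Q (x *m z))) => [y yl|x1 x2|a x1].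
  + apply: (Az (fun z => Q (y *m z))) => [y' yl'|x1 x2|a x1].
    * by apply/Ql/lM.
    * by rewrite mulmxBr; apply: QB.
    by move=> aK; rewrite -scalemxAr; apply: QZ.
  + by rewrite mulmxBl; apply: QB.
  by move=> aK; rewrite -scalemxAl; apply: QZ.
- by move=> x z Ax Az Q Ql QB QZ; apply: (QB); [apply: Ax | apply: Az].
- by move=> a x aK Ax Q Ql QB QZ; apply: (QZ) => //; apply: Ax.
- move=> b a v Ab v0 bv; have [C [hC eC]] := AC b Ab.
  have ra := root_eigen v0 bv.
  have /eigenvalueP[f fb f0] : eigenvalue b a by rewrite eigenvalue_root_char.
  have [j fj] : exists j, f 0 j != 0 by apply/rV0Pn.
  pose z : 'cV_N := \col_i (f *m t i) 0 j.
  apply: (K0root (char_poly_monic C) (char_poly_over hC)).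
  apply: (@root_eigen _ _ _ z).
    have [i ti] := tP _ l1; apply/negP=> /eqP/colP/(_ i).
    by rewrite mxE -ti mulmx1 mxE => /eqP; rewrite (negPf fj).
  apply/colP=> i; transitivity ((f *m (b *m t i)) 0 j); last first.
    by rewrite mulmxA fb -scalemxAl [(a *: z) i 0]mxE [z i 0]mxE [LHS]mxE.
  rewrite eC mulmx_sumr summxE mxE; apply: eq_bigr => k _.
  by rewrite -scalemxAr [RHS]mxE [z k 0]mxE.
have [|Hr uHr hH] := @free_rows _ n (fun r => exists2 g, g \in l & r = (g *m u)^T).
  move=> z hz; apply: trmx_inj; rewrite trmx0.
  apply: (irr_col l1 lM irr u0) => g gl.
  have := hz _ (ex_intro2 _ _ g gl erefl).
  by move/(congr1 trmx); rewrite trmx_mul trmxK trmx0 mulmxA.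
have [|Kr uKr hK] := @free_rows _ n (fun r => exists2 g, g \in l & r = v *m g).
  move=> z hz; apply: (irr_row l1 lM irr v0) => g gl.
  by apply: hz; exists g.
have uH : Hr^T \in unitmx by rewrite unitmx_tr.
exists Hr^T => // y yl.
have hC x : x \in l -> forall i j, (Kr *m x *m Hr^T) i j \in K0.
  move=> xl i j; have [g gl eg] := hK i; have [h hl eh] := hH j.
  have -> : (Kr *m x *m Hr^T) i j = (v *m (g *m x *m h) *m u) 0 0.
    rewrite !mulmxA -eg -[row i Kr *m x *m h *m u]mulmxA -[h *m u]trmxK -eh.
    rewrite tr_row -row_mul [LHS]mxE [RHS]mxE; apply: eq_bigr => k _.
    by rewrite [row _ _ 0 k]mxE [col _ _ k 0]mxE.
  by apply: huv; apply: Al; apply: (lM) => //; apply: (lM).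
have -> : invmx Hr^T *m y *m Hr^T = invmx (Kr *m Hr^T) *m (Kr *m y *m Hr^T).
  apply: (can_inj (mulKmx uH)); apply: (can_inj (mulKmx uKr)).
  rewrite !mulmxA mulmxV ?unitmx_mul ?uKr // mul1mx.
  by rewrite mulmxK.
apply: mulmx_over; last exact: hC.
by apply: invmx_over; have := hC _ l1; rewrite mulmx1.
Qed.

End Realize.

(** * Descent of irreducible representations of the Weil group *)

Lemma uniq_map_period (T : choiceType) (l : seq T) (f g : T -> T) :
  cancel f g -> (forall y, y \in l -> f y \in l) ->
  exists2 m, (0 < m)%N & forall y, y \in l -> iter m f y = y.
Proof.
move=> fg fl.
pose h (x : seq_sub l) : seq_sub l := SeqSub (fl _ (ssvalP x)).
have hI : injective h.
  by move=> x y /(congr1 (@ssval _ _)) /= /(can_inj fg)/val_inj.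
exists #[perm hI]%g; first exact: order_gt0.
move=> y yl; pose x := SeqSub yl.
have : (perm hI ^+ #[perm hI])%g x = x by rewrite expg_order perm1.
rewrite permX => /(congr1 (@ssval _ _)) /= {2}<-.
elim: #[_]%g => //= k ->.
by rewrite permE.
Qed.

Section RealizeRep.
Context (F : closedFieldType) (char0 : forall n, n.+1%:R != 0 :> F).
Context (G : groupType) (w : wgroup G).

(** Frobenius permutes the finite image of inertia. *)
Lemma good_period n (r : G -> 'M[F]_n) : good w r ->
  exists2 m, (0 < m)%N & forall i, wI w i ->
    r (wphi w) ^+ m *m r i = r i *m r (wphi w) ^+ m.
Proof.
move=> gr; have [hr _ _] := gr.
have [l [[_ _ _ _ lA] lE]] := good_frame gr.
set A := r (wphi w) in lA *; have [uA _] := rep_unit hr (wHphi w).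
have [|m m0 hm] := @uniq_map_period _ l (fun y => A *m y *m invmx A)
   (fun y => invmx A *m y *m A) _ lA.
  by move=> y /=; rewrite !mulmxA mulVmx // mul1mx mulmxKV.
exists m => // i Ii.
have : iter m (fun y => A *m y *m invmx A) (r i) *m A ^+ m = A ^+ m *m r i.
  elim: m {m0 hm} => [|m IH]; first by rewrite mulmx1 mul1mx.
  by rewrite iterS expmxS mulmxA mulmxKV // -mulmxA IH mulmxA.
by rewrite hm //; apply/lE; exists i.
Qed.

(** Schur's lemma. *)
Lemma irr_scalar n (r : G -> 'M[F]_n) (X : 'M_n) a (v : 'cV_n) :
  irreducible_rep (wH w) r -> twine w r r X -> v != 0 -> X *m v = a *: v ->
  X = a%:M.
Proof.
move=> [_ _ irr] tX v0 Xv.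
have h : (forall x : 'cV_n, X *m x - a *: x = 0 -> x = 0) \/
         (forall x : 'cV_n, X *m x - a *: x = 0).
  apply: (@irr_pred _ n (fun g => exists2 s, wH w s & g = r s)).
  - move=> U hU; apply: irr => g Hg x xU; apply: hU => //.
    by exists g.
  - by rewrite mulmx0 scaler0 subr0.
  - move=> b x y hx hy; rewrite mulmxDr -scalemxAr scalerDr scalerA mulrC -scalerA.
    by rewrite opprD addrACA -scalerBr hx hy scaler0 addr0.
  - move=> _ x [s Hs ->] /(congr1 (mulmx (r s))).
    have -> : X *m (r s *m x) = r s *m (X *m x) by rewrite !mulmxA tX.
    by rewrite mulmxBr mulmx0 scalemxAr.
case: h => [/(_ v)|h]; first by rewrite Xv subrr => /(_ erefl) e; rewrite e eqxx in v0.
apply/matrixP=> i j; have /colP/(_ i) := h (delta_mx j 0).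
rewrite -colE !mxE => /eqP; rewrite subr_eq0 => /eqP->.
by rewrite eqxx andbT mulr_natr.
Qed.

Context (K0 : subringClosed F).
Context (K0V : forall x, x \in K0 -> x^-1 \in K0).
Context (K0root : forall (p : {poly F}) a, p \is monic -> p \is a polyOver K0 ->
  root p a -> a \in K0).

(** Up to a twist by an unramified character, an irreducible representation has
    finite image, so that it is realised over any ring that contains K0 and the
    eigenvalue mu of Frobenius. *)
Lemma good_realize n (r : G -> 'M[F]_n) mu (v : 'cV_n) :
  good w r -> irreducible_rep (wH w) r -> v != 0 -> r (wphi w) *m v = mu *: v ->
  exists P m, [/\ P \in unitmx, (0 < m)%N, r (wphi w) ^+ m = (mu ^+ m)%:M &
   forall S : subringClosed F, {subset K0 <= S} -> mu \in S -> mu^-1 \in S ->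
   forall g, wH w g -> forall i j, (invmx P *m r g *m P) i j \in S].
Proof.
move=> gr ir v0 rv; have [hr _ _] := gr; have [_ n0 irr] := ir.
have [m m0 hm] := good_period gr.
set A := r (wphi w) in hm rv *; have [uA _] := rep_unit hr (wHphi w).
have Am : A ^+ m = (mu ^+ m)%:M.
  apply: (irr_scalar ir _ v0 (exp_eigen m rv)).
  apply: twine_gen => // [|i Ii]; last by rewrite hm.
  by rewrite -expmxS expmxSr.
have mu0 : mu != 0.
  apply: contraNneq v0 => z; rewrite z scale0r in rv.
  by rewrite -[v](mulKmx uA) rv mulmx0.
have [l [[ul l1 lM lU lA] lE]] := good_frame gr.
pose B : 'M[F]_n := mu^-1 *: A.
have Bm : B ^+ m = 1%:M.
  rewrite scale_expmx Am scale_scalar_mx -exprMn mulVf // expr1n //.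
have AB : A = mu *: B by rewrite scalerA mulfV // scale1r.
have lB k y : y \in l -> exists2 z, z \in l & B ^+ k *m y = z *m B ^+ k.
  elim: k => [|k IH] in y * => yl; first by exists y; rewrite ?mul1mx ?mulmx1.
  have [z zl e] := IH y yl; exists (A *m z *m invmx A); first exact: lA.
  have Bz : B *m z = A *m z *m invmx A *m B.
    by rewrite /B -scalemxAl -scalemxAr mulmxKV.
  by rewrite expmxS -[LHS]mulmxA e !mulmxA Bz.
pose M := [seq B ^+ k *m y | k <- iota 0 m, y <- l].
have MP k y : y \in l -> B ^+ k *m y \in M.
  move=> yl; apply/allpairsP; exists ((k %% m)%N, y).
  split=> //=; first by rewrite mem_iota /= ltn_mod.
  congr (_ *m _); rewrite {1}(divn_eq k m) exprD mulnC exprM Bm.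
  by rewrite -[1%:M]/(1 : 'M_n) expr1n mul1r.
have Bml k : B ^+ k *m B ^+ (k * m.-1) = 1%:M.
  rewrite -[LHS]/(B ^+ k * B ^+ (k * m.-1)) -exprD -mulnS prednK // mulnC exprM.
  by rewrite Bm -[1%:M]/(1 : 'M_n) expr1n.
have MM y z : y \in M -> z \in M -> y *m z \in M.
  move=> /allpairsP[[a x] /= [_ xl ->]] /allpairsP[[b x'] /= [_ xl' ->]].
  have [x2 x2l e] := lB (b * m.-1)%N x xl.
  suff -> : B ^+ a *m x *m (B ^+ b *m x') = B ^+ (a + b) *m (x2 *m x').
    by apply/MP/lM.
  have xe : x *m (B ^+ b *m x') = B ^+ b *m (x2 *m x').
    rewrite -[x in LHS]mul1mx -(Bml b) -!mulmxA [B ^+ (b * _) *m _]mulmxA e.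
    rewrite -mulmxA [B ^+ (b * _) *m _]mulmxA.
    by rewrite (mulmx1C (Bml b)) mul1mx.
  by rewrite -mulmxA xe exprD mulmxA.
pose Q y := is_true (y \in M).
have M1 : 1%:M \in M by have := MP 0%N _ l1; rewrite expr0 mulmx1.
have rM1 g : wH w g -> exists c y, [/\ y \in M, r g = c *: y &
    forall S : subringClosed F, mu \in S -> mu^-1 \in S -> c \in S].
  move=> Hg; have [k [i [Ii]]] := wHgen Hg; have [_ rM] := hr.
  have il : r i \in l by apply/lE; exists i.
  case=> gi.
    exists (mu ^+ k), (B ^+ k *m r i); split; first exact: MP.
      rewrite gi rM ?rep_exp //; [|exact: wHX|exact: wIH].
      by rewrite -/A {1}AB scale_expmx scalemxAl.
    by move=> S muS _; apply: rpredX.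
  exists (mu^-1 ^+ k), (B ^+ (k * m.-1) *m r i); split; first exact: MP.
    have uAk : A ^+ k \in unitmx by rewrite -rep_exp //; case: (rep_unit hr (wHX w k)).
    apply: (can_inj (mulKmx uAk)).
    rewrite -{1}(rep_exp k hr) -rM // ?gi; last exact: wHX.
    rewrite {1}AB scale_expmx -scalemxAl -scalemxAr scalerA -exprMn mulfV //.
    by rewrite expr1n scale1r mulmxA Bml mul1mx.
  by move=> S _ muS; apply: rpredX.
have [|H uH hH] := finite_realize K0V K0root n0 M1 MM.
  move=> U hU; apply: irr => g Hg x xU.
  have [c [y [yM -> _]]] := rM1 g Hg.
  by rewrite -scalemxAl memvZ // hU.
exists H, m; split=> // S KS muS muVS g Hg i j.
have [c [y [yM -> hc]]] := rM1 g Hg.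
rewrite -scalemxAr -scalemxAl mxE rpredM ?hc //.
exact/KS/hH.
Qed.

End RealizeRep.

(** * Integers of the algebraic closure of a valued field *)

Section Valuation.
Context (K : fieldType) (v : dval K).

Lemma dv1 : v 1 = 0.
Proof.
have /esym := dvM v (oner_neq0 _) (oner_neq0 _).
by rewrite mulr1 -[RHS]addr0 => /addrI.
Qed.

Lemma dvN x : v (- x) = v x.
Proof.
have [->|x0] := eqVneq x 0; first by rewrite oppr0.
have n10 : (-1 : K) != 0 by rewrite oppr_eq0 oner_neq0.
have : v (-1) + v (-1) = 0 by rewrite -(dvM v n10 n10) mulrNN mulr1 dv1.
rewrite -mulr2n => /eqP; rewrite mulrn_eq0 /= => /eqP vN1.
by rewrite -mulN1r (dvM v n10 x0) vN1 add0r.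
Qed.

Definition vr_pred : {pred K} := fun x => dv_ge v 0 x.

Lemma vrE x : (x \in vr_pred) = (x == 0) || (0 <= v x).
Proof. by []. Qed.

Lemma vr_subring : subring_closed vr_pred.
Proof.
split=> [|x y|x y]; rewrite !vrE.
- by rewrite dv1 lexx orbT.
- have [->|x0] := eqVneq x 0; first by rewrite sub0r oppr_eq0 dvN.
  have [->|y0] := eqVneq y 0; first by rewrite subr0 (negPf x0).
  rewrite /= => vx vy; have [//|xy0] := eqVneq (x - y) 0.
  have := dvD v x0 (_ : - y != 0) xy0; rewrite oppr_eq0 => /(_ y0).
  by apply: le_trans; rewrite dvN le_min vx vy.
- have [->|x0] := eqVneq x 0; first by rewrite mul0r eqxx.
  have [->|y0] := eqVneq y 0; first by rewrite mulr0 eqxx.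
  by rewrite /= => vx vy; rewrite (dvM v x0 y0) addr_ge0 ?orbT.
Qed.

HB.instance Definition _ := GRing.isSubringClosed.Build K vr_pred vr_subring.
Record vring := VRing { vr_val :> K; _ : vr_val \in vr_pred }.
HB.instance Definition _ := [isSub for vr_val].
HB.instance Definition _ := [Choice of vring by <:].
HB.instance Definition _ := [SubChoice_isSubComNzRing of vring by <:].

Context (L : algClosure K).

Definition vr_emb : {rmorphism vring -> L} :=
  (ac_emb L \o (val : {rmorphism vring -> K}) : {rmorphism vring -> L}).

(** The definition through polynomials over K is ordinary integrality over the
    valuation ring. *)
Lemma bar_intP x : bar_integer v x <-> integralOver vr_emb x.
Proof.
split=> [[P [Pm PV Px]]|[P Pm Px]].
  apply: (@integral_root_monic _ _ _ _ (map_poly (ac_emb L) P)) => //.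
    exact: monic_map.
  apply/integral_poly => i; rewrite coef_map /=.
  exact: (integral_id vr_emb (VRing (PV i))).
exists (map_poly val P); split; first exact: monic_map.
  by move=> i; rewrite coef_map; exact: (valP P`_i).
by rewrite -map_poly_comp.
Qed.

Lemma bintB (x y : L) : bar_integer v x -> bar_integer v y -> bar_integer v (x - y).
Proof. by rewrite !bar_intP; apply: integral_sub. Qed.
Lemma bintM (x y : L) : bar_integer v x -> bar_integer v y -> bar_integer v (x * y).
Proof. by rewrite !bar_intP; apply: integral_mul. Qed.
Lemma bint_emb (x : K) : dv_ge v 0 x -> bar_integer v (ac_emb L x).
Proof. move=> vx; apply/bar_intP; exact: (integral_id vr_emb (VRing vx)). Qed.
Lemma bint1 : bar_integer v (1 : L).
Proof. by apply/bar_intP; apply: integral1. Qed.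
Lemma bintD (x y : L) : bar_integer v x -> bar_integer v y -> bar_integer v (x + y).
Proof. by rewrite !bar_intP; apply: integral_add. Qed.
Lemma bintN (x : L) : bar_integer v x -> bar_integer v (- x).
Proof. by rewrite !bar_intP; apply: integral_opp. Qed.
Lemma bint_exp k (x : L) : bar_integer v x -> bar_integer v (x ^+ k).
Proof. by move=> hx; elim: k => [|k IH]; [exact: bint1 | rewrite exprS; apply: bintM]. Qed.
Lemma bint_sum (I : Type) (s : seq I) (P : pred I) (f : I -> L) :
  (forall i, P i -> bar_integer v (f i)) -> bar_integer v (\sum_(i <- s | P i) f i).
Proof.
move=> h; elim/big_ind: _ => //; last exact: bintD.
by apply/bar_intP/integral0.
Qed.

Lemma bint_gal (s : AbsGal L) x : bar_integer v x -> bar_integer v (s x).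
Proof.
move=> [P [Pm PV Px]]; exists P; split=> //.
have [_ _ _ sK] := galP s.
have -> : map_poly (ac_emb L) P = map_poly s (map_poly (ac_emb L) P).
  by rewrite -map_poly_comp; apply: eq_map_poly => y /=; rewrite sK.
by rewrite fmorph_root.
Qed.


Let u := s2val (cid2 (dv_surj v)).
Let u0 : u != 0. Proof. exact: (s2valP (cid2 (dv_surj v))). Qed.
Let vu : v u = 1. Proof. exact: (s2valP' (cid2 (dv_surj v))). Qed.

Lemma dvV (x : K) : x != 0 -> v x^-1 = - v x.
Proof.
move=> x0; have := dvM v x0 (_ : x^-1 != 0); rewrite invr_eq0 => /(_ x0).
by rewrite mulfV // dv1 => /eqP; rewrite eq_sym addrC addr_eq0 => /eqP.
Qed.

Lemma bmaxP (x : L) : bar_maximal v x <->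
  bar_integer v x /\ exists k, bar_integer v (x ^+ k / ac_emb L u).
Proof.
split=> [[hx [u' [k [u'0 vu' h]]]]|[hx [k h]]]; split=> //; last by exists u, k.
exists k; have := bintM h (bint_emb (_ : dv_ge v 0 (u' / u))).
rewrite rmorphM /= fmorphV mulrA mulfVK; first last.
  by rewrite fmorph_eq0.
apply; rewrite /dv_ge (dvM v u'0) ?invr_eq0 // dvV // vu vu' subrr lexx orbT //.
Qed.

Lemma bmaxM (a x : L) : bar_integer v a -> bar_maximal v x -> bar_maximal v (a * x).
Proof.
rewrite !bmaxP => ha [hx [k h]]; split; first exact: bintM.
exists k; rewrite exprMn -mulrA; apply: bintM => //; exact: bint_exp.
Qed.

Lemma bmaxD (x y : L) : bar_maximal v x -> bar_maximal v y -> bar_maximal v (x + y).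
Proof.
rewrite !bmaxP => -[hx [k hk]] [hy [l hl]]; split; first exact: bintD.
exists (k + l)%N; rewrite exprDn mulr_suml; apply: bint_sum => i _.
have [li|/ltnW il] := leqP l i.
  rewrite mulrnAl -mulr_natl; apply: bintM.
    by apply/bar_intP/integral_nat.
  rewrite -mulrA; apply: bintM; first exact: bint_exp.
  rewrite -(subnK li) exprD -mulrA; apply: bintM => //; exact: bint_exp.
rewrite mulrnAl -mulr_natl; apply: bintM.
  by apply/bar_intP/integral_nat.
rewrite -mulrA mulrCA; apply: bintM; first exact: bint_exp.
rewrite -addnBA // addnC exprD -mulrA; apply: bintM => //; exact: bint_exp.
Qed.

Lemma bmaxN (x : L) : bar_maximal v x -> bar_maximal v (- x).
Proof. by move=> h; rewrite -mulN1r; apply: bmaxM => //; apply/bintN/bint1. Qed.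

Lemma bmax0 : bar_maximal v (0 : L).
Proof.
apply/bmaxP; split; first by apply/bar_intP/integral0.
by exists 1%N; rewrite mul0r; apply/bar_intP/integral0.
Qed.

Lemma bmax_gal (s : AbsGal L) x : bar_maximal v x -> bar_maximal v (s x).
Proof.
rewrite !bmaxP => -[hx [k h]]; split; first exact: bint_gal.
have [_ _ _ sK] := galP s.
by exists k; have := bint_gal s h; rewrite rmorphM rmorphXn fmorphV /= sK.
Qed.

Lemma bmax1 : ~ bar_maximal v (1 : L).
Proof.
move=> /bmaxP[_ [k]]; rewrite expr1n div1r -fmorphV => -[P [Pm PV Px]].
rewrite fmorph_root in Px; move/rootP: Px.
rewrite horner_coef; set n := size P => e.
have n0 : (0 < n)%N by rewrite lt0n size_poly_eq0 monic_neq0.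
have : \sum_(i < n) P`_i * u ^+ (n.-1 - i) = 0.
  transitivity (u ^+ n.-1 * \sum_(i < n) P`_i * u^-1 ^+ i); last by rewrite e mulr0.
  rewrite mulr_sumr; apply: eq_bigr => i _.
  rewrite mulrCA; congr (_ * _).
  have ilt : (i <= n.-1)%N by rewrite -ltnS prednK.
  by rewrite -{2}(subnK ilt) exprD exprVn mulfK // expf_neq0.
rewrite -(prednK n0) big_ord_recr /= subnn expr0 mulr1.
have -> : P`_n.-1 = 1 by move: Pm; rewrite monicE lead_coefE => /eqP.
have -> : \sum_(i < n.-1) P`_i * u ^+ (n.-1 - i) =
   u * \sum_(i < n.-1) P`_i * u ^+ (n.-1 - i.+1).
  rewrite mulr_sumr; apply: eq_bigr => i _.
  by rewrite mulrCA -exprS subnSK.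
set b := \sum_(i < _) _; move=> /eqP; rewrite addr_eq0 => /eqP ub.
have bV : b \in vr_pred.
  apply: rpred_sum => i _; apply: rpredM; first exact: PV.
  by apply: rpredX; rewrite vrE vu ler01 orbT.
have b0 : b != 0 by apply: contraPneq ub => ->; rewrite mulr0 => /eqP; rewrite eq_sym oppr_eq0 oner_eq0.
have := dvM v u0 b0; rewrite ub dvN dv1 vu => e1.
by move: bV; rewrite vrE (negPf b0) /= => vb; have := ler_wpDr vb (lexx 1); rewrite -e1.
Qed.

Definition bmod (x y : L) := bar_maximal v (x - y).

Lemma bmod_trans y x z : bmod x y -> bmod y z -> bmod x z.
Proof. by rewrite /bmod => hx hy; rewrite -(subrKA y); apply: bmaxD. Qed.
Lemma bmod_sym x y : bmod x y -> bmod y x.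
Proof. by rewrite /bmod => /bmaxN; rewrite opprB. Qed.
Lemma bmod_exp k x y : bar_integer v x -> bar_integer v y -> bmod x y ->
  bmod (x ^+ k) (y ^+ k).
Proof.
move=> hx hy h; rewrite /bmod subrXX mulrC; apply: bmaxM => //.
by apply: bint_sum => i _; apply: bintM; apply: bint_exp.
Qed.
Lemma bmod_gal (s : AbsGal L) x y : bmod x y -> bmod (s x) (s y).
Proof. by move=> h; rewrite /bmod -rmorphB /=; apply: bmax_gal. Qed.

(** p is invertible in the residue field, which keeps p-power roots of unity apart. *)
Lemma bmod_unity p k (z : L) i : prime p -> v p%:R = 0 -> p%:R != 0 :> K ->
  (p ^ k)%N.-primitive_root z ->
  bmod (z ^+ i) z -> z ^+ i = z.
Proof.
move=> pp vp p0 zp h; have pk0 : (0 < p ^ k)%N by rewrite expn_gt0 prime_gt0.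
have z0 : z != 0.
  apply/eqP => z0; move: (prim_expr_order zp).
  by rewrite z0 expr0n gtn_eqF //= => /eqP; rewrite eq_sym oner_eq0.
have zi : bar_integer v z.
  apply/bar_intP; apply: (@integral_root_monic _ _ _ _ ('X^(p ^ k) - 1)).
  - by rewrite monicXnsubC.
  - by rewrite rootE !hornerE (prim_expr_order zp) subrr.
  apply/integral_poly => j; rewrite coefB coefXn coef1.
  by apply: integral_sub; apply: integral_nat.
have zVi : bar_integer v z^-1.
  have -> : z^-1 = z ^+ (p ^ k).-1.
    by apply: (mulfI z0); rewrite mulfV // -exprS prednK // (prim_expr_order zp).
  exact: bint_exp.
have h1 : bmod (z ^+ (i + (p ^ k).-1)) 1.
  have := bmaxM zVi h; rewrite mulrBr mulVf // exprD mulrC /bmod.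
  suff -> : z^-1 = z ^+ (p ^ k).-1 by [].
  by apply: (mulfI z0); rewrite mulfV // -exprS prednK // (prim_expr_order zp).
set j := (i + (p ^ k).-1)%N in h1.
suff zj : z ^+ j = 1.
  by rewrite -[RHS]mul1r -zj /j -exprSr -addnS prednK // exprD (prim_expr_order zp) mulr1.
apply/eqP; apply/negP => /negP zj; apply: bmax1.
have pkE : (p ^ k)%:R = \prod_(1 <= i < p ^ k) (1 - z ^+ i).
  have := factor_Xn_sub_1 zp; rewrite big_ltn // expr0 => e.
  have /(congr1 (fun P => P.[1])) : \prod_(1 <= i < p ^ k) ('X - (z ^+ i)%:P) =
     \sum_(i < p ^ k) 'X^i.
    have /mulfI : 'X - 1%:P != 0 :> {poly L} by rewrite polyXsubC_eq0.
    by apply; rewrite e subrX1 polyC1.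
  rewrite horner_prod horner_sum (eq_bigr (fun i => 1 - z ^+ i)); last first.
    by move=> a _; rewrite !hornerE.
  move=> ->; rewrite (eq_bigr (fun=> 1)); last by move=> a _; rewrite !hornerE expr1n.
  by rewrite sumr_const card_ord.
have jm : (j %% p ^ k)%N \in index_iota 1 (p ^ k).
  rewrite mem_index_iota ltn_mod pk0 andbT lt0n.
  by rewrite -(prim_expr_mod zp) in zj; apply: contraNneq zj => ->.
rewrite (big_rem _ jm) /= (prim_expr_mod zp) in pkE.
have : bar_maximal v ((p ^ k)%:R : L).
  rewrite pkE mulrC; apply: bmaxM; last exact: bmod_sym.
  elim/big_ind: _ => [||a _]; [exact: bint1|exact: bintM|].
  by apply: bintB; [exact: bint1|exact: bint_exp].
have pV : bar_integer v (ac_emb L (p%:R ^- k)).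
  apply: bint_emb; rewrite -exprVn; apply: (rpredX _ (_ : _ \in vr_pred)).
  by rewrite vrE dvV // vp oppr0 lexx orbT.
move=> /(bmaxM pV); rewrite fmorphV rmorphXn /= rmorph_nat -natrX mulVf //.
by rewrite natrX -(rmorph_nat (ac_emb L)) expf_neq0 // fmorph_eq0.
Qed.

End Valuation.

(** * The Weil group and the tame character *)

Section GexpZ.
Context (G : groupType) (g : G).

Lemma gexpzS n : gexpz g (n + 1) = (g * gexpz g n)%g.
Proof.
case: n => [n|[|n]]; rewrite /gexpz.
- by rewrite -PoszD addn1 expgS.
- by rewrite /= expg1 mulgV.
- have -> : Negz n.+1 + 1 = Negz n by rewrite !NegzE; ring.
  by rewrite (expgSr _ n.+1) invMg mulKVg.
Qed.

Lemma gexpzD m n : gexpz g (m + n) = (gexpz g m * gexpz g n)%g.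
Proof.
have nat_case (k : nat) n' : gexpz g (k%:Z + n') = (gexpz g k%:Z * gexpz g n')%g.
  elim: k => [|k IH]; first by rewrite add0r mul1g.
  have -> : k.+1%:Z + n' = (k%:Z + n') + 1 by rewrite -addn1 PoszD; ring.
  rewrite gexpzS IH mulgA -gexpzS; congr (gexpz g _ * _)%g.
  by rewrite -PoszD addn1.
case: m => [m|m]; first exact: nat_case.
have e : gexpz g n = (g ^+ m.+1 * gexpz g (Negz m + n))%g.
  have -> : n = m.+1%:Z + (Negz m + n) by rewrite NegzE addrA subrr add0r.
  by rewrite nat_case NegzE addKr.
by rewrite e /= mulKg.
Qed.

Lemma gexpzN n : gexpz g (- n) = (gexpz g n)^-1%g.
Proof.
apply: (mulgI (gexpz g n)); rewrite -gexpzD subrr mulgV //.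
Qed.
End GexpZ.

Section GaloisBasics.
Context (K : fieldType) (L : algClosure K).
Implicit Types (s t : AbsGal L) (x : L).

Lemma galVK s x : (s^-1)%g (s x) = x.
Proof. by have := congr1 (fun t : AbsGal L => t x) (mulVg s). Qed.
Lemma galKV s x : s ((s^-1)%g x) = x.
Proof. by have := congr1 (fun t : AbsGal L => t x) (mulgV s). Qed.
Lemma gal_emb s (y : K) : s (ac_emb L y) = ac_emb L y.
Proof. by case: (galP s). Qed.
Lemma gal_expE s k x : (s ^+ k)%g x = iter k s x.
Proof. by elim: k => [|k IH] //=; rewrite expgS /= -IH. Qed.

(** Add all roots of equations over K of the members of the list. *)
Lemma conj_list (l : seq L) : exists l' : seq L,
  {subset l <= l'} /\ forall s x, x \in l' -> s x \in l'.
Proof.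
elim: l => [|a l [l' [h1 h2]]]; first by exists [::]; split.
have [P P0 Pa] := ac_alg a.
have [rs rsE] := closed_field_poly_normal (map_poly (ac_emb L) P).
set Q := map_poly _ P in Pa rsE.
have Q0 : Q != 0 by rewrite map_poly_eq0.
have rsP x : (x \in rs) = root Q x.
  rewrite rsE rootZ ?lead_coef_eq0 // root_prod_XsubC //.
exists (rs ++ l'); split.
  move=> x; rewrite inE mem_cat => /orP[/eqP->|/h1->]; last by rewrite orbT.
  by rewrite rsP Pa.
move=> s x; rewrite !mem_cat => /orP[|/h2->]; last by rewrite orbT.
rewrite !rsP => h; apply/orP; left.
have -> : Q = map_poly s Q.
  by rewrite -map_poly_comp; apply: eq_map_poly => y /=; rewrite gal_emb.
by rewrite fmorph_root.
Qed.

(** The orbit of the list is finite, as conjugates are roots of one polynomial. *)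
Lemma gal_power_fix (l : seq L) s : exists2 m, (0 < m)%N &
  forall x, x \in l -> (s ^+ m)%g x = x.
Proof.
have [l' [ll' l'S]] := conj_list l.
have [|m m0 h] := @uniq_map_period _ l' s (s^-1)%g (galVK s); first exact: l'S.
by exists m => // x /ll' /h; rewrite gal_expE.
Qed.
End GaloisBasics.

Section ZpFacts.
Context (p : nat) (p_prime : prime p) (Zp : padicInt p).

Let pk1 k : (1 < p ^ k.+1)%N.
Proof. by rewrite -(exp1n k.+1) ltn_exp2r // prime_gt1. Qed.

Lemma zp_eq (x y : Zp) : (forall k, zp_proj Zp k x = zp_proj Zp k y) -> x = y.
Proof.
move=> h; have [z [_ uz]] := @zp_lim _ Zp _ (fun k => zp_proj_coh k x).
by rewrite -(uz x) // -(uz y).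
Qed.

Lemma zp_char0 n : n.+1%:R != 0 :> Zp.
Proof.
apply/eqP => /(congr1 (zp_proj Zp n)); rewrite rmorph0 rmorph_nat.
move=> /(congr1 val); rewrite /= (val_Zp_nat (pk1 n)) modn_small //.
by apply: leq_ltn_trans (ltn_expl _ (prime_gt1 p_prime)) _; rewrite ltn_exp2l ?prime_gt1.
Qed.
End ZpFacts.

Section LocalWeilFacts.
Context (p : nat) (p_prime : prime p) (Zp : padicInt p) (K : fieldType)
  (v : dval K) (L : algClosure K) (W : localWeil Zp v L).
Context (vp : v p%:R = 0) (pK : p%:R != 0 :> K).
Implicit Types (s t i : AbsGal L).
Let q := lw_q W.
Let phi := lw_phi W.
Let inW := weil v q (L := L).
Let inI := inertia v (L := L).

Lemma inertia1 : inI 1%g.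
Proof. by move=> x _; rewrite subrr; apply: bmax0. Qed.
Lemma inertiaM s t : inI s -> inI t -> inI (s * t)%g.
Proof.
move=> hs ht x hx; apply: (bmod_trans (y := t x)); last exact: ht.
by apply: hs; apply: bint_gal.
Qed.
Lemma inertiaJ s i : inI i -> inI (s * i * s^-1)%g.
Proof.
move=> hi x hx; have := bmod_gal s (hi _ (bint_gal s^-1%g hx)).
by rewrite galKV.
Qed.
Lemma inertiaV s : inI s -> inI s^-1%g.
Proof.
move=> hs x hx; apply: bmod_sym.
by have := hs _ (bint_gal s^-1%g hx); rewrite galKV.
Qed.

Let frob (k : nat) s := frob_power v q k%:Z s.

Lemma frobM k l s t : frob k s -> frob l t -> frob (k + l) (s * t)%g.
Proof.
move=> hs ht x hx; rewrite expnD exprM.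
apply: (bmod_trans (y := t x ^+ (q ^ l))); last exact: ht.
apply: bmod_exp; [| exact: bint_gal|by apply: hs; apply: bint_gal].
exact: (bint_exp (q ^ k) (bint_gal (s * t)%g hx)).
Qed.
Lemma frob_inertia i : frob 0 i <-> inI i.
Proof. by split=> h x /h; rewrite expn0 expr1. Qed.
Lemma frob_phi k : frob k (phi ^+ k)%g.
Proof.
elim: k => [|k IH]; first exact/frob_inertia/inertia1.
by rewrite expgS -add1n; apply: frobM => //; apply: lw_phiP.
Qed.
Lemma frob_neg k s : frob_power v q (Negz k) s <-> frob k.+1 s^-1%g.
Proof.
split=> h x hx.
  have := h _ (bint_gal s^-1%g hx); rewrite galKV => /bmod_sym //.
by have /bmod_sym := h _ (bint_gal s hx); rewrite galVK.
Qed.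
Lemma frob_div k s t : frob k s -> frob k t -> inI (s^-1 * t)%g.
Proof.
move=> hs ht x hx; have hz := bint_gal t hx.
have := hs _ (bint_gal s^-1%g hz); rewrite galKV => /bmod_sym h1.
exact: bmod_trans h1 (ht x hx).
Qed.

(** Two elements that induce the same power of Frobenius on the residue field
    differ by inertia. *)
Lemma weilE g : inW g <-> exists n, inI (gexpz phi (- n) * g)%g.
Proof.
split=> [[[k|k] hg]|[[k|k]]].
- exists k%:Z; rewrite gexpzN; exact: frob_div (frob_phi k) hg.
- move/frob_neg in hg; exists (Negz k); rewrite NegzE opprK /=.
  have := inertiaJ (phi ^+ k.+1)%g (frob_div hg (frob_phi k.+1)).
  by rewrite invgK mulgA mulgK.
- rewrite gexpzN /= => hi; exists k%:Z.
  by have := frobM (frob_phi k) ((frob_inertia _).2 hi); rewrite mulKVg addn0.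
- rewrite NegzE opprK /= => hi; exists (Negz k); apply/frob_neg.
  have := inertiaJ (phi ^+ k.+1)^-1%g (inertiaV hi); rewrite invgK => /(frob_inertia _).2.
  move/(frobM (frob_phi k.+1)); rewrite addn0.
  by rewrite invMg !mulgA mulgV mul1g mulgKV.
Qed.

Lemma weilM s t : inW s -> inW t -> inW (s * t)%g.
Proof.
move=> /weilE[m hs] /weilE[n ht]; apply/weilE; exists (m + n).
have := inertiaM (inertiaJ (gexpz phi (- n)) hs) ht.
by rewrite !gexpzN gexpzD !invMg invgK -!mulgA mulKVg.
Qed.
Lemma weilV s : inW s -> inW s^-1%g.
Proof.
move=> /weilE[m hs]; apply/weilE; exists (- m); rewrite opprK.
have := inertiaJ (gexpz phi m) (inertiaV hs).
by rewrite gexpzN invMg invgK -!mulgA mulgV mulg1.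
Qed.
Lemma weilI i : inI i -> inW i.
Proof. by move=> hi; apply/weilE; exists 0; rewrite oppr0 mul1g. Qed.
Lemma weil1 : inW 1%g. Proof. exact/weilI/inertia1. Qed.
Lemma weil_phi : inW phi.
Proof. by exists 1%:Z; apply: lw_phiP. Qed.
Lemma weil_gexpz n : inW (gexpz phi n).
Proof.
have h (k : nat) : inW (phi ^+ k)%g.
  by exists k%:Z; apply: frob_phi.
by case: n => k /=; [exact: h | apply/weilV/h].
Qed.

Lemma lw_v_gexpz n : lw_v W (gexpz phi n) = n.
Proof.
have h (k : nat) : lw_v W (phi ^+ k)%g = k%:Z.
  elim: k => [|k IH]; first exact/lw_vI/inertia1.
  rewrite expgS lw_vM ?IH ?lw_vphi //; first exact: weil_phi.
  by exists k%:Z; apply: frob_phi.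
case: n => k /=; first exact: h.
have hk : inW (phi ^+ k.+1)%g by exists k.+1%:Z; apply: frob_phi.
apply/eqP; rewrite NegzE -addr_eq0 -(h k.+1) -lw_vM //; last exact: weilV.
by rewrite mulVg; apply/eqP/lw_vI/inertia1.
Qed.

Lemma weil_v g : inW g -> inI (gexpz phi (- lw_v W g) * g)%g.
Proof.
move=> hg; have /weilE[n hn] := hg.
have -> : lw_v W g = n; last by [].
apply/eqP; rewrite -subr_eq0 addrC -(lw_vI W hn) lw_vM ?lw_v_gexpz //.
exact: weil_gexpz.
Qed.

Lemma weil_gen g : inW g -> exists (k : nat) i,
  inI i /\ (g = phi ^+ k * i \/ phi ^+ k * g = i)%g.
Proof.
move=> /weil_v; case: (lw_v W g) => k.
  rewrite gexpzN /= => hi; exists k, ((phi ^+ k)^-1 * g)%g; split=> //.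
  by left; rewrite mulKVg.
rewrite NegzE opprK /= => hi; exists k.+1, (phi ^+ k.+1 * g)%g; split=> //.
by right.
Qed.

Definition weil_group : wgroup (AbsGal L) :=
  WGroup weil1 weilM weilV weil_phi weilI inertia1 inertiaM inertiaV
    (fun i => @inertiaJ phi i) weil_gen.

Lemma lwt1 : lw_t W 1%g = 0.
Proof.
have := lw_tM W inertia1 inertia1; rewrite mulg1 => /eqP.
by rewrite -subr_eq0 opprD addrA subrr add0r oppr_eq0 => /eqP.
Qed.
Lemma inertiaX i k : inI i -> inI (i ^+ k)%g.
Proof.
by move=> hi; elim: k => [|k IH]; [exact: inertia1|rewrite expgS; apply: inertiaM].
Qed.
Lemma lwtX i k : inI i -> lw_t W (i ^+ k)%g = k%:R * lw_t W i.
Proof.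
move=> hi; elim: k => [|k IH]; first by rewrite lwt1 mul0r.
by rewrite expgS lw_tM ?IH //; [rewrite -natr1; ring|exact: inertiaX].
Qed.
Lemma lwtV i : inI i -> lw_t W i^-1%g = - lw_t W i.
Proof.
move=> hi; apply/eqP; rewrite -addr_eq0 -lw_tM //; last exact: inertiaV.
by rewrite mulVg lwt1.
Qed.

(** Frobenius raises roots of unity to the power 1/q, so that conjugation by it
    divides the tame character by q. *)
Lemma lwt_phi i : inI i -> q%:R * lw_t W (phi * i * phi^-1)%g = lw_t W i.
Proof.
move=> hi; apply: zp_eq => k; rewrite rmorphM rmorph_nat.
set A := zp_proj Zp k (lw_t W i); set B := zp_proj Zp k _.
pose z := lw_zeta W k.+1; have zp : (p ^ k.+1)%N.-primitive_root z := lw_zeta_prim W k.+1.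
have [u u0 vu] := dv_surj v.
have pk0 : (0 < p ^ k.+1)%N by rewrite expn_gt0 prime_gt0.
have [x xE] : exists x : L, x ^+ (p ^ k.+1) = ac_emb L u.
  have /closed_rootP[x] : size ('X^(p ^ k.+1) - (ac_emb L u)%:P) != 1%N.
    by rewrite size_XnsubC // eqSS -lt0n.
  by rewrite rootE !hornerE subr_eq0 => /eqP xE; exists x.
have x0 : x != 0.
  apply/eqP=> x0; move/eqP: xE; rewrite x0 expr0n gtn_eqF //= eq_sym fmorph_eq0.
  by rewrite (negPf u0).
have [c cE] : exists c : nat, phi z = z ^+ c.
  have [|c ->] := prim_rootP zp (_ : phi z ^+ (p ^ k.+1) = 1); last by exists c.
  by rewrite -rmorphXn /= (prim_expr_order zp) rmorph1.
have zi : bar_integer v z.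
  apply/bar_intP; apply: (@integral_root_monic _ _ _ _ ('X^(p ^ k.+1) - 1)).
  - by rewrite monicXnsubC.
  - by rewrite rootE !hornerE (prim_expr_order zp) subrr.
  apply/integral_poly => j; rewrite coefB coefXn coef1.
  by apply: integral_sub; apply: integral_nat.
have zcq : z ^+ (c * q) = z.
  apply: (bmod_unity p_prime vp pK zp).
  by have := lw_phiP W zi; rewrite /= expn1 cE -exprM.
have e1 := lw_t_kummer W (inertiaJ phi hi) u0 vu xE.
have yE : ((phi^-1)%g x) ^+ (p ^ k.+1) = ac_emb L u.
  by rewrite -rmorphXn /= xE gal_emb.
have e2 := lw_t_kummer W hi u0 vu yE.
have : z ^+ B = z ^+ (c * A).
  apply: (mulIf x0); rewrite -e1 /= e2 rmorphM rmorphXn /= galKV -/z cE exprM //.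
move=> /(congr1 (fun y => y ^+ q)); rewrite -!exprM [(c * A * q)%N]mulnAC [in RHS]exprM zcq => /eqP.
rewrite (eq_prim_root_expr zp) => /eqP e.
have pk1 : (1 < p ^ k.+1)%N by rewrite -(exp1n k.+1) ltn_exp2r // prime_gt1.
rewrite -[A]natr_Zp -[B]natr_Zp -natrM mulnC.
by rewrite -[LHS](Zp_nat_mod pk1) e (Zp_nat_mod pk1).
Qed.

Lemma lw_q_gt1 : (1 < q)%N.
Proof.
rewrite /q; have [s [<- _ sP]] := lw_qP W.
have d0 : dv_ge v 0 0 by rewrite /dv_ge eqxx.
have d1 : dv_ge v 0 1 by rewrite /dv_ge dv1 lexx orbT.
have h (x : K) : dv_ge v 0 x -> exists2 y, y \in s & dv_ge v 1 (x - y).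
  by move=> /sP h; apply/hasP; rewrite has_count h.
have [y0 y0s h0] := h _ d0; have [y1 y1s h1] := h _ d1.
have ne : y0 != y1.
  apply/eqP=> e; rewrite e in h0; have := sP _ d1 => _.
  move: h0 h1; rewrite sub0r /dv_ge oppr_eq0 dvN.
  have [->|y10] := eqVneq y1 0; first by rewrite subr0 oner_eq0 dv1.
  rewrite /= => v1; have [e1|n0] := eqVneq (1 - y1) 0.
    by move: v1; rewrite -(subr0_eq e1) dv1.
  rewrite /= => v2; have : 1 - y1 + y1 != 0 by rewrite subrK oner_neq0.
  move/(dvD v n0 y10); rewrite subrK dv1 => h'.
  by have := le_trans (_ : 1 <= Num.min (v (1 - y1)) (v y1)) h'; rewrite le_min v1 v2 => /(_ isT).
case: s y0s y1s {sP h} => [|a [|b s]] //.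
by rewrite !inE => /eqP e0 /eqP e1; rewrite e0 e1 eqxx in ne.
Qed.

(** A power of an inertia element with tame character 1 fixes any given list. *)
Lemma tame_generator (l : seq L) : exists i M,
  [/\ inI i, forall x, x \in l -> i x = x & lw_t W i = M.+1%:R].
Proof.
have [i hi ti] := lw_t_surj W 1.
have [[//|m] _ hm] := gal_power_fix l i.
exists (i ^+ m.+1)%g, m; split=> //; first exact: inertiaX.
by rewrite lwtX // ti mulr1.
Qed.

End LocalWeilFacts.

(** * Monodromy and Frobenius-semisimplification *)

Section UnipotentRoot.
Context (F : closedFieldType) (char0 : forall n, n.+1%:R != 0 :> F).

(** A unipotent matrix is determined by its powers: the commutator with U is a
    nilpotent operation D, and on the last nonzero iterate of D the relation
    U^m y = y U^m degenerates to multiplication by m. *)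
Lemma unip_root_comm d (U y : 'M[F]_d) m : nilpotent_mx (U - 1%:M) ->
  U ^+ m.+1 *m y = y *m U ^+ m.+1 -> U *m y = y *m U.
Proof.
move=> nU e; pose D (Z : 'M[F]_d) := U *m Z - Z *m U.
pose n : 'M[F]_d := U - 1%:M.
have Dn Z : D Z = n *m Z - Z *m n.
  rewrite /D /n mulmxBl mulmxBr mul1mx mulmx1 opprB addrC addrA subrK addrC //.
have D0 : D 0 = 0 by rewrite /D mulmx0 mul0mx subrr.
have Dsum I (r : seq I) (f : I -> 'M[F]_d) : D (\sum_(i <- r) f i) = \sum_(i <- r) D (f i).
  by rewrite /D mulmx_sumr mulmx_suml -sumrB.
have DU i j Z : D (U ^+ i *m Z *m U ^+ j) = U ^+ i *m D Z *m U ^+ j.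
  rewrite /D mulmxBr mulmxBl !mulmxA -expmxS expmxSr -!mulmxA.
  by rewrite -expmxSr expmxS.
have nil Z : iter (d + d) D Z = 0.
  have h k : forall a b, (d + d <= a + b + k)%N -> n ^+ a *m iter k D Z *m n ^+ b = 0.
    elim: k => [|k IH] a b hab.
      have [da|ad] := leqP d a; first by rewrite (nilp_exp nU da) !mul0mx.
      rewrite (@nilp_exp _ _ n b nU) ?mulmx0 //; lia.
    rewrite /= Dn mulmxBr mulmxBl.
    have -> : n ^+ a *m (n *m iter k D Z) *m n ^+ b = 0.
      by rewrite mulmxA -expmxSr IH //; lia.
    have -> : n ^+ a *m (iter k D Z *m n) *m n ^+ b = 0.
      by rewrite !mulmxA -[_ *m n *m _]mulmxA -expmxS IH //; lia.
    by rewrite subr0.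
  by have := h (d + d)%N 0%N 0%N (leqnn _); rewrite !expr0 mul1mx mulmx1.
have ex : exists k, iter k D y == 0 by exists (d + d)%N; rewrite nil.
suff /eqP : D y = 0 by rewrite subr_eq0 => /eqP.
case: (ex_minnP ex) => [[|[|k]]] /eqP h hm.
- by move: h => /= ->.
- exact: h.
set w := iter k.+1 D y; have w0 : w != 0 by apply/negP=> /hm; rewrite ltnn.
have Uw : U *m w = w *m U by apply/eqP; rewrite -subr_eq0; apply/eqP.
have Uwk j : w *m U ^+ j = U ^+ j *m w.
  elim: j => [|j IH]; first by rewrite !expr0 mulmx1 mul1mx.
  by rewrite expmxSr mulmxA IH -mulmxA -Uw mulmxA.
have tel : \sum_(i < m.+1) U ^+ i *m D y *m U ^+ (m - i) = 0.
  have tele j : \sum_(i < j) U ^+ i *m D y *m U ^+ (j.-1 - i) =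
      U ^+ j *m y - y *m U ^+ j.
    elim: j => [|j IH]; first by rewrite big_ord0 !expr0 mul1mx mulmx1 subrr.
    rewrite big_ord_recr /= subnn expr0 mulmx1.
    rewrite (eq_bigr (fun i : 'I_j => U ^+ i *m D y *m U ^+ (j.-1 - i) *m U)); last first.
      move=> i _; rewrite -[RHS]mulmxA -expmxSr; congr (_ *m U ^+ _).
      by have := ltn_ord i; lia.
    rewrite -mulmx_suml IH mulmxBl -[y *m _ *m U]mulmxA -expmxSr.
    by rewrite /D mulmxBr !mulmxA -expmxSr addrC addrA subrK.
  by rewrite (tele m.+1) e subrr.
have : iter k D (\sum_(i < m.+1) U ^+ i *m D y *m U ^+ (m - i)) = m.+1%:R *: (U ^+ m *m w).
  have it j : iter j D (\sum_(i < m.+1) U ^+ i *m D y *m U ^+ (m - i)) =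
     \sum_(i < m.+1) U ^+ i *m iter j.+1 D y *m U ^+ (m - i).
    elim: j => [//|j /= ->]; rewrite Dsum; apply: eq_bigr => i _.
    by rewrite DU.
  rewrite it (eq_bigr (fun=> U ^+ m *m w)) => [|i _].
    by rewrite sumr_const card_ord scaler_nat.
  rewrite -/w -mulmxA Uwk mulmxA -[U ^+ i *m _]/(U ^+ i * _) -exprD subnKC //.
  by rewrite -ltnS.
rewrite tel; have -> : iter k D 0 = 0 by elim: k {h hm w w0 Uw Uwk} => //= k ->.
move=> /esym/eqP; rewrite scaler_eq0 (negPf (char0 m)) /= => /eqP z.
have uU : U ^+ m \in unitmx.
  elim: (m) => [|j IH]; first by rewrite expr0 unitmx1.
  by rewrite expmxS unitmx_mul IH (unip_unit nU).
by rewrite -[w](mulKmx uU) z mulmx0 eqxx in w0.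
Qed.

Lemma expmx_unit d (A : 'M[F]_d) k : A \in unitmx -> A ^+ k \in unitmx.
Proof.
by move=> uA; elim: k => [|k IH]; [rewrite expr0 unitmx1|rewrite expmxS unitmx_mul uA].
Qed.

Lemma ssmx_exp d (A : 'M[F]_d) k : ssmx A -> ssmx (A ^+ k).
Proof.
case=> rs [urs h]; exists (undup [seq z ^+ k | z <- rs]); split; first exact: undup_uniq.
set p := \prod_(z <- undup _) _.
have -> : pmx (A ^+ k) p = pmx A (p \Po 'X^k).
  rewrite comp_polyE pmx_sum pmxE; apply: eq_bigr => i _.
  by rewrite pmxZ pmx_exp pmxXn.
apply: dvdp_pmx0 h; apply: uniq_roots_dvdp; last by rewrite uniq_rootsE.
apply/allP=> z zr; rewrite root_comp hornerXn root_prod_XsubC mem_undup.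
exact: map_f.
Qed.

End UnipotentRoot.


Section MxPowz.
Context (E : fieldType) (d : nat).

Lemma invmx_exp (A : 'M[E]_d) k : A \in unitmx -> invmx A ^+ k = invmx (A ^+ k).
Proof.
move=> uA; have e : A ^+ k *m invmx A ^+ k = 1%:M.
  elim: k => [|k IH]; first by rewrite !expr0 mul1mx.
  by rewrite expmxSr expmxS mulmxA -[_ *m A *m _]mulmxA mulmxV // mulmx1.
have [u _] := mulmx1_unit e.
by apply: (can_inj (mulKmx u)); rewrite e mulmxV.
Qed.

Lemma mxpowz_unit (A : 'M[E]_d) n : A \in unitmx -> mxpowz A n \in unitmx.
Proof.
have h (B : 'M[E]_d) k : B \in unitmx -> B ^+ k \in unitmx.
  by move=> uB; elim: k => [|k IH]; [rewrite expr0 unitmx1|rewrite expmxS unitmx_mul uB].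
by case: n => n uA /=; [apply: h | apply: h; rewrite unitmx_inv].
Qed.

Lemma mxpowzS (A : 'M[E]_d) n : A \in unitmx -> mxpowz A (n + 1) = A *m mxpowz A n.
Proof.
move=> uA; case: n => [n|[|n]]; rewrite /mxpowz.
- by rewrite -PoszD addn1 expmxS.
- by rewrite /= expr1 mulmxV.
- have -> : Negz n.+1 + 1 = Negz n by rewrite !NegzE; ring.
  by rewrite [_ ^+ n.+2]expmxS mulKVmx.
Qed.

Lemma mxpowzD (A : 'M[E]_d) m n : A \in unitmx ->
  mxpowz A (m + n) = mxpowz A m *m mxpowz A n.
Proof.
move=> uA; have nat_case (k : nat) n' : mxpowz A (k%:Z + n') = mxpowz A k%:Z *m mxpowz A n'.
  elim: k => [|k IH]; first by rewrite add0r mul1mx.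
  have -> : k.+1%:Z + n' = (k%:Z + n') + 1 by rewrite -addn1 PoszD; ring.
  by rewrite mxpowzS // IH mulmxA -mxpowzS // -PoszD addn1.
case: m => [m|m]; first exact: nat_case.
have e : mxpowz A n = A ^+ m.+1 *m mxpowz A (Negz m + n).
  have -> : n = m.+1%:Z + (Negz m + n) by rewrite NegzE addrA subrr add0r.
  by rewrite nat_case NegzE addKr.
rewrite [in RHS]e /= invmx_exp // mulKmx //; exact: (@mxpowz_unit _ m.+1%:Z).
Qed.

Lemma mxpowz_scale_twine (A N : 'M[E]_d) a n : A \in unitmx -> a != 0 ->
  A *m N = a *: (N *m A) -> mxpowz A n *m N = a ^ n *: (N *m mxpowz A n).
Proof.
move=> uA a0 h; have hk (k : nat) : A ^+ k *m N = a ^+ k *: (N *m A ^+ k).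
  elim: k => [|k IH]; first by rewrite mul1mx mulmx1 scale1r.
  rewrite expmxS -mulmxA IH -scalemxAr mulmxA h -!scalemxAl scalerA exprSr.
  by rewrite -mulmxA -expmxS.
case: n => n /=; first exact: hk.
have uAn := @mxpowz_unit A n.+1%:Z uA; rewrite /= in uAn.
rewrite invmx_exp //; apply: (can_inj (mulKmx uAn)); rewrite mulKVmx //.
rewrite -scalemxAr mulmxA hk -scalemxAl mulmxK // scalerA.
by rewrite -[a ^ _]/(a ^- n.+1) mulVf ?scale1r // expf_neq0.
Qed.
End MxPowz.

(** The Frobenius-semisimplification rr of the Weil-Deligne representation of
    (rho, N), obtained from the Jordan decomposition S U of rho(phi). *)
Record frss_data (p : nat) (Zp : padicInt p) (K : fieldType) (v : dval K)
  (L : algClosure K) (W : localWeil Zp v L) (E : closedFieldType)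
  (c : {rmorphism Zp -> E}) (d : nat) (rho : AbsGal L -> 'M[E]_d) (N S U : 'M[E]_d)
  (rr : AbsGal L -> 'M[E]_d) : Prop := FrssData {
  fd_mono : is_monodromy W c rho N;
  fd_SU : rho (lw_phi W) = S *m U;
  fd_USC : S *m U = U *m S;
  fd_S : ssmx S;
  fd_U : nilpotent_mx (U - 1%:M);
  fd_rr : rr = fun s => wd_rep (WD W c rho N) s *m mxpowz U (- lw_v W s);
  fd_good : good (weil_group W) rr;
  fd_phi : rr (lw_phi W) = S;
  fd_rN : forall s, weil v (lw_q W) s -> rr s *m N = art_inv W E s *: (N *m rr s);
  fd_UN : U *m N = N *m U;
  fd_I : forall i, inertia v i -> rho i = rr i *m mxexp (c (lw_t W i) *: N);
  fd_UI : forall i, inertia v i -> U *m rr i = rr i *m U;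
  fd_period : exists m, forall i, inertia v i ->
    rho (lw_phi W) ^+ m.+1 *m rr i = rr i *m rho (lw_phi W) ^+ m.+1 }.

Section WDFacts.
Context (p : nat) (p_prime : prime p) (Zp : padicInt p) (K : fieldType)
  (v : dval K) (L : algClosure K) (W : localWeil Zp v L).
Context (vp : v p%:R = 0) (pK : p%:R != 0 :> K).
Context (E : closedFieldType) (char0 : forall n, n.+1%:R != 0 :> E).
Context (c : {rmorphism Zp -> E}).
Let q := lw_q W.
Let phi := lw_phi W.
Let inW := weil v q (L := L).
Let inI := inertia v (L := L).

Lemma q_neq0 : q%:R != 0 :> E.
Proof. by apply: natc_neq0 => //; apply: ltn_trans (lw_q_gt1 W). Qed.

Lemma mono_list d (rho : AbsGal L -> 'M[E]_d) N : is_monodromy W c rho N ->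
  exists l : seq L, (forall (s : AbsGal L) x, x \in l -> s x \in l) /\
   forall i, inI i -> {in l, forall x, i x = x} -> rho i = mxexp (c (lw_t W i) *: N).
Proof.
case=> nN [l hl]; have [l' [ll' l'S]] := conj_list l; exists l'; split=> // i hi il.
by apply: hl => // x /ll' /il.
Qed.

Lemma nilpZ d a (N : 'M[E]_d) : nilpotent_mx N -> nilpotent_mx (a *: N).
Proof. by case=> k e; exists k; rewrite scale_expmx e scaler0. Qed.

Section Rho.
Context (d : nat) (rho : AbsGal L -> 'M[E]_d) (hr : is_rep inW rho).
Context (N : 'M[E]_d) (mono : is_monodromy W c rho N).
Let nN : nilpotent_mx N. Proof. by case: mono. Qed.
Let w := weil_group W.

Lemma mono_conj g a : inW g ->
  (forall i, inI i -> c (lw_t W (g * i * g^-1)%g) = a * c (lw_t W i)) ->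
  rho g *m N = a *: (N *m rho g).
Proof.
move=> Hg ha; have [l [lS lE]] := mono_list mono.
have [i [M [Ii il ti]]] := tame_generator W l.
have [ug gV] := @rep_unit E _ w d rho g hr Hg.
pose X : 'M[E]_d := rho g *m (M.+1%:R *: N) *m invmx (rho g).
pose Y : 'M[E]_d := (a * M.+1%:R) *: N.
have nX : nilpotent_mx X.
  have [k e] := nilpZ M.+1%:R nN; exists k.
  have t : X *m rho g = rho g *m (M.+1%:R *: N) by rewrite /X mulmxKV.
  apply: (can_inj (mulmxK ug)); rewrite mul0mx.
  by rewrite (expmx_twine k t) e mulmx0.
have XY : X = Y.
  apply: mxexp_inj => // [|t]; first exact: nilpZ.
  pose j := (i ^+ t)%g; have Ij : inI j by apply: inertiaX.
  have jl x : x \in l -> j x = x.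
    by move=> xl; rewrite /j gal_expE; elim: t {j Ij} => //= t ->; apply: il.
  have tj : c (lw_t W j) = t%:R * M.+1%:R by rewrite lwtX // ti rmorphM !rmorph_nat.
  have e1 : rho (g * j * g^-1)%g = mxexp (t%:R *: Y).
    rewrite lE; [|exact: inertiaJ|].
      by rewrite ha // tj scalerA; congr (mxexp (_ *: _)); ring.
    move=> x xl /=; have := jl _ (lS g^-1%g _ xl) => e.
    by rewrite -[RHS](galKV g); congr (g _).
  have [_ rM] := hr; rewrite -e1.
  rewrite rM; [|apply: weilM => //; exact: weilI|exact: weilV].
  rewrite rM; [|by []|exact: weilI].
  rewrite (lE j Ij jl) tj -gV.
  have t0 : rho g *m (t%:R * M.+1%:R *: N) = t%:R *: X *m rho g.
    by rewrite -scalemxAl /X mulmxKV // -scalerA -scalemxAr.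
  by rewrite (mxexp_twine t0) mulmxK.
have : X *m rho g = Y *m rho g by rewrite XY.
rewrite /X /Y mulmxKV // -scalemxAr -scalemxAl => e.
apply: (scalerI (char0 M)); rewrite e scalerA; congr (_ *: _); ring.
Qed.

Lemma mono_I i : inI i -> rho i *m N = N *m rho i.
Proof.
move=> Ii; rewrite -[RHS]scale1r; apply: mono_conj; first exact: weilI.
move=> j Ij; have Ii' := inertiaV Ii; have Iij := inertiaM Ii Ij.
by rewrite mul1r !lw_tM ?lwtV //; congr (c _); ring.
Qed.

(** Conjugation by Frobenius divides the tame character by q, and a nilpotent
    matrix is determined by the exponentials of its multiples. *)
Lemma mono_phi : rho phi *m N = q%:R^-1 *: (N *m rho phi).
Proof.
apply: mono_conj; first exact: weil_phi.
move=> i Ii; apply: (mulfI q_neq0); rewrite mulrA mulfV ?mul1r ?q_neq0 //.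
by rewrite -(lwt_phi p_prime W vp pK Ii) rmorphM rmorph_nat.
Qed.

Let y i := rho i *m mxexp (- c (lw_t W i) *: N).

Lemma y_rho i : inI i -> rho i = y i *m mxexp (c (lw_t W i) *: N).
Proof.
by move=> Ii; rewrite -mulmxA mxexpD // addNr scale0r mxexp0 mulmx1.
Qed.

Lemma y_mul i j : inI i -> inI j -> y (i * j)%g = y i *m y j.
Proof.
move=> Ii Ij; rewrite /y; have [_ rM] := hr; rewrite rM; [|exact: weilI|exact: weilI].
rewrite lw_tM // rmorphD opprD -(mxexpD char0 _ _ nN) -!mulmxA; congr (_ *m _).
rewrite !mulmxA; congr (_ *m _); apply: mxexp_twine.
by rewrite -scalemxAl -scalemxAr mono_I.
Qed.

Lemma y_conj i : inI i -> y (phi * i * phi^-1)%g *m rho phi = rho phi *m y i.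
Proof.
move=> Ii; have Ii' : inI (phi * i * phi^-1)%g by apply: inertiaJ.
have -> : rho phi *m y i = rho (phi * i * phi^-1)%g *m rho phi *m mxexp (- c (lw_t W i) *: N).
  have [_ rM] := hr; rewrite /y mulmxA -!rM ?mulgKV //; try exact: weilI; exact: weil_phi.
rewrite /y -!mulmxA; congr (_ *m _); apply/esym/mxexp_twine.
rewrite -scalemxAr mono_phi -scalemxAl scalerA; congr (_ *: _).
rewrite -(lwt_phi p_prime W vp pK Ii) rmorphM rmorph_nat -/q; field.
exact: q_neq0.
Qed.

(** Once the exponential of the monodromy is divided out, the action of inertia
    depends only on its permutation of a finite list of algebraic numbers. *)
Lemma y_finite : exists l : seq 'M[E]_d, forall i, inI i -> y i \in l.
Proof.
have [l [lS lE]] := mono_list mono.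
pose A (i : AbsGal L) : {ffun seq_sub l -> seq_sub l} :=
  [ffun x => SeqSub (lS i _ (ssvalP x))].
pose Y (f : {ffun seq_sub l -> seq_sub l}) : 'M[E]_d :=
  if pselect (exists i, inI i /\ A i = f) is left h then y (sval (cid h)) else 0.
exists [seq Y f | f : {ffun seq_sub l -> seq_sub l}] => i Ii.
have -> : y i = Y (A i).
  rewrite /Y; case: pselect => [h|[]]; last by exists i.
  case: cid => j /= [Ij /ffunP Aji].
  have e x : x \in l -> j x = i x.
    by move=> xl; have := Aji (SeqSub xl); rewrite !ffunE => /(congr1 (@ssval _ _)).
  have k1 : y (j^-1 * i)%g = 1%:M.
    have Ik : inI (j^-1 * i)%g by apply: inertiaM => //; apply: inertiaV.
    rewrite /y lE // ?mxexpK // => x xl /=.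
    by rewrite -e // galVK.
  by rewrite -[i in LHS](mulKVg j) y_mul ?k1 ?mulmx1 //; apply: inertiaM => //; apply: inertiaV.
exact: image_f.
Qed.

(** Frobenius permutes the finite set of the previous lemma, so a power of it
    commutes with each element. *)
Lemma y_period : exists m, forall i, inI i ->
  rho phi ^+ m.+1 *m y i = y i *m rho phi ^+ m.+1.
Proof.
have [l lE] := y_finite; have [uA _] := @rep_unit E _ w d rho phi hr (weil_phi W).
have iE k i : inI i -> iter k (fun y => rho phi *m y *m invmx (rho phi)) (y i) =
    y (phi ^+ k * i * (phi ^+ k)^-1)%g.
  move=> Ii; elim: k => [|k IH]; first by rewrite mul1g invg1 mulg1.
  rewrite iterS IH -y_conj ?mulmxK //; last exact: inertiaJ.
  by congr y; rewrite expgS invMg !mulgA.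
pose l' := [seq x <- l | `[< exists2 i, inI i & x = y i >]].
have l'P x : reflect (exists2 i, inI i & x = y i) (x \in l').
  rewrite mem_filter; apply: (iffP andP) => [[/asboolP //]|[i Ii e]].
  by split; [apply/asboolP; exists i|rewrite e lE].
have [||m m0 hm] := @uniq_map_period _ l' (fun z => rho phi *m z *m invmx (rho phi))
   (fun z => invmx (rho phi) *m z *m rho phi).
- by move=> z /=; rewrite !mulmxA mulVmx // mul1mx mulmxKV.
- move=> _ /l'P[i Ii ->]; apply/l'P; exists (phi * i * phi^-1)%g; first exact: inertiaJ.
  by rewrite -y_conj // mulmxK.
case: m m0 hm => // m _ hm; exists m => i Ii.
have {2}<- := hm (y i) _; last by apply/l'P; exists i.
elim: m.+1 => [|k IH]; first by rewrite mulmx1 mul1mx.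
by rewrite iterS [in RHS]expmxS [RHS]mulmxA mulmxKV // -[RHS]mulmxA -IH mulmxA -expmxS.
Qed.

(** A power of rho(phi) commutes with the finite part of inertia; hence so do the
    same powers of S and of U, and U itself by uniqueness of unipotent roots. *)
Lemma frss_of S U : rho phi = S *m U -> S *m U = U *m S -> ssmx S ->
  nilpotent_mx (U - 1%:M) -> frss_data W c rho N S U
    (fun s => wd_rep (WD W c rho N) s *m mxpowz U (- lw_v W s)).
Proof.
move=> eSU SUC sS nU; have [uA _] := @rep_unit E _ w d rho phi hr (weil_phi W).
have uS : S \in unitmx by move: uA; rewrite eSU unitmx_mul => /andP[].
have uU := unip_unit nU.
have UI i : inI i -> U *m y i = y i *m U.
  move=> Ii; have [m hm] := y_period; apply: (unip_root_comm char0 nU (m := m)).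
  have SUm k : (S *m U) ^+ k = S ^+ k *m U ^+ k.
    by rewrite -[LHS]/((S * U) ^+ k) exprMn_comm.
  have cm k : S ^+ k *m U ^+ k = U ^+ k *m S ^+ k.
    apply: (@expmx_twine _ _ _ S S) => //.
    by apply/esym; apply: (@expmx_twine _ _ _ U U); rewrite SUC.
  have hS : S ^+ m.+1 *m y i = 1 *: y i *m S ^+ m.+1.
    have e : rho phi ^+ m.+1 = S ^+ m.+1 *m U ^+ m.+1 by rewrite eSU SUm.
    have hs := ssmx_exp m.+1 sS; have hu : nilpotent_mx (U ^+ m.+1 - 1%:M) by apply: unip_exp.
    have h1 : rho phi ^+ m.+1 *m y i = 1 *: y i *m rho phi ^+ m.+1 by rewrite scale1r hm.
    exact: (jordan_twine e (cm _) hs hu e (cm _) hs hu (oner_neq0 _) h1).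
  rewrite scale1r in hS; have := hm i Ii; rewrite eSU SUm -mulmxA => e.
  apply: (can_inj (mulKmx (expmx_unit m.+1 uS))).
  by rewrite e mulmxA -hS -mulmxA.
have SN : S *m N = q%:R^-1 *: (N *m S).
  have h1 : rho phi *m N = q%:R^-1 *: N *m rho phi by rewrite -scalemxAl mono_phi.
  have q0 : q%:R^-1 != 0 :> E by rewrite invr_eq0 q_neq0.
  by rewrite scalemxAl; apply: (jordan_twine eSU SUC sS nU eSU SUC sS nU q0 h1).
have UN : U *m N = N *m U.
  apply: (can_inj (mulKmx uS)); rewrite mulmxA -eSU mono_phi eSU !mulmxA SN.
  by rewrite -!scalemxAl.
have yN i : inI i -> y i *m N = N *m y i.
  move=> Ii; rewrite /y -mulmxA; have -> : mxexp (- c (lw_t W i) *: N) *m N =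
      N *m mxexp (- c (lw_t W i) *: N).
    by apply/esym/mxexp_twine; rewrite -scalemxAl -scalemxAr.
  by rewrite !mulmxA mono_I.
have SI i : inI i -> y (phi * i * phi^-1)%g *m S = S *m y i.
  move=> Ii; apply: (can_inj (mulmxK uU)).
  by rewrite -mulmxA -eSU y_conj // eSU -mulmxA UI // mulmxA.
have SIn (n : nat) i : inI i -> y (phi ^+ n * i * (phi ^+ n)^-1)%g *m S ^+ n = S ^+ n *m y i.
  move=> Ii; elim: n => [|n IH].
    by rewrite expg0 mul1g invg1 mulg1 !expr0 mulmx1 mul1mx.
  rewrite expgS expmxS invMg mulmxA.
  have -> : (phi * phi ^+ n * i * ((phi ^+ n)^-1 * phi^-1))%g = 
      (phi * (phi ^+ n * i * (phi ^+ n)^-1) * phi^-1)%g by rewrite !mulgA.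
  rewrite SI; last exact: inertiaJ.
  by rewrite -[LHS]mulmxA IH mulmxA.
have SIz n i : inI i -> y (gexpz phi n * i * (gexpz phi n)^-1)%g *m mxpowz S n = mxpowz S n *m y i.
  move=> Ii; case: n => n /=; first exact: SIn.
  have uSn := @mxpowz_unit _ _ S n.+1%:Z uS; rewrite /= in uSn.
  rewrite invmx_exp // invgK; apply: (can_inj (mulKmx uSn)); rewrite mulKVmx // mulmxA.
  apply: (can_inj (mulmxK uSn)); rewrite mulmxKV //.
  have Ii' : inI ((phi ^+ n.+1)^-1 * i * phi ^+ n.+1)%g.
    by have := inertiaJ (phi ^+ n.+1)^-1%g Ii; rewrite invgK.
  rewrite -(SIn n.+1 _ Ii'); congr (y _ *m _).
  by rewrite !mulgA mulgV mul1g mulgK.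
pose rr s := wd_rep (WD W c rho N) s *m mxpowz U (- lw_v W s).
have Uz n i : inI i -> mxpowz U n *m y i = y i *m mxpowz U n.
  move=> Ii; rewrite (mxpowz_scale_twine (a := 1) n uU (oner_neq0 _)) ?exp1rz ?scale1r //.
  by rewrite UI.
have vE n i : inI i -> lw_v W (gexpz phi n * i)%g = n.
  move=> Ii; rewrite lw_vM ?lw_v_gexpz ?lw_vI ?addr0 //; [exact: weil_gexpz|exact: weilI].
have rz n : rho (gexpz phi n) = mxpowz (rho phi) n.
  case: n => n /=; first by apply: (@rep_exp E _ w d rho n hr).
  have [uk kV] := @rep_unit E _ w d rho (phi ^+ n.+1)%g hr (weil_gexpz W n.+1).
  by rewrite invmx_exp // -kV (@rep_exp E _ w d rho n.+1 hr).
have SUz n : mxpowz (rho phi) n = mxpowz S n *m mxpowz U n.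
  have SUk (k : nat) : rho phi ^+ k = S ^+ k *m U ^+ k.
    by rewrite eSU -[LHS]/((S * U) ^+ k) exprMn_comm.
  have cm k : S ^+ k *m U ^+ k = U ^+ k *m S ^+ k.
    apply: (@expmx_twine _ _ _ S S) => //.
    by apply/esym; apply: (@expmx_twine _ _ _ U U); rewrite SUC.
  case: n => n /=; first exact: SUk.
  have uSn := @mxpowz_unit _ _ S n.+1%:Z uS; have uUn := @mxpowz_unit _ _ U n.+1%:Z uU.
  rewrite /= in uSn uUn; rewrite !invmx_exp // SUk.
  have uSU : S ^+ n.+1 *m U ^+ n.+1 \in unitmx by rewrite unitmx_mul uSn uUn.
  apply: (can_inj (mulKmx uSU)); rewrite mulmxV // {1}cm -!mulmxA mulKVmx //.
  by rewrite mulmxV.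
have rrE n i : inI i -> rr (gexpz phi n * i)%g = mxpowz S n *m y i.
  move=> Ii; rewrite /rr /= vE // gexpzN mulKg.
  have [_ rM] := hr; rewrite rM; [|exact: weil_gexpz|exact: weilI].
  rewrite -[_ *m rho i *m _]mulmxA -/(y i) rz SUz.
  rewrite -[_ *m mxpowz U n *m y i]mulmxA Uz // [mxpowz S n *m _]mulmxA.
  by rewrite -[LHS]mulmxA -mxpowzD // subrr mulmx1.
have rrI i : inI i -> rr i = y i.
  by move=> Ii; have := rrE 0 i Ii; rewrite mul1g mul1mx.
have I1 : inI 1%g by apply: inertia1.
have y1 : y 1%g = 1%:M.
  by case: hr => r1 _; rewrite /y r1 lwt1 rmorph0 oppr0 scale0r mxexp0 mulmx1.
have rrP : rr phi = S.
  by have := rrE 1 _ I1; rewrite /= mulg1 => ->; rewrite y1 mulmx1.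
have gE g : inW g -> exists n i, inI i /\ g = (gexpz phi n * i)%g.
  move=> Hg; exists (lw_v W g), (gexpz phi (- lw_v W g) * g)%g; split; first exact: weil_v.
  by rewrite gexpzN mulKVg.
rewrite -/rr; split=> //.
- split.
  + split; first by rewrite rrI.
    move=> g h /gE[n [i [Ii ->]]] /gE[m [j [Ij ->]]].
    have Ii' : inI ((gexpz phi m)^-1 * i * gexpz phi m)%g.
      by have := inertiaJ (gexpz phi m)^-1%g Ii; rewrite invgK.
    have -> : (gexpz phi n * i * (gexpz phi m * j) =
       gexpz phi (n + m) * ((gexpz phi m)^-1 * i * gexpz phi m * j))%g.
      by rewrite gexpzD -!mulgA mulKVg.
    rewrite !rrE //; last exact: inertiaM.
    have e2 := SIz m _ Ii'; rewrite !mulgA mulgV mul1g mulgK in e2.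
    rewrite mxpowzD // y_mul // -[RHS]mulmxA -[LHS]mulmxA; congr (_ *m _).
    exact: etrans (mulmxA _ _ _) (etrans (congr1 (mulmx^~ (y j)) (esym e2)) (esym (mulmxA _ _ _))).
  + by rewrite rrP.
  + have [l lP] := y_finite; exists l => i Ii.
    by rewrite rrI // lP.
- move=> g /gE[n [i [Ii ->]]]; rewrite rrE // /art_inv vE // -[LHS]mulmxA yN //.
  rewrite [LHS]mulmxA (mxpowz_scale_twine n uS _ SN) ?invr_eq0 ?q_neq0 //.
  by rewrite -[LHS]scalemxAl exprz_inv -[N *m _ *m y i]mulmxA.
- by move=> i Ii; rewrite rrI // -y_rho.
- by move=> i Ii; rewrite rrI // UI.
- by have [m hm] := y_period; exists m => i Ii; rewrite rrI // hm.
Qed.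

End Rho.
End WDFacts.

(** * Transfer of monodromy between representations with related traces *)

(** The logarithm of a unipotent matrix, as an integral polynomial in it: the
    coefficients come from the adjugate of a Vandermonde matrix. *)
Lemma log_poly d : exists (D : int) (a : {poly int}), D != 0 /\
  forall (F : closedFieldType) (N : 'M[F]_d), (forall n, n.+1%:R != 0 :> F) ->
    nilpotent_mx N -> pmx (mxexp N) (map_poly intr a) = D%:~R *: N.
Proof.
pose n := d.+2; pose b : 'rV[int]_n := \row_j (j : nat)%:Z.
pose V := Vandermonde n b; pose A := \adj V.
have V0 : \det V != 0.
  rewrite det_Vandermonde; apply/prodf_neq0 => i _; apply/prodf_neq0 => j ij.
  by rewrite !mxE subr_eq0 eqz_nat neq_ltn ij orbT.
pose i1 : 'I_n := Ordinal (isT : 1 < n)%N.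
exists (\det V), (\poly_(m < n) (if insub m is Some m' then A m' i1 else 0)); split=> //.
move=> F N char0 nN.
have expX m : mxexp N ^+ m = mxexp (m%:R *: N).
  elim: m => [|m IH]; first by rewrite scale0r mxexp0.
  by rewrite expmxS IH -{1}[N]scale1r mxexpD // -natr1 addrC.
have expE (m : nat) : mxexp (m%:R *: N) = \sum_(k < n) (k`!%:R^-1 * m%:R ^+ k) *: N ^+ k.
  rewrite /n -addn2 big_split_ord /= [X in _ + X]big1 ?addr0 => [|k _].
    by apply: eq_bigr => k _; rewrite scale_expmx scalerA.
  by rewrite (nilp_exp nN) ?scaler0 // leq_addr.
rewrite poly_def raddf_sum /= pmx_sum.
rewrite (eq_bigr (fun m : 'I_n => \sum_(k < n) ((V k m * A m i1)%:~R / k`!%:R) *: N ^+ k)); last first.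
  move=> m _; rewrite map_polyZ map_polyXn /= pmxZ pmxXn expX expE scaler_sumr.
  rewrite valK; apply: eq_bigr => k _; rewrite scalerA.
  have -> : V k m = (m : nat)%:Z ^+ k by rewrite !mxE.
  rewrite rmorphM rmorphXn /=; have -> : (m : nat)%:Z%:~R = (m : nat)%:R :> F by [].
  by congr (_ *: _); ring.
rewrite exchange_big /= (bigD1 i1) //= [X in _ + X]big1 ?addr0; last first.
  move=> k ki; rewrite -scaler_suml -mulr_suml -rmorph_sum /=.
  have /matrixP/(_ k i1) := mul_mx_adj V; rewrite !mxE (negPf ki) => ->.
  by rewrite mul0r scale0r.
rewrite -scaler_suml -mulr_suml -rmorph_sum /=.
have /matrixP/(_ i1 i1) := mul_mx_adj V; rewrite !mxE eqxx => ->.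
by rewrite (_ : 1`! = 1)%N // divr1 expr1.
Qed.

Section Basis.
Context (G : groupType).

(** Burnside's theorem. *)
Lemma irr_basis (k : closedFieldType) d (rho : G -> 'M[k]_d) :
  irreducible_rep (@whole G) rho ->
  exists g : 'I_(d * d) -> G, vecs (fun i => rho (g i)) \in unitmx.
Proof.
move=> [[r1 rM] d0 irr].
have [z hz|M uM MP] := @free_rows k (d * d) (fun v => exists g, v = mxvec (rho g)).
  pose Z := vec_mx z^T : 'M[k]_d.
  suff Z0 : Z^T = 0.
    apply: trmx_inj; rewrite trmx0 -[z^T]vec_mxK -/Z.
    by rewrite -[Z]trmxK Z0 trmx0 linear0.
  apply: (@irr_trace_nondeg k d (fun x => exists g, x = rho g)) => //.
  - by exists 1%g.
  - by move=> _ _ [g ->] [h ->]; exists (g * h)%g; rewrite rM.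
  - by move=> U hU; apply: irr => g _ x xU; apply: hU => //; exists g.
  move=> _ [g ->]; rewrite -mxtrace_tr trmx_mul trmxK -mxvec_dot.
  have -> : (mxvec Z)^T = z by rewrite vec_mxK trmxK.
  by rewrite hz ?mxE //; exists g.
pose g i := sval (cid (MP i)); exists g.
suff -> : vecs (fun i => rho (g i)) = M by [].
by apply/row_matrixP=> i; rewrite rowK /g; case: cid.
Qed.

Lemma vecs_nondeg (F : fieldType) d N (g : 'I_N -> 'M[F]_d) (Z : 'M[F]_d) :
  row_full (vecs g) -> (forall i, \tr (Z *m g i) = 0) -> Z = 0.
Proof.
move=> full h; have /row_fullP[B BM] := full.
suff : vecs g *m (mxvec Z^T)^T = 0.
  move=> /(congr1 (mulmx B)); rewrite mulmxA BM mul1mx mulmx0 => /(congr1 trmx).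
  by rewrite trmxK trmx0 => /(congr1 vec_mx); rewrite mxvecK linear0 => /(congr1 trmx); rewrite trmxK trmx0.
apply/row_matrixP=> i; rewrite row_mul rowK row0; apply/matrixP=> a b.
rewrite !ord1 mxvec_dot mxE -[RHS](h i) -mxtrace_tr trmx_mul !trmxK //.
Qed.

Context (O : comNzRingType) (T : G -> O) (E k : fieldType).
Context (f : {rmorphism O -> E}) (psi : {rmorphism O -> k}).
Context (ker : forall z, f z = 0 -> psi z = 0).

(** The Gram determinant of the trace form is nonzero over E if it is over k. *)
Lemma basis_transfer d (rho : G -> 'M[E]_d) (rhok : G -> 'M[k]_d) (g : 'I_(d * d) -> G) :
  is_rep (@whole G) rho -> is_rep (@whole G) rhok ->
  (forall h, \tr (rho h) = f (T h)) -> (forall h, \tr (rhok h) = psi (T h)) ->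
  vecs (fun i => rhok (g i)) \in unitmx -> vecs (fun i => rho (g i)) \in unitmx.
Proof.
move=> [_ rM] [_ kM] rT kT uk.
pose A : 'M[O]_(d * d) := \matrix_(i, j) T (g i * g j)%g.
have e1 : map_mx f A = gram (fun i => rho (g i)) 1%:M.
  by apply/matrixP=> i j; rewrite !mxE mulmx1 -rM // rT.
have e2 : map_mx psi A = gram (fun i => rhok (g i)) 1%:M.
  by apply/matrixP=> i j; rewrite !mxE mulmx1 -kM // kT.
have := rank_map_le A ker; rewrite e1 e2 gram_rank_eq // mxrank1 => h.
rewrite -row_full_unit /row_full eqn_leq rank_leq_col /=.
exact: leq_trans h (gram_rank_vecs _ _).
Qed.
End Basis.

Section DecHom.
Context (F : fieldType) (w : dval F) (Fbar : algClosure F) (K : completion w)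
  (L : algClosure K) (dec : decomposition Fbar L).

Lemma decM (s t : AbsGal L) : dec (s * t)%g = (dec s * dec t)%g.
Proof. by apply: gal_ext => x; apply: (fmorph_inj (dc_emb dec)); rewrite dc_resE /= !dc_resE. Qed.
Lemma dec1 : dec (1%g : AbsGal L) = 1%g.
Proof. by apply: gal_ext => x; apply: (fmorph_inj (dc_emb dec)); rewrite dc_resE. Qed.
End DecHom.

Section MonoTransfer.
Context (p : nat) (p_prime : prime p) (Zp : padicInt p) (K : fieldType)
  (v : dval K) (L : algClosure K) (W : localWeil Zp v L).
Context (G : groupType) (dec : AbsGal L -> G) (decX : forall s k, dec (s ^+ k)%g = (dec s ^+ k)%g).
Context (O : comNzRingType) (iota : {rmorphism Zp -> O}) (T : G -> O).
Context (E1 E2 : closedFieldType).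
Context (char1 : forall n, n.+1%:R != 0 :> E1) (char2 : forall n, n.+1%:R != 0 :> E2).
Context (f1 : {rmorphism O -> E1}) (f2 : {rmorphism O -> E2}) (f1_inj : injective f1).
Context (d : nat) (r1 : G -> 'M[E1]_d) (r2 : G -> 'M[E2]_d).
Context (h1 : is_rep (@whole G) r1) (h2 : is_rep (@whole G) r2).
Context (t1 : forall g, \tr (r1 g) = f1 (T g)) (t2 : forall g, \tr (r2 g) = f2 (T g)).
Context (nondeg : forall Z : 'M[E2]_d, (forall g, \tr (Z *m r2 g) = 0) -> Z = 0).

(** A relation between values of r2 can be tested by traces against all r2(g), and
    those are values of T. *)
Lemma relation_transfer (P : {poly O}) (o : O) x y :
  f1 o *: r1 y = pmx (r1 x) (map_poly f1 P) -> f2 o *: r2 y = pmx (r2 x) (map_poly f2 P).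
Proof.
move=> e; apply/eqP; rewrite -subr_eq0; apply/eqP/nondeg => g.
pose z := o * T (y * g)%g - \sum_(i < size P) P`_i * T (x ^+ i * g)%g.
have zE (E : closedFieldType) (f : {rmorphism O -> E}) (r : G -> 'M[E]_d) :
    is_rep (@whole G) r -> (forall g, \tr (r g) = f (T g)) ->
    \tr ((f o *: r y - pmx (r x) (map_poly f P)) *m r g) = f z.
  move=> [ra rM] rT; have rX k : r x ^+ k = r (x ^+ k)%g.
    by elim: k => [|k IH]; [rewrite expg0 ra | rewrite expmxS IH expgS rM].
  have -> : pmx (r x) (map_poly f P) = \sum_(i < size P) f P`_i *: r (x ^+ i)%g.
    rewrite -{1}[P]coefK poly_def raddf_sum pmx_sum; apply: eq_bigr => i _.
    by rewrite /= map_polyZ map_polyXn pmxZ pmxXn rX.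
  rewrite mulmxBl -scalemxAl -rM // mulmx_suml raddfB /= mxtraceZ rT.
  rewrite (raddf_sum (@mxtrace _ _)) /z rmorphB rmorphM rmorph_sum; congr (_ - _).
  by apply: eq_bigr => i _; rewrite -scalemxAl -rM //= mxtraceZ rT rmorphM.
rewrite zE // -(rmorph0 f2); congr (f2 _); apply: f1_inj.
by rewrite -(zE _ _ r1) // e subrr mul0mx linear0 rmorph0.
Qed.

Let Ft (D : int) (a : {poly int}) (M : nat) (t : Zp) : {poly O} :=
  \sum_(k < d) (D%:~R ^+ (d - k) * iota t ^+ k * M.+1%:R ^+ (d - k) * (d ^_ (d - k))%:R)
    *: (map_poly intr a) ^+ k.

Lemma pmx_Ft (E : closedFieldType) (char0 : forall n, n.+1%:R != 0 :> E) (f : {rmorphism O -> E})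
    (X N : 'M[E]_d) D a M t :
  pmx X (map_poly intr a) = (D%:~R * M.+1%:R) *: N ->
  pmx X (map_poly f (Ft D a M t)) =
    (D%:~R ^+ d * M.+1%:R ^+ d * d`!%:R) *: mxexp (f (iota t) *: N).
Proof.
move=> e; rewrite /Ft rmorph_sum pmx_sum /mxexp scaler_sumr; apply: eq_bigr => k _.
rewrite /= map_polyZ rmorphXn /= -map_poly_comp.
have -> : map_poly (f \o intr) a = map_poly intr a.
  by apply: eq_map_poly => z /=; rewrite rmorph_int.
rewrite pmxZ pmx_exp e !scale_expmx !scalerA; congr (_ *: _).
have kd : (k <= d)%N by apply: ltnW.
have -> : d`!%:R = (d ^_ (d - k))%:R * k`!%:R :> E.
  by rewrite -natrM -{2}(subKn kd) ffact_fact // leq_subr.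
have kf : k`!%:R != 0 :> E by have := fact_gt0 k; case: (k`!).
rewrite !rmorphM !rmorphXn /= rmorph_int !rmorph_nat exprMn.
have eD (x : E) : x ^+ d = x ^+ (d - k) * x ^+ k by rewrite -exprD subnK.
rewrite (eD D%:~R) (eD M.+1%:R) mulrA; field.
exact: kf.
Qed.

(** The logarithm of r1 at one tame element is N up to an integer factor, and it is
    an integral polynomial in that value. The same polynomial over E2 defines N',
    and the relations it must satisfy are among those that transfer. *)
Lemma mono_transfer N : is_monodromy W (f1 \o iota : {rmorphism Zp -> E1}) (fun s => r1 (dec s)) N ->
  exists N', is_monodromy W (f2 \o iota : {rmorphism Zp -> E2}) (fun s => r2 (dec s)) N'.
Proof.
move=> mono; have [nN _] := mono.
have [l [lS lE]] := mono_list mono.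
have [i [M [Ii il ti]]] := tame_generator W l.
have [D [a [D0 ha]]] := log_poly d.
have D1 (E : closedFieldType) : (forall n, n.+1%:R != 0 :> E) -> D%:~R != 0 :> E.
  move=> ch; case: (D) D0 => [[|n]|n] // _; [exact: ch|].
  by rewrite NegzE rmorphN oppr_eq0; apply: ch.
have xE : r1 (dec i) = mxexp (M.+1%:R *: N).
  by rewrite lE //= ti !rmorph_nat.
have aE : pmx (r1 (dec i)) (map_poly intr a) = (D%:~R * M.+1%:R) *: N.
  by rewrite xE ha ?scalerA //; apply: nilpZ.
pose B := pmx (r2 (dec i)) (map_poly intr a).
pose N' := (D%:~R * M.+1%:R)^-1 *: B.
have c0 : D%:~R * M.+1%:R != 0 :> E2 by rewrite mulf_neq0 ?D1.
have BN : B = (D%:~R * M.+1%:R) *: N' by rewrite scalerA mulfV // scale1r.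
have mapa (E : closedFieldType) (f : {rmorphism O -> E}) :
    map_poly f (map_poly intr a) = map_poly intr a.
  by rewrite -map_poly_comp; apply: eq_map_poly => z /=; rewrite rmorph_int.
exists N'; split.
  apply: nilpZ; exists d; rewrite -pmx_exp.
  have := @relation_transfer ((map_poly intr a) ^+ d) 0 (dec i) 1%g.
  rewrite !rmorph0 !scale0r !rmorphXn /= !mapa => <- //.
  by rewrite pmx_exp aE scale_expmx (nilp_exp nN) ?scaler0.
exists l => g Ig gl /=.
have o0 : D%:~R ^+ d * M.+1%:R ^+ d * d`!%:R != 0 :> E2.
  rewrite !mulf_neq0 ?expf_neq0 ?D1 ?char2 //.
  by have := fact_gt0 d; case: (d`!).
apply: (scalerI o0); rewrite -(@pmx_Ft E2 char2 f2 (r2 (dec i)) N' D a M (lw_t W g)) //.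
have oE (E : closedFieldType) (f : {rmorphism O -> E}) :
  D%:~R ^+ d * M.+1%:R ^+ d * d`!%:R = f (D%:~R ^+ d * M.+1%:R ^+ d * d`!%:R).
  by rewrite !rmorphM !rmorphXn /= rmorph_int !rmorph_nat.
rewrite (oE E2 f2); apply: relation_transfer; rewrite -(oE E1 f1) (@pmx_Ft E1 char1 f1 _ N) //.
by rewrite lE.
Qed.

End MonoTransfer.

(** * Adjoining integral elements compatibly with a specialisation *)

(** Adjoining finitely many elements of S to O, together with a compatible
    specialisation to k: the value of a new element is a common root of the
    specialised relations, and the determinant of a relation evaluated at a
    companion matrix shows that such a root exists. *)
Section Extension.
Context (O : idomainType) (S : comNzRingType) (E : fieldType) (k : closedFieldType).
Context (j0 : {rmorphism O -> S}) (f : {rmorphism S -> E}) (psi : {rmorphism O -> k}).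
Context (p : nat) (psi_p : psi p%:R != 0) (ker : forall z, f (j0 z) = 0 -> psi z = 0).

Definition p_integral (x : S) := exists (P : {poly O}) (e : nat),
  P \is monic /\ root (map_poly j0 P) (p%:R ^+ e * x).

Record extension (xs : seq S) := Extension {
  ex_C : comNzRingType;
  ex_S : {rmorphism ex_C -> S};
  ex_k : {rmorphism ex_C -> k};
  ex_O : {rmorphism O -> ex_C};
  ex_SO : forall z, ex_S (ex_O z) = j0 z;
  ex_kO : forall z, ex_k (ex_O z) = psi z;
  ex_ker : forall z, f (ex_S z) = 0 -> ex_k z = 0;
  ex_im : forall x, x \in xs -> exists z, ex_S z = x }.

(** Among the polynomials over C that vanish at x over E, take one whose image over k
    is nonzero of least degree. Pseudo-division shows that the other images vanish
    at its roots. It has a root: were its image a nonzero constant, its determinant at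
    a companion matrix of x would be nonzero over k although it vanishes over E. *)
Lemma common_root (C : comNzRingType) (c1 : {rmorphism C -> S}) (c2 : {rmorphism C -> k})
    (j : {rmorphism O -> C}) x :
  (forall z, c1 (j z) = j0 z) -> (forall z, c2 (j z) = psi z) ->
  (forall z, f (c1 z) = 0 -> c2 z = 0) -> p_integral x ->
  exists y, forall F : {poly C}, f (map_poly c1 F).[x] = 0 -> (map_poly c2 F).[y] = 0.
Proof.
move=> c1j c2j kerC [P [e [Pm Px]]].
pose I (F : {poly C}) := f (map_poly c1 F).[x] = 0.
have [all0|] := pselect (forall F, I F -> map_poly c2 F = 0).
  by exists 0 => F /all0 ->; rewrite horner0.
move=> /existsNP[F1 /not_implyP[IF1 F1n0]].
pose Sz n := `[< exists F, [/\ I F, map_poly c2 F != 0 & size (map_poly c2 F) = n] >].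
have exS : exists n, Sz n by exists (size (map_poly c2 F1)); apply/asboolP; exists F1; split=> //; apply/eqP.
case: (ex_minnP exS) => n /asboolP[F0 [IF0 F00 sF0]] hmin.
have min F : I F -> (size (map_poly c2 F) < n)%N -> map_poly c2 F = 0.
  move=> IF sF; apply/eqP/negP => /negP Fn0.
  by move: sF; rewrite ltnNge => /negP; apply; apply: hmin; apply/asboolP; exists F.
set F0k := map_poly c2 F0 in F00 sF0.
have n1 : n != 1%N.
  apply/eqP=> n1; rewrite n1 in sF0.
  have /size_poly1P[a a0 aE] : size F0k == 1%N by rewrite sF0.
  pose D := size F0; pose M := map_mx j (companionmx P).
  pose G : {poly C} := \sum_(i < D) (F0`_i * p%:R ^+ (e * (D - i))) *: 'X^i.
  pose z := \det (pmx M G).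
  have c2z : c2 z != 0.
    have coef0 i : c2 F0`_i = if i == 0%N then a else 0.
      by rewrite -coef_map /= -/F0k aE coefC.
    have -> : c2 z = \det ((a * psi p%:R ^+ (e * D))%:M : 'M[k]_((size P).-1)).
      rewrite /z -det_map_mx map_pmx; congr (\det _).
      rewrite /G rmorph_sum /= pmx_sum.
      have D0 : (0 < D)%N.
        rewrite lt0n size_poly_eq0; apply: contraNneq F00 => e0.
        by rewrite /F0k e0 rmorph0.
      rewrite (bigD1 (Ordinal D0)) //= big1 ?addr0 => [|i i0].
        by rewrite map_polyZ map_polyXn pmxZ pmxXn rmorphM rmorphXn /= coef0 subn0 expr0 scalemx1 !rmorph_nat.
      rewrite map_polyZ map_polyXn pmxZ rmorphM /= coef0.
      have -> : (nat_of_ord i == 0)%N = false by apply/negbTE; move: i0; rewrite -val_eqE.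
      by rewrite mul0r scale0r.
    by rewrite det_scalar expf_neq0 // mulf_neq0 // expf_neq0.
  apply/negP: c2z; rewrite negbK; apply/eqP/kerC.
  pose g : {rmorphism C -> E} := (f \o c1 : {rmorphism C -> E}).
  rewrite -[f (c1 z)]/(g z) /z -det_map_mx map_pmx.
  set A := map_mx g M; set l := f (p%:R ^+ e * x).
  have PE : map_poly (f \o j0) P \is monic by apply: monic_map.
  have AE : char_poly A = map_poly (f \o j0) P.
    rewrite /A /M -map_mx_comp -map_char_poly.
    have -> : char_poly (companionmx P) = P by apply: companionmxK.
    by apply: eq_map_poly => o /=; rewrite c1j.
  have : eigenvalue A l.
    rewrite eigenvalue_root_char AE map_poly_comp /l.
    by have /rootP e1 := Px; rewrite /root horner_map e1 rmorph0.
  case/eigenvalueP=> v vA v0; apply/eqP; rewrite -[_ == 0]negbK -unitfE -unitmxE.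
  apply/negP=> uG; move: v0; rewrite -[v](mulmxK uG).
  have -> : v *m pmx A (map_poly g G) = (map_poly g G).[l] *: v.
    rewrite pmxE mulmx_sumr horner_coef scaler_suml; apply: eq_bigr => i _.
    rewrite -scalemxAr -scalerA; congr (_ *: _).
    elim: (nat_of_ord i) => [|m IH]; first by rewrite !expr0 mulmx1 scale1r.
    by rewrite expmxS mulmxA vA -scalemxAl IH scalerA exprS.
  suff -> : (map_poly g G).[l] = 0 by rewrite scale0r mul0mx eqxx.
  have -> : (map_poly g G).[l] = f p%:R ^+ (e * D) * f (map_poly c1 F0).[x].
    rewrite /G rmorph_sum horner_sum (horner_coef_wide _ (_ : size _ <= D)%N); last first.
      exact: size_poly.
    rewrite rmorph_sum mulr_sumr; apply: eq_bigr => i _ /=.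
    rewrite map_polyZ map_polyXn hornerZ hornerXn /l coef_map /= !rmorphM !rmorphXn /=.
    rewrite !rmorph_nat exprMn -exprM.
    have -> : (e * D = e * (D - i) + e * i)%N by rewrite -mulnDr subnK // ltnW.
    by rewrite exprD; ring.
  by rewrite IF0 mulr0.
have [y /rootP y0] : exists y, root F0k y.
  by apply/closed_rootP; rewrite sF0.
exists y => F; move: {2}(size (map_poly c2 F)) (leqnn (size (map_poly c2 F))) => m.
elim: m F => [|m IH] F sF IF.
  by move: sF; rewrite leqn0 size_poly_eq0 => /eqP->; rewrite horner0.
have [lt|ge] := ltnP (size (map_poly c2 F)) n; first by rewrite min ?horner0.
set Fk := map_poly c2 F in sF ge *; set s := size Fk in sF ge.
have n0 : (0 < n)%N by rewrite -sF0 size_poly_gt0.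
pose a := F0`_n.-1; pose b := F`_s.-1.
have c2a : c2 a = lead_coef F0k by rewrite /a -coef_map /= lead_coefE sF0.
have c2b : c2 b = lead_coef Fk by rewrite /b -coef_map /= lead_coefE.
pose H := a *: F - b *: ('X^(s - n) * F0).
have IH' : I H.
  rewrite /I /H rmorphB /= !map_polyZ rmorphM /= map_polyXn !hornerE rmorphB !rmorphM.
  by rewrite [f _.[x]]IF IF0 !mulr0 subrr.
have HE : map_poly c2 H = lead_coef F0k *: Fk - lead_coef Fk *: ('X^(s - n) * F0k).
  by rewrite /H rmorphB /= !map_polyZ rmorphM /= map_polyXn c2a c2b.
have sH : (size (map_poly c2 H) <= m)%N.
  apply/leq_sizeP=> i mi; rewrite HE coefB !coefZ coefXnM.
  have si : (s.-1 <= i)%N by lia.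
  have nis : (i < s - n)%N = false by apply/negbTE; rewrite -leqNgt; lia.
  rewrite nis; have [e1|ne] := eqVneq i s.-1.
    rewrite e1 -lead_coefE.
    have -> : (s.-1 - (s - n) = n.-1)%N by lia.
    by rewrite -sF0 -lead_coefE mulrC subrr.
  rewrite [Fk`_i]nth_default; last by rewrite -/s; lia.
  rewrite [F0k`_ _]nth_default; first by rewrite !mulr0 subrr.
  by rewrite sF0; lia.
have := IH H sH IH'; rewrite HE hornerD hornerN !hornerZ hornerM y0 mulr0 mulr0 subr0 => /eqP.
by rewrite mulf_eq0 lead_coef_eq0 (negPf F00) /= => /eqP.
Qed.

Lemma extension_exists xs : (forall x, x \in xs -> p_integral x) -> inhabited (extension xs).
Proof.
elim: xs => [|x xs IH] hx; first by split; exact: (@Extension [::] O j0 psi idfun).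
have [|[C c1 c2 j c1j c2j kerC imC]] := IH; first by move=> y yx; apply: hx; rewrite inE yx orbT.
have [y hy] := common_root c1j c2j kerC (hx x (mem_head _ _)).
pose d1 : {rmorphism {poly C} -> S} := (horner_eval x \o map_poly c1 : {rmorphism {poly C} -> S}).
pose d2 : {rmorphism {poly C} -> k} := (horner_eval y \o map_poly c2 : {rmorphism {poly C} -> k}).
split; apply: (@Extension _ {poly C} d1 d2 (polyC \o j : {rmorphism O -> {poly C}})).
- by move=> z; apply: etrans (c1j z); rewrite /d1 /= /horner_eval map_polyC hornerC.
- by move=> z; apply: etrans (c2j z); rewrite /d2 /= /horner_eval map_polyC hornerC.
- exact: hy.
- move=> t; rewrite inE => /orP[/eqP->|/imC[z <-]].
    by exists 'X; rewrite /d1 /= /horner_eval map_polyX hornerX.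
  by exists z%:P; rewrite /d1 /= /horner_eval map_polyC hornerC.
Qed.
End Extension.

Section Newton.
Context (F : fieldType).

Lemma deriv_prod_XsubC (r : seq F) (P := \prod_(z <- r) ('X - z%:P)) :
  P^`() = \sum_(z <- r) P %/ ('X - z%:P).
Proof.
rewrite {}/P; elim: r => [|a r IH]; first by rewrite !big_nil derivC.
set Q := \prod_(z <- r) _ in IH *.
have PE : \prod_(z <- a :: r) ('X - z%:P) = ('X - a%:P) * Q by rewrite big_cons.
rewrite PE derivM derivXsubC mul1r IH big_cons mulKp ?polyXsubC_eq0 //.
congr (_ + _); rewrite mulr_sumr [LHS]big_seq [RHS]big_seq.
apply: eq_bigr => z zr; rewrite divp_mulA //.
by rewrite dvdp_XsubCl /Q root_prod_XsubC.
Qed.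

Lemma coef_divp_XsubC (P : {poly F}) z j : root P z ->
  (P %/ ('X - z%:P))`_j = (drop_poly j.+1 P).[z].
Proof.
move=> Pz; pose q := \poly_(i < size P) (drop_poly i.+1 P).[z].
have step i : (drop_poly i P).[z] = P`_i + z * (drop_poly i.+1 P).[z].
  have -> : drop_poly i P = (P`_i)%:P + 'X * drop_poly i.+1 P.
    apply/polyP=> l; rewrite coefD coefC coefXM !coef_drop_poly.
    by case: l => [|l] /=; rewrite ?addr0 ?add0r ?add0n // addSnnS.
  by rewrite !hornerE.
have big i : (size P <= i)%N -> (drop_poly i P).[z] = 0.
  by move=> h; rewrite drop_poly_eq0 // horner0.
have qE i : q`_i = (drop_poly i.+1 P).[z].
  by rewrite coef_poly; case: ltnP => // h; rewrite big // leqW.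
suff PE : P = q * ('X - z%:P) by rewrite -qE {1}PE mulpK ?polyXsubC_eq0.
apply/polyP=> i; rewrite mulrBr coefB coefMX coefMC !qE; case: i => [|i] /=.
  have /rootP := Pz; rewrite -{1}[P]drop_poly0l step => /eqP; rewrite addr_eq0 => /eqP->.
  by rewrite sub0r mulrC.
by rewrite step [z * _]mulrC addrK.
Qed.

(** Newton's identities: over a ring containing the rationals, the power sums
    generate the coefficients. *)
Lemma newton_coef (S : subringClosed F) (r : seq F) :
  (forall m, m.+1%:R^-1 \in S) -> (forall m, m.+1%:R != 0 :> F) ->
  (forall m, \sum_(z <- r) z ^+ m \in S) ->
  \prod_(z <- r) ('X - z%:P) \is a polyOver S.
Proof.
move=> SV ch Sp; set P := \prod_(z <- r) _.
have sP : size P = (size r).+1 by rewrite size_prod_XsubC.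
have key j : (j.+1 <= size r)%N ->
    (size r - j.+1)%:R * P`_j.+1 =
      - \sum_(l < size P) P`_(l.+1 + j.+1) * \sum_(z <- r) z ^+ l.+1.
  move=> jr; have /(congr1 (fun Q : {poly F} => Q`_j)) := deriv_prod_XsubC r.
  rewrite -/P coef_deriv coef_sum.
  rewrite big_seq (eq_bigr (fun z => (drop_poly j.+1 P).[z])); last first.
    by move=> z zr; rewrite coef_divp_XsubC // /P root_prod_XsubC.
  rewrite -big_seq (eq_bigr (fun z => \sum_(l < (size P).+1) P`_(l + j.+1) * z ^+ l)); last first.
    move=> z _; rewrite (@horner_coef_wide _ (size P).+1); last first.
      by rewrite size_drop_poly; lia.
    by apply: eq_bigr => l _; rewrite coef_drop_poly.
  rewrite exchange_big /= big_ord_recl /= add0n.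
  rewrite (eq_bigr (fun=> P`_j.+1)); last by move=> z _; rewrite expr0 mulr1.
  rewrite big_const_seq count_predT iter_addr_0 => e.
  rewrite natrB // mulrBl !mulr_natl e opprD addrA subrr sub0r; congr (- _).
  by apply: eq_bigr => l _; rewrite mulr_sumr.
have h n : forall i, (size r <= i + n)%N -> P`_i \in S.
  elim: n => [|n IH] i hi.
    rewrite addn0 leq_eqVlt in hi; case/orP: hi => [/eqP<-|hi].
      have := monic_prod_XsubC r xpredT id; rewrite monicE lead_coefE -/P sP /= => /eqP->.
      exact: rpred1.
    by rewrite nth_default ?rpred0 // sP.
  case: i hi => [|i] hi; last first.
    have [ir|ir] := leqP (size r) i.+1; first by apply: IH; lia.
    have := key i (ltnW ir); case E : (size r - i.+1)%N => [|m]; first by lia.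
    move=> e; have -> : P`_i.+1 = m.+1%:R^-1 * (m.+1%:R * P`_i.+1) by rewrite mulKf.
    rewrite e; apply: rpredM => //; rewrite rpredN; apply: rpred_sum => l _.
    by apply: rpredM => //; apply: IH; lia.
  have [r0|rn0] := posnP (size r).
    by rewrite /P (size0nil r0) big_nil coefC rpred1.
  have e : (size r)%:R * P`_0 = - \sum_(l < size r) P`_l.+1 * \sum_(z <- r) z ^+ l.+1.
    apply/eqP; rewrite -addr_eq0; apply/eqP.
    have : \sum_(z <- r) P.[z] = 0.
      by rewrite big_seq big1 // => z zr; apply/rootP; rewrite root_prod_XsubC.
    rewrite (eq_bigr (fun z => \sum_(l < (size r).+1) P`_l * z ^+ l)); last first.
      by move=> z _; rewrite horner_coef sP.
    rewrite exchange_big /= big_ord_recl /= => e0; rewrite -[RHS]e0; congr (_ + _).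
      rewrite (eq_bigr (fun=> P`_0)); last by move=> z _; rewrite expr0 mulr1.
      by rewrite big_const_seq count_predT iter_addr_0 mulr_natl.
    by apply: eq_bigr => l _; rewrite mulr_sumr.
  case E : (size r) rn0 => [|m] // _; rewrite E in e.
  have -> : P`_0 = m.+1%:R^-1 * (m.+1%:R * P`_0) by rewrite mulKf.
  rewrite e; apply: rpredM => //; rewrite rpredN; apply: rpred_sum => l _.
  by apply: rpredM => //; apply: IH; lia.
apply/polyOverP => i; apply: (h (size r)); exact: leq_addl.
Qed.
End Newton.

(** * Weil numbers and pure representations *)

Lemma map_expmx (R R' : comNzRingType) (f : {rmorphism R -> R'}) n (A : 'M[R]_n) k :
  map_mx f (A ^+ k) = (map_mx f A) ^+ k.
Proof.
elim: k => [|k IH]; first by rewrite !expr0 map_mx1.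
by rewrite !expmxS map_mxM IH.
Qed.

Section Companion.
Context (F : fieldType).

Lemma eigen_row_unit n (A : 'M[F]_n) a : eigenvalue A a = (A - a%:M \notin unitmx).
Proof.
apply/idP/idP => [/eigenvalueP[v vA v0]|].
  apply: contraNN v0 => uA; rewrite -[v](mulmxK uA) mulmxBr vA mul_mx_scalar subrr mul0mx //.
rewrite /eigenvalue /eigenspace -row_free_unit -kermx_eq0 //.
Qed.

Lemma eigen_exp n (A : 'M[F]_n) a k : eigenvalue A a -> eigenvalue (A ^+ k) (a ^+ k).
Proof.
case/eigenvalueP=> v vA v0; apply/eigenvalueP; exists v => //.
elim: k => [|k IH]; first by rewrite !expr0 mulmx1 scale1r.
by rewrite expmxS mulmxA vA -scalemxAl IH scalerA exprS.
Qed.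
End Companion.

Lemma eigen_exp_inv (F : closedFieldType) n (A : 'M[F]_n) b k :
  eigenvalue (A ^+ k.+1) b -> exists2 a, eigenvalue A a & a ^+ k.+1 = b.
Proof.
rewrite eigen_row_unit => nu.
have [rs rsE] := closed_field_poly_normal ('X^(k.+1) - b%:P : {poly F}).
have mon := monicXnsubC b (ltn0Sn k).
rewrite (monicP mon) scale1r in rsE.
have e : A ^+ k.+1 - b%:M = pmx A (\prod_(z <- rs) ('X - z%:P)).
  by rewrite -rsE pmxB pmxXn pmxC.
have : ~~ all (fun z => A - z%:M \in unitmx) rs.
  apply: contraNN nu => /allP h; rewrite e.
  rewrite big_seq; elim/big_rec: _ => [|z P zr IH]; first by rewrite pmx1 unitmx1.
  by rewrite pmxM unitmx_mul IH pmxXsubC h.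
case/allPn=> z zr nz; exists z; first by rewrite eigen_row_unit.
have : root ('X^(k.+1) - b%:P) z by rewrite rsE root_prod_XsubC.
by rewrite rootE !hornerE subr_eq0 => /eqP.
Qed.

Section WeilNumbers.
Context (E : closedFieldType) (charE : forall n, n.+1%:R != 0 :> E).
Context (q : nat) (q1 : (1 < q)%N).

Lemma ratr_morph : exists2 f : {rmorphism rat -> E}, True & forall x, f x = ratr x.
Proof.
have [f] := rat_morph charE; exists f => // x.
have -> : x = (numq x)%:~R / (denq x)%:~R by rewrite divq_num_den.
rewrite /ratr !rmorphM /= fmorphV !rmorph_int /=.
by rewrite divq_num_den.
Qed.

(** mu is a root of the characteristic polynomials of two rational matrices, hence of
    their greatest common divisor, which is computed over the rationals. *)
Lemma common_eigen n m (A : 'M[rat]_n) (B : 'M[rat]_m) (f : {rmorphism rat -> E}) mu :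
  eigenvalue (map_mx f A) mu -> eigenvalue (map_mx f B) mu ->
  exists z : algC, eigenvalue (map_mx ratr A) z /\ eigenvalue (map_mx ratr B) z.
Proof.
rewrite !eigenvalue_root_char -!map_char_poly => hA hB.
have : ~~ coprimep (char_poly A) (char_poly B).
  apply/negP; rewrite -(coprimep_map f) => /coprimep_root /(_ hA).
  by rewrite (rootP hB) eqxx.
rewrite coprimep_def => sg.
have /closed_rootP[z zg] : size (map_poly (ratr : rat -> algC) (gcdp (char_poly A) (char_poly B))) != 1%N.
  by rewrite size_map_poly.
exists z; rewrite !eigenvalue_root_char -!map_char_poly.
by rewrite -!dvdp_XsubCl in zg *; split; apply: dvdp_trans zg _; rewrite dvdp_map ?dvdp_gcdl ?dvdp_gcdr.
Qed.

Let s : algC := sqrtC q%:R.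
Let s1 : 1 < s.
Proof. by rewrite -[1]sqrtC1 ltr_sqrtC ?qualifE /= ?ler01 ?ler0n // ltr1n. Qed.

Let spow_inj b b' : s ^ b = s ^ b' -> b = b'.
Proof.
wlog le : b b' / b' <= b => [h e|].
  by case/orP: (le_total b' b) => l; [exact: h | exact/esym/h].
have s0 : s != 0 by rewrite gt_eqF // (lt_trans _ s1).
move=> e; have : s ^ (b - b') = 1 by rewrite expfzDr // e -expfzDr // subrr.
case E' : (b - b') => [[|n]|n]; [by move=> _; lia | | by lia].
move=> e1; have : 1 < s ^+ n.+1 by apply: exprn_egt1.
by rewrite -[s ^+ _]/(s ^ n.+1%:Z) e1 ltxx.
Qed.

Lemma weil_comp b (l : E) : weil_number q b l -> exists n (A : 'M[rat]_n),
  (forall f : {rmorphism rat -> E}, (forall x, f x = ratr x) -> eigenvalue (map_mx f A) l) /\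
  forall z : algC, eigenvalue (map_mx ratr A) z -> `|z| = s ^ b.
Proof.
case=> [[P [irrP Pl Pz]] _].
have P0 : P != 0 by apply: irredp_neq0.
pose Q := (lead_coef P)^-1 *: P.
have Qm : Q \is monic by rewrite monicE lead_coefZ mulVf // lead_coef_eq0.
have cK : char_poly (companionmx Q) = Q by apply: companionmxK.
exists (size Q).-1, (companionmx Q); split=> [f fE|z].
  rewrite eigenvalue_root_char -map_char_poly cK map_polyZ rootZ ?fmorph_eq0 ?invr_eq0 ?lead_coef_eq0 //.
  by rewrite (eq_map_poly fE).
rewrite eigenvalue_root_char -map_char_poly cK map_polyZ rootZ ?fmorph_eq0 ?invr_eq0 ?lead_coef_eq0 //.
exact: Pz.
Qed.

(** The two numbers have conjugate powers, so their absolute values agree. *)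
Lemma weil_pow b b' (l l' : E) k : weil_number q b l -> weil_number q b' l' ->
  l ^+ k.+1 = l' ^+ k.+1 -> b = b'.
Proof.
move=> /weil_comp[n [A [hA zA]]] /weil_comp[m [B [hB zB]]] e.
have [f _ fE] := ratr_morph.
have [||z []] := @common_eigen n m (A ^+ k.+1) (B ^+ k.+1) f (l ^+ k.+1).
- by rewrite map_expmx eigen_exp // hA.
- by rewrite map_expmx e eigen_exp // hB.
rewrite !map_expmx => /eigen_exp_inv[x /zA xA <-] /eigen_exp_inv[y /zB yB].
move=> /(congr1 Num.norm); rewrite !normrX xA yB.
by rewrite !exprnP !exprz_exp => /spow_inj h; nia.
Qed.

(** Multiplication by q multiplies all complex absolute values by q. *)
Lemma weil_scale b b' (l l' : E) : weil_number q b l -> weil_number q b' l' ->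
  l = q%:R * l' -> b = b' + 2.
Proof.
move=> /weil_comp[n [A [hA zA]]] /weil_comp[m [B [hB zB]]] e.
have [f _ fE] := ratr_morph.
have [||z [/zA zb]] := @common_eigen n m A (q%:R *: B) f l.
- exact: hA.
- rewrite map_mxZ rmorph_nat e; case/eigenvalueP: (hB f fE) => v vB v0.
  by apply/eigenvalueP; exists v => //; rewrite -scalemxAr vB scalerA.
have q0 : q%:R != 0 :> algC by rewrite pnatr_eq0 -lt0n; apply: ltn_trans q1.
rewrite map_mxZ rmorph_nat => /eigenvalueP[v vB v0].
have /zB : eigenvalue (map_mx ratr B) (z / q%:R).
  apply/eigenvalueP; exists v => //; apply: (scalerI q0).
  by rewrite scalemxAr vB scalerA mulrCA mulfV // mulr1.
rewrite normrM normfV normr_nat zb => /(congr1 ( *%R^~ q%:R)); rewrite mulfVK //.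
have s0 : 0 < s by apply: lt_trans s1.
have -> : q%:R = s ^ 2%:Z :> algC by rewrite -exprnP sqrtCK.
by rewrite -expfzDr ?gt_eqF // => /spow_inj.
Qed.

(** In a pure representation an eigenvector of Frobenius lies in the step of the
    monodromy filtration that its weight prescribes; hence N^k is bijective from
    the part of weight k to the part of weight -k. *)
Section Pure.
Context (d : nat) (S N : 'M[E]_d) (a : int) (M : int -> {vspace 'cV[E]_d}).
Context (sS : ssmx S) (SN : S *m N = q%:R^-1 *: (N *m S)).
Context (filt : monodromy_filtration N M).
Context (pure : forall i l, (exists x, [/\ x \in M i, x \notin M (i - 1) &
                S *m x - l *: x \in M (i - 1)]) -> weil_number q (a + i) l).

(** Take the smallest step of the filtration that contains x, and apply purity to the
    class of x. *)
Lemma eigen_level x l : x != 0 -> S *m x = l *: x ->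
  exists i, [/\ x \in M i, x \notin M (i - 1) & weil_number q (a + i) l].
Proof.
move=> x0 Sx; have [mono [b [Mb Mnb]] _ _ _] := filt.
have sub i (k : nat) y : y \in M i -> y \in M (i + k%:Z).
  elim: k => [|k IH] yi; first by rewrite addr0.
  apply: (subvP (mono _)); have -> : i + k.+1%:Z - 1 = i + k%:Z by lia.
  exact: IH.
pose P n := x \in M (- b%:Z + n%:Z).
have exP : exists n, P n.
  exists (b + b)%N; rewrite /P (_ : - b%:Z + (b + b)%N%:Z = b%:Z) ?Mb ?memvf //; lia.
case: (ex_minnP exP) => n Pn hn; exists (- b%:Z + n%:Z).
have nx : x \notin M (- b%:Z + n%:Z - 1).
  case: n Pn hn => [|n] Pn hn; first by move: Pn; rewrite /P addr0 Mnb memv0 (negPf x0).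
  have -> : - b%:Z + n.+1%:Z - 1 = - b%:Z + n%:Z by lia.
  by apply/negP=> /hn; rewrite ltnn.
split=> //; apply: pure; exists x; split=> //.
by rewrite Sx subrr mem0v.
Qed.

Lemma SNk k : S *m N ^+ k = q%:R^-1 ^+ k *: (N ^+ k *m S).
Proof.
elim: k => [|k IH]; first by rewrite mulmx1 mul1mx scale1r.
rewrite expmxS mulmxA SN -scalemxAl -mulmxA IH -scalemxAr scalerA -exprS.
by rewrite mulmxA.
Qed.

Context (w : E -> int) (w_weil : forall l, eigenvalue S l -> weil_number q (a + w l) l).
Let q0 : q%:R != 0 :> E. Proof. by apply: natc_neq0 => //; apply: ltn_trans q1. Qed.

(** The weight of an eigenvalue is unique, so the step in which an eigenvector
    sits is determined. *)
Lemma level_weight x l : x != 0 -> S *m x = l *: x -> x \in M (w l) /\ x \notin M (w l - 1).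
Proof.
move=> x0 Sx; have [i [xi nxi wi]] := eigen_level x0 Sx.
have : eigenvalue S l.
  by rewrite eigenvalue_root_char; apply: root_eigen Sx.
move=> /w_weil wl; have := @weil_pow _ _ l l 0 wi wl erefl => /addrI <-.
by split.
Qed.

(** Lagrange interpolation on the eigenvalues of S. *)
Lemma eigen_components : exists (rs : seq E) (l : E -> {poly E}), [/\ uniq rs,
   forall x : 'cV_d, x = \sum_(b <- rs) pmx S (l b) *m x &
   forall b (x : 'cV_d), b \in rs -> S *m (pmx S (l b) *m x) = b *: (pmx S (l b) *m x)].
Proof.
have [rs [l [urs l1 l2]]] := ssmx_idem sS; exists rs, l; split=> // [x|b x /l2 e].
  by rewrite -mulmx_suml l1 mul1mx.
by rewrite mulmxA e -scalemxAl.
Qed.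

Lemma pmx_ker k P (x : 'cV_d) : N ^+ k *m x = 0 -> N ^+ k *m (pmx S P *m x) = 0.
Proof.
move=> h; have t : (q%:R ^+ k *: S) *m N ^+ k = N ^+ k *m S.
  by rewrite -scalemxAl SNk scalerA -exprMn mulfV // expr1n scale1r.
by rewrite mulmxA -(pmx_twine _ t) -mulmxA h mulmx0.
Qed.

Lemma pure_inj (k : nat) (e : 'M[E]_d) (x : 'cV_d) : S *m e = e *m S ->
  (forall b (y : 'cV_d), S *m y = b *: y -> w b != k%:Z -> e *m y = 0) ->
  N ^+ k *m (e *m x) = 0 -> e *m x = 0.
Proof.
move=> Se he h; have [rs [l [urs l1 l2]]] := eigen_components.
rewrite [RHS](_ : _ = e *m 0); last by rewrite mulmx0.
rewrite [LHS]l1 mulmx0 big_seq big1 // => b br.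
set y := _ *m _; have [//|y0] := eqVneq y 0.
have Sy : S *m y = b *: y by apply: l2.
have ye : y = e *m (pmx S (l b) *m x).
  by rewrite /y !mulmxA; congr (_ *m _); rewrite (pmx_twine _ Se).
have wb : w b = k%:Z.
  apply/eqP/negPn/negP => wb; move: y0; by rewrite ye (he b _ (l2 b x br) wb) eqxx.
have [yM nyM] := level_weight y0 Sy; rewrite wb in yM nyM.
have [_ _ _ inj _] := filt.
by move: nyM; rewrite inj // pmx_ker ?mem0v.
Qed.

(** Descending induction along the filtration: N^k maps onto each graded piece. *)
Lemma deep_image (k : nat) y : y \in M (- k%:Z) -> exists z, y = N ^+ k *m z.
Proof.
have [_ [b [_ Mnb]] _ _ surj] := filt.
move: {2}(b - k)%N (leqnn (b - k)) => m; elim: m k y => [|m IH] k y h yM.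
  exists 0; rewrite mulmx0; apply/eqP; rewrite -memv0 -Mnb.
  have [mono _ _ _ _] := filt.
  have sub i (n : nat) y' : y' \in M i -> y' \in M (i + n%:Z).
    elim: n => [|n IHn] yi; first by rewrite addr0.
    apply: (subvP (mono _)); have -> : i + n.+1%:Z - 1 = i + n%:Z by lia.
    exact: IHn.
  have -> : - b%:Z = - k%:Z + (k - b)%N%:Z by lia.
  exact: sub.
have [x xM hx] := surj k y yM.
have e1 : - k%:Z - 1 = - k.+1%:Z by lia.
rewrite e1 in hx.
have [|z hz] := IH k.+1 _ _ hx; first by lia.
exists (x + N *m z); rewrite mulmxDr mulmxA -expmxSr -hz addrC subrK //.
Qed.

Lemma weight_N j (x : 'cV_d) l : S *m x = l *: x -> N ^+ j *m x != 0 ->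
  w l = w (q%:R^-1 ^+ j * l) + (j + j)%N%:Z.
Proof.
move=> Sx; elim: j => [|j IH] nz; first by rewrite expr0 mul1r addr0.
have Sj i : S *m (N ^+ i *m x) = (q%:R^-1 ^+ i * l) *: (N ^+ i *m x).
  by rewrite mulmxA SNk -scalemxAl -mulmxA Sx -scalemxAr scalerA.
have nz' : N ^+ j *m x != 0.
  by apply: contraNneq nz => z; rewrite expmxS -mulmxA z mulmx0.
have ev i : N ^+ i *m x != 0 -> eigenvalue S (q%:R^-1 ^+ i * l).
  by move=> h; rewrite eigenvalue_root_char; apply: root_eigen (Sj i).
have e : q%:R^-1 ^+ j * l = q%:R * (q%:R^-1 ^+ j.+1 * l).
  by rewrite exprS !mulrA mulfV // mul1r.
have := weil_scale (w_weil (ev j nz')) (w_weil (ev j.+1 nz)) e.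
by rewrite IH // => h; lia.
Qed.

Lemma pure_surj (k : nat) (e e' : 'M[E]_d) (x : 'cV_d) : S *m e' = e' *m S ->
  (forall b (y : 'cV_d), S *m y = b *: y -> w b != - k%:Z -> e' *m y = 0) ->
  (forall b (y : 'cV_d), S *m y = b *: y -> w b = k%:Z -> e *m y = y) ->
  exists z, e' *m x = N ^+ k *m (e *m z).
Proof.
move=> Se he he'; have [rs [l [urs l1 l2]]] := eigen_components.
suff h b : b \in rs -> exists z, pmx S (l b) *m (e' *m x) = N ^+ k *m (e *m z).
  have : exists z, \sum_(b <- rs) pmx S (l b) *m (e' *m x) = N ^+ k *m (e *m z).
    rewrite big_seq; elim/big_rec: _ => [|b y br [z ->]].
      by exists 0; rewrite !mulmx0.
    by have [z' ->] := h b br; exists (z' + z); rewrite !mulmxDr.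
  by case=> z hz; exists z; rewrite -hz -l1.
move=> br; set y := _ *m _.
have Sy : S *m y = b *: y by apply: l2.
have [y0|y0] := eqVneq y 0; first by exists 0; rewrite y0 !mulmx0.
have ye : y = e' *m (pmx S (l b) *m x).
  by rewrite /y !mulmxA; congr (_ *m _); rewrite (pmx_twine _ Se).
have wb : w b = - k%:Z.
  apply/eqP/negPn/negP => wb; move: y0; by rewrite ye (he b _ (l2 b x br) wb) eqxx.
have [yM _] := level_weight y0 Sy; rewrite wb in yM.
have [z hz] := deep_image yM.
have pb_eig b' (v : 'cV_d) : S *m v = b' *: v -> b' != b -> pmx S (l b) *m v = 0.
  move=> Sv b'b; have h1 := l2 b v br.
  have : S *m (pmx S (l b) *m v) = b' *: (pmx S (l b) *m v).
    by rewrite mulmxA -(pmx_twine (l b) (erefl (S *m S))) -mulmxA Sv -scalemxAr.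
  rewrite h1 => /eqP; rewrite -subr_eq0 -scalerBl scaler_eq0 subr_eq0 eq_sym (negPf b'b) /=.
  by move/eqP.
pose zc c := pmx S (l c) *m z.
have Szc c : c \in rs -> S *m (N ^+ k *m zc c) = (q%:R^-1 ^+ k * c) *: (N ^+ k *m zc c).
  move=> cr; rewrite mulmxA SNk -scalemxAl -mulmxA (l2 c z cr) -scalemxAr scalerA //.
have pby : pmx S (l b) *m y = y.
  rewrite [RHS]l1 (bigD1_seq b) //= big_seq_cond big1 ?addr0 // => c /andP[cr cb].
  have h1 := l2 c y cr.
  have : S *m (pmx S (l c) *m y) = b *: (pmx S (l c) *m y).
    by rewrite mulmxA -(pmx_twine (l c) (erefl (S *m S))) -mulmxA Sy -scalemxAr.
  rewrite h1 => /eqP; rewrite -subr_eq0 -scalerBl scaler_eq0 subr_eq0 (negPf cb) /=.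
  by move/eqP.
pose z'' := \sum_(c <- rs | c == q%:R ^+ k * b) zc c.
have yz : y = N ^+ k *m z''.
  rewrite -pby hz {1}[z]l1 !mulmx_sumr [RHS]big_mkcond [LHS]big_seq [RHS]big_seq.
  apply: eq_bigr => c cr; rewrite -/(zc c).
  have qk : q%:R^-1 ^+ k * q%:R ^+ k = 1 :> E by rewrite -exprMn mulVf // expr1n.
  case: eqP => [ce|/eqP cne]; last first.
    apply: pb_eig (Szc c cr) _; apply: contraNneq cne => <-.
    by rewrite mulrA [_ * q%:R^-1 ^+ k]mulrC qk mul1r.
  have Sv := Szc c cr; rewrite ce mulrA qk mul1r in Sv.
  rewrite [RHS]l1 (bigD1_seq b) //= big_seq_cond [X in _ + X]big1 ?addr0 => [|c' /andP[cr' cb']].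
    by rewrite /zc ce.
  have h1 := l2 c' (N ^+ k *m zc c) cr'.
  have : S *m (pmx S (l c') *m (N ^+ k *m zc c)) = b *: (pmx S (l c') *m (N ^+ k *m zc c)).
    by rewrite mulmxA -(pmx_twine (l c') (erefl (S *m S))) -mulmxA ce Sv -scalemxAr.
  rewrite h1 => /eqP; rewrite -subr_eq0 -scalerBl scaler_eq0 subr_eq0 (negPf cb') /=.
  by move/eqP.
exists z''; rewrite -/y yz; congr (_ *m _); apply/esym.
have Sz : S *m z'' = (q%:R ^+ k * b) *: z''.
  rewrite mulmx_sumr scaler_sumr big_seq_cond [RHS]big_seq_cond.
  by apply: eq_bigr => c /andP[cr /eqP <-]; apply: l2.
apply: (he' _ _ Sz); have := @weight_N k z'' _ Sz; rewrite -yz => /(_ y0).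
have -> : q%:R^-1 ^+ k * (q%:R ^+ k * b) = b.
  by rewrite mulrA -exprMn mulVf // expr1n mul1r.
by rewrite wb => ->; lia.
Qed.
End Pure.
End WeilNumbers.

(** * Idempotents attached to labelled eigenvalues *)

Lemma pmx_comp (R : comNzRingType) n (A : 'M[R]_n) (p h : {poly R}) :
  pmx (pmx A h) p = pmx A (p \Po h).
Proof.
rewrite comp_polyE pmx_sum pmxE; apply: eq_bigr => i _.
by rewrite pmxZ pmx_exp.
Qed.

Section Bezout.
Context (C : comNzRingType) (k : fieldType) (c2 : {rmorphism C -> k}).

(** A substitute for coprimality over C: a Bezout identity whose constant term
    is nonzero over k. *)
Definition separated (P Q : {poly C}) :=
  exists u v R, u * Q + v * P = R%:P /\ c2 R != 0.

Lemma separatedM P Q1 Q2 : separated P Q1 -> separated P Q2 -> separated P (Q1 * Q2).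
Proof.
move=> [u [v [R [e R0]]]] [u' [v' [R' [e' R'0]]]].
exists (u * u'), (v * R'%:P + u * Q1 * v'), (R * R'); split; last by rewrite rmorphM mulf_neq0.
by rewrite polyCM -e -e'; ring.
Qed.

Lemma separated_sym P Q : separated P Q -> separated Q P.
Proof. by move=> [u [v [R [e R0]]]]; exists v, u, R; rewrite addrC. Qed.

Lemma separated1 P : separated P 1.
Proof. by exists 1, 0, 1; split; [rewrite polyC1; ring|rewrite rmorph1 oner_neq0]. Qed.

Lemma separated_prod I (s : seq I) P (F : I -> {poly C}) (p : pred I) :
  (forall i, p i -> separated P (F i)) -> separated P (\prod_(i <- s | p i) F i).
Proof.
move=> h; elim/big_ind: _ => //; [exact: separated1 | exact: separatedM].
Qed.

Lemma separated_exp P Q n : separated P Q -> separated P (Q ^+ n).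
Proof.
by move=> h; elim: n => [|n IH]; [exact: separated1|rewrite exprS; apply: separatedM].
Qed.

Lemma separated_XsubC a b : c2 a != c2 b -> separated ('X - a%:P) ('X - b%:P).
Proof.
move=> ab; exists 1, (-1), (a - b); split; last by rewrite rmorphB subr_eq0.
by rewrite polyCB; ring.
Qed.
End Bezout.

Section Labels.
Context (C : comNzRingType) (k : fieldType) (c2 : {rmorphism C -> k}).
Context (ls : seq (C * int)) (d : nat) (d0 : (0 < d)%N).

(** The exponent d makes the polynomial kill generalised eigenspaces. *)
Definition lab_poly (p : pred int) : {poly C} :=
  (\prod_(x <- ls | p x.2) ('X - x.1%:P)) ^+ d.

Context (sep : forall x y, x \in ls -> y \in ls -> x.2 != y.2 -> c2 x.1 != c2 y.1).

(** Over C, u Q + v P is a constant that does not vanish over k, not 1; dividing by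
    it is possible over each field that maps to k compatibly. *)
Lemma lab_bezout : exists (EE : int -> {poly C}) (RR : int -> C) (u v : int -> {poly C}),
  forall m, [/\ EE m = u m * lab_poly (predC1 m), (RR m)%:P - EE m = v m * lab_poly (pred1 m)
               & c2 (RR m) != 0].
Proof.
suff h m : exists t : {poly C} * C * {poly C} * {poly C},
   [/\ t.1.1.1 = t.1.2 * lab_poly (predC1 m),
       (t.1.1.2)%:P - t.1.1.1 = t.2 * lab_poly (pred1 m) & c2 t.1.1.2 != 0].
  pose t m := sval (cid (h m)).
  exists (fun m => (t m).1.1.1), (fun m => (t m).1.1.2), (fun m => (t m).1.2), (fun m => (t m).2) => m.
  by rewrite /t; case: cid.
have [u [v [R [e R0]]]] : separated c2 (lab_poly (pred1 m)) (lab_poly (predC1 m)).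
  apply/separated_exp; rewrite big_seq_cond; apply: separated_prod => y /andP[yl /= ym].
  apply/separated_sym/separated_exp; rewrite big_seq_cond; apply: separated_prod => x /andP[xl /eqP xm].
  by apply: separated_XsubC; apply: sep => //; rewrite xm.
by exists (u * lab_poly (predC1 m), R, u, v); split=> //=; rewrite -e; ring.
Qed.

Context (EE : int -> {poly C}) (RR : int -> C) (u v : int -> {poly C}).
Context (bez : forall m, [/\ EE m = u m * lab_poly (predC1 m),
   (RR m)%:P - EE m = v m * lab_poly (pred1 m) & c2 (RR m) != 0]).

Section Specialise.
Context (E : closedFieldType) (charE : forall n, n.+1%:R != 0 :> E).
Context (c1 : {rmorphism C -> E}) (ker : forall z, c1 z = 0 -> c2 z = 0).
Context (A : 'M[E]_d) (specA : spec A [seq c1 x.1 | x <- ls]).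
Context (chA : forall z, root (char_poly A) z -> exists2 x, x \in ls & z = c1 x.1).

Definition lab_idem m : 'M[E]_d := (c1 (RR m))^-1 *: pmx A (map_poly c1 (EE m)).
Local Notation e := lab_idem.
Local Notation lp p := (map_poly c1 (lab_poly p)).

Lemma lab_R0 m : c1 (RR m) != 0.
Proof. by case: (bez m) => _ _; apply: contraNneq => /ker->. Qed.

Lemma lab_polyE p : lp p = (\prod_(x <- ls | p x.2) ('X - (c1 x.1)%:P)) ^+ d.
Proof.
rewrite rmorphXn rmorph_prod; congr (_ ^+ _); apply: eq_bigr => x _.
by rewrite rmorphB /= map_polyX map_polyC.
Qed.

Lemma lab_kill m : pmx A (lp (predC1 m) * lp (pred1 m)) = 0.
Proof.
have [r [rE sr]] := char_poly_split A.
apply: (dvdp_pmx0 _ (pmx_char A)); rewrite rE.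
have -> : lp (predC1 m) * lp (pred1 m) = (\prod_(x <- ls) ('X - (c1 x.1)%:P)) ^+ size r.
  rewrite !lab_polyE -exprMn sr; congr (_ ^+ _).
  by rewrite [RHS](bigID (fun x => pred1 m x.2)) /= mulrC.
apply: dvdp_prod_seq => z zr; have [|x xl ->] := chA (z := z).
  by rewrite rE root_prod_XsubC.
by rewrite (big_rem x) //= dvdp_mulr.
Qed.

Lemma lab_eE m : map_poly c1 (EE m) = map_poly c1 (u m) * lp (predC1 m).
Proof. by case: (bez m) => -> _ _; rewrite rmorphM. Qed.
Lemma lab_eE' m : (c1 (RR m))%:P - map_poly c1 (EE m) = map_poly c1 (v m) * lp (pred1 m).
Proof. by case: (bez m) => _ h _; rewrite -rmorphM -h rmorphB /= map_polyC. Qed.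

Lemma lab_idem_kill m : e m *m pmx A (lp (pred1 m)) = 0.
Proof.
by rewrite /e -scalemxAl -pmxM lab_eE -mulrA pmxM lab_kill mulmx0 scaler0.
Qed.

Lemma lab_idemC m : A *m e m = e m *m A.
Proof.
by rewrite /e -scalemxAr -scalemxAl; congr (_ *: _); rewrite -{1}(pmxX A) pmxMC pmxX.
Qed.

Lemma lab_idem_pmxC m P : pmx A P *m e m = e m *m pmx A P.
Proof. by rewrite /e -scalemxAr -scalemxAl pmxMC. Qed.

Lemma lab_idem2 m : e m *m e m = e m.
Proof.
have : e m *m (pmx A ((c1 (RR m))%:P - map_poly c1 (EE m))) = 0.
  by rewrite lab_eE' pmxM pmxMC mulmxA lab_idem_kill mul0mx.
rewrite pmxB pmxC mulmxBr mul_mx_scalar => /eqP; rewrite subr_eq0 => /eqP h.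
by rewrite {2}/e -scalemxAr -h scalerA mulVf ?lab_R0 // scale1r.
Qed.

Lemma lab_idem_orth m n : m != n -> e m *m e n = 0.
Proof.
move=> mn; rewrite {2}/e -scalemxAr lab_eE pmxM pmxMC mulmxA.
suff -> : e m *m pmx A (lp (predC1 n)) = 0 by rewrite mul0mx scaler0.
have /dvdpP[Q ->] : lp (pred1 m) %| lp (predC1 n).
  rewrite !lab_polyE dvdp_exp2r //.
  rewrite [X in _ %| X](bigID (fun x => pred1 m x.2)) /= dvdp_mulr //=.
  rewrite [X in _ %| X](eq_bigl (fun x : C * int => x.2 == m)) // => x /=.
  by case: (x.2 =P m) => [->|]; rewrite ?mn ?andbF.
by rewrite pmxM pmxMC mulmxA lab_idem_kill mul0mx.
Qed.

Definition labels := undup [seq x.2 | x <- ls].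

Lemma lab_idem_out m : m \notin labels -> e m = 0.
Proof.
rewrite mem_undup => ml; have := lab_idem_kill m.
suff -> : lp (pred1 m) = 1 by rewrite pmx1 mulmx1.
rewrite lab_polyE big_seq_cond big_pred0 ?expr1n // => x.
apply/negP=> /andP[xl /eqP xm]; move/negP: ml; apply; rewrite -xm; exact: map_f.
Qed.

Lemma lab_idem_sum (s : seq int) : uniq s -> {subset labels <= s} -> \sum_(m <- s) e m = 1%:M.
Proof.
move=> us ls_s.
have key (t : seq int) : uniq t -> 1%:M - \sum_(m <- t) e m =
     pmx A (\prod_(m <- t) ((c1 (RR m))^-1 *: ((c1 (RR m))%:P - map_poly c1 (EE m)))).
  elim: t => [|m t IH]; first by rewrite !big_nil subr0 pmx1.
  rewrite cons_uniq => /andP[mt ut]; rewrite !big_cons pmxM -IH //.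
  rewrite pmxZ pmxB pmxC scalerBr -/(e m) scale_scalar_mx mulVf ?lab_R0 //.
  have z : \sum_(n <- t) e m *m e n = 0.
    rewrite big_seq big1 // => n nt.
    by apply: lab_idem_orth; apply: contraNneq mt => ->.
  by rewrite mulmxBr mulmx1 mulmxBl mul1mx mulmx_sumr z subr0 opprD addrA.
apply/eqP; rewrite eq_sym -subr_eq0 key //; apply/eqP.
rewrite (eq_bigr (fun m => ((c1 (RR m))^-1 *: map_poly c1 (v m)) * lp (pred1 m))); last first.
  by move=> m _; rewrite lab_eE' scalerAl.
rewrite big_split pmxM; suff -> : pmx A (\prod_(m <- s) lp (pred1 m)) = 0 by rewrite mulmx0.
have [r [rE sr]] := char_poly_split A.
apply: (dvdp_pmx0 _ (pmx_char A)); rewrite rE.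
rewrite (eq_bigr (fun m => (\prod_(x <- ls | pred1 m x.2) ('X - (c1 x.1)%:P)) ^+ d)); last first.
  by move=> m _; rewrite lab_polyE.
rewrite prodrXl -sr; apply: dvdp_prod_seq => z zr; have [|x xl ->] := chA (z := z).
  by rewrite rE root_prod_XsubC.
have xs : x.2 \in s by apply: ls_s; rewrite mem_undup map_f.
by rewrite (big_rem x.2) //= dvdp_mulr // (big_rem x) //= eqxx dvdp_mulr.
Qed.

Lemma lab_idem_tr m : \tr (e m) = (count (fun x => x.2 == m) ls)%:R.
Proof.
have trE P : \tr (pmx A P) = \sum_(x <- ls) P.[c1 x.1].
  have [_ h] := specA; rewrite pmxE raddf_sum /=.
  rewrite (eq_bigr (fun i : 'I_(size P) => \sum_(x <- ls) P`_i * c1 x.1 ^+ i)).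
    by rewrite exchange_big /=; apply: eq_bigr => x _; rewrite horner_coef.
  by move=> i _; rewrite mxtraceZ h big_map mulr_sumr.
rewrite /e mxtraceZ trE mulr_sumr -sum1_count natr_sum [RHS]big_mkcond big_seq [RHS]big_seq.
apply: eq_bigr => x xl; have lp0 (p : pred int) : p x.2 -> (lp p).[c1 x.1] = 0.
  move=> px; rewrite lab_polyE horner_exp (big_rem x) //= px !hornerE subrr mul0r.
  by rewrite expr0n gtn_eqF.
case: eqP => [xm|/eqP xm].
  have := congr1 (fun P : {poly E} => P.[c1 x.1]) (lab_eE' m).
  rewrite !hornerE lp0 ?mulr0 => [/eqP|]; last by rewrite /= xm.
  by rewrite subr_eq0 => /eqP <-; rewrite mulVf ?lab_R0.
by rewrite lab_eE hornerM lp0 ?mulr0 //.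
Qed.


(** Y intertwines g(A) and h(A), and these have disjoint spectra between the parts
    of label m and n. *)
Lemma lab_sylvester m n (g h : {poly E}) (Y : 'M[E]_d) :
  pmx A g *m Y = Y *m pmx A h ->
  (forall x y, x \in ls -> y \in ls -> x.2 = m -> y.2 = n -> g.[c1 x.1] != h.[c1 y.1]) ->
  e m *m Y *m e n = 0.
Proof.
move=> tY ne; pose pp (f : {poly E}) m : {poly E} :=
   (\prod_(x <- ls | x.2 == m) ('X - (f.[c1 x.1])%:P)) ^+ d.
have kill f l : e l *m pmx (pmx A f) (pp f l) = 0.
  rewrite pmx_comp; suff /dvdpP[Q ->] : lp (pred1 l) %| pp f l \Po f.
    by rewrite pmxM pmxMC mulmxA lab_idem_kill mul0mx.
  rewrite lab_polyE /pp rmorphXn /= dvdp_exp2r // rmorph_prod /=.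
  elim: (ls) => [|x s IH]; first by rewrite !big_nil.
  rewrite !big_cons /=; case: ifP => // _; apply: dvdp_mul => //.
  by rewrite comp_polyB comp_polyX comp_polyC dvdp_XsubCl rootE !hornerE subrr.
apply: (@sylvester0 _ _ _ (pmx A g) (pmx A h) _ (pp h n) (pp g m)).
- rewrite -[RHS]mulmxA -lab_idem_pmxC !mulmxA lab_idem_pmxC.
  by rewrite -[e m *m _ *m Y]mulmxA tY mulmxA.
- by rewrite -[LHS]mulmxA kill mulmx0.
- rewrite !mulmxA; suff -> : pmx (pmx A g) (pp g m) *m e m = e m *m pmx (pmx A g) (pp g m).
    by rewrite kill !mul0mx.
  by rewrite pmx_comp lab_idem_pmxC.
rewrite coprimep_expl // coprimep_expr //.
rewrite big_seq_cond; elim/big_ind: _ => [|P Q hP hQ|x /andP[xl /eqP xn]].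
- exact: coprime1p.
- by rewrite coprimepMl hP hQ.
rewrite big_seq_cond; elim/big_ind: _ => [|P Q hP hQ|y /andP[yl /eqP ym]].
- exact: coprimep1.
- by rewrite coprimepMr hP hQ.
by rewrite coprimep_XsubC root_XsubC ne.
Qed.

(** Powers of eigenvalues with different labels differ, so Y cannot mix labels. *)
Lemma lab_comm (s : seq int) l (Y : 'M[E]_d) m : uniq s -> {subset labels <= s} ->
  (forall x y, x \in ls -> y \in ls -> x.2 != y.2 -> c2 x.1 ^+ l != c2 y.1 ^+ l) ->
  A ^+ l *m Y = Y *m A ^+ l -> e m *m Y = Y *m e m.
Proof.
move=> us sl sepl tY; have z a b : a != b -> e a *m Y *m e b = 0.
  move=> ab; apply: (@lab_sylvester _ _ 'X^l 'X^l); first by rewrite pmxXn.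
  move=> x y xl yl xa yb; rewrite !hornerXn -!rmorphXn -subr_eq0 -rmorphB.
  have := sepl x y xl yl (_ : x.2 != y.2); rewrite xa yb => /(_ ab).
  rewrite -!rmorphXn -subr_eq0 -rmorphB; apply: contraNneq => /ker -> //.
have [ml|ml] := boolP (m \in s); last first.
  have : m \notin labels by apply: contraNN ml; apply: sl.
  by move=> /lab_idem_out->; rewrite mul0mx mulmx0.
have S1 := lab_idem_sum us sl.
rewrite -[LHS]mulmx1 -S1 mulmx_sumr (bigD1_seq m) //= big1 ?addr0 => [|b bm]; last first.
  by rewrite z // eq_sym.
rewrite -[Y in RHS]mul1mx -S1 !mulmx_suml (bigD1_seq m) //= [X in _ + X]big1 ?addr0 //.
by move=> b bm; rewrite z.
Qed.

(** N multiplies eigenvalues by a, which raises the label by 2. *)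
Lemma lab_shift (s : seq int) a (N : 'M[E]_d) m : uniq s -> {subset labels <= s} ->
  (forall x y, x \in ls -> y \in ls -> c2 a * c2 x.1 = c2 y.1 -> y.2 = x.2 + 2) ->
  c1 a *: (A *m N) = N *m A -> e m *m N = N *m e (m + 2).
Proof.
move=> us sl sepl tN; have z i j : j != i + 2 -> e i *m N *m e j = 0.
  move=> ij; apply: (@lab_sylvester _ _ (c1 a *: 'X) 'X).
    by rewrite pmxZ pmxX -scalemxAl tN.
  move=> x y xl yl xa yb; rewrite !hornerE; apply: contraNneq ij => h.
  rewrite -xa -yb; apply/eqP/(sepl x y xl yl)/eqP.
  rewrite -rmorphM -subr_eq0 -rmorphB; apply/eqP/ker.
  by rewrite rmorphB rmorphM h subrr.
have out b : b \notin s -> e b = 0.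
  by move=> bs; apply: lab_idem_out; apply: contraNN bs; apply: sl.
have S1 := lab_idem_sum us sl.
transitivity (e m *m N *m e (m + 2)).
  rewrite -[LHS]mulmx1 -S1 mulmx_sumr; have [ml|ml] := boolP (m + 2 \in s).
    by rewrite (bigD1_seq (m + 2)) //= big1 ?addr0 // => b bm; rewrite z.
  rewrite [e (m + 2)]out // mulmx0 big_seq big1 // => b bs; rewrite z //.
  by apply: contraNneq ml => <-.
rewrite -[N in RHS]mul1mx -S1 !mulmx_suml; have [ml|ml] := boolP (m \in s).
  rewrite (bigD1_seq m) //= [X in _ = _ + X]big1 ?addr0 // => b bm; rewrite z //.
  by apply: contraNneq bm => /addIr->.
rewrite [e m]out // !mul0mx big_seq big1 // => b bs; rewrite z //.
by apply: contraNneq ml => /addIr->.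
Qed.

End Specialise.
End Labels.

(** * Comparison of ranks through traces *)

Section Linked.
Context (G : groupType) (C : comNzRingType) (E k : fieldType).
Context (c1 : {rmorphism C -> E}) (c2 : {rmorphism C -> k}).
Context (d : nat) (d0 : (0 < d)%N) (rho : G -> 'M[E]_d) (rhok : G -> 'M[k]_d).
Context (hr : is_rep (@whole G) rho) (hk : is_rep (@whole G) rhok).

(** X and Y are the values of one element of the group algebra C[G]. *)
Definition linked (X : 'M[E]_d) (Y : 'M[k]_d) := exists L : seq (C * G),
  X = \sum_(x <- L) c1 x.1 *: rho x.2 /\ Y = \sum_(x <- L) c2 x.1 *: rhok x.2.

Lemma linked_rep a g : linked (c1 a *: rho g) (c2 a *: rhok g).
Proof. by exists [:: (a, g)]; rewrite !big_seq1. Qed.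

Lemma linkedD X Y X' Y' : linked X Y -> linked X' Y' -> linked (X + X') (Y + Y').
Proof. by move=> [L [-> ->]] [L' [-> ->]]; exists (L ++ L'); rewrite !big_cat. Qed.

Lemma linked0 : linked 0 0.
Proof. by exists [::]; rewrite !big_nil. Qed.

Lemma linkedM X Y X' Y' : linked X Y -> linked X' Y' -> linked (X *m X') (Y *m Y').
Proof.
move=> [L [-> ->]] [L' [-> ->]].
exists [seq ((x.1 * y.1)%R, (x.2 * y.2)%g) | x <- L, y <- L'].
have h (F : fieldType) (c : {rmorphism C -> F}) (r : G -> 'M[F]_d) : is_rep (@whole G) r ->
   (\sum_(x <- L) c x.1 *: r x.2) *m (\sum_(x <- L') c x.1 *: r x.2) =
   \sum_(x <- [seq ((x.1 * y.1)%R, (x.2 * y.2)%g) | x <- L, y <- L']) c x.1 *: r x.2.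
  move=> [_ rM]; rewrite big_allpairs_dep mulmx_suml; apply: eq_bigr => x _.
  rewrite mulmx_sumr; apply: eq_bigr => y _ /=.
  by rewrite rmorphM rM // -scalemxAl -scalemxAr scalerA.
by split; apply: h.
Qed.

Lemma linked1 : linked 1%:M 1%:M.
Proof.
have := linked_rep 1 1%g; rewrite !rmorph1 !scale1r.
by case: hr => -> _; case: hk => -> _.
Qed.

Lemma linkedX X Y n : linked X Y -> linked (X ^+ n) (Y ^+ n).
Proof.
by move=> h; elim: n => [|n IH]; [exact: linked1|rewrite !expmxS; apply: linkedM].
Qed.

Lemma linkedZ a X Y : linked X Y -> linked (c1 a *: X) (c2 a *: Y).
Proof.
move=> h; have := linkedM (linked_rep a 1%g) h.
by rewrite -!scalemxAl; case: hr => -> _; case: hk => -> _; rewrite !mul1mx.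
Qed.

Lemma linked_pmx X Y (P : {poly C}) : linked X Y ->
  linked (pmx X (map_poly c1 P)) (pmx Y (map_poly c2 P)).
Proof.
move=> h; rewrite -[P]coefK poly_def !rmorph_sum !pmx_sum.
elim/big_rec2: _ => [|i A B _ IH]; first exact: linked0.
apply: linkedD => //; rewrite /= !map_polyZ !map_polyXn !pmxZ !pmxXn.
exact/linkedZ/linkedX.
Qed.

Context (ker : forall z, c1 z = 0 -> c2 z = 0) (T : G -> C).
Context (tr1 : forall g, \tr (rho g) = c1 (T g)) (tr2 : forall g, \tr (rhok g) = c2 (T g)).
Context (g : 'I_(d * d) -> G) (ug : vecs (fun i => rhok (g i)) \in unitmx).

(** The rank of X is, up to the factor d, the rank of a matrix of traces over C,
    and nonzero minors over k come from nonzero minors over E. *)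
Lemma linked_rank X Y : linked X Y -> (\rank Y <= \rank X)%N.
Proof.
move=> [L [XE YE]].
pose A : 'M[C]_(d * d) := \matrix_(i, j) \sum_(x <- L) x.1 * T (g i * x.2 * g j)%g.
have h (F : fieldType) (c : {rmorphism C -> F}) (r : G -> 'M[F]_d) Z :
   is_rep (@whole G) r -> (forall g, \tr (r g) = c (T g)) ->
   Z = \sum_(x <- L) c x.1 *: r x.2 -> map_mx c A = gram (fun i => r (g i)) Z.
  move=> [_ rM] rT ->; apply/matrixP=> i j; rewrite !mxE rmorph_sum.
  rewrite mulmx_sumr mulmx_suml raddf_sum; apply: eq_bigr => x _.
  by rewrite -scalemxAr -scalemxAl /= mxtraceZ rmorphM -rT !rM.
have := rank_map_le A ker; rewrite (h _ _ _ _ hr tr1 XE) (h _ _ _ _ hk tr2 YE) gram_rank_eq //.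
by move=> /leq_trans /(_ (gram_rank_le _ _)); rewrite leq_pmul2r.
Qed.
End Linked.

(** * Hard Lefschetz gradings and their primitive parts *)

(** A grading by weights, through the projections e m. The range of weights is not
    part of the data, so that gradings with different ranges can be compared. *)
Record graded (F : closedFieldType) (G : groupType) (w : wgroup G) (chi : G -> F)
  (d : nat) (r : G -> 'M[F]_d) (N : 'M[F]_d) (e : int -> 'M[F]_d) : Prop := Graded {
  gr_tw : forall m, twine w r r (e m);
  gr_idem : forall m, e m *m e m = e m;
  gr_orth : forall m n, m != n -> e m *m e n = 0;
  gr_shift : forall m, e m *m N = N *m e (m + 2);
  gr_sum : exists s0 : seq int, (forall m, m \notin s0 -> e m = 0) /\
     forall s, uniq s -> {subset s0 <= s} -> \sum_(m <- s) e m = 1%:M;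
  gr_rN : forall g, wH w g -> r g *m N = chi g *: (N *m r g) }.

(** The hard Lefschetz property, with the inverse J of N^k as a matrix. *)
Record lefschetz (F : closedFieldType) (G : groupType) (w : wgroup G) (chi : G -> F)
  (d : nat) (r : G -> 'M[F]_d) (N : 'M[F]_d) (e : int -> 'M[F]_d) : Prop := Lefschetz {
  lf_gr : graded w chi r N e;
  lf_J : forall k : nat, exists J : 'M[F]_d, [/\ J *m (N ^+ k *m e k%:Z) = e k%:Z,
     (N ^+ k *m e k%:Z) *m J = e (- k%:Z) & J = e k%:Z *m J *m e (- k%:Z)] }.

Section GradedBlocks.
Context (F : closedFieldType) (G : groupType) (w : wgroup G) (chi : G -> F).
Context (d : nat) (r : G -> 'M[F]_d) (N : 'M[F]_d) (e : int -> 'M[F]_d).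
Context (gr : graded w chi r N e).

Lemma graded_shiftX m k : e m *m N ^+ k = N ^+ k *m e (m + (k + k)%N%:Z).
Proof.
elim: k => [|k IH]; first by rewrite expr0 mul1mx mulmx1 addr0.
rewrite expmxSr mulmxA IH -mulmxA (gr_shift gr) mulmxA; congr (_ *m e _); lia.
Qed.

(** Only the coefficient of index k shifts the weight by 2k. *)
Lemma graded_block m (k : nat) (f : {poly F}) :
  e m *m pmx N f *m e (m + (k + k)%N%:Z) = f`_k *: (N ^+ k *m e (m + (k + k)%N%:Z)).
Proof.
set n := m + _; have h i : i != k -> e m *m (f`_i *: N ^+ i) *m e n = 0.
  move=> ik; rewrite -scalemxAr -scalemxAl graded_shiftX -mulmxA (gr_orth gr) ?mulmx0 ?scaler0 //.
  by apply: contraNneq ik => /addrI; lia.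
rewrite pmxE mulmx_sumr mulmx_suml; have [kf|fk] := ltnP k (size f).
  rewrite (bigD1 (Ordinal kf)) //= big1 ?addr0 => [|i ik]; last exact: h.
  by rewrite -scalemxAr -scalemxAl graded_shiftX -/n -mulmxA (gr_idem gr).
rewrite nth_default // scale0r big1 // => i _; apply: h.
by apply: contraTneq (ltn_ord i) => ->; rewrite -leqNgt.
Qed.

Lemma graded_block0 m (f : {poly F}) : e m *m pmx N f *m e m = f`_0 *: e m.
Proof. by have := graded_block m 0 f; rewrite addr0 mul1mx. Qed.
End GradedBlocks.

Section Lefschetz.
Context (F : closedFieldType) (charF : forall n, n.+1%:R != 0 :> F).
Context (G : groupType) (w : wgroup G) (chi : G -> F) (chi0 : forall g, wH w g -> chi g != 0).
Context (d : nat) (r : G -> 'M[F]_d) (N : 'M[F]_d).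

Section One.
Context (e : int -> 'M[F]_d) (lf : lefschetz w chi r N e).
Let gr := lf_gr lf.

Let gr_shiftX := graded_shiftX gr.

Lemma gr_rNX g k : wH w g -> r g *m N ^+ k = chi g ^+ k *: (N ^+ k *m r g).
Proof.
move=> Hg; elim: k => [|k IH]; first by rewrite expr0 mul1mx mulmx1 scale1r.
rewrite expmxS mulmxA (gr_rN gr Hg) -scalemxAl -mulmxA IH -scalemxAr scalerA -exprS.
by rewrite mulmxA.
Qed.

Definition lf_inv k : 'M[F]_d := sval (cid (lf_J lf k)).
Let J := lf_inv.
Lemma lf_inv1 k : J k *m (N ^+ k *m e k%:Z) = e k%:Z.
Proof. by rewrite /J /lf_inv; case: cid => j []. Qed.
Lemma lf_inv2 k : (N ^+ k *m e k%:Z) *m J k = e (- k%:Z).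
Proof. by rewrite /J /lf_inv; case: cid => j []. Qed.
Lemma lf_inv3 k : J k = e k%:Z *m J k *m e (- k%:Z).
Proof. by rewrite /J /lf_inv; case: cid => j []. Qed.
Lemma lf_inv_l k : e k%:Z *m J k = J k.
Proof. by rewrite lf_inv3 !mulmxA (gr_idem gr). Qed.
Lemma lf_inv_r k : J k *m e (- k%:Z) = J k.
Proof. by rewrite lf_inv3 -mulmxA (gr_idem gr). Qed.
Lemma lf_inv2' k : N ^+ k *m J k = e (- k%:Z).
Proof. by rewrite -lf_inv2 -mulmxA lf_inv_l. Qed.

Lemma lf_inv1' k : J k *m N ^+ k = e k%:Z.
Proof.
rewrite -lf_inv_r -mulmxA gr_shiftX (_ : - k%:Z + (k + k)%N%:Z = k%:Z) ?lf_inv1 //; lia.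
Qed.

Lemma lf_inv_tw k g : wH w g -> J k *m r g = chi g ^+ k *: (r g *m J k).
Proof.
move=> Hg; rewrite -[J k in LHS]lf_inv_r -mulmxA -(gr_tw gr _ Hg).
rewrite -{1}lf_inv2 !mulmxA -[J k *m r g *m _]mulmxA (gr_rNX _ Hg).
rewrite -scalemxAr -!scalemxAl; congr (_ *: _).
by rewrite -!mulmxA [r g *m (_ *m _)]mulmxA (gr_tw gr _ Hg) !mulmxA -[J k *m _ *m _]mulmxA lf_inv1 -(gr_tw gr _ Hg) -mulmxA lf_inv_l.
Qed.

(* The non-primitive part of weight k. *)
Let psi (k : nat) := N *m J k.+2 *m N ^+ k.+1 *m e k%:Z.
Definition primitive (k : nat) : 'M[F]_d := e k%:Z - psi k.
Local Notation pi := primitive.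

Lemma e_psi k : e k%:Z *m psi k = psi k.
Proof.
rewrite /psi !mulmxA (gr_shift gr) -[N *m e _ *m _]mulmxA.
have -> : k%:Z + 2 = k.+2%:Z by lia.
by rewrite lf_inv_l.
Qed.
Lemma psi_e k : psi k *m e k%:Z = psi k.
Proof. by rewrite /psi -mulmxA (gr_idem gr). Qed.
Lemma psi2 k : psi k *m psi k = psi k.
Proof.
rewrite -{2}e_psi e_psi {1}/psi -mulmxA e_psi /psi !mulmxA -[_ *m N ^+ k.+1 *m N]mulmxA -expmxSr.
rewrite -[_ *m N ^+ k.+2 *m _]mulmxA lf_inv2' -[N *m _ *m e _]mulmxA lf_inv_r //.
Qed.

Lemma prim_idem k : pi k *m pi k = pi k.
Proof.
by rewrite /pi mulmxBl !mulmxBr (gr_idem gr) e_psi psi_e psi2 subrr subr0.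
Qed.
Lemma prim_e k : pi k *m e k%:Z = pi k.
Proof. by rewrite /pi mulmxBl (gr_idem gr) psi_e. Qed.

Lemma prim_nil k : N ^+ k.+1 *m pi k = 0.
Proof.
rewrite /pi mulmxBr /psi !mulmxA -expmxSr lf_inv2'.
by rewrite gr_shiftX -mulmxA (_ : - k.+2%:Z + (k.+1 + k.+1)%N%:Z = k%:Z) ?(gr_idem gr) ?subrr //; lia.
Qed.

Lemma prim_N k : pi k *m N = 0.
Proof.
have kk : k%:Z + 2 = k.+2%:Z by lia.
rewrite /pi mulmxBl /psi.
have -> : N *m J k.+2 *m N ^+ k.+1 *m e k%:Z *m N = N *m J k.+2 *m (N ^+ k.+2 *m e k.+2%:Z).
  by rewrite -[LHS]mulmxA (gr_shift gr) kk mulmxA -[_ *m N ^+ _ *m N]mulmxA -expmxSr -mulmxA.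
by rewrite (gr_shift gr) kk -[N *m J _ *m _]mulmxA lf_inv1 subrr.
Qed.

Lemma prim_tw k : twine w r r (pi k).
Proof.
move=> g Hg; rewrite /pi mulmxBr mulmxBl (gr_tw gr _ Hg); congr (_ - _).
have c0 := chi0 Hg; rewrite /psi.
rewrite -[RHS]mulmxA -(gr_tw gr _ Hg) !mulmxA (gr_rN gr Hg) -!scalemxAl.
have -> : N *m r g *m J k.+2 = (chi g ^+ k.+2)^-1 *: (N *m J k.+2 *m r g).
  rewrite -[in RHS]mulmxA lf_inv_tw // -scalemxAr scalerA mulVf ?expf_neq0 //.
  by rewrite scale1r mulmxA.
rewrite -!scalemxAl scalerA -[_ *m r g *m N ^+ _]mulmxA gr_rNX // -scalemxAr -scalemxAl.
rewrite scalerA [chi g ^+ k.+2]exprS !mulmxA.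
have -> : chi g / (chi g * chi g ^+ k.+1) * chi g ^+ k.+1 = 1.
  by field; rewrite c0 expf_neq0.
by rewrite scale1r.
Qed.

(** Up to the twist by chi, the complement psi is conjugate to e (k + 2) by N and
    its partial inverse. *)
Lemma prim_tr k g : wH w g ->
  \tr (r g *m pi k) = \tr (r g *m e k%:Z) - chi g * \tr (r g *m e k.+2%:Z).
Proof.
move=> Hg; rewrite /pi mulmxBr raddfB /=; congr (_ - _).
rewrite /psi !mulmxA mxtrace_mulC !mulmxA.
have -> : e k%:Z *m r g *m N = chi g *: (N *m (r g *m e k.+2%:Z)).
  rewrite -(gr_tw gr _ Hg) -mulmxA (gr_shift gr) mulmxA (gr_rN gr Hg).
  by rewrite -scalemxAl -mulmxA (_ : k%:Z + 2 = k.+2%:Z) //; lia.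
rewrite -!scalemxAl mxtraceZ; congr (_ * _).
rewrite -!mulmxA mxtrace_mulC !mulmxA -[_ *m _ *m N]mulmxA -expmxSr -[_ *m J _ *m _]mulmxA.
by rewrite lf_inv1' -mulmxA (gr_idem gr).
Qed.

(** One step of the Lefschetz decomposition. *)
Lemma prim_split m : (exists k, m = k%:Z /\ exists Z, e m = pi k + N *m Z) \/
   (exists Z, e m = N *m Z).
Proof.
case: m => k.
  left; exists k; split=> //; exists (J k.+2 *m N ^+ k.+1 *m e k%:Z).
  by rewrite !mulmxA -/(psi k) /pi subrK.
right; exists (N ^+ k *m J k.+1); rewrite mulmxA -expmxS lf_inv2' NegzE //.
Qed.

Lemma lf_inj (m : nat) k X : (k.+1 <= m)%N -> N ^+ k.+1 *m X = 0 -> e m%:Z *m X = 0 :> 'M_d.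
Proof.
move=> km h; rewrite -lf_inv1 -!mulmxA [N ^+ m *m _]mulmxA.
have -> : N ^+ m *m e m%:Z = e (- m%:Z) *m N ^+ m.
  by rewrite gr_shiftX; congr (_ *m e _); lia.
rewrite -mulmxA -(subnK km) [N ^+ (_ + _)]exprD -[_ * _ *m X]mulmxA.
by rewrite h !mulmx0.
Qed.
End One.

(** The primitive parts for two gradings of the same representation are
    conjugate, since both map isomorphically to the subquotient
    ker N^(k+1) / (ker N^k + im N). *)
Lemma prim_absorb e1 e2 (l1 : lefschetz w chi r N e1) (l2 : lefschetz w chi r N e2) k :
  primitive l1 k *m primitive l2 k *m primitive l1 k = primitive l1 k.
Proof.
set p1 := primitive l1 k; set p2 := primitive l2 k.
have p1k (Z : 'M[F]_d) : N ^+ k *m Z = 0 -> p1 *m Z = 0.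
  case: k @p1 @p2 => [|k] p1 p2 h; first by move: h; rewrite mul1mx => ->; rewrite mulmx0.
  by rewrite /p1 -prim_e -mulmxA (lf_inj l1 (leqnn _) h) mulmx0.
have N1 Z : p1 *m (N *m Z) = 0 by rewrite mulmxA prim_N mul0mx.
have key (X : 'M[F]_d) m : N ^+ k.+1 *m X = 0 -> m != k%:Z -> p1 *m (e2 m *m X) = 0.
  move=> h mk; have [[j [mj [Z eZ]]]|[Z eZ]] := prim_split l2 m; last first.
    by rewrite eZ -mulmxA N1.
  have [kj|jk] := leqP k.+1 j; first by rewrite mj (lf_inj l2 kj h) mulmx0.
  have jk' : (j < k)%N by rewrite ltn_neqAle -ltnS jk andbT; apply: contraNneq mk => <-; rewrite mj.
  rewrite eZ [_ *m X]mulmxDl [LHS]mulmxDr -[N *m _ *m _]mulmxA N1 addr0; apply: p1k.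
  by rewrite -(subnK jk') exprD -mulmxA [X in _ *m X]mulmxA prim_nil mul0mx mulmx0.
have h1 : N ^+ k.+1 *m p1 = 0 by apply: prim_nil.
have [s0 [out sum]] := gr_sum (lf_gr l2).
pose s := undup (k%:Z :: s0).
have us : uniq s by apply: undup_uniq.
have ks : k%:Z \in s by rewrite mem_undup mem_head.
have S1 : \sum_(m <- s) e2 m = 1%:M.
  by apply: sum => // m ms; rewrite mem_undup inE ms orbT.
have p1E : p1 = \sum_(m <- s) p1 *m (e2 m *m p1).
  by rewrite -mulmx_sumr -mulmx_suml S1 mul1mx /p1 prim_idem.
rewrite [RHS]p1E (bigD1_seq (k%:Z)) //= [X in _ = _ + X]big1 ?addr0; last by move=> m mk; apply: key.
have -> : e2 k%:Z = p2 + N *m (lf_inv l2 k.+2 *m N ^+ k.+1 *m e2 k%:Z).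
  by rewrite !mulmxA /p2 /primitive subrK.
by rewrite [(p2 + _) *m p1]mulmxDl [RHS]mulmxDr -[N *m _ *m p1]mulmxA N1 addr0 mulmxA.
Qed.

Lemma prim_unique e1 e2 (l1 : lefschetz w chi r N e1) (l2 : lefschetz w chi r N e2) k g :
  wH w g -> \tr (r g *m primitive l1 k) = \tr (r g *m primitive l2 k).
Proof.
move=> Hg; have t1 := prim_tw l1 k Hg; have t2 := prim_tw l2 k Hg.
rewrite -(prim_absorb l1 l2) -[in RHS](prim_absorb l2 l1).
move: t1 t2; set p1 := primitive l1 k; set p2 := primitive l2 k => t1 t2.
have i1 : p1 *m p1 = p1 by apply: prim_idem.
have i2 : p2 *m p2 = p2 by apply: prim_idem.
have -> : \tr (r g *m (p1 *m p2 *m p1)) = \tr (r g *m p1 *m p2).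
  by rewrite !mulmxA mxtrace_mulC !mulmxA -t1 -[r g *m p1 *m p1]mulmxA i1.
have -> : \tr (r g *m (p2 *m p1 *m p2)) = \tr (r g *m p2 *m p1).
  by rewrite !mulmxA mxtrace_mulC !mulmxA -t2 -[r g *m p2 *m p2]mulmxA i2.
by rewrite t1 -mulmxA mxtrace_mulC.
Qed.
End Lefschetz.

(** * Sums of special representations *)

Section MxDiag.
Context (R : comNzRingType) (m : nat) (p : 'I_m -> nat).
Implicit Types A B : forall i, 'M[R]_(p i).

Lemma mxdiagM A B : (\mxdiag_i A i) *m (\mxdiag_i B i) = \mxdiag_i (A i *m B i).
Proof.
rewrite [X in _ *m X]/mxdiag mul_mxdiag_mxblock; apply: eq_mxblock => i j.
by case: (i =P j) => [ij|_]; rewrite ?mulmx0 //; case: _ / ij; rewrite !conform_mx_id.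
Qed.

Lemma mxdiag1 : \mxdiag_i (1%:M : 'M[R]_(p i)) = 1%:M.
Proof. exact: mxdiagZ. Qed.

Lemma mxdiagX A k : (\mxdiag_i A i) ^+ k = \mxdiag_i (A i ^+ k).
Proof.
elim: k => [|k IH]; first by rewrite expr0 -[1]/(1%:M) -mxdiag1.
by rewrite expmxS IH mxdiagM; apply: eq_mxdiag => i; rewrite expmxS.
Qed.

Lemma mxdiag_scale a A : a *: (\mxdiag_i A i) = \mxdiag_i (a *: A i).
Proof.
rewrite -mul_scalar_mx -(mxdiagZ (p_ := p) a) mxdiagM; apply: eq_mxdiag => i.
by rewrite mul_scalar_mx.
Qed.

Lemma mxdiag_bigsum I (s : seq I) (F : I -> forall i, 'M[R]_(p i)) :
  \mxdiag_i (\sum_(k <- s) F k i) = \sum_(k <- s) \mxdiag_i F k i.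
Proof.
elim: s => [|k s IH].
  rewrite big_nil -[RHS](mxdiag0 (p_ := p)); apply: eq_mxdiag => i; by rewrite big_nil.
rewrite big_cons -IH -mxdiagD; apply: eq_mxdiag => i; by rewrite big_cons.
Qed.

Lemma pmx_mxdiag A P : pmx (\mxdiag_i A i) P = \mxdiag_i pmx (A i) P.
Proof.
rewrite pmxE (eq_bigr (fun k : 'I_(size P) => \mxdiag_i (P`_k *: A i ^+ k))).
  by rewrite -mxdiag_bigsum; apply: eq_mxdiag => i; rewrite pmxE.
by move=> k _; rewrite mxdiagX mxdiag_scale.
Qed.

Lemma submxrow_mul q (A : 'M[R]_(q, \sum_i p i)) j : submxrow A j = A *m submxrow 1%:M j.
Proof. by rewrite /submxrow mulmx_colsub mulmx1. Qed.
End MxDiag.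

Section GoodDsum.
Context (F : closedFieldType) (G : groupType) (w : wgroup G).
Context (m : nat) (p : 'I_m -> nat) (r : forall i, G -> 'M[F]_(p i)).
Arguments good {F G} w [n] r.

Lemma good_mxdiag : (forall i, good w (r i)) -> good w (fun g => \mxdiag_i r i g).
Proof.
move=> gr; split.
- split; first by rewrite -mxdiag1; apply: eq_mxdiag => i; case: (gr i) => -[].
  move=> g h Hg Hh; rewrite mxdiagM; apply: eq_mxdiag => i.
  by case: (gr i) => -[_ rM] _ _; rewrite rM.
- pose rs i := sval (cid (let: And3 _ h _ := gr i in h)).
  have rsP i : uniq (rs i) /\ pmx (r i (wphi w)) (\prod_(z <- rs i) ('X - z%:P)) = 0.
    by rewrite /rs; case: cid.
  pose t := undup (flatten [seq rs i | i : 'I_m]).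
  exists t; split; first exact: undup_uniq.
  rewrite pmx_mxdiag -[RHS](mxdiag0 (p_ := p)); apply: eq_mxdiag => i.
  have [u h] := rsP i; apply: dvdp_pmx0 h; apply: uniq_roots_dvdp; last by rewrite uniq_rootsE.
  apply/allP=> z zr; rewrite root_prod_XsubC mem_undup; apply/flattenP.
  by exists (rs i) => //; apply: image_f.
pose l i := sval (cid (let: And3 _ _ h := gr i in h)).
have lP i g : wI w g -> r i g \in l i.
  by move=> Ig; rewrite /l; case: cid => s /= h; apply: h.
exists [seq \mxdiag_i nth 0 (l i) (f i) | f : {dffun forall i, 'I_(size (l i))}] => g Ig.
pose f : {dffun forall i, 'I_(size (l i))} :=
  [ffun i => Ordinal (etrans (index_mem (r i g) (l i)) (lP i g Ig))].
have -> : \mxdiag_i r i g = \mxdiag_i nth 0 (l i) (f i).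
  by apply: eq_mxdiag => i; rewrite ffunE /= nth_index ?lP.
exact: image_f.
Qed.
End GoodDsum.

Lemma mx_square_inv (F : fieldType) m n (A : 'M[F]_(m, n)) (B : 'M[F]_(n, m)) :
  m = n -> A *m B = 1%:M -> B *m A = 1%:M.
Proof. by move=> e; case: _ / e in A B * => h; apply: mulmx1C. Qed.

Section SpIso.
Context (p : nat) (Zp : padicInt p) (K : fieldType) (v : dval K) (L : algClosure K)
  (W : localWeil Zp v L).
Context (E : closedFieldType) (charE : forall n, n.+1%:R != 0 :> E).
Let w := weil_group W.
Let chi := art_inv W E.
Context (d : nat) (r : AbsGal L -> 'M[E]_d) (N : 'M[E]_d) (e : int -> 'M[E]_d).
Context (gr : good w r) (lf : lefschetz w chi r N e).
Context (m : nat) (t ee : 'I_m -> nat) (t0 : forall i, (0 < t i)%N).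
Context (rl : forall i, AbsGal L -> 'M[E]_(ee i)) (grl : forall i, good w (rl i)).
Context (trE : forall k g, wH w g ->
  \tr (r g *m primitive lf k) = \sum_(i < m | t i == k.+1) \tr (rl i g)).

Let chi0 g : chi g != 0.
Proof. by rewrite /chi /art_inv expfz_neq0 // q_neq0. Qed.

Let R g := \mxdiag_i rl i g.
Let delta k := \mxdiag_i (if t i == k.+1 then 1%:M else 0 : 'M[E]_(ee i)).

(** Equality of characters on the primitive parts. *)
Lemma prim_components k : exists (X : forall i, 'M[E]_(d, ee i)) (Y : forall i, 'M[E]_(ee i, d)),
  [/\ primitive lf k = \sum_i X i *m Y i,
      forall i, t i != k.+1 -> X i = 0,
      forall i g, wH w g -> r g *m X i = X i *m rl i g &
      forall i, N ^+ k.+1 *m X i = 0].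
Proof.
have dd : delta k *m delta k = delta k.
  by rewrite mxdiagM; apply: eq_mxdiag => i; case: ifP => _; rewrite ?mulmx1 ?mulmx0.
have gR : good w R by apply: good_mxdiag.
have tR : twine w R R (delta k).
  move=> g _; rewrite !mxdiagM; apply: eq_mxdiag => i.
  by case: ifP => _; rewrite ?mulmx1 ?mul1mx ?mulmx0 ?mul0mx.
have [g Hg|X [Y [[tX tY XY YX] [pX Xq]]]] := good_equiv charE gr gR (prim_tw (fun g _ => chi0 g) lf k) tR
   (prim_idem lf k) dd.
  rewrite trE // mxdiagM mxtrace_mxdiag [LHS]big_mkcond; apply: eq_bigr => i _.
  by case: ifP => _; rewrite ?mulmx1 ?mulmx0 ?mxtrace0.
have XE : X = \mxrow_i submxrow X i by rewrite submxrowK.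
have YE : Y = \mxcol_i submxcol Y i by rewrite submxcolK.
exists (submxrow X), (submxcol Y); split.
- by rewrite -XY {1}XE {1}YE mul_mxrow_mxcol.
- move=> i ti; move: Xq; rewrite {1}XE {2}XE mul_mxrow_mxdiag => /eq_mxrowP/(_ i) ->.
  by rewrite (negPf ti) mulmx0.
- move=> i g Hg; have := tX g Hg; rewrite {1}XE {2}XE mul_mxrow mul_mxrow_mxdiag.
  by move=> /eq_mxrowP/(_ i).
- move=> i; rewrite submxrow_mul mulmxA pX mulmxA prim_nil !mul0mx //.
Qed.

Let XX k := sval (cid (prim_components k)).
Let X i : 'M[E]_(d, ee i) := XX (t i).-1 i.

Let XXP k := svalP (cid (prim_components k)).

Let Phi_ i : 'M[E]_(d, \sum_(k < t i) ee i) := \mxrow_(k < t i) (N ^+ (t i - k.+1) *m X i).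
Let Phi : 'M[E]_(d, \sum_i \sum_(k < t i) ee i) := \mxrow_i Phi_ i.
Let D' := wd_dsum (fun i => Sp W (t i) (rl i)).

Lemma Phi_rep g : wH w g -> r g *m Phi = Phi *m wd_rep D' g.
Proof.
move=> Hg; rewrite /Phi /= mul_mxrow mul_mxrow_mxdiag; apply: eq_mxrow => i.
rewrite /Phi_ mul_mxrow mul_mxrow_mxdiag; apply: eq_mxrow => k.
have [Y [_ _ tX _]] := XXP (t i).-1.
rewrite mulmxA (gr_rNX lf) // -scalemxAl -mulmxA tX // -scalemxAr mulmxA //.
Qed.

Lemma Phi_N : N *m Phi = Phi *m wd_N D'.
Proof.
rewrite /Phi /= mul_mxrow mul_mxrow_mxdiag; apply: eq_mxrow => i.
rewrite /Phi_ mul_mxrow mul_mxrow_mxblock; apply: eq_mxrow => l.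
have [Y [_ _ _ NX]] := XXP (t i).-1.
have := ltn_ord l; case E' : (l : nat) => [|j] lt.
  rewrite big1 ?mulmxA => [|k _]; last by rewrite mulmx0.
  by rewrite -expmxS -(prednK (t0 i)) subn1 /= NX.
have jt : (j < t i)%N by apply: ltnW.
rewrite (bigD1 (Ordinal jt)) //= eqxx mulmx1 big1 ?addr0 => [|k kj].
  by rewrite mulmxA -expmxS subnSK.
by rewrite eqSS; case: eqP => [kj'|]; rewrite ?mulmx0 //; move: kj; rewrite -val_eqE /= kj' eqxx.
Qed.

Let reach q (Z : 'M[E]_(d, q)) := exists Psi, Z = Phi *m Psi.

Let reachD q (Z1 Z2 : 'M[E]_(d, q)) : reach Z1 -> reach Z2 -> reach (Z1 + Z2).
Proof. by move=> [P1 ->] [P2 ->]; exists (P1 + P2); rewrite mulmxDr. Qed.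
Let reach0 q : reach (0 : 'M[E]_(d, q)).
Proof. by exists 0; rewrite mulmx0. Qed.
Let reachM q q' (Z : 'M[E]_(d, q)) (Z' : 'M_(q, q')) : reach Z -> reach (Z *m Z').
Proof. by move=> [P1 ->]; exists (P1 *m Z'); rewrite mulmxA. Qed.
Let reachN q (Z : 'M[E]_(d, q)) : reach Z -> reach (N *m Z).
Proof. by move=> [P1 ->]; exists (wd_N D' *m P1); rewrite !mulmxA Phi_N. Qed.
Let reachNX q (Z : 'M[E]_(d, q)) k : reach Z -> reach (N ^+ k *m Z).
Proof.
move=> h; elim: k => [|k IH]; first by rewrite mul1mx.
by rewrite expmxS -mulmxA; apply: reachN.
Qed.

Let reach_X i : reach (X i).
Proof.
have lt : ((t i).-1 < t i)%N by rewrite prednK.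
have -> : X i = submxrow (Phi_ i) (Ordinal lt).
  by rewrite /Phi_ mxrowK /= prednK // subnn mul1mx.
rewrite submxrow_mul; apply: reachM.
have -> : Phi_ i = submxrow Phi i by rewrite /Phi mxrowK.
by rewrite submxrow_mul; exists (submxrow 1%:M i).
Qed.

Let reach_prim k : reach (primitive lf k).
Proof.
have [Y [e0 X0 _ _]] := XXP k; rewrite e0; elim/big_ind: _ => [||i _]; [exact: reach0|exact: reachD|].
apply: reachM; have [ti|ti] := eqVneq (t i) k.+1; last by rewrite X0.
by have := reach_X i; rewrite /X ti.
Qed.

Lemma weight_bound : exists B : nat, (forall k : nat, (B <= k)%N -> e k%:Z = 0) /\
  forall B', (B <= B')%N -> \sum_(m <- [seq Posz k | k <- iota 0 B'] ++ [seq Negz k | k <- iota 0 B']) e m = 1%:M.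
Proof.
have [s0 [out sum]] := gr_sum (lf_gr lf).
pose B := (\max_(m <- s0) `|m|%N).+1.
have Bm x : x \in s0 -> (`|x| < B)%N by move=> xs; rewrite ltnS; apply: (@leq_bigmax_seq _ s0 xpredT absz).
exists B; split=> [k Bk|B' BB'].
  by apply: out; apply/negP=> /Bm /=; rewrite ltnNge Bk.
apply: sum.
  rewrite cat_uniq !map_inj_uniq ?iota_uniq /= ?andbT; try by move=> x y [].
  by apply/hasPn=> _ /mapP[x _ ->]; apply/negP=> /mapP[].
move=> x /Bm xB; rewrite mem_cat; case: x xB => k /= kB; apply/orP; [left|right];
  apply/map_f; rewrite mem_iota add0n /=; lia.
Qed.

(** Descending induction on the weight, by the Lefschetz decomposition. *)
Lemma reach1 : reach 1%:M.
Proof.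
have [B [B0 B1]] := weight_bound; rewrite -(B1 B (leqnn _)).
have pos n : forall k : nat, (B <= k + n)%N -> reach (e k%:Z).
  elim: n => [|n IH] k hk; first by rewrite B0 // -[k]addn0.
  have -> : e k%:Z = primitive lf k + N *m (lf_inv lf k.+2 *m N ^+ k.+1 *m e k%:Z).
    by rewrite !mulmxA /primitive subrK.
  apply: reachD; first exact: reach_prim.
  apply: reachN; rewrite -lf_inv_l -!mulmxA; apply: reachM; apply: IH; lia.
elim/big_ind: _ => [||x _]; [exact: reach0|exact: reachD|].
case: x => k; first by apply: (pos B); apply: leq_addl.
rewrite NegzE -(lf_inv2 lf); apply/reachM/reachNX/(pos B); exact: leq_addl.
Qed.

(** Dimensions are traces at 1; those of the primitive parts telescope. *)
Lemma dim_eq : d = (\sum_i \sum_(k < t i) ee i)%N.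
Proof.
have [B0 [e0 eS]] := weight_bound.
pose B := (B0 + \max_i t i)%N.
have tB i : (t i <= B)%N by apply: leq_trans (leq_addl _ _); apply: leq_bigmax.
pose a k := \tr (e k%:Z).
have aneg k : \tr (e (Negz k)) = a k.+1.
  by rewrite NegzE -(lf_inv2 lf) mxtrace_mulC (lf_inv1 lf).
have chi1 : chi 1%g = 1 by rewrite /chi /art_inv lw_vI //; apply: inertia1.
have r1 : r 1%g = 1%:M by case: gr => -[].
have trp k : \sum_(i < m | t i == k.+1) (ee i)%:R = a k - a k.+2.
  have := trE k (wH1 w); rewrite r1 mul1mx.
  have := prim_tr lf k (wH1 w); rewrite r1 !mul1mx chi1 mul1r => -> ->.
  by apply: eq_bigr => i _; case: (grl i) => -[-> _] _ _; rewrite mxtrace1.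
have tele C : \sum_(k < C) k.+1%:R * (a k - a k.+2) =
    \sum_(k < C) (a k + a k.+1) - C%:R * (a C + a C.+1).
  elim: C => [|C IH]; first by rewrite !big_ord0 mul0r subrr.
  by rewrite !big_ord_recr /= IH -natr1; ring.
apply: (natc_inj charE); rewrite -(mxtrace1 E) -(eS B (leq_addr _ _)) raddf_sum /=.
rewrite big_cat !big_map /=.
rewrite [X in _ + X](eq_bigr (fun k : nat => a k.+1)); last by move=> k _; apply: aneg.
rewrite -big_split /= (_ : iota 0 B = index_iota 0 B) ?big_mkord; last by rewrite /index_iota subn0.
have aB k : (B <= k)%N -> a k = 0.
  by move=> Bk; rewrite /a e0 ?mxtrace0 // (leq_trans _ Bk) // leq_addr.
have := tele B; rewrite (aB B) // (aB B.+1) // addr0 mulr0 subr0 => <-.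
rewrite (eq_bigr (fun k : 'I_B => \sum_(i < m) if t i == k.+1 then (t i * ee i)%:R else 0)); last first.
  move=> k _; rewrite -trp mulr_sumr [LHS]big_mkcond; apply: eq_bigr => i _ /=.
  by case: eqP => // ->; rewrite natrM.
rewrite exchange_big natr_sum /=; apply: eq_bigr => i _.
have lt : ((t i).-1 < B)%N by apply: leq_trans (tB i); rewrite prednK.
rewrite (bigD1 (Ordinal lt)) //= prednK // eqxx big1 ?addr0 => [|k ki].
  by rewrite sum_nat_const card_ord.
case: eqP => // tk; move: ki; rewrite -val_eqE /= tk eqxx //.
Qed.

(** Phi sends the k-th copy of rl i to N^(t i - k - 1) of the primitive part; it is
    surjective by reach1, and bijective because the dimensions agree. *)
Lemma sp_iso : wd_iso W (WDRep r N) D'.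
Proof.
have [Psi /esym PP] := reach1.
have PP' := mx_square_inv dim_eq PP.
exists Psi, Phi; split=> // [s Hs|].
  have h := Phi_rep Hs; transitivity (Psi *m (r s *m Phi) *m Psi).
    by rewrite -!mulmxA PP mulmx1.
  by rewrite h mulmxA PP' mul1mx.
have h := Phi_N; transitivity (Psi *m (N *m Phi) *m Psi).
  by rewrite -!mulmxA PP mulmx1.
by rewrite h mulmxA PP' mul1mx.
Qed.
End SpIso.

(** * The grading by weights *)

Section SpectralGrading.
Context (p : nat) (p_prime : prime p) (Zp : padicInt p) (K : fieldType)
  (v : dval K) (L : algClosure K) (W : localWeil Zp v L).
Context (vp : v p%:R = 0) (pK : p%:R != 0 :> K).
Let q := lw_q W.
Let phi := lw_phi W.
Let w := weil_group W.
Context (C : comNzRingType) (k : fieldType) (c2 : {rmorphism C -> k}).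
Context (ls : seq (C * int)) (d : nat) (d0 : (0 < d)%N).
Context (sep : forall x y n, x \in ls -> y \in ls -> x.2 != y.2 -> c2 x.1 ^+ n.+1 != c2 y.1 ^+ n.+1).
Context (sepq : forall x y, x \in ls -> y \in ls -> q%:R * c2 x.1 = c2 y.1 -> y.2 = x.2 + 2).
Context (EE : int -> {poly C}) (RR : int -> C) (u v' : int -> {poly C}).
Context (bez : forall m, [/\ EE m = u m * lab_poly ls d (predC1 m),
   (RR m)%:P - EE m = v' m * lab_poly ls d (pred1 m) & c2 (RR m) != 0]).

Section Field.
Context (F : closedFieldType) (charF : forall n, n.+1%:R != 0 :> F) (z : {rmorphism Zp -> F}).
Context (c : {rmorphism C -> F}) (ker : forall x, c x = 0 -> c2 x = 0).
Context (rho : AbsGal L -> 'M[F]_d) (hr : is_rep (weil v q) rho).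
Context (N S U : 'M[F]_d) (rr : AbsGal L -> 'M[F]_d) (fd : frss_data W z rho N S U rr).
Context (specA : spec (rho phi) [seq c x.1 | x <- ls]).
Context (chA : forall a, root (char_poly (rho phi)) a -> exists2 x, x \in ls & a = c x.1).

Definition wt_idem (m : int) : 'M[F]_d := lab_idem EE RR c (rho phi) m.
Local Notation e := wt_idem.

Lemma wt_pmx m : pmx (rho phi) (map_poly c (EE m)) = c (RR m) *: e m.
Proof.
by rewrite /e /wt_idem /lab_idem scalerA mulfV ?scale1r // (lab_R0 bez ker).
Qed.

Let uS : S \in unitmx.
Proof.
have [uA _] := @rep_unit F _ w d rho phi hr (weil_phi W).
by move: uA; rewrite (fd_SU fd) unitmx_mul => /andP[].
Qed.

Lemma wt_S m : S *m e m = e m *m S.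
Proof.
have [P [PS _]] := jordan_poly [::] (fd_SU fd) (fd_USC fd) (fd_S fd) (fd_U fd).
by rewrite -PS; apply: lab_idem_pmxC.
Qed.

Lemma wt_U m : U *m e m = e m *m U.
Proof.
apply: (can_inj (mulKmx uS)); rewrite mulmxA -(fd_SU fd) lab_idemC -/(e m) (fd_SU fd).
by rewrite !mulmxA wt_S.
Qed.

(** A power of rho(phi) commutes with the finite part of inertia, and powers of
    eigenvalues of different weights are different. *)
Lemma wt_graded : graded w (art_inv W F) rr N e.
Proof.
have hrr : is_rep (wH w) rr by case: (fd_good fd).
have sep1 x y : x \in ls -> y \in ls -> x.2 != y.2 -> c2 x.1 != c2 y.1.
  by move=> xl yl xy; have := @sep x y 0 xl yl xy.
split.
- move=> m; apply: twine_gen => //; first by rewrite /= (fd_phi fd) wt_S.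
  move=> i Ii; have [l hl] := fd_period fd.
  have hs x y : x \in ls -> y \in ls -> x.2 != y.2 -> c2 x.1 ^+ l.+1 != c2 y.1 ^+ l.+1.
    by apply: sep.
  have h := (@lab_comm _ _ _ ls d EE RR u v' bez F c ker _ chA (labels ls) l.+1 (rr i) m (undup_uniq _) (fun _ h => h) hs).
  exact: (esym (h (hl i Ii))).
- by move=> m; apply: (lab_idem2 bez ker chA).
- by move=> m n; apply: (lab_idem_orth bez chA).
- move=> m; apply: (@lab_shift _ _ _ ls d EE RR u v' bez F c ker _ chA (labels ls) q%:R N m (undup_uniq _) (fun _ h => h)).
    by move=> x y xl yl; rewrite rmorph_nat; apply: sepq.
  have mono := fd_mono fd.
  rewrite rmorph_nat (mono_phi p_prime vp pK charF hr mono) scalerA mulfV ?scale1r //.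
  exact: q_neq0.
- exists (labels ls); split=> [m|s us sl]; first exact: (lab_idem_out bez chA).
  exact: (lab_idem_sum bez ker chA us sl).
- by move=> g Hg; apply: (fd_rN fd).
Qed.

Lemma wt_rank m : \rank (e m) = count (fun x => x.2 == m) ls.
Proof.
apply: (natc_inj charF); rewrite -idem_tr ?(lab_idem2 bez ker chA) //.
exact: (lab_idem_tr d0 bez ker specA).
Qed.

Lemma mxpowz_unip n : nilpotent_mx (mxpowz U n - 1%:M).
Proof.
have nU := fd_U fd; case: n => n /=; first exact: unip_exp.
apply: unip_exp; have uU := unip_unit nU.
have -> : invmx U - 1%:M = (U - 1%:M) *m (- invmx U).
  by rewrite mulmxN mulmxBl mulmxV // mul1mx opprB.
by apply: nilp_mul => //; rewrite mulmxN mulNmx mulmxBl mulmxBr mulmxV // mulVmx // mulmx1 mul1mx.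
Qed.

(** Between parts of equal weight, the exponential of N contributes only its
    constant term, and the commuting unipotent factor U does not change traces. *)
Lemma wt_tr m g : wH w g -> \tr (rr g *m e m) = \tr (rho g *m e m).
Proof.
move=> Hg; have gr := wt_graded; have uU := unip_unit (fd_U fd).
set t := z (lw_t W (gexpz phi (- lw_v W g) * g)%g).
have [nN _] := fd_mono fd.
have rrE : rho g = rr g *m mxpowz U (lw_v W g) *m mxexp (t *: N).
  rewrite (fd_rr fd) /= -[_ *m mxpowz U _ *m mxpowz U _]mulmxA -mxpowzD //.
  by rewrite addNr mulmx1 -mulmxA mxexpD // addNr scale0r mxexp0 mulmx1.
have tU : twine w rr rr U.
  have hrr : is_rep (wH w) rr by case: (fd_good fd).
  apply: twine_gen => //; first by rewrite /= (fd_phi fd) (fd_USC fd).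
  by move=> i Ii; rewrite (fd_UI fd).
have Uz n (X : 'M[F]_d) : X *m U = U *m X -> X *m mxpowz U n = mxpowz U n *m X.
  move=> h; have := @mxpowz_scale_twine _ _ U X 1 n uU (oner_neq0 _).
  by rewrite !scale1r exp1rz scale1r => ->.
rewrite rrE.
have -> : \tr (rr g *m mxpowz U (lw_v W g) *m mxexp (t *: N) *m e m) =
    \tr (rr g *m mxpowz U (lw_v W g) *m e m).
  rewrite -{1}[e m](gr_idem gr) !mulmxA mxtrace_mulC !mulmxA.
  rewrite -(gr_tw gr _ Hg) -[_ *m e m *m mxpowz _ _]mulmxA Uz ?wt_U //.
  rewrite mxexpE -!mulmxA [e m *m (pmx _ _ *m _)]mulmxA (graded_block0 gr).
  by rewrite coef_poly d0 fact0 invr1 expr0 ?mul1r ?mulr1 scale1r.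
have -> : rr g *m mxpowz U (lw_v W g) *m e m = rr g *m e m *m mxpowz U (lw_v W g).
  by rewrite -[LHS]mulmxA -Uz ?mulmxA // wt_U.
rewrite [RHS]unip_comm_tr //; first exact: mxpowz_unip.
by apply: Uz; rewrite -mulmxA -wt_U !mulmxA (tU g Hg).
Qed.

Lemma exp_poly_coef (a : F) n : (n < d)%N -> ((exp_poly d a - 1) ^+ n)`_n = a ^+ n.
Proof.
move=> nd; case: n nd => [|n] nd; first by rewrite !expr0 coefC.
set f := _ - 1; have f0 : f`_0 = 0.
  by rewrite coefB coef_poly d0 coefC fact0 invr1 expr0 ?mul1r ?mulr1 subrr.
have -> : f = 'X * drop_poly 1 f.
  apply/polyP=> i; rewrite coefXM coef_drop_poly; case: i => [|i] //=; by rewrite addn1.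
rewrite exprMn coefXnM ltnn subnn -horner_coef0 horner_exp horner_coef0 coef_drop_poly.
rewrite coefB coef_poly coefC (leq_ltn_trans _ nd) // subr0.
by rewrite /= invr1 expr1 ?mul1r ?mulr1.
Qed.

(** (exp(aN) - 1)^m starts with a^m N^m, and no other term maps weight m to -m. *)
Lemma wt_tame (m : nat) i (a : F) : rho i = mxexp (a *: N) ->
  pmx (rho phi) (map_poly c (EE (- m%:Z))) *m (rho i - 1%:M) ^+ m *m
    pmx (rho phi) (map_poly c (EE m%:Z)) =
  (c (RR (- m%:Z)) * c (RR m%:Z) * a ^+ m) *: (N ^+ m *m e m%:Z).
Proof.
move=> ri; pose f := (exp_poly d a - 1) ^+ m.
have em : m%:Z = - m%:Z + (m + m)%N%:Z by lia.
have blk : e (- m%:Z) *m pmx N f *m e m%:Z = f`_m *: (N ^+ m *m e m%:Z).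
  by have := graded_block wt_graded (- m%:Z) m f; rewrite -em.
rewrite !wt_pmx ri mxexpE -(pmx1 N) -pmxB -pmx_exp -/f.
move: blk; move: (e (- m%:Z)) (e m%:Z) => e1 e2 blk.
rewrite -!scalemxAl -scalemxAr scalerA blk scalerA.
have [md|dm] := ltnP m d; last by rewrite (nilp_exp (proj1 (fd_mono fd)) dm) mul0mx !scaler0.
by rewrite /f exp_poly_coef.
Qed.
End Field.
End SpectralGrading.

(** * From purity at a point to hard Lefschetz over other fields *)

(** Elements of two fields over S can be compared even though no map relates the
    fields: a and b are the same fraction of elements of S. The denominator is only
    required to be nonzero in E2. *)
Section Compat.
Context (S : comNzRingType) (E1 E2 : fieldType) (s1 : {rmorphism S -> E1}) (s2 : {rmorphism S -> E2}).
Context (s1_inj : injective s1).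

Definition compat (a : E1) (b : E2) := exists R z : S,
  [/\ s2 R != 0, s1 R * a = s1 z & s2 R * b = s2 z].

Lemma compat_S x : compat (s1 x) (s2 x).
Proof. by exists 1, x; rewrite !rmorph1 !mul1r oner_neq0. Qed.

Lemma compatD a b a' b' : compat a b -> compat a' b' -> compat (a + a') (b + b').
Proof.
move=> [R [z [R0 h1 h2]]] [R' [z' [R0' h1' h2']]]; exists (R * R'), (z * R' + z' * R).
rewrite !rmorphM mulf_neq0 // !rmorphD !rmorphM -h1 -h2 -h1' -h2'.
by split=> //; ring.
Qed.

Lemma compatM a b a' b' : compat a b -> compat a' b' -> compat (a * a') (b * b').
Proof.
move=> [R [z [R0 h1 h2]]] [R' [z' [R0' h1' h2']]]; exists (R * R'), (z * z').
rewrite !rmorphM mulf_neq0 // -h1 -h2 -h1' -h2'.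
by split=> //; ring.
Qed.

Lemma compatN a b : compat a b -> compat (- a) (- b).
Proof.
by move=> [R [z [R0 h1 h2]]]; exists R, (- z); rewrite !mulrN h1 h2 !rmorphN.
Qed.

Lemma compat_sum I (s : seq I) (P : pred I) a b : (forall i, P i -> compat (a i) (b i)) ->
  compat (\sum_(i <- s | P i) a i) (\sum_(i <- s | P i) b i).
Proof.
move=> h; elim/big_rec2: _ => [|i x y Pi]; last by apply: compatD; apply: h.
by have := compat_S 0; rewrite !rmorph0.
Qed.

Lemma compat_nat_exp (q : nat) (n : int) : q%:R != 0 :> E1 -> q%:R != 0 :> E2 ->
  compat (q%:R ^ n) (q%:R ^ n).
Proof.
move=> q1 q2; case: n => n /=.
  by have := compat_S (q%:R ^+ n); rewrite !rmorphXn !rmorph_nat.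
exists (q%:R ^+ n.+1), 1; rewrite !rmorphXn !rmorph_nat !rmorph1 expf_neq0 //.
by rewrite ![_ ^ Negz n]/(_ ^- n.+1) !mulfV // expf_neq0.
Qed.

(** As s1 is injective, the fraction is an identity in S. *)
Lemma compat_eq x b : compat (s1 x) b -> b = s2 x.
Proof.
move=> [R [z [R0]]]; rewrite -rmorphM => /s1_inj <- ; rewrite rmorphM => /(mulfI R0) //.
Qed.
End Compat.

Section Key.
Context (p : nat) (p_prime : prime p) (Zp : padicInt p) (K : fieldType)
  (v : dval K) (L : algClosure K) (W : localWeil Zp v L).
Context (vp : v p%:R = 0) (pK : p%:R != 0 :> K).
Let q := lw_q W.
Let phi := lw_phi W.
Let w := weil_group W.
Context (G : groupType) (dec : AbsGal L -> G) (dec1 : dec 1%g = 1%g)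
  (decM : forall s t, dec (s * t)%g = (dec s * dec t)%g).
Context (O : idomainType) (iota : {rmorphism Zp -> O}) (T : G -> O).
Context (S : comNzRingType) (j0 : {rmorphism O -> S}).
Context (Lb E k : closedFieldType).
Context (charL : forall n, n.+1%:R != 0 :> Lb) (charE : forall n, n.+1%:R != 0 :> E)
  (chark : forall n, n.+1%:R != 0 :> k).
Context (jL : {rmorphism O -> Lb}) (jE : {rmorphism O -> E}) (psi : {rmorphism O -> k}).
Context (sL : {rmorphism S -> Lb}) (f : {rmorphism S -> E}) (sL_inj : injective sL) (jL_inj : injective jL).
Context (jLE : forall z, sL (j0 z) = jL z) (jEE : forall z, f (j0 z) = jE z).
Context (ker : forall z, jE z = 0 -> psi z = 0) (psip : psi p%:R != 0).
Context (Sint : forall x, p_integral j0 p x).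
Context (zL : {rmorphism Zp -> Lb}) (zE : {rmorphism Zp -> E}) (zk : {rmorphism Zp -> k}).
Context (d : nat) (d0 : (0 < d)%N).
Context (sigma : G -> 'M[Lb]_d) (rho : G -> 'M[E]_d) (rhok : G -> 'M[k]_d).
Context (hs : is_rep (@whole G) sigma) (hr : is_rep (@whole G) rho) (hk : irreducible_rep (@whole G) rhok).
Context (trs : forall g, \tr (sigma g) = jL (T g)) (trr : forall g, \tr (rho g) = jE (T g))
  (trk : forall g, \tr (rhok g) = psi (T g)).
Context (NL SL UL : 'M[Lb]_d) (rrL : AbsGal L -> 'M[Lb]_d)
  (fdL : frss_data W zL (fun s => sigma (dec s)) NL SL UL rrL).
Context (NE SE UE : 'M[E]_d) (rrE : AbsGal L -> 'M[E]_d)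
  (fdE : frss_data W zE (fun s => rho (dec s)) NE SE UE rrE).
Context (purek : pure_rep W zk (fun s => rhok (dec s))).
Context (lam : seq S) (lamP : spec (sigma (dec phi)) [seq sL x | x <- lam]).

Lemma decX s n : dec (s ^+ n)%g = (dec s ^+ n)%g.
Proof. by elim: n => [|n IH]; rewrite ?expg0 // !expgS decM IH. Qed.

Lemma dec_is_rep (R : comNzRingType) n (r : G -> 'M[R]_n) (H : AbsGal L -> Prop) :
  is_rep (@whole G) r -> is_rep H (fun s => r (dec s)).
Proof. by move=> [r1 rM]; split=> [|g h _ _]; rewrite ?dec1 // decM rM. Qed.

Lemma whole_repX (R : comNzRingType) n (r : G -> 'M[R]_n) g m :
  is_rep (@whole G) r -> r g ^+ m = r (g ^+ m)%g.
Proof.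
by move=> [r1 rM]; elim: m => [|m IH]; rewrite ?expg0 ?r1 // expmxS IH expgS rM.
Qed.

Lemma spec_root (F : closedFieldType) (charF : forall n, n.+1%:R != 0 :> F) n (A : 'M[F]_n) s :
  A \in unitmx -> spec A s -> s =i root (char_poly A).
Proof.
move=> uA sA; have [s' s'A s'E] := spec_exists uA.
by move=> x; rewrite (perm_mem (spec_uniq charF sA s'A)).
Qed.

Lemma rep_dec_unit (F : closedFieldType) n (r : G -> 'M[F]_n) s :
  is_rep (@whole G) r -> weil v q s -> r (dec s) \in unitmx.
Proof. by move=> h Hs; have [] := @rep_unit F _ w n (fun s => r (dec s)) s (dec_is_rep _ h) Hs. Qed.

Lemma wd_phi (F : closedFieldType) (z : {rmorphism Zp -> F}) n (r : AbsGal L -> 'M[F]_n) N :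
  wd_rep (WD W z r N) phi = r phi.
Proof.
by rewrite /= lw_vphi /= expg1 mulVg lwt1 rmorph0 oppr0 scale0r mxexp0 mulmx1.
Qed.

(** The Lefschetz property over k comes from purity, and it passes to E by the
    ranks of linked matrices; the traces agree because e m is the value of one
    polynomial over C divided by one constant. *)
Lemma weight_transfer : exists (eL : int -> 'M[Lb]_d) (eE : int -> 'M[E]_d),
  [/\ lefschetz w (art_inv W Lb) rrL NL eL, lefschetz w (art_inv W E) rrE NE eE,
      forall m g, wH w g -> compat sL f (\tr (rrL g *m eL m)) (\tr (rrE g *m eE m)) &
      forall g, wH w g -> \tr (rrL g) = \tr (sigma (dec g))].
Proof.
have [hkr _ _] := hk.
have [g ug] := irr_basis hk.
have kerS z : f (j0 z) = 0 -> psi z = 0 by rewrite jEE; apply: ker.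
have [|X] := @extension_exists O S E k j0 f psi p psip kerS lam; first by move=> x _; apply: Sint.
pose C := ex_C X.
pose cL : {rmorphism C -> Lb} := (sL \o ex_S X : {rmorphism C -> Lb}).
pose cE : {rmorphism C -> E} := (f \o ex_S X : {rmorphism C -> E}).
pose ck : {rmorphism C -> k} := ex_k X.
have kerE x : cE x = 0 -> ck x = 0 by apply: ex_ker.
have kerL x : cL x = 0 -> ck x = 0.
  move=> h; apply: kerE; have e0 : ex_S X x = 0 by apply: sL_inj; rewrite rmorph0; exact: h.
  by rewrite /cE /= e0 rmorph0.
pose Tc g := ex_O X (T g).
have trsC h : \tr (sigma h) = cL (Tc h) by rewrite trs /cL /Tc /= ex_SO jLE.
have trrC h : \tr (rho h) = cE (Tc h) by rewrite trr /cE /Tc /= ex_SO jEE.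
have trkC h : \tr (rhok h) = ck (Tc h) by rewrite trk /ck /Tc ex_kO.
(* the eigenvalues lie in S; C was built so that they lift to it *)
pose lft x : C := if pselect (exists z, ex_S X z = x) is left h then sval (cid h) else 0.
have lftP x : x \in lam -> ex_S X (lft x) = x.
  by move=> /(ex_im X) h; rewrite /lft; case: pselect => // h'; case: cid.
pose ell := [seq lft x | x <- lam].
have ellS : [seq ex_S X x | x <- ell] = lam.
  rewrite /ell -map_comp -[RHS]map_id; apply/eq_in_map => x /lftP //.
have [szl trl] := lamP; rewrite size_map in szl.
have powS n : \sum_(x <- lam) x ^+ n = j0 (T (dec phi ^+ n)%g).
  apply: sL_inj; rewrite jLE -trs -whole_repX // trl big_map rmorph_sum.
  by apply: eq_bigr => x _; rewrite rmorphXn.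
have powE n : \sum_(x <- lam) x ^+ n = ex_S X (\sum_(x <- ell) x ^+ n).
  transitivity (\sum_(x <- [seq ex_S X x | x <- ell]) x ^+ n); first by rewrite ellS.
  by rewrite big_map rmorph_sum; apply: eq_bigr => x _; rewrite rmorphXn.
have specE : spec (rho (dec phi)) [seq cE x | x <- ell].
  split; first by rewrite !size_map.
  move=> n; rewrite whole_repX // trr -jEE -powS -ellS !big_map rmorph_sum.
  by apply: eq_bigr => x _; rewrite rmorphXn.
have specL : spec (sigma (dec phi)) [seq cL x | x <- ell].
  have -> : [seq cL x | x <- ell] = [seq sL x | x <- lam] by rewrite -[in RHS]ellS -map_comp.
  by [].
have speck : spec (rhok (dec phi)) [seq ck x | x <- ell].
  split; first by rewrite !size_map.
  move=> n; rewrite whole_repX // trkC; apply/eqP; rewrite big_map.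
  rewrite (eq_bigr (fun x => ck (x ^+ n))); last by move=> x _; rewrite rmorphXn.
  rewrite -rmorph_sum -subr_eq0 -rmorphB; apply/eqP/kerE.
  by rewrite rmorphB; apply/eqP; rewrite subr_eq0 /cE /Tc /= ex_SO -powS powE.
have Wphi : weil v q phi by apply: weil_phi.
have uAk := rep_dec_unit hkr Wphi; have uAE := rep_dec_unit hr Wphi; have uAL := rep_dec_unit hs Wphi.
(* the weight of an eigenvalue is chosen over k, where purity provides one *)
have [Nk [Dk [a [monok [Sk [Uk [SUk SUCk Sdk nUk DkE]]] purek']]]] := purek.
rewrite wd_phi in SUk; have sSk : ssmx Sk by apply/ssmxP.
have fdk := frss_of p_prime vp pK chark (dec_is_rep (weil v q) hkr) monok SUk SUCk sSk nUk.
set rrk := (fun s => wd_rep _ _ *m mxpowz _ _) in fdk.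
have {}DkE : Dk = WDRep rrk Nk by [].
subst Dk; have [M filt pureM] := purek'; rewrite /= in M filt pureM.
have pureS i l : (exists x, [/\ x \in M i, x \notin M (i - 1) & Sk *m x - l *: x \in M (i - 1)]) ->
   weil_number q (a + i) l.
  move=> [x [xi nxi hx]]; apply: pureM; exists x; split=> //=.
  by rewrite (fd_phi fdk).
have q1 := lw_q_gt1 W.
pose wt (b : k) : int := if pselect (exists i, weil_number q (a + i) b) is left h then sval (cid h) else 0.
have wtP b : eigenvalue Sk b -> weil_number q (a + wt b) b.
  rewrite eigenvalue_root_char => /eigen_col[x x0 Sx].
  have [i [_ _ wi]] := eigen_level q1 filt pureS x0 Sx.
  by rewrite /wt; case: pselect => [h|[]]; [case: cid | exists i].
have eigS b : root (char_poly (rhok (dec phi))) b -> eigenvalue Sk b.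
  case/eigen_col=> x x0 Ax; have [P [PS Pb]] := jordan_poly [:: b] SUk SUCk sSk nUk.
  rewrite eigenvalue_root_char; apply: (root_eigen x0).
  rewrite -PS (pmx_eigen _ Ax); congr (_ *: _); apply/eqP; rewrite -subr_eq0.
  by have := Pb b (mem_head _ _); rewrite dvdp_XsubCl rootE !hornerE.
pose ls := [seq (x, wt (ck x)) | x <- ell].
have lsE (F : fieldType) (c : C -> F) : [seq c x.1 | x <- ls] = [seq c x | x <- ell].
  by rewrite -map_comp.
have lsW x : x \in ls -> x.2 = wt (ck x.1) /\ weil_number q (a + x.2) (ck x.1).
  case/mapP=> y yl -> /=; split=> //; apply/wtP/eigS.
  have := spec_root chark uAk speck (ck y); rewrite map_f // => /esym; exact.
have sep x y n : x \in ls -> y \in ls -> x.2 != y.2 -> ck x.1 ^+ n.+1 != ck y.1 ^+ n.+1.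
  move=> /lsW[_ wx] /lsW[_ wy]; apply: contraNneq => h.
  by have /addrI-> := weil_pow chark q1 wx wy h.
have sepq x y : x \in ls -> y \in ls -> q%:R * ck x.1 = ck y.1 -> y.2 = x.2 + 2.
  move=> /lsW[_ wx] /lsW[_ wy] h; have := weil_scale chark q1 wy wx (esym h).
  by rewrite -addrA => /addrI.
have sep0 x y : x \in ls -> y \in ls -> x.2 != y.2 -> ck x.1 != ck y.1.
  by move=> xl yl xy; have := sep x y 0 xl yl xy.
have [EE [RR [u [v' bez]]]] := lab_bezout d sep0.
have ch (F : closedFieldType) (charF : forall n, n.+1%:R != 0 :> F) (c : C -> F) n (A : 'M[F]_n) :
    A \in unitmx -> spec A [seq c x | x <- ell] ->
    forall b, root (char_poly A) b -> exists2 x, x \in ls & b = c x.1.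
  move=> uA sA b rb; have /mapP[x xl ->] : b \in [seq c x | x <- ell].
    by rewrite (spec_root charF uA sA); exact: rb.
  by exists (x, wt (ck x)) => //; apply: map_f.
have chE := ch _ charE cE _ _ uAE specE; have chL := ch _ charL cL _ _ uAL specL.
have chk := ch _ chark ck _ _ uAk speck.
rewrite -lsE in specE; rewrite -lsE in specL; rewrite -lsE in speck.
pose ek := wt_idem W EE RR ck (fun s => rhok (dec s)).
have kerk x : ck x = 0 -> ck x = 0 by [].
have rE := dec_is_rep (weil v q) hr; have rL := dec_is_rep (weil v q) hs; have rk := dec_is_rep (weil v q) hkr.
have grk := wt_graded p_prime vp pK sep sepq bez chark kerk rk fdk chk.
have grE := wt_graded p_prime vp pK sep sepq bez charE kerE rE fdE chE.
have grL := wt_graded p_prime vp pK sep sepq bez charL kerL rL fdL chL.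
(* e m is the projection of A to labels, whereas purity speaks of eigenvectors of
   its semisimple part *)
have ek0 b (y : 'cV_d) m : Sk *m y = b *: y -> wt b != m -> ek m *m y = 0.
  move=> Sy wb; set z := ek m *m y; have [//|z0] := eqVneq z 0.
  have Sz : Sk *m z = b *: z by rewrite /z mulmxA (wt_S EE RR ck fdk) -mulmxA Sy scalemxAr.
  have ez : ek m *m z = z by rewrite /z mulmxA (gr_idem grk).
  have Pz : pmx (rhok (dec phi)) (map_poly ck (lab_poly ls d (pred1 m))) *m z = 0.
    by rewrite -ez mulmxA lab_idem_pmxC (lab_idem_kill bez chk) mul0mx.
  have [j [zj Uz]] := nilp_last nUk z0.
  set z' := (Uk - 1%:M) ^+ j *m z in zj Uz.
  have cSU : Sk *m (Uk - 1%:M) = (Uk - 1%:M) *m Sk by rewrite mulmxBr mulmxBl SUCk mulmx1 mul1mx.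
  have Sz' : Sk *m z' = b *: z'.
    have cSj : Sk *m (Uk - 1%:M) ^+ j = (Uk - 1%:M) ^+ j *m Sk.
      by apply/esym/expmx_twine; rewrite cSU.
    by rewrite /z' mulmxA cSj -mulmxA Sz -scalemxAr.
  have Az' : rhok (dec phi) *m z' = b *: z'.
    move: Uz; rewrite mulmxBl mul1mx => /eqP; rewrite subr_eq0 => /eqP Uz.
    by rewrite SUk -mulmxA Uz Sz'.
  have : pmx (rhok (dec phi)) (map_poly ck (lab_poly ls d (pred1 m))) *m z' = 0.
    have cA : rhok (dec phi) *m (Uk - 1%:M) ^+ j = (Uk - 1%:M) ^+ j *m rhok (dec phi).
      apply/esym/expmx_twine; rewrite SUk mulmxBl mulmxBr mul1mx mulmx1 SUCk -!mulmxA SUCk //.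
    by rewrite /z' mulmxA (pmx_twine _ cA) -mulmxA Pz mulmx0.
  rewrite (pmx_eigen _ Az') => /eqP; rewrite scaler_eq0 (negPf zj) orbF lab_polyE horner_exp.
  rewrite expf_eq0 d0 /= horner_prod prodf_seq_eq0 => /hasP[x xl] /andP[/eqP xm].
  rewrite !hornerE subr_eq0 => /eqP bx; have [xw _] := lsW x xl.
  by case/eqP: wb; rewrite bx -xw.
have ek1 b (y : 'cV_d) m : Sk *m y = b *: y -> wt b = m -> ek m *m y = y.
  move=> Sy wb; have [s0 [out sum]] := gr_sum grk.
  have us := undup_uniq (m :: s0); rewrite -[RHS]mul1mx -(sum _ us); last first.
    by move=> x xs; rewrite mem_undup inE xs orbT.
  rewrite mulmx_suml (bigD1_seq m) ?mem_undup ?mem_head //= [X in _ = _ + X]big1 ?addr0 // => j jm.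
  by apply: (ek0 b); rewrite // wb eq_sym.
have Sk_N := fd_rN fdk Wphi; rewrite (fd_phi fdk) /art_inv lw_vphi exprN1 in Sk_N.
have rkk n : \rank (Nk ^+ n *m ek n%:Z) = \rank (ek n%:Z) /\ \rank (ek n%:Z) = \rank (ek (- n%:Z)).
  have e1 : (\rank (ek n%:Z) <= \rank (Nk ^+ n *m ek n%:Z))%N.
    apply: rank_ker_le => x; rewrite -mulmxA.
    apply: (pure_inj chark q1 sSk Sk_N filt pureS wtP (wt_S EE RR ck fdk _)).
    by move=> b y Sy wb; apply: (ek0 b).
  have e2 : (\rank (ek (- n%:Z)) <= \rank (Nk ^+ n *m ek n%:Z))%N.
    apply: rank_im_le => y.
    have [|b y' Sy wb|x hx] := pure_surj chark q1 sSk Sk_N filt pureS wtP y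
       (wt_S EE RR ck fdk (- n%:Z)) (k := n) (e := ek n%:Z).
    - by move=> b y' Sy wb; apply: (ek0 b).
    - exact: (ek1 b).
    by exists x; rewrite hx mulmxA.
  have e3 : (\rank (Nk ^+ n *m ek n%:Z) <= \rank (ek n%:Z))%N by apply: mxrankM_maxr.
  have e4 : (\rank (Nk ^+ n *m ek n%:Z) <= \rank (ek (- n%:Z)))%N.
    have -> : Nk ^+ n *m ek n%:Z = ek (- n%:Z) *m Nk ^+ n.
      rewrite (graded_shiftX grk); congr (_ *m ek _); lia.
    exact: mxrankM_maxl.
  by split; apply/eqP; rewrite eqn_leq ?e3 ?e1 //= (leq_trans e1 e4) (leq_trans e2 e3).
(* one tame element serves for E and k, so the two values of its group algebra
   element are linked *)
have lefF (F : closedFieldType) (charF : forall n, n.+1%:R != 0 :> F) (z : {rmorphism Zp -> F})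
  (c : {rmorphism C -> F}) (kerc : forall x, c x = 0 -> ck x = 0) (r : G -> 'M[F]_d)
  (h : is_rep (@whole G) r) (tr : forall g, \tr (r g) = c (Tc g)) N S' U rr
  (fd : frss_data W z (fun s => r (dec s)) N S' U rr)
  (sp : spec (r (dec phi)) [seq c x.1 | x <- ls])
  (chF : forall b, root (char_poly (r (dec phi))) b -> exists2 x, x \in ls & b = c x.1) :
  graded w (art_inv W F) rr N (wt_idem W EE RR c (fun s => r (dec s))) ->
  lefschetz w (art_inv W F) rr N (wt_idem W EE RR c (fun s => r (dec s))).
  move=> gr; split=> // n.
  have [l1 [_ l1P]] := mono_list (fd_mono fd); have [l2 [_ l2P]] := mono_list monok.
  have [i [M' [Ii il ti]]] := tame_generator W (l1 ++ l2).
  have ri : r (dec i) = mxexp (M'.+1%:R *: N).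
    by rewrite l1P // => [|x xl]; [rewrite ti rmorph_nat | apply: il; rewrite mem_cat xl].
  have rki : rhok (dec i) = mxexp (M'.+1%:R *: Nk).
    by rewrite l2P // => [|x xl]; [rewrite ti rmorph_nat | apply: il; rewrite mem_cat xl orbT].
  have XE := wt_tame p_prime vp pK d0 sep sepq bez charF kerc (dec_is_rep _ h) fd chF n ri.
  have YE := wt_tame p_prime vp pK d0 sep sepq bez chark kerk rk fdk chk n rki.
  have lr g0 : linked c ck r rhok (r g0) (rhok g0).
    have : linked c ck r rhok (c 1 *: r g0) (ck 1 *: rhok g0) by apply: linked_rep.
    by rewrite !rmorph1 !scale1r.
  have l1r : linked c ck r rhok (- 1%:M) (- 1%:M).
    have : linked c ck r rhok (c (-1) *: 1%:M) (ck (-1) *: 1%:M).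
      by apply: linkedZ => //; apply: linked1.
    by rewrite !rmorphN1 !scaleN1r.
  have lk := linkedM h hkr (linkedM h hkr (linked_pmx h hkr (EE (- n%:Z)) (lr (dec phi)))
    (linkedX h hkr n (linkedD (lr (dec i)) l1r))) (linked_pmx h hkr (EE n%:Z) (lr (dec phi))).
  have := linked_rank d0 h hkr kerc tr trkC ug lk; rewrite {lk} XE YE.
  have sc (F' : fieldType) (x : F') (Y : 'M[F']_d) : x != 0 -> \rank (x *: Y) = \rank Y.
    by move=> x0; rewrite (eqmx_scale _ x0).
  have R0 := lab_R0 bez kerc; have Rk := lab_R0 bez kerk.
  rewrite !sc ?mulf_neq0 ?expf_neq0 ?charF ?chark // (rkk n).1 => rk1.
  have rc m : \rank (wt_idem W EE RR c (fun s => r (dec s)) m) = count (fun x => x.2 == m) ls.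
    exact: (wt_rank d0 bez charF kerc sp chF).
  have rkc m : \rank (ek m) = count (fun x => x.2 == m) ls.
    exact: (wt_rank d0 bez chark kerk speck chk).
  have en : \rank (N ^+ n *m wt_idem W EE RR c (fun s => r (dec s)) n%:Z) =
            \rank (wt_idem W EE RR c (fun s => r (dec s)) n%:Z).
    apply/eqP; rewrite eqn_leq mxrankM_maxr /=; apply: leq_trans rk1.
    by rewrite rc rkc.
  apply: iso_of_rank => //; try exact: (gr_idem gr).
  - by rewrite -mulmxA (gr_idem gr).
  - rewrite mulmxA (graded_shiftX gr) -!mulmxA (_ : - n%:Z + (n + n)%N%:Z = n%:Z); last by lia.
    by rewrite (gr_idem gr).
  - by rewrite en !rc -!rkc (rkk n).2.
exists (wt_idem W EE RR cL (fun s => sigma (dec s))), (wt_idem W EE RR cE (fun s => rho (dec s))).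
have trF (F : closedFieldType) (charF : forall n, n.+1%:R != 0 :> F) (z : {rmorphism Zp -> F})
  (c : {rmorphism C -> F}) (kerc : forall x, c x = 0 -> ck x = 0) (r : G -> 'M[F]_d)
  (h : is_rep (@whole G) r) (tr : forall g, \tr (r g) = c (Tc g)) N S' U rr
  (fd : frss_data W z (fun s => r (dec s)) N S' U rr)
  (chF : forall b, root (char_poly (r (dec phi))) b -> exists2 x, x \in ls & b = c x.1) m g0 :
  wH w g0 -> c (RR m) * \tr (rr g0 *m wt_idem W EE RR c (fun s => r (dec s)) m) =
  c (\sum_(i < size (EE m)) (EE m)`_i * Tc (dec g0 * dec phi ^+ i)%g).
  move=> Hg; have [_ rM] := h.
  rewrite (wt_tr p_prime vp pK d0 sep sepq bez charF kerc (dec_is_rep _ h) fd chF m Hg).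
  rewrite -mxtraceZ scalemxAr -(wt_pmx W bez kerc (fun s => r (dec s))).
  rewrite -{1}[EE m]coefK poly_def !rmorph_sum pmx_sum mulmx_sumr raddf_sum.
  apply: eq_bigr => i _.
  rewrite /= map_polyZ map_polyXn pmxZ pmxXn -/phi (whole_repX _ _ h) -scalemxAr -rM // mxtraceZ tr.
  by rewrite rmorphM.
split; [exact: lefF trsC _ _ _ _ fdL specL chL grL | exact: lefF trrC _ _ _ _ fdE specE chE grE | | ]; last first.
  move=> g0 Hg; have [s0 [out sum]] := gr_sum grL; have us := undup_uniq s0.
  rewrite -[rrL g0]mulmx1 -[sigma (dec g0)]mulmx1 -(sum _ us); last by move=> x; rewrite mem_undup.
  rewrite !mulmx_sumr !raddf_sum; apply: eq_bigr => m _.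
  exact: (wt_tr p_prime vp pK d0 sep sepq bez charL kerL rL fdL chL m Hg).
move=> m g0 Hg.
exists (ex_S X (RR m)), (ex_S X (\sum_(i < size (EE m)) (EE m)`_i * Tc (dec g0 * dec phi ^+ i)%g)).
split; first exact: (lab_R0 bez kerE m).
  exact: (trF _ charL zL cL kerL sigma hs trsC _ _ _ _ fdL chL).
exact: (trF _ charE zE cE kerE rho hr trrC _ _ _ _ fdE chE).
Qed.
End Key.

(** * Direct sums and change of coefficients *)

Section TotalGraded.
Context (F : closedFieldType) (G : groupType) (w : wgroup G) (chi : G -> F).
Context (n : nat) (d : 'I_n -> nat) (r : forall i, G -> 'M[F]_(d i))
  (N : forall i, 'M[F]_(d i)) (e : forall i, int -> 'M[F]_(d i)).

(** The weights of the summands need not agree, so the range of the total grading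
    is the union of theirs. *)
Lemma lefschetz_dsum : (forall i, lefschetz w chi (r i) (N i) (e i)) ->
  lefschetz w chi (fun g => \mxdiag_i r i g) (\mxdiag_i N i) (fun m => \mxdiag_i e i m).
Proof.
move=> lf; split; first split.
- by move=> m g Hg /=; rewrite !mxdiagM; apply: eq_mxdiag => i; apply: (gr_tw (lf_gr (lf i))).
- by move=> m; rewrite mxdiagM; apply: eq_mxdiag => i; apply: (gr_idem (lf_gr (lf i))).
- move=> m k mk; rewrite mxdiagM -[RHS](mxdiag0 (p_ := d)); apply: eq_mxdiag => i.
  exact: (gr_orth (lf_gr (lf i))).
- by move=> m; rewrite !mxdiagM; apply: eq_mxdiag => i; apply: (gr_shift (lf_gr (lf i))).
- pose s i := sval (cid (gr_sum (lf_gr (lf i)))).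
  have sP i : (forall m, m \notin s i -> e i m = 0) /\
      forall s', uniq s' -> {subset s i <= s'} -> \sum_(m <- s') e i m = 1%:M.
    by rewrite /s; case: cid.
  have sub i m : m \in s i -> m \in flatten [seq s i | i : 'I_n].
    by move=> h; apply/flattenP; exists (s i) => //; apply: image_f.
  exists (flatten [seq s i | i : 'I_n]); split=> [m ms|s' us ss].
    rewrite -[RHS](mxdiag0 (p_ := d)); apply: eq_mxdiag => i; apply: (sP i).1.
    by apply: contra ms; apply: sub.
  rewrite -mxdiag_bigsum -mxdiag1; apply: eq_mxdiag => i; apply: (sP i).2 => // m /sub.
  exact: ss.
- move=> g Hg /=; rewrite !mxdiagM mxdiag_scale; apply: eq_mxdiag => i.
  exact: (gr_rN (lf_gr (lf i))).
move=> k; pose J i := sval (cid (lf_J (lf i) k)).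
have JP i : [/\ J i *m (N i ^+ k *m e i k%:Z) = e i k%:Z,
     (N i ^+ k *m e i k%:Z) *m J i = e i (- k%:Z) & J i = e i k%:Z *m J i *m e i (- k%:Z)].
  by rewrite /J; case: cid.
by exists (\mxdiag_i J i); rewrite !mxdiagX !mxdiagM; split; apply: eq_mxdiag => i; case: (JP i).
Qed.
End TotalGraded.

Section FrssDsum.
Context (E : closedFieldType) (charE : forall n, n.+1%:R != 0 :> E).
Context (n : nat) (d : 'I_n -> nat).

Lemma le_sum_dim i : (d i <= \sum_j d j)%N.
Proof. by rewrite (bigD1 i) //= leq_addr. Qed.

Lemma nilp_dsum (N : forall i, 'M[E]_(d i)) : (forall i, nilpotent_mx (N i)) ->
  nilpotent_mx (\mxdiag_i N i).
Proof.
move=> nN; exists (\sum_j d j)%N; rewrite mxdiagX -[RHS](mxdiag0 (p_ := d)).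
by apply: eq_mxdiag => i; apply: nilp_exp => //; apply: le_sum_dim.
Qed.

(** The exponential is truncated at the size of the matrix, and longer truncations
    do not change it. *)
Lemma mxexp_dsum a (N : forall i, 'M[E]_(d i)) : (forall i, nilpotent_mx (N i)) ->
  mxexp (a *: \mxdiag_i N i) = \mxdiag_i mxexp (a *: N i).
Proof.
move=> nN; rewrite mxexpE pmx_mxdiag; apply: eq_mxdiag => i; rewrite mxexpE.
apply/eqP; rewrite -subr_eq0 -pmxB; apply/eqP/pmx_low0 => // k kn.
by rewrite coefB !coef_poly kn (leq_trans kn) ?le_sum_dim // subrr.
Qed.

Lemma mxpowz_dsum (U : forall i, 'M[E]_(d i)) m : (forall i, U i \in unitmx) ->
  mxpowz (\mxdiag_i U i) m = \mxdiag_i mxpowz (U i) m.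
Proof.
move=> uU; case: m => m /=; first by rewrite mxdiagX.
have UV : (\mxdiag_i U i) *m (\mxdiag_i invmx (U i)) = 1%:M.
  by rewrite mxdiagM -mxdiag1; apply: eq_mxdiag => i; rewrite mulmxV.
have [uD _] := mulmx1_unit UV.
have -> : invmx (\mxdiag_i U i) = \mxdiag_i invmx (U i) by rewrite -[LHS]mulmx1 -UV mulKmx.
by rewrite mxdiagX.
Qed.

Context (p : nat) (Zp : padicInt p) (K : fieldType)
  (v : dval K) (L : algClosure K) (W : localWeil Zp v L).
Context (c : {rmorphism Zp -> E}).

Lemma mono_ext (c' : {rmorphism Zp -> E}) m (r : AbsGal L -> 'M[E]_m) (N : 'M[E]_m) :
  c' =1 c -> is_monodromy W c r N -> is_monodromy W c' r N.
Proof.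
move=> cc [nN [l hl]]; split=> //; exists l => g Ig gl.
by rewrite hl //; congr (mxexp (_ *: _)); rewrite cc.
Qed.

Context (rho : forall i, AbsGal L -> 'M[E]_(d i)) (N S U : forall i, 'M[E]_(d i))
  (rr : forall i, AbsGal L -> 'M[E]_(d i)).
Context (fd : forall i, frss_data W c (rho i) (N i) (S i) (U i) (rr i)).

Lemma mono_dsum : is_monodromy W c (rep_dsum rho) (\mxdiag_i N i).
Proof.
have nN i : nilpotent_mx (N i) := proj1 (fd_mono (fd i)).
split; first exact: nilp_dsum.
pose s i := sval (cid (proj2 (fd_mono (fd i)))).
have sP i g : inertia v g -> {in s i, forall x, g x = x} ->
    rho i g = mxexp (c (lw_t W g) *: N i).
  by rewrite /s; case: cid => /= l h; apply: h.
exists (flatten [seq s i | i : 'I_n]) => g Ig gs.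
rewrite mxexp_dsum //; apply: eq_mxdiag => i; apply: sP => // x xs; apply: gs.
by apply/flattenP; exists (s i) => //; apply: image_f.
Qed.

Lemma frss_dsum : is_frss W (WD W c (rep_dsum rho) (\mxdiag_i N i))
  (WDRep (fun s => \mxdiag_i rr i s) (\mxdiag_i N i)).
Proof.
have nN i : nilpotent_mx (N i) := proj1 (fd_mono (fd i)).
have uU i : U i \in unitmx by apply: unip_unit (fd_U (fd i)).
exists (\mxdiag_i S i), (\mxdiag_i U i); split.
- rewrite wd_phi /= /rep_dsum mxdiagM; apply: eq_mxdiag => i; exact: (fd_SU (fd i)).
- rewrite !mxdiagM; apply: eq_mxdiag => i; exact: (fd_USC (fd i)).
- have [_ sS _] := good_mxdiag (fun i => fd_good (fd i)).
  apply/ssmxP; have <- : \mxdiag_i rr i (lw_phi W) = \mxdiag_i S i; last exact: sS.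
  apply: eq_mxdiag => i; exact: (fd_phi (fd i)).
- have -> : \mxdiag_i U i - 1%:M = \mxdiag_i (U i - 1%:M).
    by rewrite -[in LHS](mxdiag1 E d) -mxdiagB.
  by apply: nilp_dsum => i; apply: (fd_U (fd i)).
congr WDRep; apply/funext => s /=; rewrite /rep_dsum mxexp_dsum // mxpowz_dsum // !mxdiagM.
by apply: eq_mxdiag => i; rewrite (fd_rr (fd i)).
Qed.

Lemma total_iso (e : int -> 'M[E]_(\sum_i d i))
  (lf : lefschetz (weil_group W) (art_inv W E) (fun s => \mxdiag_i rr i s) (\mxdiag_i N i) e)
  (m : nat) (t ee : 'I_m -> nat) (t0 : forall i, (0 < t i)%N)
  (rl : forall i, AbsGal L -> 'M[E]_(ee i)) :
  (forall i, good (weil_group W) (rl i)) ->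
  (forall k g, wH (weil_group W) g -> \tr ((\mxdiag_i rr i g) *m primitive lf k) =
     \sum_(i < m | t i == k.+1) \tr (rl i g)) ->
  wd_frss_iso W c (rep_dsum rho) (wd_dsum (fun i => Sp W (t i) (rl i))).
Proof.
move=> grl trE; exists (\mxdiag_i N i), (WDRep (fun s => \mxdiag_i rr i s) (\mxdiag_i N i)).
split; [exact: mono_dsum | exact: frss_dsum |].
exact: (sp_iso charE (good_mxdiag (fun i => fd_good (fd i))) t0 grl trE).
Qed.
End FrssDsum.

Section Case.
Context (p : nat) (p_prime : prime p) (Zp : padicInt p) (K : fieldType)
  (v : dval K) (L : algClosure K) (W : localWeil Zp v L).
Context (vp : v p%:R = 0) (pK : p%:R != 0 :> K).
Let w := weil_group W.
Context (G : groupType) (dec : AbsGal L -> G) (dec1 : dec 1%g = 1%g)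
  (decM : forall s t, dec (s * t)%g = (dec s * dec t)%g).
Context (O : idomainType) (iota : {rmorphism Zp -> O}) (n : nat) (T : 'I_n -> G -> O).
Context (S : comNzRingType) (j0 : {rmorphism O -> S}).
Context (Lb E k : closedFieldType).
Context (charL : forall n, n.+1%:R != 0 :> Lb) (charE : forall n, n.+1%:R != 0 :> E)
  (chark : forall n, n.+1%:R != 0 :> k).
Context (jL : {rmorphism O -> Lb}) (jE : {rmorphism O -> E}) (psi : {rmorphism O -> k}).
Context (sL : {rmorphism S -> Lb}) (f : {rmorphism S -> E}) (sL_inj : injective sL) (jL_inj : injective jL).
Context (jLE : forall z, sL (j0 z) = jL z) (jEE : forall z, f (j0 z) = jE z).
Context (ker : forall z, jE z = 0 -> psi z = 0) (psip : psi p%:R != 0).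
Context (Sint : forall x, p_integral j0 p x).
Context (zE : {rmorphism Zp -> E}) (zk : {rmorphism Zp -> k}).
Context (zEE : forall t, zE t = jE (iota t)).
Context (d : 'I_n -> nat) (d0 : forall i, (0 < d i)%N).
Context (sigma : forall i, G -> 'M[Lb]_(d i)) (rho : forall i, G -> 'M[E]_(d i))
  (rhok : forall i, G -> 'M[k]_(d i)).
Context (hs : forall i, is_rep (@whole G) (sigma i)) (hr : forall i, is_rep (@whole G) (rho i))
  (hk : forall i, irreducible_rep (@whole G) (rhok i)).
Context (trs : forall i g, \tr (sigma i g) = jL (T i g)) (trr : forall i g, \tr (rho i g) = jE (T i g))
  (trk : forall i g, \tr (rhok i g) = psi (T i g)).
Context (NL SL UL : forall i, 'M[Lb]_(d i)) (rrL : forall i, AbsGal L -> 'M[Lb]_(d i))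
  (fdL : forall i, frss_data W (jL \o iota : {rmorphism Zp -> Lb})
    (fun s => sigma i (dec s)) (NL i) (SL i) (UL i) (rrL i)).
Context (purek : forall i, pure_rep W zk (fun s => rhok i (dec s))).
Context (lam : forall i, seq S)
  (lamP : forall i, spec (sigma i (dec (lw_phi W))) [seq sL x | x <- lam i]).

(** The data lives in Type so that it can be chosen for all i at once. *)
Record case_rec (i : 'I_n) := CaseRec {
  cr_N : 'M[E]_(d i); cr_S : 'M[E]_(d i); cr_U : 'M[E]_(d i);
  cr_rr : AbsGal L -> 'M[E]_(d i);
  cr_eL : int -> 'M[Lb]_(d i); cr_eE : int -> 'M[E]_(d i);
  cr_fd : frss_data W zE (fun s => rho i (dec s)) cr_N cr_S cr_U cr_rr;
  cr_lfL : lefschetz w (art_inv W Lb) (rrL i) (NL i) cr_eL;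
  cr_lfE : lefschetz w (art_inv W E) cr_rr cr_N cr_eE;
  cr_tr : forall m g, wH w g ->
    compat sL f (\tr (rrL i g *m cr_eL m)) (\tr (cr_rr g *m cr_eE m));
  cr_trL : forall g, wH w g -> \tr (rrL i g) = \tr (sigma i (dec g)) }.

Lemma case_exists i : inhabited (case_rec i).
Proof.
have [hkr _ _] := hk i; have [g ug] := irr_basis (hk i).
have uE := basis_transfer ker (hr i) hkr (trr i) (trk i) ug.
have nd (Z : 'M[E]_(d i)) : (forall g, \tr (Z *m rho i g) = 0) -> Z = 0.
  by move=> h; apply: (@vecs_nondeg E (d i) _ (fun j => rho i (g j))) => //; rewrite row_full_unit.
have mL := fd_mono (fdL i).
have [N mN] := mono_transfer charL charE jL_inj (hs i) (hr i) (trs i) (trr i) nd mL.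
have {}mN : is_monodromy W zE (fun s => rho i (dec s)) N by apply: mono_ext mN => t /=; rewrite zEE.
have uA := rep_dec_unit dec1 decM (hr i) (weil_phi W).
have [S' [U [SU SUC sS nU _]]] := jordan_exists uA.
have fd := frss_of p_prime vp pK charE (dec_is_rep dec1 decM _ (hr i)) mN SU SUC sS nU.
have [eL [eE [lL lE tr trL]]] := weight_transfer p_prime vp pK dec1 decM charL charE chark sL_inj jLE jEE ker psip
  Sint (d0 i) (hs i) (hr i) (hk i) (trs i) (trr i) (trk i) (fdL i) fd (purek i) (lamP i).
by constructor; exists N S' U (fun s => wd_rep (WD W zE (fun s => rho i (dec s)) N) s *m mxpowz U (- lw_v W s)) eL eE.
Qed.

Let D i : case_rec i := let: exist x _ := cid (let: inhabits x := case_exists i in ex_intro (fun=> True) x Logic.I) in x.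

Lemma lef_total : exists e, lefschetz w (art_inv W Lb)
  (fun s => \mxdiag_i rrL i s) (\mxdiag_i NL i) e.
Proof. by eexists; apply: lefschetz_dsum => i; apply: (cr_lfL (D i)). Qed.

Lemma frss_trace i g : wH w g -> \tr (rrL i g) = \tr (sigma i (dec g)).
Proof. exact: (cr_trL (D i)). Qed.

(** The traces over E of the primitive parts are the images under f of the traces
    over Lb, because compatible pairs with first entry in S are determined by it. *)
Lemma case_iso (e0 : int -> 'M[Lb]_(\sum_i d i))
  (lf0 : lefschetz w (art_inv W Lb) (fun s => \mxdiag_i rrL i s) (\mxdiag_i NL i) e0)
  (m : nat) (t ee : 'I_m -> nat) (t0 : forall i, (0 < t i)%N)
  (rl : forall i, AbsGal L -> 'M[S]_(ee i)) :
  (forall l, good w (fun s => map_mx f (rl l s))) ->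
  (forall k g, wH w g -> \tr ((\mxdiag_i rrL i g) *m primitive lf0 k) =
     \sum_(l < m | t l == k.+1) \tr (map_mx sL (rl l g))) ->
  wd_frss_iso W zE (rep_dsum (fun i s => rho i (dec s)))
    (wd_dsum (fun l => Sp W (t l) (fun s => map_mx f (rl l s)))).
Proof.
move=> gl tr0.
have lfL := lefschetz_dsum (fun i => cr_lfL (D i)).
have lfE := lefschetz_dsum (fun i => cr_lfE (D i)).
have q0 (F : closedFieldType) (charF : forall n, n.+1%:R != 0 :> F) : (lw_q W)%:R != 0 :> F.
  exact: q_neq0.
have chi0 g : wH w g -> art_inv W Lb g != 0 by move=> _; rewrite /art_inv expfz_neq0 // q0.
have ce m' g : wH w g -> compat sL f
    (\tr ((\mxdiag_i rrL i g) *m (\mxdiag_i cr_eL (D i) m')))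
    (\tr ((\mxdiag_i cr_rr (D i) g) *m (\mxdiag_i cr_eE (D i) m'))).
  move=> Hg; rewrite !mxdiagM !mxtrace_mxdiag; apply: compat_sum => i _.
  exact: (cr_tr (D i)).
apply: (total_iso charE (fun i => cr_fd (D i)) (lf := lfE)) => // k0 g Hg.
transitivity (f (\sum_(l < m | t l == k0.+1) \tr (rl l g))); last first.
  by rewrite rmorph_sum; apply: eq_bigr => l _; rewrite trace_map_mx.
apply: (compat_eq sL_inj).
have -> : sL (\sum_(l < m | t l == k0.+1) \tr (rl l g)) =
    \tr ((\mxdiag_i rrL i g) *m primitive lfL k0).
  rewrite (prim_unique chi0 lfL lf0 k0 Hg) tr0 // rmorph_sum.
  by apply: eq_bigr => l _; rewrite trace_map_mx.
rewrite !prim_tr //; apply: compatD; first exact: ce.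
apply: compatN; apply: compatM; last exact: ce.
by apply: compat_nat_exp; apply: q0.
Qed.
End Case.

Section RootsOfScalars.
Context (F : closedFieldType) (charF : forall n, n.+1%:R != 0 :> F).

(** X^m - nu has simple roots when nu is not 0. *)
Lemma ssmx_pow n (A : 'M[F]_n) m nu : nu != 0 -> A ^+ m.+1 = nu%:M -> ssmx A.
Proof.
move=> nu0 Am; pose P : {poly F} := 'X^(m.+1) - nu%:P.
have [rs Prs] := closed_field_poly_normal P.
have lP : lead_coef P = 1 by apply/eqP; apply: monicXnsubC.
rewrite lP scale1r in Prs; exists rs; split; last first.
  by rewrite -Prs /P pmxB pmxXn pmxC Am subrr.
rewrite -separable_prod_XsubC -Prs separable_poly.unlock.
have dP : P^`() = m.+1%:R *: 'X^m by rewrite /P derivB derivC subr0 derivXn scaler_nat.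
apply/Bezout_eq1_coprimepP; exists (- (nu^-1)%:P, ((m.+1%:R * nu)^-1) *: 'X) => /=.
rewrite dP -scalerAl -scalerAr scalerA (_ : (m.+1%:R * nu)^-1 * m.+1%:R = nu^-1); last first.
  by rewrite invfM mulrAC mulVf ?mul1r.
by rewrite -exprS -mul_polyC /P mulrBr !mulNr -polyCM mulVf // polyC1 opprK addrAC addNr add0r.
Qed.

Context (G : groupType) (w : wgroup G) (S : comNzRingType) (f : {rmorphism S -> F}).

(** Semisimplicity of Frobenius is not preserved by specialisation in general; it
    is when a power of Frobenius is scalar. *)
Lemma good_map n (r : G -> 'M[S]_n) m nu (l : seq 'M[S]_n) :
  is_rep (wH w) r -> f nu != 0 -> r (wphi w) ^+ m.+1 = nu%:M ->
  (forall i, wI w i -> r i \in l) -> good w (fun s => map_mx f (r s)).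
Proof.
move=> [r1 rM] nu0 rm rl; split.
- by split=> [|g h Hg Hh]; rewrite ?r1 ?map_mx1 // rM // map_mxM.
- by apply: (ssmx_pow nu0 (m := m)); rewrite -map_expmx rm map_scalar_mx.
by exists [seq map_mx f x | x <- l] => i Ii; apply/map_f/rl.
Qed.
End RootsOfScalars.

(** * The ring of integral elements with p inverted *)

Lemma qemb_inj (A : idomainType) (C : Qbar A) : injective (qemb C).
Proof. by move=> x y /fmorph_inj /eqP; rewrite tofrac_eq => /eqP. Qed.

(** The inverses modulo the powers of p are coherent. *)
Lemma zp_unit p (p_prime : prime p) (Zp : padicInt p) u : coprime p u ->
  exists y : Zp, u%:R * y = 1.
Proof.
move=> pu; have pk k : (1 < p ^ k.+1)%N by rewrite -(exp1n k.+1) ltn_exp2r // prime_gt1.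
pose a k : 'Z_(p ^ k.+1) := (u%:R)^-1.
have uU k : (u%:R : 'Z_(p ^ k.+1)) \is a GRing.unit by rewrite unitZpE ?coprimeXl.
have aU k : u%:R * a k = 1 :> 'Z_(p ^ k.+1) by exact: (mulrV (uU k)).
have coh k : (a k : nat) = ((a k.+1 : nat) %% p ^ k.+1)%N.
  have e : (u * (a k.+1 : nat))%:R = 1%:R :> 'Z_(p ^ k.+1).
    have : (u * (a k.+1 : nat))%:R = 1%:R :> 'Z_(p ^ k.+2).
      by rewrite natrM natr_Zp aU.
    move=> /(congr1 (@nat_of_ord _)); rewrite !(val_Zp_nat (pk _)) => h.
    apply: ord_inj; rewrite !(val_Zp_nat (pk _)).
    have pd : (p ^ k.+1 %| p ^ k.+2)%N by apply: dvdn_exp2l.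
    by rewrite -(modn_dvdm _ pd) h modn_dvdm.
  have -> : a k = (a k.+1 : nat)%:R :> 'Z_(p ^ k.+1).
    by apply: (mulrI (uU k)); rewrite aU -natrM e.
  by rewrite (val_Zp_nat (pk _)).
have [y [hy _]] := zp_lim Zp coh.
exists y; apply: zp_eq => k; rewrite rmorphM rmorph_nat hy rmorph1; exact: aU.
Qed.

Section IntegralOverP.
Context (p : nat) (p_prime : prime p) (Zp : padicInt p) (O : idomainType)
  (iota : {rmorphism Zp -> O}) (iota_inj : injective iota) (C : Qbar O).
Local Notation SP := (@intalp_pred _ C p).

Lemma char0_inj (B : nzRingType) (g : {rmorphism Zp -> B}) n : injective g -> n.+1%:R != 0 :> B.
Proof.
move=> gi; apply/eqP => h; have /eqP[] := zp_char0 p_prime Zp n.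
by apply: gi; rewrite rmorph_nat h rmorph0.
Qed.

Lemma char0_C n : n.+1%:R != 0 :> C.
Proof.
apply: (char0_inj (g := qemb C \o iota : {rmorphism Zp -> C})).
by move=> x y /= /(qemb_inj (C:=C)) /iota_inj.
Qed.

Lemma SP_qemb z : qemb C z \in SP.
Proof. by apply/asboolP; exists 0%N; rewrite mul1r; apply: integral_id. Qed.

(** Integers prime to p are units of Z_p, and p is inverted. *)
Lemma SP_nat_inv m : m.+1%:R^-1 \in SP.
Proof.
have [u pu ->] := pfactor_coprime p_prime (ltn0Sn m).
have p0 : p%:R != 0 :> C by have := char0_C p.-1; rewrite prednK ?prime_gt0.
have [y uy] := zp_unit p_prime Zp pu.
rewrite natrM natrX invfM -exprVn; apply: rpredM; last first.
  by apply/rpredX/asboolP; exists 1%N; rewrite expr1 mulfV //; apply: integral1.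
have -> : u%:R^-1 = qemb C (iota y); last exact: SP_qemb.
have h : u%:R * qemb C (iota y) = 1 by have := congr1 (qemb C \o iota) uy; rewrite /= !rmorphM !rmorph_nat !rmorph1.
have u0 : u%:R != 0 :> C by apply: contra_eq_neq h => ->; rewrite mul0r eq_sym oner_neq0.
by apply: (mulfI u0); rewrite mulfV // h.
Qed.

(** Multiply the root by a power of p that clears the denominators of all
    coefficients. *)
Lemma SP_closed (P : {poly C}) z : P \is monic -> P \is a polyOver SP -> root P z -> z \in SP.
Proof.
move=> mP /polyOverP hP rz.
have intp k : integralOver (qemb C) (p%:R ^+ k) by rewrite -natrX; apply: integral_nat.
have [k hk] : exists k, forall x, x \in (P : seq C) -> integralOver (qemb C) (p%:R ^+ k * x).
  have : forall x, x \in (P : seq C) -> x \in SP by move=> x /(nthP 0)[i _ <-]; apply: hP.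
  elim: (P : seq C) => [|x s IH] h; first by exists 0%N.
  have [|k hk] := IH; first by move=> y ys; apply: h; rewrite inE ys orbT.
  have /asboolP[l hl] : x \in SP by apply: h; rewrite mem_head.
  exists (k + l)%N => y; rewrite inE => /orP[/eqP->|/hk hy].
    by rewrite exprD -mulrA; apply: integral_mul.
  by rewrite addnC exprD -mulrA; apply: integral_mul.
pose n := (size P).-1.
have sP : size P = n.+1 by rewrite prednK // size_poly_gt0 monic_neq0.
have Pn : P`_n = 1 by move: mP; rewrite monicE /lead_coef -/n => /eqP.
pose Q := \poly_(i < n.+1) (P`_i * p%:R ^+ (k * (n - i))).
have Qn : Q`_n = 1 by rewrite coef_poly ltnSn subnn muln0 Pn mulr1.
apply/asboolP; exists k; apply: (@integral_root_monic _ _ (qemb C) _ Q).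
- rewrite monicE /lead_coef (_ : size Q = n.+1) ?Qn // size_poly_eq // subnn muln0 Pn mulr1.
  exact: oner_neq0.
- rewrite rootE horner_poly (_ : \sum_(i < n.+1) _ = p%:R ^+ (k * n) * P.[z]).
    by rewrite (rootP rz) mulr0.
  rewrite horner_coef sP mulr_sumr; apply: eq_bigr => i _.
  have ni : (i <= n)%N by rewrite -ltnS.
  have -> : (k * n = k * (n - i) + k * i)%N by rewrite -mulnDr subnK.
  by rewrite exprD exprMn -exprM; ring.
apply/integral_poly => i; rewrite coef_poly; case: ifP => [|_]; last exact: integral0.
rewrite ltnS leq_eqVlt => /orP[/eqP->|ni].
  by rewrite Pn subnn muln0 mulr1; apply: integral1.
have -> : (k * (n - i) = k + k * (n - i).-1)%N by rewrite -mulnS prednK // subn_gt0.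
rewrite exprD mulrA [P`_i * _]mulrC; apply: integral_mul => //.
by apply/hk/mem_nth; rewrite sP ltnW.
Qed.

Definition alg_pred (f : {rmorphism rat -> C}) : {pred C} := fun x => `[< algebraicOver f x >].

Lemma alg_subring f : subring_closed (alg_pred f).
Proof.
split=> [|x y /asboolP hx /asboolP hy|x y /asboolP hx /asboolP hy]; apply/asboolP.
- exact: algebraic1.
- exact: algebraic_sub.
- exact: algebraic_mul.
Qed.
HB.instance Definition _ f := GRing.isSubringClosed.Build C (alg_pred f) (alg_subring f).

Lemma algV f x : x \in alg_pred f -> x^-1 \in alg_pred f.
Proof. by move=> /asboolP h; apply/asboolP/algebraic_inv. Qed.

Lemma alg_root f (P : {poly C}) a : P \is monic -> P \is a polyOver (alg_pred f) ->
  root P a -> a \in alg_pred f.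
Proof.
move=> mP /polyOverP hP ra; apply/asboolP/integral_algebraic.
apply: (integral_root_monic mP ra); apply/integral_poly => i.
by apply/integral_algebraic; have /asboolP := hP i.
Qed.

Lemma alg_sub f : {subset alg_pred f <= SP}.
Proof.
move=> x /asboolP/integral_algebraic[P mP rP]; apply: SP_closed rP; first exact: monic_map.
apply/polyOverP => i; rewrite coef_map /= -[P`_i]divq_num_den fmorph_div !rmorph_int.
apply: rpredM; first exact: rpred_int.
case: (denq _) (denq_gt0 P`_i) => [[|m]|m] //= _; exact: SP_nat_inv.
Qed.

Section Eigen.
Context (G : groupType) (N : nat) (r : G -> 'M[C]_N) (T : G -> O).
Context (hr : is_rep (@whole G) r) (tr : forall g, \tr (r g) = qemb C (T g)).

Lemma whole_rep_unit g : r g \in unitmx.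
Proof.
have [r1 rM] := hr; have h : r g *m r g^-1%g = 1%:M by rewrite -rM // mulgV r1.
by have [] := mulmx1_unit h.
Qed.

(** The power sums of the eigenvalues are traces, so Newton's identities apply. *)
Lemma eigS g z : root (char_poly (r g)) z -> z \in SP.
Proof.
move=> rz; have [s [sz sP] sr] := spec_exists (whole_rep_unit g).
apply: (@SP_closed (\prod_(z <- s) ('X - z%:P))); first exact: monic_prod_XsubC.
  apply: newton_coef; [exact: SP_nat_inv | exact: char0_C | move=> m].
  by rewrite -sP (whole_repX _ _ hr) tr; apply: SP_qemb.
by rewrite root_prod_XsubC sr.
Qed.

(** The inverses are eigenvalues of the inverse element. *)
Lemma eigSV g z : root (char_poly (r g)) z -> z^-1 \in SP.
Proof.
have [r1 rM] := hr; move=> /eigen_col[x x0 rx].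
have e : x = z *: (r g^-1%g *m x) by rewrite scalemxAr -rx mulmxA -rM // mulVg r1 mul1mx.
have z0 : z != 0 by apply: contraNneq x0 => h; rewrite e h scale0r.
apply: (@eigS g^-1%g); apply: (root_eigen x0).
by rewrite {2}e scalerA mulVf // scale1r.
Qed.

Definition ival : {rmorphism intalp C p -> C} := \val.

Lemma ival_inj : injective ival.
Proof. exact: val_inj. Qed.

Lemma lam_exists g : exists lam : seq (intalp C p), spec (r g) [seq ival x | x <- lam].
Proof.
have [s sA sr] := spec_exists (whole_rep_unit g).
have [lam lE] : exists lam : seq (intalp C p), [seq ival x | x <- lam] = s.
  have : forall z, z \in s -> z \in SP by move=> z; rewrite sr; apply: eigS.
  elim: {sA sr} s => [|z s IH] h; first by exists [::].
  have [|lam lE] := IH; first by move=> y ys; apply: h; rewrite inE ys orbT.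
  by exists (Intalp (h z (mem_head _ _)) :: lam); rewrite /= lE.
by exists lam; rewrite lE.
Qed.
End Eigen.

Definition intalp_of (z : O) : intalp C p := Intalp (SP_qemb z).

Fact intalp_of_zmod : GRing.zmod_morphism intalp_of.
Proof. by move=> x y; apply: val_inj; exact: (rmorphB (qemb C) x y). Qed.
Fact intalp_of_monoid : GRing.monoid_morphism intalp_of.
Proof. by split=> [|x y]; apply: val_inj; [exact: (rmorph1 (qemb C)) | exact: (rmorphM (qemb C) x y)]. Qed.
HB.instance Definition _ := GRing.isZmodMorphism.Build O (intalp C p) intalp_of intalp_of_zmod.
HB.instance Definition _ := GRing.isMonoidMorphism.Build O (intalp C p) intalp_of intalp_of_monoid.

Lemma intalp_integral (x : intalp C p) : p_integral intalp_of p x.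
Proof.
have /asboolP[k [P mP rP]] := valP x; exists P, k; split=> //.
rewrite rootE; apply/eqP/val_inj; rewrite -[RHS]/(0 : C) -(rootP rP).
transitivity (map_poly ival (map_poly intalp_of P)).[ival (p%:R ^+ k * x)].
  by rewrite horner_map.
rewrite -map_poly_comp rmorphM rmorphXn rmorph_nat.
by congr (_.[_]); apply: eq_map_poly.
Qed.
End IntegralOverP.

(** * Realisation of the irreducible constituents *)

Lemma irr_conj (F : fieldType) (G : groupType) (H : G -> Prop) n (r r' : G -> 'M[F]_n) P :
  P \in unitmx -> is_rep H r' -> (forall g, H g -> r' g = invmx P *m r g *m P) ->
  irreducible_rep H r -> irreducible_rep H r'.
Proof.
move=> uP hr' rE [_ n0 irr]; split=> // U sU.
pose PL : 'Hom('cV[F]_n, 'cV[F]_n) := linfun (mulmx P).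
have PLE (x : 'cV_n) : PL x = P *m x by rewrite lfunE.
have sV : stable_sub H r (PL @: U)%VS.
  move=> g Hg _ /memv_imgP[x xU ->]; apply/memv_imgP; exists (r' g *m x); first exact: sU.
  by rewrite !PLE rE // !mulmxA mulmxV // mul1mx.
have Pinj (x y : 'cV_n) : P *m x = P *m y -> x = y by move=> /(can_inj (mulKmx uP)).
have [V0|V1] := irr _ sV; [left|right].
  apply/eqP; rewrite -subv0; apply/subvP => x xU; rewrite memv0; apply/eqP/Pinj.
  have : PL x \in (PL @: U)%VS by apply: memv_img.
  by rewrite V0 memv0 PLE mulmx0 => /eqP.
apply/vspaceP => x; rewrite memvf.
have : P *m x \in (PL @: U)%VS by rewrite V1 memvf.
by case/memv_imgP=> y yU; rewrite PLE => /Pinj->.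
Qed.

Section Pieces.
Context (p : nat) (p_prime : prime p) (Zp : padicInt p) (K : fieldType) (v : dval K)
  (L : algClosure K) (W : localWeil Zp v L).
Context (O : idomainType) (iota : {rmorphism Zp -> O}) (iota_inj : injective iota) (C : Qbar O).
Let w := weil_group W.
Local Notation SP := (@intalp_pred _ C p).
Local Notation S := (intalp C p).
Local Notation iv := (ival p C).

(** An irreducible constituent of a primitive part, with coefficients in S. The
    field co_pow keeps Frobenius semisimple after any specialisation of S. *)
Record constituent := Constituent {
  co_t : nat; co_dim : nat; co_rep : AbsGal L -> 'M[S]_co_dim;
  co_t0 : (0 < co_t)%N;
  co_isrep : is_rep (wH w) co_rep;
  co_irr : irreducible_rep (wH w) (fun s => map_mx iv (co_rep s));
  co_pow : exists m nu nu', nu * nu' = 1 /\ co_rep (wphi w) ^+ m.+1 = nu%:M;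
  co_fin : exists l : seq 'M[S]_co_dim, forall i, wI w i -> co_rep i \in l }.

HB.instance Definition _ := gen_eqMixin constituent.

Let charC := char0_C p_prime iota_inj C.
Context (d : nat) (r : AbsGal L -> 'M[C]_d) (gr : good w r).
Context (eig : forall z, root (char_poly (r (wphi w))) z -> z \in SP /\ z^-1 \in SP).

Definition to_intalp (x : C) : S := insubd 0 x.
Lemma to_intalpK x : x \in SP -> iv (to_intalp x) = x.
Proof. by move=> h; rewrite /to_intalp /ival; exact: insubdK. Qed.

Lemma map_ival_inj n : injective (fun A : 'M[S]_n => map_mx iv A).
Proof.
by move=> A B /matrixP e; apply/matrixP=> i j; have := e i j; rewrite !mxE => /ival_inj.
Qed.

(** A conjugate of the constituent has entries in S, because its Frobenius
    eigenvalue and the inverse of it are in S. *)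
Lemma piece_realize q t (c : piece C d) : (0 < t)%N -> piece_ok w r q c ->
  exists x : constituent, co_t x = t /\
    forall g, wH w g -> \tr (r g *m (pc_X c *m pc_Y c)) = \tr (map_mx iv (co_rep x g)).
Proof.
move=> t0 ok; have [YX ir tX tY qX] := ok.
have gR := good_piece gr ok; have [_ n0 _] := ir.
have [mu rmu] : exists mu, root (char_poly (piece_rep r c (wphi w))) mu.
  by apply/closed_rootP; rewrite size_char_poly eqSS -lt0n.
have [x x0 Rx] := eigen_col rmu.
have : root (char_poly (r (wphi w))) mu.
  apply: (@root_eigen _ _ _ (pc_X c *m x)).
    by apply: contraNneq x0 => h; rewrite -[x]mul1mx -YX -mulmxA h mulmx0.
  by rewrite mulmxA (tX _ (wHphi w)) -mulmxA Rx scalemxAr.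
move=> /eig[muS muVS].
have [f _] := rat_morph charC.
have [P [m [uP m0 Rm ent]]] := @good_realize C _ w (alg_pred f) (@algV _ C f) (@alg_root _ C f)
  _ (piece_rep r c) mu x gR ir x0 Rx.
have [R RE] : exists R, R = piece_rep r c by exists (piece_rep r c).
rewrite -RE in ir tX tY gR Rm ent Rx.
pose r' g : 'M[S]_(pc_e c) := \matrix_(i, j) to_intalp ((invmx P *m R g *m P) i j).
have r'E g : wH w g -> map_mx iv (r' g) = invmx P *m R g *m P.
  move=> Hg; apply/matrixP=> i j; rewrite mxE mxE to_intalpK //.
  by apply: (ent (SP : subringClosed C)) => //; apply: (alg_sub p_prime iota_inj).
have [[R1 RM] _ [l lP]] := gR.
have rep : is_rep (wH w) r'.
  split=> [|g h Hg Hh]; apply: map_ival_inj.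
    rewrite r'E; last exact: wH1.
    by rewrite R1 mulmx1 mulVmx // map_mx1.
  rewrite map_mxM !r'E //; last exact: wHM.
  by rewrite RM // !mulmxA -[_ *m P *m invmx P]mulmxA mulmxV // mulmx1.
have irr : irreducible_rep (wH w) (fun s => map_mx iv (r' s)).
  apply: (irr_conj uP _ r'E ir); case: rep => r1 rM.
  by split=> [|g h Hg Hh]; rewrite ?r1 ?map_mx1 // rM // map_mxM.
have cj (A : 'M_(pc_e c)) n : (invmx P *m A *m P) ^+ n = invmx P *m A ^+ n *m P.
  elim: n => [|n IH]; first by rewrite !expr0 mulmx1 mulVmx.
  by rewrite !expmxS IH !mulmxA -[_ *m P *m invmx P]mulmxA mulmxV // mulmx1.
have mu0 : mu != 0.
  have [uR _] := rep_unit (let: And3 h _ _ := gR in h) (wHphi w).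
  apply: contraNneq x0 => z; rewrite z scale0r in Rx.
  by rewrite -[x]mul1mx -(mulVmx uR) -mulmxA Rx mulmx0.
have pow : exists m nu nu', nu * nu' = 1 /\ r' (wphi w) ^+ m.+1 = nu%:M.
  exists m.-1, (to_intalp (mu ^+ m)), (to_intalp (mu^-1 ^+ m)); split.
    apply: (@ival_inj _ _ C); rewrite rmorphM rmorph1 !to_intalpK ?rpredX //.
    by rewrite -exprMn mulfV // expr1n.
  apply: map_ival_inj; rewrite prednK // map_expmx r'E ?cj; last exact: wHphi.
  by rewrite Rm mul_mx_scalar -scalemxAl mulVmx // map_scalar_mx to_intalpK ?rpredX // scalemx1.
have fin : exists l : seq 'M[S]_(pc_e c), forall i, wI w i -> r' i \in l.
  exists [seq (\matrix_(i, j) to_intalp ((invmx P *m y *m P) i j) : 'M[S]_(pc_e c)) | y <- l] => i Ii.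
  by apply/mapP; exists (R i) => //; apply: lP.
exists (Constituent t0 rep irr pow fin); split=> //= g Hg.
rewrite r'E // mulmxA mxtrace_mulC !mulmxA [RHS]mxtrace_mulC mulmxA mulmxV // mul1mx.
by rewrite RE.
Qed.

Lemma pieces_realize q t (ps : seq (piece C d)) : (0 < t)%N ->
  (forall c, c \in ps -> piece_ok w r q c) ->
  exists xs : seq constituent, [/\ all (fun x => co_t x == t) xs,
    pairwise leq [seq co_t x | x <- xs] &
    forall g, wH w g -> \tr (r g *m (\sum_(c <- ps) pc_X c *m pc_Y c)) =
      \sum_(x <- xs) \tr (map_mx iv (co_rep x g))].
Proof.
move=> t0; elim: ps => [|c ps IH] ok.
  by exists [::]; split=> // g _; rewrite !big_nil mulmx0 mxtrace0.
have [|xs [xt xp xE]] := IH; first by move=> c' c'ps; apply: ok; rewrite inE c'ps orbT.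
have [x [tx xg]] := piece_realize t0 (ok c (mem_head _ _)).
exists (x :: xs); split=> [||g Hg] /=; first by rewrite tx eqxx.
  rewrite xp andbT; apply/allP => _ /mapP[y yxs ->].
  by rewrite tx (eqP (allP xt y yxs)).
by rewrite !big_cons mulmxDr raddfD /= xg // xE.
Qed.

(** The primitive parts are treated by increasing weight, which makes the indices
    t ascend. *)
Lemma constituents (chi : AbsGal L -> C) (chi0 : forall g, wH w g -> chi g != 0) N e
  (lf : lefschetz w chi r N e) :
  exists Ls : seq constituent, sorted leq [seq co_t x | x <- Ls] /\
    forall k g, wH w g -> \tr (r g *m primitive lf k) =
      \sum_(x <- Ls | co_t x == k.+1) \tr (map_mx iv (co_rep x g)).
Proof.
have key B : exists Ls : seq constituent, [/\ all (fun x => (co_t x <= B)%N) Ls,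
    pairwise leq [seq co_t x | x <- Ls] &
    forall k g, (k < B)%N -> wH w g -> \tr (r g *m primitive lf k) =
      \sum_(x <- Ls | co_t x == k.+1) \tr (map_mx iv (co_rep x g))].
  elim: B => [|B [Ls [aL pL eL]]]; first by exists [::].
  have [ps [pE ok]] := good_decomp charC gr (prim_tw chi0 lf B) (prim_idem lf B).
  have [xs [ax px ex]] := pieces_realize (ltn0Sn B) ok.
  have ax' x : x \in xs -> co_t x = B.+1 by move=> /(allP ax)/eqP.
  exists (Ls ++ xs); split=> [||k g].
  - rewrite all_cat; apply/andP; split; first by apply: sub_all aL => x /leqW.
    by apply/allP => x /ax' ->.
  - rewrite map_cat pairwise_cat pL px !andbT; apply/allrelP => _ _ /mapP[x xL ->] /mapP[y yx ->].
    by rewrite (ax' y yx) leqW // (allP aL x xL).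
  rewrite ltnS leq_eqVlt => /orP[/eqP->|kB] Hg; rewrite big_cat /=.
    rewrite big_seq_cond big1 ?add0r => [|x /andP[xL /eqP h]]; last first.
      by have := allP aL x xL; rewrite h ltnn.
    rewrite big_seq_cond (eq_bigl (fun x => x \in xs)) => [|x]; last first.
      by case xxs: (x \in xs) => //=; rewrite ax' ?eqxx.
    by rewrite -big_seq pE ex.
  rewrite [X in _ = _ + X]big_seq_cond [X in _ = _ + X]big1 ?addr0 ?eL // => x /andP[/ax'->].
  by rewrite eqSS => /eqP h; rewrite h ltnn in kB.
have [s0 [out _]] := gr_sum (lf_gr lf).
pose B := (\max_(m <- s0) `|m|%N).+1.
have e0 k : (B <= k)%N -> primitive lf k = 0.
  move=> Bk; rewrite -prim_e out ?mulmx0 //; apply/negP => ks.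
  have := @leq_bigmax_seq _ s0 xpredT absz _ ks isT; rewrite /= => h.
  by have := leq_ltn_trans h Bk; rewrite ltnn.
have [Ls [aL pL eL]] := key B; exists Ls; split=> [|k g Hg].
  by rewrite sorted_pairwise //; apply: leq_trans.
have [kB|Bk] := ltnP k B; first exact: eL.
rewrite e0 // mulmx0 mxtrace0 big_seq_cond big1 // => x /andP[xL /eqP h].
by have := allP aL x xL; rewrite h ltnNge Bk.
Qed.
End Pieces.

(** * Points of the locus *)

(** The unipotent part fixes a vector of each eigenspace of S. *)
Lemma ss_eig (F : closedFieldType) n (A S U : 'M[F]_n) z : A = S *m U ->
  S *m U = U *m S -> nilpotent_mx (U - 1%:M) ->
  root (char_poly S) z -> root (char_poly A) z.
Proof.
move=> AE SU nU /eigen_col[x x0 Sx]; have [j [y0 Uy]] := nilp_last nU x0.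
apply: (root_eigen y0).
have cS : S *m (U - 1%:M) = (U - 1%:M) *m S by rewrite mulmxBr mulmxBl SU mulmx1 mul1mx.
have cj : S *m (U - 1%:M) ^+ j = (U - 1%:M) ^+ j *m S by apply/esym/expmx_twine; rewrite cS.
have Sy : S *m ((U - 1%:M) ^+ j *m x) = z *: ((U - 1%:M) ^+ j *m x).
  by rewrite mulmxA cj -mulmxA Sx -scalemxAr.
move: Sy Uy; move: ((U - 1%:M) ^+ j *m x) => y Sy.
rewrite mulmxBl mul1mx => /eqP; rewrite subr_eq0 => /eqP Uy.
by rewrite AE -mulmxA Uy Sy.
Qed.

Lemma is_rep_dsum (G : groupType) (H : G -> Prop) (A : comNzRingType) n (d : 'I_n -> nat)
  (r : forall i, G -> 'M[A]_(d i)) : (forall i, is_rep H (r i)) -> is_rep H (rep_dsum r).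
Proof.
move=> hr; split=> [|g h Hg Hh]; rewrite /rep_dsum.
  by rewrite -mxdiag1; apply: eq_mxdiag => i; case: (hr i).
by rewrite mxdiagM; apply: eq_mxdiag => i; case: (hr i) => _ ->.
Qed.

Section Traces.
Context (p : nat) (Zp : padicInt p) (K : fieldType) (v : dval K) (L : algClosure K)
  (W : localWeil Zp v L) (E : closedFieldType).

Lemma wd_iso_trace (D D' : wdrep (AbsGal L) E) s : wd_iso W D D' -> weil v (lw_q W) s ->
  \tr (wd_rep D s) = \tr (wd_rep D' s).
Proof.
move=> [P [Q [PQ QP h _]]] Hs.
rewrite -[wd_rep D' s]mulmx1 -PQ mulmxA -h // -[RHS]mxtrace_mulC mulmxA QP mul1mx //.
Qed.

Lemma Sp_trace t d (r : AbsGal L -> 'M[E]_d) s :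
  \tr (wd_rep (Sp W t r) s) = \sum_(j < t) \tr (art_inv W E s ^+ j *: r s).
Proof.
rewrite mxtrace_mxdiag (reindex_inj rev_ord_inj) /=; apply: eq_bigr => j _.
by congr (\tr (_ ^+ _ *: _)); have := ltn_ord j; lia.
Qed.
End Traces.

(** A lift is only prescribed on the elements of A, through their integrality. *)
Lemma dagE p (A B : idomainType) (f : {rmorphism A -> B}) (CA : Qbar A) (CB : Qbar B)
  (dag : ilift p f CA CB) z : dag (intalp_of p CA z) = intalp_of p CB (f z).
Proof.
have iz : qemb CA z \in @intal_pred _ CA by apply/asboolP/integral_id.
apply: val_inj; rewrite /= (@ilift_intalp_ext _ _ _ _ _ _ dag (Intal iz)) //.
by apply: ilift_ext.
Qed.

Section Main.
Context (p : nat) (p_prime : prime p) (Zp : padicInt p)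
  (F : fieldExtType rat) (Fbar : algClosure F)
  (w : dval F) (w_nmid_p : w p%:R = 0)
  (K : completion w) (Kbar : algClosure K)
  (W : localWeil Zp (cp_val K) Kbar) (dec : decomposition Fbar Kbar)
  (O : idomainType) (iota : {rmorphism Zp -> O}) (iota_inj : injective iota)
  (Lbar : Qbar O) (n : nat) (Ti : 'I_n -> AbsGal Fbar -> O)
  (d : 'I_n -> nat) (sigma : forall i, AbsGal Fbar -> 'M[Lbar]_(d i))
  (sigma_irr : forall i, irreducible_rep (@whole _) (sigma i))
  (sigma_tr : forall i g, qemb Lbar (Ti i g) = \tr (sigma i g))
  (sigma_mono : forall i,
     monodromic W (qemb Lbar \o iota : {rmorphism Zp -> Lbar})
       (fun s : AbsGal Kbar => sigma i (dec s))).
Local Notation S := (intalp Lbar p).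
Local Notation zL := (qemb Lbar \o iota : {rmorphism Zp -> Lbar}).
Let wg := weil_group W.
Let charL := char0_C p_prime iota_inj Lbar.

Let pF0 : p%:R != 0 :> F.
Proof.
have := prime_gt0 p_prime; case: p => // m _.
by rewrite -scaler_nat scaler_eq0 oner_eq0 orbF pnatr_eq0.
Qed.

Lemma residual_val : cp_val K p%:R = 0.
Proof. by rewrite -(rmorph_nat (cp_emb K)) cp_valE. Qed.

Lemma residual_neq0 : p%:R != 0 :> K.
Proof. by rewrite -(rmorph_nat (cp_emb K)) fmorph_eq0. Qed.

Let vp := residual_val.
Let pK := residual_neq0.
Let sigma_rep i : is_rep (@whole _) (sigma i).
Proof. by case: (sigma_irr i). Qed.

Record sig_frss i := SigFrss {
  sf_N : 'M[Lbar]_(d i); sf_S : 'M[Lbar]_(d i); sf_U : 'M[Lbar]_(d i);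
  sf_rr : AbsGal Kbar -> 'M[Lbar]_(d i);
  sf_fd : frss_data W zL (fun s => sigma i (dec s)) sf_N sf_S sf_U sf_rr }.

Lemma sig_frss_exists i : inhabited (sig_frss i).
Proof.
have [N mN] := sigma_mono i.
have uA := rep_dec_unit (dec1 dec) (decM dec) (sigma_rep i) (weil_phi W).
have [S' [U [SU SUC sS nU _]]] := jordan_exists uA.
have fd := frss_of p_prime vp pK charL (dec_is_rep (dec1 dec) (decM dec) _ (sigma_rep i)) mN SU SUC sS nU.
constructor; exact: (SigFrss fd).
Qed.

Definition sf i : sig_frss i :=
  let: exist x _ := cid (let: inhabits x := sig_frss_exists i in ex_intro (fun=> True) x Logic.I) in x.

Definition tot_rr g := \mxdiag_i sf_rr (sf i) g.
Definition tot_N := \mxdiag_i sf_N (sf i).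

Lemma tot_good : good wg tot_rr.
Proof. exact: (good_mxdiag (fun i => fd_good (sf_fd (sf i)))). Qed.

Lemma tot_tr g : \tr (rep_dsum sigma g) = qemb Lbar (\sum_i Ti i g).
Proof. by rewrite mxtrace_mxdiag rmorph_sum; apply: eq_bigr => i _; rewrite sigma_tr. Qed.

(** Eigenvalues of the semisimple part are eigenvalues of the full Frobenius. *)
Lemma tot_eig z : root (char_poly (tot_rr (lw_phi W))) z ->
  z \in @intalp_pred _ Lbar p /\ z^-1 \in @intalp_pred _ Lbar p.
Proof.
have hr := is_rep_dsum sigma_rep; move=> rz.
have : root (char_poly (rep_dsum sigma (dec (lw_phi W)))) z.
  have fd i := sf_fd (sf i).
  apply: (@ss_eig _ _ _ (\mxdiag_i sf_S (sf i)) (\mxdiag_i sf_U (sf i))).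
  - by rewrite mxdiagM; apply: eq_mxdiag => i; apply: (fd_SU (fd i)).
  - by rewrite !mxdiagM; apply: eq_mxdiag => i; apply: (fd_USC (fd i)).
  - have -> : \mxdiag_i sf_U (sf i) - 1%:M = \mxdiag_i (sf_U (sf i) - 1%:M).
      by rewrite -[in LHS](mxdiag1 Lbar d) -mxdiagB.
    by apply: nilp_dsum => i; apply: (fd_U (fd i)).
  have <- : tot_rr (lw_phi W) = \mxdiag_i sf_S (sf i); last exact: rz.
  by apply: eq_mxdiag => i; apply: (fd_phi (fd i)).
by move=> h; split; [apply: (eigS p_prime iota_inj hr tot_tr h) | apply: (eigSV p_prime iota_inj hr tot_tr h)].
Qed.

(** The dimensions agree since in characteristic 0 they are the traces at 1. *)
Lemma transfer (E k : closedFieldType) (chark : forall m, m.+1%:R != 0 :> k)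
  (jE : {rmorphism O -> E}) (psi : {rmorphism O -> k}) (f : {rmorphism S -> E})
  (jEE : forall z, f (intalp_of p Lbar z) = jE z) (ker : forall z, jE z = 0 -> psi z = 0)
  (zE : {rmorphism Zp -> E}) (zk : {rmorphism Zp -> k}) (zEE : forall t, zE t = jE (iota t))
  (dE dk : 'I_n -> nat) (rho : forall i, AbsGal Fbar -> 'M[E]_(dE i))
  (rhok : forall i, AbsGal Fbar -> 'M[k]_(dk i))
  (hr : forall i, is_rep (@whole _) (rho i)) (hk : forall i, irreducible_rep (@whole _) (rhok i))
  (trr : forall i g, \tr (rho i g) = jE (Ti i g)) (trk : forall i g, \tr (rhok i g) = psi (Ti i g))
  (purek : forall i, pure_rep W zk (fun s => rhok i (dec s))) :
  [/\ exists e, lefschetz wg (art_inv W Lbar) tot_rr tot_N e,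
      forall i g, weil (cp_val K) (lw_q W) g -> \tr (sf_rr (sf i) g) = \tr (sigma i (dec g)) &
      forall (e0 : int -> 'M[Lbar]_(\sum_i d i))
        (lf0 : lefschetz wg (art_inv W Lbar) tot_rr tot_N e0)
        (m : nat) (t ee : 'I_m -> nat) (t0 : forall i, (0 < t i)%N)
        (rl : forall i, AbsGal Kbar -> 'M[S]_(ee i)),
        (forall l, good wg (fun s => map_mx f (rl l s))) ->
        (forall k g, wH wg g -> \tr (tot_rr g *m primitive lf0 k) =
          \sum_(l < m | t l == k.+1) \tr (map_mx (ival p Lbar) (rl l g))) ->
        wd_frss_iso W zE (rep_dsum (fun i s => rho i (dec s)))
          (wd_dsum (fun l => Sp W (t l) (fun s => map_mx f (rl l s))))].
Proof.
have charE m : m.+1%:R != 0 :> E.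
  apply/eqP => h; have /eqP[] := chark m; rewrite -(rmorph_nat psi); apply: ker.
  by rewrite rmorph_nat.
have dO i : Ti i 1%g = (d i)%:R.
  apply: (@qemb_inj _ Lbar); rewrite sigma_tr rmorph_nat.
  by case: (sigma_rep i) => -> _; rewrite mxtrace1.
have eE : dE = d.
  apply: funext => i; apply: (natc_inj charE); have := trr i 1%g.
  by case: (hr i) => -> _; rewrite mxtrace1 dO rmorph_nat.
have ek : dk = d.
  apply: funext => i; apply: (natc_inj chark); have := trk i 1%g.
  by case: (hk i) => -[-> _] _ _; rewrite mxtrace1 dO rmorph_nat.
subst dE dk.
have d0 i : (0 < d i)%N by case: (sigma_irr i).
have trs i g : \tr (sigma i g) = qemb Lbar (Ti i g) by rewrite sigma_tr.
have jLE z : ival p Lbar (intalp_of p Lbar z) = qemb Lbar z by [].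
have psip : psi p%:R != 0.
  by rewrite rmorph_nat; have := chark p.-1; rewrite prednK ?prime_gt0.
pose lam i := sval (cid (lam_exists p_prime iota_inj (sigma_rep i) (trs i) (dec (lw_phi W)))).
have lamP i : spec (sigma i (dec (lw_phi W))) [seq ival p Lbar x | x <- lam i].
  by rewrite /lam; case: cid.
have lI := @ival_inj p O Lbar; have qI := @qemb_inj O Lbar.
have Sint := @intalp_integral p O Lbar.
have fdL i := sf_fd (sf i).
split.
- exact: (lef_total p_prime vp pK (dec1 dec) (decM dec) charL charE chark lI qI jLE jEE ker psip
    Sint zEE d0 sigma_rep hr hk trs trr trk fdL purek lamP).
- exact: (frss_trace p_prime vp pK (dec1 dec) (decM dec) charL charE chark lI qI jLE jEE ker psip
    Sint zEE d0 sigma_rep hr hk trs trr trk fdL purek lamP).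
move=> e0 lf0 m t ee t0 rl.
exact: (case_iso p_prime vp pK (dec1 dec) (decM dec) charL charE chark lI qI jLE jEE ker psip
    Sint zEE d0 sigma_rep hr hk trs trr trk fdL purek lamP t0).
Qed.

Section Point.
Context (x : locus_elt W dec iota Ti).

Definition le_psi : {rmorphism O -> le_kbar x} :=
  (qemb (le_kbar x) \o le_pi x \o le_res x : {rmorphism O -> le_kbar x}).

Lemma le_char0 m : m.+1%:R != 0 :> le_kbar x.
Proof.
apply: (char0_inj p_prime (g := qemb (le_kbar x) \o le_Qp x \o @tofrac Zp : {rmorphism Zp -> le_kbar x})).
by move=> a b /= /(@qemb_inj _ (le_kbar x)) /fmorph_inj /eqP; rewrite tofrac_eq => /eqP.
Qed.

(** If a in P had a nonzero residue, a b - t would vanish in the residue field for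
    some b and some t outside P; but it lies outside P, so it is a unit there. *)
Lemma residue_P a : a \in le_P x -> le_red x (le_loc x a) = 0.
Proof.
have [unitP frac _] := le_locP x; move=> aP; apply/eqP/negPn/negP => y0.
have [b' hb] := le_red_surj (le_red x (le_loc x a))^-1.
have [b [t [tP bE]]] := frac b'.
have h : le_red x (le_loc x (a * b - t)) = 0.
  have ut := unitP t tP.
  rewrite !rmorphB !rmorphM; apply/eqP; rewrite subr_eq0; apply/eqP.
  have -> : le_loc x b = b' * le_loc x t by rewrite bE mulrVK.
  by rewrite rmorphM hb mulrA mulfV // mul1r.
have nP : a * b - t \notin le_P x.
  apply: contra tP => hP; have abP : a * b \in le_P x by rewrite mulrC; apply: idealMr.
  by have := rpredB abP hP; rewrite opprB addrC subrK.
have := rmorph_unit (le_red x) (unitP _ nP); rewrite h unitr0 //.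
Qed.

(** An element with nonzero residue lies outside P, hence is inverted. *)
Lemma pi_unit z : le_psi z != 0 -> le_loc x (le_res x z) \is a GRing.unit.
Proof.
move=> h; have [unitP _ _] := le_locP x; apply: unitP; apply: contra h => /residue_P e.
by rewrite /le_psi /= e rmorph0.
Qed.
End Point.
End Main.

Theorem theorem5p6
  (p : nat) (p_prime : prime p) (Zp : padicInt p)
  (F : fieldExtType rat) (Fbar : algClosure F)
  (w : dval F) (w_nmid_p : w p%:R = 0)
  (K : completion w) (Kbar : algClosure K)
  (W : localWeil Zp (cp_val K) Kbar) (dec : decomposition Fbar Kbar)
  (O : idomainType) (iota : {rmorphism Zp -> O}) (iota_inj : injective iota)
  (Lbar : Qbar O)
  (n : nat) (n_gt0 : (0 < n)%N)
  (T : AbsGal Fbar -> O) (T_pseudo : pseudocharacter T)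
  (Ti : 'I_n -> AbsGal Fbar -> O) (T_sum : forall g, T g = \sum_i Ti i g)
  (d : 'I_n -> nat) (sigma : forall i, AbsGal Fbar -> 'M[Lbar]_(d i))
  (sigma_irr : forall i, irreducible_rep (@whole _) (sigma i))
  (sigma_tr : forall i g, qemb Lbar (Ti i g) = \tr (sigma i g))
  (sigma_mono : forall i,
     monodromic W (qemb Lbar \o iota : {rmorphism Zp -> Lbar})
       (fun s : AbsGal Kbar => sigma i (dec s)))
  (locus_nonempty : inhabited (locus_elt W dec iota Ti)) :
  exists (m : nat) (t e : 'I_m -> nat)
         (r : forall i, AbsGal Kbar -> 'M[intalp Lbar p]_(e i)),
    [/\ (0 < m)%N,
        forall i, (0 < t i)%N,
        forall i j : 'I_m, (i <= j)%N -> (t i <= t j)%N,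
        forall i, irr_fss_rep W (r i) &
        (forall s : AbsGal Kbar, weil (cp_val K) (lw_q W) s ->
           qemb Lbar (T (dec s)) =
             \sum_(i < m) \sum_(j < t i)
               \tr (art_inv W Lbar s ^+ j *:
                      map_mx (@intalp_val O Lbar p) (r i s))) /\
        (forall (x : locus_elt W dec iota Ti) (c : locus_choice x)
           (res_dag : ilift p (le_res x) Lbar (lc_Abar c))
           (pi_dag : ilift p (le_pi x) (lc_Abar c) (le_kbar x))
           (pia_dag : ilift p (lc_piahp c) (lc_Abar c) (lc_Bbar c)),
         [/\ wd_frss_iso W (le_Zp_kbar x)
               (rep_dsum (fun i (s : AbsGal Kbar) => le_rho x i (dec s)))
               (wd_dsum (fun i => Sp W (t i) (fun s =>
                  map_mx (fun a : intalp Lbar p =>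
                    intalp_val (pi_dag (res_dag a))) (r i s)))),
             wd_frss_iso W (lc_Zp_Bbar c)
               (rep_dsum (fun i (s : AbsGal Kbar) =>
                  map_mx (qemb (lc_Bbar c) \o lc_pia c)
                    (lc_rhoh c i (dec s))))
               (wd_dsum (fun i => Sp W (t i) (fun s =>
                  map_mx (fun a : intalp Lbar p =>
                    intalp_val (pia_dag (res_dag a))) (r i s)))),
             wd_frss_iso W (lc_Zp_Abar c)
               (rep_dsum (fun i (s : AbsGal Kbar) => lc_rho c i (dec s)))
               (wd_dsum (fun i => Sp W (t i) (fun s =>
                  map_mx (fun a : intalp Lbar p =>
                    intalp_val (res_dag a)) (r i s)))) &
             wd_frss_iso W (qemb Lbar \o iota : {rmorphism Zp -> Lbar})
               (rep_dsum (fun i (s : AbsGal Kbar) => sigma i (dec s)))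
               (wd_dsum (fun i => Sp W (t i) (fun s =>
                  map_mx (@intalp_val O Lbar p) (r i s))))])].
Proof.
have charL := char0_C p_prime iota_inj Lbar.
have zLE t : (qemb Lbar \o iota : {rmorphism Zp -> Lbar}) t = qemb Lbar (iota t) by [].
have psi0 (y : locus_elt W dec iota Ti) (E : closedFieldType) (jE : {rmorphism O -> E}) :
    injective jE -> forall z, jE z = 0 -> le_psi y z = 0.
  by move=> jI z h; rewrite (jI z 0) ?rmorph0.
have rep_sigma i : is_rep (@whole _) (sigma i) by case: (sigma_irr i).
have trs i g : \tr (sigma i g) = qemb Lbar (Ti i g) by rewrite sigma_tr.
have trk (y : locus_elt W dec iota Ti) i g : \tr (le_rho y i g) = le_psi y (Ti i g).
  by rewrite -le_rho_tr.
have jLE z : ival p Lbar (intalp_of p Lbar z) = qemb Lbar z by [].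
have isoL y := transfer p_prime w_nmid_p iota_inj sigma_irr sigma_tr sigma_mono (le_char0 p_prime y)
  jLE (psi0 y _ _ (@qemb_inj _ Lbar)) zLE rep_sigma (le_rho_irr y) trs (trk y)
  (le_rho_pure y).
(* The Lefschetz grading over Lbar, and with it t and r, comes from one point x0;
   other points enter only by comparison of primitive parts with it. *)
have [x0] := locus_nonempty; have [[e0 lf0] trL isoL0] := isoL x0.
have chi0 g : wH (weil_group W) g -> art_inv W Lbar g != 0.
  by move=> _; rewrite /art_inv expfz_neq0 // q_neq0.
have [Ls [sLs trE]] := constituents p_prime iota_inj
  (tot_good p_prime w_nmid_p iota_inj sigma_irr sigma_mono)
  (@tot_eig _ p_prime _ _ _ _ w_nmid_p _ _ _ _ _ _ iota_inj _ _ _ _ _ sigma_irr sigma_tr sigma_mono) chi0 lf0.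
pose c (i : 'I_(size Ls)) := tnth (in_tuple Ls) i.
have trE' k g : wH (weil_group W) g ->
    \tr (tot_rr p_prime w_nmid_p iota_inj sigma_irr sigma_mono g *m primitive lf0 k) =
    \sum_(l < size Ls | co_t (c l) == k.+1) \tr (map_mx (ival p Lbar) (co_rep (c l) g)).
  by move=> Hg; rewrite trE // big_tnth.
have t0 i : (0 < co_t (c i))%N by apply: co_t0.
have good_co (E : closedFieldType) (charE : forall m, m.+1%:R != 0 :> E)
    (f : {rmorphism intalp Lbar p -> E}) i :
    good (weil_group W) (fun s => map_mx f (co_rep (c i) s)).
  have [m [nu [nu' [nn h]]]] := co_pow (c i); have [l hl] := co_fin (c i).
  apply: (good_map charE (co_isrep (c i)) _ h hl).
  by apply/eqP => z; have /eqP := congr1 f nn; rewrite rmorphM z mul0r rmorph1 eq_sym oner_eq0.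
have iso_sigma := isoL0 e0 lf0 _ _ _ t0 (fun i => co_rep (c i)) (good_co _ charL _) trE'.
have trT (s : AbsGal Kbar) : weil (cp_val K) (lw_q W) s -> qemb Lbar (T (dec s)) =
    \sum_(i < size Ls) \sum_(j < co_t (c i))
      \tr (art_inv W Lbar s ^+ j *: map_mx (@intalp_val O Lbar p) (co_rep (c i) s)).
  move=> Hs; rewrite T_sum -(tot_tr sigma_tr) mxtrace_mxdiag.
  have := sp_iso charL (tot_good p_prime w_nmid_p iota_inj sigma_irr sigma_mono) t0
    (good_co _ charL (ival p Lbar)) trE'.
  move=> /wd_iso_trace /(_ Hs); rewrite /= !mxtrace_mxdiag => h.
  transitivity (\sum_i \tr (sf_rr (sf p_prime w_nmid_p iota_inj sigma_irr sigma_mono i) s)).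
    by apply: eq_bigr => i _; rewrite trL.
  rewrite h; apply: eq_bigr => i _; exact: (Sp_trace W (co_t (c i)) (fun s => map_mx (ival p Lbar) (co_rep (c i) s)) s).
exists (size Ls), (fun i => co_t (c i)), (fun i => co_dim (c i)), (fun i => co_rep (c i)).
split; [| exact: t0 | | | ].
(* for m = 0 the trace formula at 1 would make the total dimension vanish *)
- rewrite lt0n; apply/eqP => m0.
  have := trT 1%g (wH1 (weil_group W)); rewrite big1 => [|i _]; last first.
    by have := ltn_ord i; rewrite {2}m0.
  rewrite T_sum rmorph_sum dec1 (eq_bigr (fun i => (d i)%:R)) => [|i _]; last first.
    by rewrite sigma_tr; case: (rep_sigma i) => -> _; rewrite mxtrace1.
  rewrite -natr_sum => /eqP; apply/negP.
  have [_ d0 _] := sigma_irr (Ordinal n_gt0).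
  by rewrite (bigD1 (Ordinal n_gt0)) //= -(prednK d0) addSn; apply: charL.
- move=> i j ij; have h (k : 'I_(size Ls)) : co_t (c k) = nth 0%N [seq co_t y | y <- Ls] k.
    by rewrite /c (tnth_nth (c k)) /= (nth_map (c k)).
  rewrite !h; apply: (sorted_leq_nth leq_trans leqnn) => //; by rewrite inE size_map.
- move=> i; split; [exact: co_isrep | exact: co_irr | |].
    by apply/ssmxP; have [_ h _] := good_co _ charL (ival p Lbar) i.
  by have [_ _ h] := good_co _ charL (ival p Lbar) i.
split; [exact: trT | move=> x cc res_dag pi_dag pia_dag].
have rI : injective (le_res x) by exact: le_res_inj.
have resE z : res_dag (intalp_of p Lbar z) = intalp_of p (lc_Abar cc) (le_res x z) by apply: dagE.
(* The three remaining isomorphisms differ only in the field and the map from O. *)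
have kcase (E : closedFieldType) (jE : {rmorphism O -> E}) (f : {rmorphism intalp Lbar p -> E})
  (jEE : forall z, f (intalp_of p Lbar z) = jE z) (ker : forall z, jE z = 0 -> le_psi x z = 0)
  (zE : {rmorphism Zp -> E}) (zEE : forall t, zE t = jE (iota t)) (dE : 'I_n -> nat)
  (rho : forall i, AbsGal Fbar -> 'M[E]_(dE i)) (hr : forall i, is_rep (@whole _) (rho i))
  (trr : forall i g, \tr (rho i g) = jE (Ti i g)) :
  wd_frss_iso W zE (rep_dsum (fun i s => rho i (dec s)))
    (wd_dsum (fun l => Sp W (co_t (c l)) (fun s => map_mx f (co_rep (c l) s)))).
  have [_ _ h] := transfer p_prime w_nmid_p iota_inj sigma_irr sigma_tr sigma_mono
    (le_char0 p_prime x) jEE ker zEE hr (le_rho_irr x) trr (trk x)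
    (le_rho_pure x).
  have charE m : m.+1%:R != 0 :> E.
    apply/eqP => e; have /eqP[] := le_char0 p_prime x m.
    by rewrite -(rmorph_nat (le_psi x)); apply: ker; rewrite rmorph_nat.
  exact: (h e0 lf0 _ _ _ t0 (fun i => co_rep (c i)) (good_co _ charE f) trE').
split.
- apply: (kcase _ (le_psi x) (ival p (le_kbar x) \o ilift_intalp pi_dag \o ilift_intalp res_dag : {rmorphism intalp Lbar p -> le_kbar x})) => //.
  + by move=> z /=; rewrite resE dagE.
  + by move=> t /=; rewrite le_resE.
  + by move=> i; case: (le_rho_irr x i).
- apply: (kcase _ (qemb (lc_Bbar cc) \o lc_piahp cc \o le_res x : {rmorphism O -> lc_Bbar cc})
    (ival p (lc_Bbar cc) \o ilift_intalp pia_dag \o ilift_intalp res_dag : {rmorphism intalp Lbar p -> lc_Bbar cc})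
    _ _ _ _ _ (fun i g => map_mx (qemb (lc_Bbar cc) \o lc_pia cc) (lc_rhoh cc i g))).
  + by move=> z /=; rewrite resE dagE.
  + move=> z /= h; apply/eqP/negPn/negP => /pi_unit u.
    have := rmorph_unit (lc_pia cc) (rmorph_unit (le_hens x) u).
    have {h} -> : lc_pia cc (le_hens x (le_loc x (le_res x z))) = 0.
      by apply: (@qemb_inj _ (lc_Bbar cc)); rewrite rmorph0.
    by rewrite unitr0.
  + by move=> t /=; rewrite le_resE.
  + move=> i; have [r1 rM] := lc_rhoh_rep cc i.
    by split=> [|g h _ _]; rewrite ?r1 ?map_mx1 // rM // map_mxM.
  + by move=> i g; rewrite trace_map_mx -lc_rhoh_tr.
- apply: (kcase _ (qemb (lc_Abar cc) \o le_res x : {rmorphism O -> lc_Abar cc})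
    (ival p (lc_Abar cc) \o ilift_intalp res_dag : {rmorphism intalp Lbar p -> lc_Abar cc})) => //.
  + by move=> z /=; rewrite resE.
  + by apply: psi0 => a b /= /(@qemb_inj _ (lc_Abar cc)) /rI.
  + by move=> t /=; rewrite le_resE.
  + by move=> i; case: (lc_rho_ss cc i).
  + by move=> i g; rewrite -lc_rho_tr.
exact: iso_sigma.
Qed.
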